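(* Let $p$ be an odd prime and let $\mathfrak m$ be the monster Lie algebra over $\mathbb Z[1/2]$. If the integers $m$ and $n$ are not both divisible by $p$, then the degree $(m,n)$ piece of $\mathfrak m\otimes\mathbb Z_p$ is self-dual under the natural bilinear form and is isomorphic to $V_{mn}\otimes\mathbb Z_p$ as a $\mathbb Z_p$-module acted on by the monster simple group.
   Context: $\mathbb Z_p$ is the ring of $p$-adic integers, and tensor products with $\mathbb Z_p$ are over $\mathbb Z[1/2]$. $V=\bigoplus_{k\ge -1}V_k$ denotes the $\mathbb Z[1/2]$-form of the monster (moonshine) vertex algebra constructed by Borcherds and Ryba (''Modular Moonshine II''), where $V_k$ is the piece of conformal weight $k+1$. It is a vertex algebra over $\mathbb Z[1/2]$ containing the conformal vector; each $V_k$ is a free $\mathbb Z[1/2]$-module of finite rank equal to the coefficient of $q^k$ in $j(\tau)-744=q^{-1}+196884q+\cdots$ ($V_k=0$ if $k<-1$); it is acted on by the monster, and has a symmetric, monster-invariant contravariant bilinear form that is self-dual on each $V_k$. $II_{1,1}$ is the even self-dual lattice $\mathbb Z\oplus \mathbb Z$ in which $(m,n)$ has norm $-2mn$. Its lattice vertex algebra has $\mathbb Z[1/2]$-form as follows. For an even lattice $L$ with double cover $\hat L$ (central extension by $\{\pm1\}$ with lifts $e^\alpha$, $e^\alpha e^\beta=(-1)^{(\alpha,\beta)}e^\beta e^\alpha$) take the ring $\mathbb Q\{\hat L\}\otimes S(\bigoplus_{j>0}L(j)\otimes\mathbb Q)$, where $\mathbb Q\{\hat L\}$ is the group ring of $\hat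 L$ with the central $-1$ identified with the scalar $-1$, with its derivation $D$ given by $D\alpha(j)=j\alpha(j+1)$, $De^\alpha=\alpha(1)e^\alpha$; the integral form is the smallest subring containing all $e^\alpha$ and closed under all $D^i/i!$, and this is tensored with $\mathbb Z[1/2]$. Its contravariant form is the one with different $L$-degrees orthogonal, $(e^\alpha,e^\alpha)=1$, and adjoint of multiplication by $\alpha(j)$ ($j>0$) equal to the derivation $\alpha(-j)$ with $\alpha(-j)\beta(k)=j(\alpha,\beta)\delta_{jk}$, $\alpha(-j)e^\beta=0$. Let $W$ be the tensor product over $\mathbb Z[1/2]$ of $V$ and the vertex algebra of $II_{1,1}$ over $\mathbb Z[1/2]$, graded by $II_{1,1}$, with Virasoro operators $L_i$ (of central charge 26) on $W\otimes\mathbb Q$, the tensor product bilinear form, and the monster acting through $V$. Let $P^1=\{w\in W\otimes\mathbb Q:L_0w=w,\ L_iw=0\text{ for }i>0\}$. The monster Lie algebra $\mathfrak m$ over $\mathbb Z[1/2]$ is the image of $W\cap P^1$ in the quotient of $P^1$ by the kernel of the bilinear form on $P^1$, with bracket $[u,v]=u_0v$; it is graded by $II_{1,1}$ and acted on by the monster. The natural bilinear form on the degree $(m,n)$ piece is the one induced by this (contravariant) form, extended $\mathbb Z_p$-linearly; self-dual means that it identifies the piece with its $\mathbb Z_p$-dual. *)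

(* Defs.v *)
From HB Require Import structures.
From mathcomp Require Import all_boot all_order all_fingroup all_algebra.
From mathcomp Require Import ring gseries generic_quotient finmap boolp.
From mathcomp.multinomials Require Import monalg.

Set Implicit Arguments.
Unset Strict Implicit.
Unset Printing Implicit Defensive.

Import GRing.Theory Num.Theory.

Local Open Scope ring_scope.
Local Open Scope quotient_scope.

Section Submodules.
Context {R : comPzRingType}.

Record submodule (M : lmodType R) := Submodule {
  in_submod :> M -> Prop;
  submod0 : in_submod 0;
  submodP : forall a x y, in_submod x -> in_submod y -> in_submod (a *: x + y) }.

Context {M : lmodType R}.
Implicit Type N : submodule M.

Definition submod_pred N : pred M := fun x => `[< N x >].

Fact submod_pred_closed N : GRing.submod_closed (submod_pred N).
Proof.
split=> [|a x y]; first exact/asboolP/submod0.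
by move=> /asboolP hx /asboolP hy; apply/asboolP/submodP.
Qed.

HB.instance Definition _ N :=
  GRing.isSubmodClosed.Build R M (submod_pred N) (submod_pred_closed N).

Record sub_of N := SubOf { sub_val : M; _ : sub_val \in submod_pred N }.

HB.instance Definition _ N := [isSub for @sub_val N].
HB.instance Definition _ N := [Choice of sub_of N by <:].
HB.instance Definition _ N := [SubChoice_isSubLmodule of sub_of N by <:].

Lemma sub_valP N (x : sub_of N) : N (val x).
Proof. exact/asboolP/(valP x). Qed.

Definition sub_mk N (x : M) (h : N x) : sub_of N := SubOf (asboolT h).

Definition quot_rel N : rel M := fun x y => `[< N (x - y) >].

Fact submodB N x y : N x -> N y -> N (x - y).
Proof. by move=> hx hy; rewrite addrC -scaleN1r; apply: submodP. Qed.

Fact quot_rel_refl N : reflexive (quot_rel N).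
Proof. by move=> x; apply/asboolP; rewrite subrr; apply: submod0. Qed.

Fact quot_rel_sym N : symmetric (quot_rel N).
Proof.
by move=> x y; apply/asboolP/asboolP => h;
   rewrite -opprB -sub0r; apply: submodB => //; apply: submod0.
Qed.

Fact quot_rel_trans N : transitive (quot_rel N).
Proof.
move=> y x z /asboolP h1 /asboolP h2; apply/asboolP.
have -> : x - z = 1 *: (x - y) + (y - z) by rewrite scale1r addrA subrK.
exact: submodP.
Qed.

Canonical quot_equiv N :=
  EquivRel (quot_rel N) (quot_rel_refl N) (quot_rel_sym N) (@quot_rel_trans N).

Definition quot_of N := {eq_quot quot_equiv N}.

HB.instance Definition _ N := Choice.on (quot_of N).

Definition quot_pi N (x : M) : quot_of N := \pi_(quot_of N) x.

Lemma quot_piP N x y : N (x - y) <-> quot_pi N x = quot_pi N y.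
Proof.
split=> [h|/eqP]; first by apply/eqP; rewrite eqmodE; apply/asboolP.
by rewrite eqmodE => /asboolP.
Qed.

Lemma quot_reprK N (q : quot_of N) : quot_pi N (repr q) = q.
Proof. exact: reprK. Qed.

Definition quot_add N (q r : quot_of N) : quot_of N := quot_pi N (repr q + repr r).
Definition quot_opp N (q : quot_of N) : quot_of N := quot_pi N (- repr q).
Definition quot_scale N (a : R) (q : quot_of N) : quot_of N :=
  quot_pi N (a *: repr q).

Fact quot_repr N x : N (repr (quot_pi N x) - x).
Proof. by apply/quot_piP; rewrite quot_reprK. Qed.

Fact quot_addE N x y : quot_add (quot_pi N x) (quot_pi N y) = quot_pi N (x + y).
Proof.
apply/quot_piP; rewrite opprD addrACA -[X in X + _]scale1r.
by apply: submodP; apply: quot_repr.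
Qed.

Fact quot_scaleE N a x : quot_scale a (quot_pi N x) = quot_pi N (a *: x).
Proof.
apply/quot_piP; rewrite -scalerBr -[X in N X]addr0.
by apply: submodP; [apply: quot_repr | apply: submod0].
Qed.

Fact quot_oppE N x : quot_opp (quot_pi N x) = quot_pi N (- x).
Proof. by rewrite -scaleN1r -quot_scaleE /quot_opp /quot_scale scaleN1r. Qed.

Fact quot_addA N : associative (@quot_add N).
Proof.
move=> a b c; rewrite -(quot_reprK a) -(quot_reprK b) -(quot_reprK c).
by rewrite !quot_addE addrA.
Qed.

Fact quot_addC N : commutative (@quot_add N).
Proof. by move=> a b; rewrite /quot_add addrC. Qed.

Fact quot_add0 N : left_id (quot_pi N 0) (@quot_add N).
Proof. by move=> a; rewrite -(quot_reprK a) quot_addE add0r. Qed.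

Fact quot_addN N : left_inverse (quot_pi N 0) (@quot_opp N) (@quot_add N).
Proof. by move=> a; rewrite -(quot_reprK a) quot_oppE quot_addE addNr. Qed.

HB.instance Definition _ N :=
  GRing.isZmodule.Build (quot_of N)
    (@quot_addA N) (@quot_addC N) (@quot_add0 N) (@quot_addN N).

Fact quot_piD N x y : quot_pi N (x + y) = quot_pi N x + quot_pi N y.
Proof. by rewrite -quot_addE. Qed.

Fact quot_scaleA N a b (q : quot_of N) :
  quot_scale a (quot_scale b q) = quot_scale (a * b) q.
Proof. by rewrite -(quot_reprK q) !quot_scaleE scalerA. Qed.

Fact quot_scale1 N : left_id 1 (@quot_scale N).
Proof. by move=> q; rewrite -(quot_reprK q) !quot_scaleE scale1r. Qed.

Fact quot_scaleDr N : right_distributive (@quot_scale N) +%R.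
Proof.
move=> a q r; rewrite -(quot_reprK q) -(quot_reprK r).
by rewrite -quot_piD !quot_scaleE -quot_piD scalerDr.
Qed.

Fact quot_scaleDl N q : {morph (@quot_scale N)^~ q : a b / a + b}.
Proof. by move=> a b; rewrite -(quot_reprK q) !quot_scaleE -quot_piD scalerDl. Qed.

HB.instance Definition _ N :=
  GRing.Zmodule_isLmodule.Build R (quot_of N)
    (@quot_scaleA N) (@quot_scale1 N) (@quot_scaleDr N) (@quot_scaleDl N).

Fact quot_pi_linear N : linear (quot_pi N).
Proof. by move=> a x y; rewrite quot_piD -quot_scaleE. Qed.

HB.instance Definition _ N :=
  GRing.isLinear.Build R M (quot_of N) _ (quot_pi N) (quot_pi_linear N).

End Submodules.

Section SubQuotMaps.
Context {R : comPzRingType} {M M' : lmodType R}.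
Variables (N : submodule M) (N' : submodule M') (f : {linear M -> M'}).
Hypothesis fN : forall x, N x -> N' (f x).

Definition sub_map (x : sub_of N) : sub_of N' := sub_mk (fN (sub_valP x)).

Fact sub_map_linear : linear sub_map.
Proof. by move=> a x y; apply: val_inj => /=; rewrite linearP. Qed.

HB.instance Definition _ :=
  GRing.isLinear.Build R (sub_of N) (sub_of N') _ sub_map sub_map_linear.

#[using="N N' f fN"]
Definition quot_map (q : quot_of N) : quot_of N' := quot_pi N' (f (repr q)).

Lemma quot_mapE x : quot_map (quot_pi N x) = quot_pi N' (f x).
Proof. by apply/quot_piP; rewrite -linearB; apply/fN/quot_repr. Qed.

Fact quot_map_linear : linear quot_map.
Proof.
move=> a x y; rewrite -(quot_reprK x) -(quot_reprK y) -linearP.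
by rewrite !quot_mapE -linearP linearP.
Qed.

HB.instance Definition _ :=
  GRing.isLinear.Build R (quot_of N) (quot_of N') _ quot_map quot_map_linear.

End SubQuotMaps.

(* The module generated by a family of symbols, subject to all linear          *)
(* relations that hold under every one of a given class of "test" maps into    *)
(* modules. Tensor products and extensions of scalars are instances: there the *)
(* test maps are the maps that the universal property factors.                 *)
Record presentation (R : comPzRingType) := Presentation {
  gens :> choiceType;
  gen_scale : R -> gens -> gens;
  test_map : forall P : lmodType R, (gens -> P) -> Prop;
  test_scale : forall (P : lmodType R) (f : gens -> P), test_map f ->
    forall a x, f (gen_scale a x) = a *: f x }.

Section PresentedModule.
Context {R : comPzRingType}.
Variable G : presentation R.

Definition eval_word (P : lmodType R) (f : G -> P) (s : seq G) : P :=
  \sum_(x <- s) f x.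

Definition word_rel : rel (seq G) := fun s t =>
  `[< forall (P : lmodType R) (f : G -> P),
        test_map f -> eval_word f s = eval_word f t >].

Fact word_rel_refl : reflexive word_rel.
Proof. by move=> s; apply/asboolP. Qed.

Fact word_rel_sym : symmetric word_rel.
Proof.
by move=> s t; apply/asboolP/asboolP => h P f hf; symmetry; apply: h.
Qed.

Fact word_rel_trans : transitive word_rel.
Proof.
move=> t s u /asboolP h1 /asboolP h2; apply/asboolP => P f hf.
by rewrite h1 // h2.
Qed.

Canonical word_equiv := EquivRel word_rel word_rel_refl word_rel_sym word_rel_trans.

Definition presented := {eq_quot word_equiv}.

HB.instance Definition _ := Choice.on presented.

Definition pres_pi (s : seq G) : presented := \pi_presented s.

Definition pres_lift (P : lmodType R) (f : G -> P) (x : presented) : P :=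
  eval_word f (repr x).

Lemma pres_liftE (P : lmodType R) (f : G -> P) s :
  test_map f -> pres_lift f (pres_pi s) = eval_word f s.
Proof.
move=> hf; have /asboolP h : word_rel (repr (pres_pi s)) s.
  by have /eqP := reprK (pres_pi s); rewrite eqmodE.
exact: h.
Qed.

Lemma presP x y :
  (forall (P : lmodType R) (f : G -> P), test_map f -> pres_lift f x = pres_lift f y) ->
  x = y.
Proof.
move=> h; rewrite -[x]reprK -[y]reprK; apply/eqP; rewrite eqmodE.
by apply/asboolP.
Qed.

Definition pres_add (x y : presented) := pres_pi (repr x ++ repr y).
Definition pres_scale (a : R) (x : presented) :=
  pres_pi [seq gen_scale a g | g <- repr x].

Fact lift_pi0 (P : lmodType R) (f : G -> P) :
  test_map f -> pres_lift f (pres_pi [::]) = 0.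
Proof. by move=> hf; rewrite pres_liftE // /eval_word big_nil. Qed.

Fact lift_add (P : lmodType R) (f : G -> P) x y :
  test_map f -> pres_lift f (pres_add x y) = pres_lift f x + pres_lift f y.
Proof. by move=> hf; rewrite pres_liftE // /eval_word big_cat. Qed.

Fact lift_scale (P : lmodType R) (f : G -> P) a x :
  test_map f -> pres_lift f (pres_scale a x) = a *: pres_lift f x.
Proof.
move=> hf; rewrite pres_liftE // /eval_word big_map scaler_sumr.
by apply: eq_bigr => i _; rewrite test_scale.
Qed.

Fact pres_addA : associative pres_add.
Proof. by move=> x y z; apply: presP => P f hf; rewrite !lift_add // addrA. Qed.

Fact pres_addC : commutative pres_add.
Proof. by move=> x y; apply: presP => P f hf; rewrite !lift_add // addrC. Qed.

Fact pres_add0 : left_id (pres_pi [::]) pres_add.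
Proof. by move=> x; apply: presP => P f hf; rewrite lift_add // lift_pi0 // add0r. Qed.

Fact pres_addN : left_inverse (pres_pi [::]) (pres_scale (-1)) pres_add.
Proof.
move=> x; apply: presP => P f hf.
by rewrite lift_add // lift_scale // lift_pi0 // scaleN1r addNr.
Qed.

HB.instance Definition _ :=
  GRing.isZmodule.Build presented pres_addA pres_addC pres_add0 pres_addN.

Fact lift_addr (P : lmodType R) (f : G -> P) :
  test_map f -> {morph pres_lift f : x y / x + y}.
Proof. by move=> hf x y; rewrite lift_add. Qed.

Fact pres_scaleA a b x : pres_scale a (pres_scale b x) = pres_scale (a * b) x.
Proof. by apply: presP => P f hf; rewrite !lift_scale // scalerA. Qed.

Fact pres_scale1 : left_id 1 pres_scale.
Proof. by move=> x; apply: presP => P f hf; rewrite lift_scale // scale1r. Qed.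

Fact pres_scaleDr : right_distributive pres_scale +%R.
Proof.
move=> a x y; apply: presP => P f hf.
by rewrite lift_scale // !lift_addr // !lift_scale // scalerDr.
Qed.

Fact pres_scaleDl x : {morph pres_scale^~ x : a b / a + b}.
Proof.
move=> a b; apply: presP => P f hf.
by rewrite lift_addr // !lift_scale // scalerDl.
Qed.

HB.instance Definition _ :=
  GRing.Zmodule_isLmodule.Build R presented
    pres_scaleA pres_scale1 pres_scaleDr pres_scaleDl.

Lemma pres_lift_linear (P : lmodType R) (f : G -> P) :
  test_map f -> linear (pres_lift f).
Proof. by move=> hf a x y; rewrite lift_addr // lift_scale. Qed.

End PresentedModule.

Section Tensor.
Context {R : comPzRingType}.

Definition bilinear_map (M N P : lmodType R) (f : M -> N -> P) :=
  (forall y, linear (f^~ y)) /\ (forall x, linear (f x)).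

Variables M N : lmodType R.

Fact tensor_test_scale (P : lmodType R) (f : M * N -> P) :
  bilinear_map (fun x y => f (x, y)) ->
  forall a z, f (a *: z.1, z.2) = a *: f z.
Proof.
move=> [hl _] a [x y] /=.
have h0 : f (0, y) = 0 by have := hl y (-1) 0 0; rewrite scaleN1r addNr scaleN1r addNr.
by have := hl y a x 0; rewrite /= !addr0 h0 addr0.
Qed.

Definition tensor_pres : presentation R :=
  @Presentation R (M * N)%type (fun a z => (a *: z.1, z.2))
    (fun P f => bilinear_map (fun x y => f (x, y))) tensor_test_scale.

Definition tensor := presented tensor_pres.

HB.instance Definition _ := GRing.Lmodule.on tensor.

Definition tens (x : M) (y : N) : tensor := pres_pi (G := tensor_pres) [:: (x, y)].

Definition tensor_lift (P : lmodType R) (f : M -> N -> P) (t : tensor) : P :=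
  pres_lift (G := tensor_pres) (fun z => f z.1 z.2) t.

Lemma tensor_liftE (P : lmodType R) (f : M -> N -> P) x y :
  bilinear_map f -> tensor_lift f (tens x y) = f x y.
Proof.
move=> hf; rewrite /tensor_lift /tens pres_liftE // /eval_word.
by rewrite big_cons big_nil addr0.
Qed.

Lemma tensor_lift_linear (P : lmodType R) (f : M -> N -> P) :
  bilinear_map f -> linear (tensor_lift f).
Proof. by move=> hf; apply: (@pres_lift_linear R tensor_pres). Qed.

Lemma tens_bilinear : bilinear_map tens.
Proof.
split=> [y a x x'|x a y y']; apply: (@presP R tensor_pres) => P f hf;
  rewrite lift_addr // lift_scale // !pres_liftE // /eval_word !big_cons !big_nil !addr0.
- exact: hf.1.
- exact: hf.2.
Qed.

Lemma tensor_ind (Q : tensor -> Prop) :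
  Q 0 -> (forall x y t, Q t -> Q (tens x y + t)) -> forall t, Q t.
Proof.
move=> h0 hS t; rewrite -[t]reprK -[\pi _]/(pres_pi (G := tensor_pres) (repr t)).
elim: (repr t) => [|[x y] s ih]; first exact: h0.
have -> : pres_pi (G := tensor_pres) ((x, y) :: s) = tens x y + pres_pi (G := tensor_pres) s.
  apply: (@presP R tensor_pres) => P f hf.
  by rewrite lift_addr // !pres_liftE // /eval_word !big_cons big_nil addr0.
exact: hS.
Qed.

End Tensor.

Section TensorMap.
Context {R : comPzRingType} {M N M' N' : lmodType R}.
Variables (f : {linear M -> M'}) (g : {linear N -> N'}).

Definition tensor_map : tensor M N -> tensor M' N' :=
  tensor_lift (fun x y => tens (f x) (g y)).

Fact tensor_map_bilinear : bilinear_map (fun x y => tens (f x) (g y)).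
Proof.
split=> [y a x x'|x a y y']; rewrite /= linearP.
- exact: (tens_bilinear M' N').1.
- exact: (tens_bilinear M' N').2.
Qed.

HB.instance Definition _ :=
  GRing.isLinear.Build R (tensor M N) (tensor M' N') _ tensor_map
    (tensor_lift_linear tensor_map_bilinear).

Lemma tensor_mapE x y : tensor_map (tens x y) = tens (f x) (g y).
Proof. exact: tensor_liftE tensor_map_bilinear. Qed.

End TensorMap.

Section BaseChange.
Context {R S : comPzRingType}.
Variable h : {rmorphism R -> S}.

Definition balanced_map (M : lmodType R) (P : lmodType S) (f : S -> M -> P) :=
  [/\ forall s, {morph f s : x y / x + y},
      forall s t x, f (s * t) x = s *: f t x,
      forall s t x, f (s + t) x = f s x + f t x
    & forall s a x, f s (a *: x) = f (s * h a) x].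

Variable M : lmodType R.

Fact base_test_scale (P : lmodType S) (f : S * M -> P) :
  balanced_map (fun s x => f (s, x)) ->
  forall a z, f (a * z.1, z.2) = a *: f z.
Proof. by move=> [_ hs _ _] a [s x] /=; apply: hs. Qed.

Definition base_pres : presentation S :=
  @Presentation S (S * M)%type (fun a z => (a * z.1, z.2))
    (fun P f => balanced_map (fun s x => f (s, x))) base_test_scale.

(* S (x)_R M, with R acting on S through h *)
Definition base_change := presented base_pres.

HB.instance Definition _ := GRing.Lmodule.on base_change.

Definition base_tens (s : S) (x : M) : base_change :=
  pres_pi (G := base_pres) [:: (s, x)].

Lemma base_tens_balanced : balanced_map base_tens.
Proof.
split=> [s x y|s t x|s t x|s a x].
all: apply: (@presP S base_pres) => P f hf;
  have [h1 h2 h3 h4] := hf;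
  rewrite ?lift_addr ?lift_scale // !pres_liftE // /eval_word !big_cons !big_nil !addr0.
- exact: h1.
- exact: h2.
- exact: h3.
- exact: h4.
Qed.

End BaseChange.

Section BaseMap.
Context {R S : comPzRingType} (h : {rmorphism R -> S}) {M N : lmodType R}.
Variable f : {linear M -> N}.

Fact base_map_balanced : balanced_map h (fun s x => base_tens h s (f x)).
Proof.
have [h1 h2 h3 h4] := base_tens_balanced h N.
split=> [s x y|s t x|s t x|s a x] /=.
- by rewrite linearD h1.
- exact: h2.
- exact: h3.
- by rewrite linearZ /= h4.
Qed.

Definition base_map (t : base_change h M) : base_change h N :=
  pres_lift (G := base_pres h M) (fun z => base_tens h z.1 (f z.2)) t.

HB.instance Definition _ :=
  GRing.isLinear.Build S (base_change h M) (base_change h N) _ base_map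
    (@pres_lift_linear S (base_pres h M) _ _ base_map_balanced).

Lemma base_mapE s x : base_map (base_tens h s x) = base_tens h s (f x).
Proof.
rewrite /base_map /base_tens pres_liftE; last exact: base_map_balanced.
by rewrite /eval_word big_cons big_nil addr0.
Qed.

End BaseMap.

Section Forms.
Context {R : comPzRingType} {N : lmodType R}.

Definition symmetric_form (T : Type) (B : N -> N -> T) := forall x y, B x y = B y x.

Definition bilinear_form (B : N -> N -> R) :=
  bilinear_map (P := (R^o : lmodType R)) B.

(* x |-> B x is a bijection from N onto Hom(N, R) *)
Definition self_dual_form (B : N -> N -> R) :=
  forall l : {linear N -> R^o}, exists! x, forall y, B x y = l y.

Definition free_of_rank (n : nat) :=
  exists b : 'I_n -> N,
    forall x, exists! c : {ffun 'I_n -> R}, x = \sum_i c i *: b i.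

End Forms.

(* Z[1/2] as a subring of Q *)
Definition Zhalf_pred : pred rat := fun x => `[< exists k : nat, x * 2 ^+ k \is a Num.int >].

Fact Zhalf_subring : GRing.subring_closed Zhalf_pred.
Proof.
split=> [|x y|x y].
- by apply/asboolP; exists 0; rewrite mul1r expr0 rpred1.
- move=> /asboolP[k hx] /asboolP[l hy]; apply/asboolP; exists (k + l)%N.
  rewrite mulrBl exprD mulrA rpredB //; first by rewrite rpredM ?rpredX.
  by rewrite mulrCA mulrC rpredM ?rpredX.
- move=> /asboolP[k hx] /asboolP[l hy]; apply/asboolP; exists (k + l)%N.
  by rewrite exprD mulrACA rpredM.
Qed.

HB.instance Definition _ := GRing.isSubringClosed.Build rat Zhalf_pred Zhalf_subring.

Record Zhalf := MkZhalf { Zhalf_val : rat; _ : Zhalf_val \in Zhalf_pred }.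

HB.instance Definition _ := [isSub for Zhalf_val].
HB.instance Definition _ := [Choice of Zhalf by <:].
HB.instance Definition _ := [SubChoice_isSubComNzRing of Zhalf by <:].

Lemma ZhalfP (x : Zhalf) : exists k a, Zhalf_val x * 2 ^+ k = a%:~R.
Proof.
have /asboolP[k /Num.Theory.intrP[a e]] := valP x.
by exists k, a.
Qed.

(* A Q-vector space viewed as a Z[1/2]-module. *)
Definition restr (M : lmodType rat) : Type := M.

Section Restriction.
Variable M : lmodType rat.

Definition restr_scale (a : Zhalf) (x : restr M) : restr M := Zhalf_val a *: (x : M).

HB.instance Definition _ := GRing.Zmodule.on (restr M).

Fact restr_scaleA a b x : restr_scale a (restr_scale b x) = restr_scale (a * b) x.
Proof. by rewrite /restr_scale scalerA. Qed.
Fact restr_scale1 : left_id 1 restr_scale.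
Proof. by move=> x; rewrite /restr_scale scale1r. Qed.
Fact restr_scaleDr : right_distributive restr_scale +%R.
Proof. by move=> a x y; rewrite /restr_scale scalerDr. Qed.
Fact restr_scaleDl x : {morph restr_scale^~ x : a b / a + b}.
Proof. by move=> a b; rewrite /restr_scale scalerDl. Qed.

HB.instance Definition _ :=
  GRing.Zmodule_isLmodule.Build Zhalf (restr M)
    restr_scaleA restr_scale1 restr_scaleDr restr_scaleDl.
End Restriction.

(* The p-adic integers as the inverse limit of the rings Z/p^n: x n is the     *)
(* representative in [0, p^n) of the component of x in Z/p^n.                  *)
Section PadicIntegers.
Variable p : nat.
Local Notation md n := (p%:Z ^+ n).

Definition padic_coherent : pred (nat -> int) :=
  fun x => `[< forall n, x n = (x n.+1 %% md n)%Z >].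

Record padicZ := MkPadic { padic_val : nat -> int; _ : padic_coherent padic_val }.

HB.instance Definition _ := [isSub for padic_val].
HB.instance Definition _ := [Choice of padicZ by <:].

Lemma padic_eq (x y : padicZ) : (forall n, padic_val x n = padic_val y n) -> x = y.
Proof. by move=> h; apply/val_inj/funext. Qed.

Lemma padicE (x : padicZ) n : padic_val x n = (padic_val x n.+1 %% md n)%Z.
Proof. exact: (asboolP _ (valP x)). Qed.

Lemma padic_red (x : padicZ) n : (padic_val x n %% md n)%Z = padic_val x n.
Proof. by rewrite [in LHS]padicE modz_mod -padicE. Qed.

Definition padic_lim (u : nat -> int) (hu : forall n, (u n = u n.+1 %[mod md n])%Z) : padicZ.
Proof.
exists (fun n => (u n %% md n)%Z); apply/asboolP => n.
rewrite hu; apply/eqP; rewrite eqz_mod_dvd.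
rewrite {1}(divz_eq (u n.+1) (md n.+1)) addrK exprS mulrA.
exact: dvdz_mull.
Defined.

Fact padic_modD (x y : padicZ) n :
  (padic_val x n + padic_val y n = padic_val x n.+1 + padic_val y n.+1 %[mod md n])%Z.
Proof. by rewrite (padicE x) (padicE y) modzDm. Qed.
Fact padic_modN (x : padicZ) n : (- padic_val x n = - padic_val x n.+1 %[mod md n])%Z.
Proof. by rewrite (padicE x) modzNm. Qed.
Fact padic_modM (x y : padicZ) n :
  (padic_val x n * padic_val y n = padic_val x n.+1 * padic_val y n.+1 %[mod md n])%Z.
Proof. by rewrite (padicE x) (padicE y) modzMm. Qed.

Definition padic_const (a : int) : padicZ := @padic_lim (fun=> a) (fun=> erefl).
Definition padic_add (x y : padicZ) : padicZ := padic_lim (padic_modD x y).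
Definition padic_opp (x : padicZ) : padicZ := padic_lim (padic_modN x).
Definition padic_mul (x y : padicZ) : padicZ := padic_lim (padic_modM x y).

Fact padic_addA : associative padic_add.
Proof. by move=> x y z; apply: padic_eq => n /=; rewrite modzDmr modzDml addrA. Qed.
Fact padic_addC : commutative padic_add.
Proof. by move=> x y; apply: padic_eq => n /=; rewrite addrC. Qed.
Fact padic_add0 : left_id (padic_const 0) padic_add.
Proof. by move=> x; apply: padic_eq => n /=; rewrite mod0z add0r padic_red. Qed.
Fact padic_addN : left_inverse (padic_const 0) padic_opp padic_add.
Proof. by move=> x; apply: padic_eq => n /=; rewrite modzDml addNr. Qed.
Fact padic_mulA : associative padic_mul.
Proof. by move=> x y z; apply: padic_eq => n /=; rewrite modzMmr modzMml mulrA. Qed.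
Fact padic_mulC : commutative padic_mul.
Proof. by move=> x y; apply: padic_eq => n /=; rewrite mulrC. Qed.
Fact padic_mul1 : left_id (padic_const 1) padic_mul.
Proof. by move=> x; apply: padic_eq => n /=; rewrite modzMml mul1r padic_red. Qed.
Fact padic_mulDl : left_distributive padic_mul padic_add.
Proof.
by move=> x y z; apply: padic_eq => n /=; rewrite modzMml modzDm mulrDl.
Qed.

HB.instance Definition _ :=
  GRing.isZmodule.Build padicZ padic_addA padic_addC padic_add0 padic_addN.
HB.instance Definition _ :=
  GRing.Zmodule_isComPzRing.Build padicZ padic_mulA padic_mulC padic_mul1 padic_mulDl.

(* For p odd, (p^n + 1)/2 is the inverse of 2 mod p^n; this gives the unique   *)
(* ring morphism from Z[1/2] to Z_p.                                           *)
Definition half_mod (n : nat) : int := ((p ^ n).+1./2)%:Z.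

Definition Zhalf_exp (x : Zhalf) : nat := projT1 (cid (ZhalfP x)).
Definition Zhalf_num (x : Zhalf) : int := projT1 (cid (projT2 (cid (ZhalfP x)))).

Fact Zhalf_numE x : Zhalf_val x * 2 ^+ Zhalf_exp x = (Zhalf_num x)%:~R.
Proof. exact: projT2 (cid (projT2 (cid (ZhalfP x)))). Qed.

Definition Zhalf_mod (x : Zhalf) (n : nat) : int :=
  Zhalf_num x * half_mod n ^+ Zhalf_exp x.

Hypothesis p_odd : odd p.

Fact half_modE n : (half_mod n * 2 = 1 %[mod md n])%Z.
Proof.
have o : odd (p ^ n) by rewrite oddX p_odd orbT.
have -> : half_mod n * 2 = 1 + md n.
  have -> : md n = (p ^ n)%:Z by elim: (n) => // k ih; rewrite exprS ih expnS.
  rewrite /half_mod -[2]/(2%:Z) -[LHS]PoszM -[RHS]PoszD muln2; congr Posz.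
  by rewrite -[RHS]odd_double_half /= o.
by rewrite modzDr.
Qed.

Fact half_modX n k : (half_mod n ^+ k * 2 ^+ k = 1 %[mod md n])%Z.
Proof. by rewrite -exprMn -modzXm half_modE modzXm expr1n. Qed.

(* the component in Z/p^n does not depend on how x is written as a / 2^k *)
Fact Zhalf_modE (x : Zhalf) k a n : Zhalf_val x * 2 ^+ k = a%:~R ->
  (Zhalf_mod x n = a * half_mod n ^+ k %[mod md n])%Z.
Proof.
move=> e; rewrite /Zhalf_mod; set l := Zhalf_exp x; set b := Zhalf_num x.
have e2 : b * 2 ^+ k = a * 2 ^+ l.
  apply: (@intr_inj rat); rewrite !rmorphM !rmorphXn /= -e -Zhalf_numE.
  by rewrite mulrAC.
have -> : (b * half_mod n ^+ l = b * half_mod n ^+ l * (half_mod n ^+ k * 2 ^+ k)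
             %[mod md n])%Z.
  by rewrite -[in RHS]modzMmr half_modX modzMmr mulr1.
have -> : b * half_mod n ^+ l * (half_mod n ^+ k * 2 ^+ k)
    = a * half_mod n ^+ k * (half_mod n ^+ l * 2 ^+ l).
  move: (half_mod n ^+ l) (half_mod n ^+ k) (2 ^+ l) (2 ^+ k) e2 => A B C D e2.
  have -> : b * A * (B * D) = b * D * (A * B) by ring.
  by rewrite e2; ring.
by rewrite -modzMmr half_modX modzMmr mulr1.
Qed.

Fact Zhalf_mod_coh x n : (Zhalf_mod x n = Zhalf_mod x n.+1 %[mod md n])%Z.
Proof.
rewrite /Zhalf_mod; set b := Zhalf_num x; set l := Zhalf_exp x.
have h : (half_mod n = half_mod n.+1 %[mod md n])%Z.
  have e : (half_mod n.+1 * 2 = 1 %[mod md n])%Z.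
    apply/eqP; rewrite eqz_mod_dvd; apply: (@dvdz_trans (md n.+1)).
      by rewrite exprS dvdz_mull.
    by rewrite -eqz_mod_dvd half_modE.
  rewrite -[half_mod n]mulr1 -modzMmr -e modzMmr.
  have -> : half_mod n * (half_mod n.+1 * 2) = half_mod n.+1 * (half_mod n * 2) by ring.
  by rewrite -modzMmr half_modE modzMmr mulr1.
by rewrite -modzMmr -modzXm h modzXm modzMmr.
Qed.

Definition Zhalf_to_padic (x : Zhalf) : padicZ := padic_lim (Zhalf_mod_coh x).

Fact half_mod_cancel n k l (c : int) :
  (c * 2 ^+ l * half_mod n ^+ (k + l) = c * half_mod n ^+ k %[mod md n])%Z.
Proof.
have -> : c * 2 ^+ l * half_mod n ^+ (k + l)
    = c * half_mod n ^+ k * (half_mod n ^+ l * 2 ^+ l).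
  by rewrite exprD -!mulrA; congr (_ * _); rewrite mulrCA; congr (_ * _); rewrite mulrC.
by rewrite -modzMmr half_modX modzMmr mulr1.
Qed.

Fact Zhalf_to_padic_is_zmod : zmod_morphism Zhalf_to_padic.
Proof.
move=> x y; apply: padic_eq => n /=; rewrite modzNm modzDm.
rewrite (@Zhalf_modE (x - y) (Zhalf_exp x + Zhalf_exp y)
   (Zhalf_num x * 2 ^+ Zhalf_exp y - Zhalf_num y * 2 ^+ Zhalf_exp x)); last first.
  rewrite intrB !intrM !rmorphXn /= -!Zhalf_numE exprD.
  change (Zhalf_val (x - y)) with (Zhalf_val x - Zhalf_val y).
  move: (Zhalf_val x) (Zhalf_val y) (2 ^+ Zhalf_exp x) (2 ^+ Zhalf_exp y) => a b c d.
  by ring.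
rewrite mulrBl -[in LHS]modzDm half_mod_cancel -[in LHS]modzNm addnC half_mod_cancel.
by rewrite modzNm modzDm.
Qed.

Fact Zhalf_to_padic_is_monoid : monoid_morphism Zhalf_to_padic.
Proof.
split=> [|x y]; apply: padic_eq => n /=.
  by rewrite (@Zhalf_modE 1 0 1) ?mulr1.
rewrite modzMm (@Zhalf_modE (x * y) (Zhalf_exp x + Zhalf_exp y)
   (Zhalf_num x * Zhalf_num y)); last first.
  rewrite intrM /= -!Zhalf_numE exprD.
  change (Zhalf_val (x * y)) with (Zhalf_val x * Zhalf_val y).
  move: (Zhalf_val x) (Zhalf_val y) (2 ^+ Zhalf_exp x) (2 ^+ Zhalf_exp y) => a b c d.
  by ring.
by rewrite exprD mulrACA.
Qed.

HB.instance Definition _ :=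
  GRing.isZmodMorphism.Build Zhalf padicZ Zhalf_to_padic Zhalf_to_padic_is_zmod.
HB.instance Definition _ :=
  GRing.isMonoidMorphism.Build Zhalf padicZ Zhalf_to_padic Zhalf_to_padic_is_monoid.

End PadicIntegers.

(* The lattice Z^r with (even, symmetric) Gram matrix A, and the space         *)
(* Q{L^} (x) S(L(1) + L(2) + ...). Its basis consists of the pairs (a, m), *)
(* a in L and m a monomial in the symbols b_i(j+1), written (i, j); the pair   *)
(* (a, m) stands for e^a m, with e^a the chosen lift of a to L^.               *)
Definition fock_basis (r : nat) : choiceType :=
  ('rV[int]_r * {cmonom ('I_r * nat)%type})%type.
Notation fock r := {malg rat[fock_basis r]}.

Section Fock.
Variable r : nat.
Local Notation L := 'rV[int]_r.
Local Notation mon := {cmonom ('I_r * nat)%type}.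
Local Notation F := (fock r).

Definition bvec (a : L) (m : mon) : F := << 1 *g ((a, m) : fock_basis r) >>.

Definition lin_ext (f : L -> mon -> F) (x : F) : F :=
  \sum_(k <- msupp x) x@_k *: f k.1 k.2.

Fact lin_extEw (P : lmodType rat) (f : fock_basis r -> P) (d : {fset fock_basis r}) (x : F) :
  (msupp x `<=` d)%fset ->
  \sum_(k <- msupp x) x@_k *: f k = \sum_(k <- d) x@_k *: f k.
Proof.
move=> le_d; rewrite [LHS](big_fset_incl _ le_d) //= => k _ /mcoeff_outdom ->.
by rewrite scale0r.
Qed.

Fact sum_supp_linear (P : lmodType rat) (f : fock_basis r -> P) :
  linear (fun x : F => \sum_(k <- msupp x) x@_k *: f k).
Proof.
move=> a x y; pose d := (msupp (a *: x + y) `|` (msupp x `|` msupp y))%fset.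
rewrite (@lin_extEw _ _ d _ (fsubsetUl _ _)).
rewrite (@lin_extEw _ _ d x) ?(@lin_extEw _ _ d y); last 2 first.
- by apply/fsubsetP => k hk; rewrite !inE hk !orbT.
- by apply/fsubsetP => k hk; rewrite !inE hk !orbT.
rewrite scaler_sumr -big_split /=; apply: eq_bigr => k _.
by rewrite mcoeffD mcoeffZ scalerDl scalerA.
Qed.

Fact lin_ext_linear f : linear (lin_ext f).
Proof. exact: (@sum_supp_linear F (fun k => f k.1 k.2)). Qed.

HB.instance Definition _ f := GRing.isLinear.Build rat F F _ (lin_ext f) (lin_ext_linear f).

Definition osc_wt (m : mon) : nat := (\sum_(v <- finsupp m) m v * v.2.+1)%N.

(* m / v, for a variable v that occurs in m *)
Definition mon_div (m : mon) (v : 'I_r * nat) : mon := divcm m (ucm v).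
Definition mon_mul (v : 'I_r * nat) (m : mon) : mon := mulcm (ucm v) m.

Variable A : 'M[int]_r.

Definition pairing (a b : L) : int := (a *m A *m b^T) 0 0.

(* A bilinear cocycle: for A even, cocycle a b * cocycle b a = (-1)^(a, b).     *)
Definition cocycle (a b : L) : rat :=
  (-1) ^+ absz (\sum_(i < r) \sum_(j < r | (i < j)%N) a 0 i * A i j * b 0 j).

Definition fock_mul (x y : F) : F :=
  lin_ext (fun a m => lin_ext (fun b m' =>
    cocycle a b *: bvec (a + b) (mulcm m m')) y) x.

(* D b(j) = j b(j+1), D e^a = a(1) e^a *)
Definition fock_D : F -> F := lin_ext (fun a m =>
  \sum_(v <- finsupp m)
     (m v * v.2.+1)%:R *: bvec a (mon_mul (v.1, v.2.+1) (mon_div m v))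
  + \sum_(i < r) (a 0 i)%:~R *: bvec a (mon_mul (i, 0%N) m)).

(* The smallest subring containing all e^a and closed under all D^i / i!       *)
Inductive lattice_Zform : F -> Prop :=
| Zform_exp a : lattice_Zform (bvec a (onecm _))
| Zform_sub x y : lattice_Zform x -> lattice_Zform y -> lattice_Zform (x - y)
| Zform_mul x y : lattice_Zform x -> lattice_Zform y -> lattice_Zform (fock_mul x y)
| Zform_D i x : lattice_Zform x -> lattice_Zform (i`!%:R^-1 *: iter i fock_D x).

(* Its tensor product with Z[1/2], as a subgroup of F                          *)
Definition lattice_Zhalf (x : F) : Prop := exists k : nat, lattice_Zform (2 ^+ k *: x).

(* Heisenberg modes of b_i: b_i(-j) (j > 0) is the multiplication by the symbol *)
(* b_i(j); the mode of index j > 0 is the derivation with b_k(j) |-> j (b_i, b_k) *)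
(* and e^a |-> 0; the mode 0 acts on degree a as (b_i, a).                      *)
Definition heis (i : 'I_r) (n : int) : F -> F := lin_ext (fun a m =>
  match n with
  | Posz 0 => (\sum_j A i j * a 0 j)%:~R *: bvec a m
  | Posz j.+1 => \sum_(v <- finsupp m | v.2 == j)
                   ((j.+1 * m v)%:R * (A i v.1)%:~R) *: bvec a (mon_div m v)
  | Negz j => bvec a (mon_mul (i, j) m)
  end).

HB.instance Definition _ i n := GRing.Linear.on (heis i n).

Definition nord (i j : 'I_r) (k l : int) (x : F) : F :=
  if (k <= l)%R then heis i k (heis j l x) else heis j l (heis i k x).

Definition gram_inv : 'M[rat]_r := invmx (map_mx intr A).

(* L_n = 1/2 sum_(i,j) A^-1_ij sum_k : b_i(k) b_j(n-k) : ; on a vector of      *)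
(* oscillator weight w only the terms with |k| <= w + |n| can be nonzero.      *)
Definition fock_vir (n : int) : F -> F := lin_ext (fun a m =>
  let N := (osc_wt m + `|n|)%N in
  \sum_(i < r) \sum_(j < r) (gram_inv i j / 2) *:
    \sum_(t < (2 * N).+1) nord i j (t%:Z - N%:Z) (n - (t%:Z - N%:Z)) (bvec a m)).

HB.instance Definition _ n := GRing.Linear.on (fock_vir n).

Definition fock_vac : F := bvec 0 (onecm _).

Definition fock_omega : F :=
  \sum_(i < r) \sum_(j < r) (gram_inv i j / 2) *: bvec 0 (mulcm (ucm (i, 0%N)) (ucm (j, 0%N))).

(* The automorphism e^a |-> e^-a, b(j) |-> - b(j) *)
Definition fock_theta : F -> F :=
  lin_ext (fun a m => (-1) ^+ mdeg m *: bvec (- a) m).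

Definition annihilate (m : mon) (x : F) : F :=
  foldr (fun v => iter (m v) (heis v.1 (Posz v.2.+1))) x (finsupp m).

Fact annihilate_linear m : linear (annihilate m).
Proof.
rewrite /annihilate; elim: (finsupp m : seq _) => [|v s ih] a x y //=.
rewrite ih; elim: (m v) => [|k ihk] //=.
by rewrite ihk linearP.
Qed.

(* The contravariant form: multiplication by b(j) is adjoint to b(-j), distinct *)
(* degrees are orthogonal and (e^a, e^a) = 1.                                   *)
Definition fock_form (x y : F) : rat :=
  \sum_(k <- msupp x) x@_k * (annihilate k.2 y)@_((k.1, onecm _) : fock_basis r).

Fact fock_form_bilinear :
  bilinear_map (M := restr F) (N := restr F) (P := restr rat^o) fock_form.
Proof.
split=> [y a x x'|x a y y'].
  exact: (@sum_supp_linear rat^o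
    (fun k => (annihilate k.2 y)@_((k.1, onecm _) : fock_basis r))).
rewrite /fock_form [a *: (_ : restr rat^o)]mulr_sumr -big_split /=.
apply: eq_bigr => k _.
have -> : (a *: y + y' : restr F) = (Zhalf_val a *: (y : F) + y' : F) by [].
by rewrite annihilate_linear mcoeffD mcoeffZ mulrDr mulrCA.
Qed.

End Fock.

Section Span.
Context {R : comPzRingType} {M : lmodType R}.
Variable P : M -> Prop.

Inductive in_span : M -> Prop :=
| span0 : in_span 0
| spanP a x y : P x -> in_span y -> in_span (a *: x + y).

Fact span_closed a x y : in_span x -> in_span y -> in_span (a *: x + y).
Proof.
move=> hx; elim: hx y => [|b u v hu _ ih] y hy; first by rewrite scaler0 add0r.
by rewrite scalerDr scalerA -addrA; apply: spanP => //; apply: ih.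
Qed.

Definition span : submodule M := Submodule span0 span_closed.
End Span.

(* Binomial coefficients n (n-1) ... (n-i+1) / i! for n in Z                   *)
Definition binz (n : int) (i : nat) : int :=
  match n with
  | Posz k => 'C(k, i)%:Z
  | Negz k => (-1) ^+ i * 'C(k + i, i)%:Z
  end.

Section VertexAlgebras.
Context {R : comPzRingType} {V : lmodType R}.
(* Y n u v is u_n v *)
Implicit Types (one : V) (Y : int -> V -> V -> V).

(* The two sums of the Borcherds identity are finite by truncation: both are   *)
(* cut off at any sufficiently large K.                                        *)
Definition borcherds_identity Y := forall (m n q : int) (u v w : V),
  exists K0 : nat, forall K : nat, (K0 <= K)%N ->
    \sum_(i < K) (binz m i)%:~R *: Y (m + n - i%:Z) (Y (q + i%:Z) u v) w
    = \sum_(i < K) ((-1) ^+ i * (binz q i)%:~R) *: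
        (Y (m + q - i%:Z) u (Y (n + i%:Z) v w)
         - (-1) ^+ absz q *: Y (n + q - i%:Z) v (Y (m + i%:Z) u w)).

Definition is_vertex_algebra one Y : Prop :=
  [/\ forall n, bilinear_map (Y n),
      forall u v, exists n0 : int, forall n, n0 <= n -> Y n u v = 0,
      forall n v, Y n one v = if n == -1 then v else 0,
      forall v, Y (-1) v one = v /\ (forall n : int, 0 <= n -> Y n v one = 0)
    & borcherds_identity Y].

Definition vir_mode Y (omega : V) (n : int) : V -> V := Y (n + 1) omega.

(* A conformal vector of central charge 24, so that c / 12 = 2                 *)
Definition is_conformal24 one Y (omega : V) : Prop :=
  let L := vir_mode Y omega in
  (forall v, L (-1) v = Y (-2) v one) /\
  (forall (m n : int) v, L m (L n v) - L n (L m v)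
     = (m - n)%:~R *: L (m + n) v
       + (if m + n == 0 then (2 * (m ^+ 3 - m))%:~R *: v else 0)).

End VertexAlgebras.

(* Y is the vertex algebra structure of the lattice vertex algebra on the Fock *)
(* space: the operators of the b_i are the Heisenberg modes, u_(-2) 1 = D u,   *)
(* and e^a(z) e^b = z^(a, b) (e^a e^b + O(z)).                                 *)
Definition is_lattice_va (r : nat) (A : 'M[int]_r)
    (Y : int -> fock r -> fock r -> fock r) : Prop :=
  [/\ is_vertex_algebra (fock_vac r) Y,
      forall i n x, Y n (bvec 0 (ucm (i, 0%N))) x = heis A i n x,
      forall x, Y (-2) x (fock_vac r) = fock_D x
    & forall a b, Y (- 1 - pairing A a b) (bvec a (onecm _)) (bvec b (onecm _))
                  = cocycle A a b *: bvec (a + b) (onecm _)].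

(* The Leech lattice is the even self-dual positive definite lattice of rank   *)
(* 24 without vectors of norm 2.                                               *)
Definition is_leech (A : 'M[int]_24) : Prop :=
  [/\ A^T = A, \det A = 1,
      forall a, exists k : int, pairing A a a = 2 * k,
      forall a, a != 0 -> 0 < pairing A a a
    & forall a, pairing A a a != 2].

(* j(tau) - 744 = E_4^3 / Delta - 744 = sum_k j_coeff k q^k                    *)
Definition e4_coeff (n : nat) : int :=
  if n is 0 then 1 else (240 * \sum_(d <- divisors n) d ^ 3)%N.

(* the coefficient of q^n in q j = E_4^3 prod_(m > 0) (1 - q^m)^-24            *)
Definition qj_coeff (n : nat) : int :=
  (((\poly_(i < n.+1) e4_coeff i) ^+ 3 *
    \prod_(1 <= m < n.+1) (\sum_(i < n.+1) 'X^(m * i)) ^+ 24) : {poly int})`_n.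

Definition j_coeff (k : int) : int :=
  match (k + 1)%R with
  | Posz n => qj_coeff n - (if n == 1%N then 744 else 0)
  | Negz _ => 0
  end.

(* By the classification of finite simple groups, the monster is the simple    *)
(* group of this order.                                                        *)
Definition is_monster (G : finGroupType) : Prop :=
  simple [set: G] /\
  #|G| = (2 ^ 46 * 3 ^ 20 * 5 ^ 9 * 7 ^ 6 * 11 ^ 2 * 13 ^ 3 * 17 * 19 * 23 * 29
          * 31 * 41 * 47 * 59 * 71)%N.

Section MonsterVertexAlgebra.
Variable V : lmodType Zhalf.
Variables (one : V) (Y : int -> V -> V -> V) (omega : V).
Local Notation L := (vir_mode Y omega).

Hypothesis Ybil : forall n, bilinear_map (Y n).

Fact vir_mode_linear n : linear (L n).
Proof. exact: (Ybil _).2. Qed.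

(* V_k: the piece of conformal weight k + 1 *)
Definition wt_piece_pred (k : int) (v : V) : Prop := L 0 v = (k + 1)%:~R *: v.

Fact wt_piece0 k : wt_piece_pred k 0.
Proof.
have h := vir_mode_linear 0 (-1) 0 0; rewrite /wt_piece_pred scaler0.
by move: h; rewrite scaler0 addr0 scaleN1r addNr.
Qed.

Fact wt_pieceP k a x y :
  wt_piece_pred k x -> wt_piece_pred k y -> wt_piece_pred k (a *: x + y).
Proof.
rewrite /wt_piece_pred => hx hy; rewrite vir_mode_linear hx hy scalerDr.
by rewrite !scalerA mulrC.
Qed.

Definition wt_piece (k : int) : submodule V := Submodule (wt_piece0 k) (@wt_pieceP k).

(* For u of weight h the adjoint of u_n is                                     *)
(*   (-1)^h sum_j (L_1^j u / j!)_(2h-j-n-2),                                   *)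
(* as in (Y(u,z)a, b) = (a, Y(e^(z L_1) (-z^-2)^(L_0) u, z^-1) b). The form    *)
(* takes values in Z[1/2]; the division by j! is done in Q.                    *)
Definition contravariant_form (B : V -> V -> Zhalf) : Prop :=
  forall (h : nat) (n : int) (u a b : V), wt_piece (h%:Z - 1) u ->
    Zhalf_val (B (Y n u a) b)
    = (-1) ^+ h * \sum_(j < h.+1)
        (j`!%:R)^-1 * Zhalf_val (B a (Y ((2 * h)%:Z - j%:Z - n - 2) (iter j (L 1) u) b)).

End MonsterVertexAlgebra.

(* The Z[1/2]-form V of the monster vertex algebra, with the action of the     *)
(* monster G. The last condition identifies V: V is built from the Leech       *)
(* lattice so that, for suitable commuting involutions z, z' such that z, z'   *)
(* and z z' are conjugate in G, the fixed point subalgebra of z is the         *)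
(* subalgebra of the Z[1/2]-form of the Leech lattice vertex algebra fixed by  *)
(* the automorphism theta that lifts -1; V is then the sum of the fixed point  *)
(* subalgebras of z, z' and z z'.                                              *)
Record monster_va (G : finGroupType) := MonsterVA {
  mva :> lmodType Zhalf;
  mva_one : mva;
  mva_Y : int -> mva -> mva -> mva;
  mva_omega : mva;
  mva_form : mva -> mva -> Zhalf;
  mva_act : G -> {linear mva -> mva};

  mvaP : is_vertex_algebra mva_one mva_Y;
  mva_bilin : forall n, bilinear_map (mva_Y n) := let: And5 h _ _ _ _ := mvaP in h;
  mva_conformal : is_conformal24 mva_one mva_Y mva_omega;
  mva_graded : forall v, in_span
    (fun u => exists2 k : int, -1 <= k & wt_piece mva_omega mva_bilin k u) v;
  mva_rank : forall k, exists2 n : nat, n%:Z = j_coeff k &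
    free_of_rank (N := sub_of (wt_piece mva_omega mva_bilin k)) n;

  mva_act1 : forall v, mva_act 1%g v = v;
  mva_actM : forall g h v, mva_act (g * h)%g v = mva_act g (mva_act h v);
  mva_act_faithful : forall g, (forall v, mva_act g v = v) -> g = 1%g;
  mva_act_Y : forall g n u v,
    mva_act g (mva_Y n u v) = mva_Y n (mva_act g u) (mva_act g v);
  mva_act_omega : forall g, mva_act g mva_omega = mva_omega;

  mva_form_bilin : bilinear_form mva_form;
  mva_form_sym : symmetric_form mva_form;
  mva_form_inv : forall g u v, mva_form (mva_act g u) (mva_act g v) = mva_form u v;
  mva_form_contra : contravariant_form mva_omega mva_bilin mva_form;
  mva_form_dual : forall k,
    self_dual_form (N := sub_of (wt_piece mva_omega mva_bilin k))
      (fun u v => mva_form (val u) (val v));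

  mva_leech : exists (A : 'M[int]_24) (YL : int -> fock 24 -> fock 24 -> fock 24)
      (z z' : G) (phi : {linear mva -> restr (fock 24)}),
    [/\ is_leech A, is_lattice_va A YL,
        [/\ #[z]%g = 2%N, commute z z', z' \in (z ^: [set: G])%g
          & (z * z')%g \in (z ^: [set: G])%g],
        [/\ forall v, mva_act z v = v -> phi v = 0 -> v = 0
          & forall x : fock 24, (lattice_Zhalf A x /\ fock_theta x = x) <->
              (exists2 v, mva_act z v = v & phi v = x)]
      & [/\ phi mva_one = fock_vac 24, phi mva_omega = fock_omega A
          & forall n u v, mva_act z u = u -> mva_act z v = v ->
              phi (mva_Y n u v) = YL n (phi u) (phi v)]] }.

Section MonsterLieAlgebra.
Context {G : finGroupType}.
Variable V : monster_va G.

Definition V_ (k : int) : submodule V := wt_piece (mva_omega V) (mva_bilin V) k.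

Definition V_L (n : int) : V -> V := vir_mode (@mva_Y G V) (mva_omega V) n.

HB.instance Definition _ n :=
  GRing.isLinear.Build Zhalf V V _ (V_L n) (vir_mode_linear _ (mva_bilin V) n).

(* II_(1,1): (m, n) has norm -2mn *)
Definition II_gram : 'M[int]_2 := \matrix_(i, j) (if i == j then 0 else -1).
Definition II_vec (m n : int) : 'rV[int]_2 :=
  \row_(i < 2) (if i == ord0 then m else n).

Local Notation F := (fock 2).
Definition II_L (n : int) (x : restr F) : restr F := fock_vir II_gram n x.

Fact II_L_linear n : linear (II_L n).
Proof. by move=> a x y; rewrite /II_L linearP. Qed.
HB.instance Definition _ n :=
  GRing.isLinear.Build Zhalf (restr F) (restr F) _ (II_L n) (II_L_linear n).

(* W (x) Q, where W is the tensor product over Z[1/2] of V and the vertex      *)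
(* algebra of II_(1,1): the latter spans F over Q, and V is free, so that      *)
(* W (x) Q is V (x) F and W is its subgroup generated by the v (x) u for u in  *)
(* the Z[1/2]-form.                                                            *)
Definition WQ : lmodType Zhalf := tensor V (restr F).

Definition W : submodule WQ :=
  span (fun w => exists v (u : F), lattice_Zhalf II_gram u /\ w = tens v (u : restr F)).

Definition WQ_deg (a : 'rV[int]_2) : submodule WQ :=
  span (fun w => exists v (x : F),
    (forall k, k \in msupp x -> k.1 = a) /\ w = tens v (x : restr F)).

Definition W_L (n : int) (w : WQ) : WQ :=
  tensor_map (V_L n) idfun w + tensor_map idfun (II_L n) w.

Fact W_L_linear n : linear (W_L n).
Proof.
by move=> a x y; rewrite /W_L !linearP /= addrACA scalerDr.
Qed.
HB.instance Definition _ n := GRing.isLinear.Build Zhalf WQ WQ _ (W_L n) (W_L_linear n).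

(* (v (x) x, v' (x) x') = (v, v') (x, x') *)
Definition W_form (w w' : WQ) : rat :=
  tensor_lift (P := restr rat^o) (fun (v : V) (x : restr F) =>
    tensor_lift (P := restr rat^o) (fun (v' : V) (x' : restr F) =>
      Zhalf_val (mva_form v v') * fock_form II_gram x x') w') w.

Definition W_act (g : G) : WQ -> WQ := tensor_map (mva_act V g) idfun.
HB.instance Definition _ g := GRing.Linear.on (W_act g).

Definition P1_pred (w : WQ) : Prop :=
  W_L 0 w = w /\ forall i : int, 0 < i -> W_L i w = 0.

Fact P1_0 : P1_pred 0.
Proof. by split=> [|i _]; rewrite linear0. Qed.
Fact P1_P a x y : P1_pred x -> P1_pred y -> P1_pred (a *: x + y).
Proof.
move=> [hx hx'] [hy hy']; split=> [|i hi]; first by rewrite W_L_linear hx hy.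
by rewrite W_L_linear hx' // hy' // scaler0 addr0.
Qed.
Definition P1 : submodule WQ := Submodule P1_0 P1_P.

Fact form_in_bilinear v x : bilinear_map (P := restr rat^o) (M := V) (N := restr F)
  (fun v' x' => Zhalf_val (mva_form v v') * fock_form II_gram x x').
Proof.
split=> [x' a v1 v2|v' a x1 x2].
  have -> : mva_form v (a *: v1 + v2) = a * mva_form v v1 + mva_form v v2.
    exact: (mva_form_bilin V).2.
  by rewrite /= mulrDl -mulrA.
rewrite ((fock_form_bilinear II_gram).2 x) mulrDr; congr (_ + _).
exact: mulrCA.
Qed.

Fact form_out_bilinear w' :
  bilinear_map (P := restr rat^o) (M := V) (N := restr F) (fun v x =>
    tensor_lift (P := restr rat^o) (fun (v' : V) (x' : restr F) =>
      Zhalf_val (mva_form v v') * fock_form II_gram x x') w').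
Proof.
split=> [x a v1 v2|v a x1 x2];
  rewrite /tensor_lift /pres_lift /eval_word scaler_sumr -big_split /=;
  apply: eq_bigr => z _.
  have -> : mva_form (a *: v1 + v2) z.1 = a * mva_form v1 z.1 + mva_form v2 z.1.
    exact: (mva_form_bilin V).1.
  by rewrite /= mulrDl -mulrA.
rewrite ((fock_form_bilinear II_gram).1 z.2) mulrDr; congr (_ + _).
exact: mulrCA.
Qed.

Lemma W_formE v x v' x' :
  W_form (tens v x) (tens v' x') = Zhalf_val (mva_form v v') * fock_form II_gram x x'.
Proof.
rewrite /W_form (tensor_liftE _ _ (form_out_bilinear _)).
exact: tensor_liftE (form_in_bilinear _ _).
Qed.

Fact W_form_bilinear : bilinear_map (P := restr rat^o) W_form.
Proof.
split=> [w'|w a x y]; first exact: tensor_lift_linear (form_out_bilinear w').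
rewrite /W_form [LHS]/tensor_lift [in RHS]/tensor_lift /pres_lift /eval_word.
rewrite scaler_sumr -big_split /=; apply: eq_bigr => z _.
exact: tensor_lift_linear (form_in_bilinear _ _) _ _ _.
Qed.

Definition P1_ker_pred (x : sub_of P1) : Prop :=
  forall y : sub_of P1, W_form (val x) (val y) = 0.

Fact P1_ker0 : P1_ker_pred 0.
Proof.
move=> y; have /= h := W_form_bilinear.1 (val y) (-1) 0 0.
by move: h; rewrite scaler0 addr0 scaleN1r addNr.
Qed.
Fact P1_kerP a x y : P1_ker_pred x -> P1_ker_pred y -> P1_ker_pred (a *: x + y).
Proof.
move=> hx hy z; have /= h := W_form_bilinear.1 (val z) a (val x) (val y).
by rewrite /= h hx hy scaler0 addr0.
Qed.
Definition P1_ker : submodule (sub_of P1) := Submodule P1_ker0 P1_kerP.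

Definition P1_quot : lmodType Zhalf := quot_of P1_ker.

Definition P1_quot_form (x y : P1_quot) : rat :=
  W_form (val (repr x)) (val (repr y)).

(* The monster Lie algebra: the image of W \cap P1 in P1 / ker, as a            *)
(* Z[1/2]-module; its bracket [u, v] = u_0 v is not used for the graded pieces. *)
Definition m_pred (q : P1_quot) : Prop :=
  exists x : sub_of P1, W (val x) /\ q = quot_pi P1_ker x.

Fact m_0 : m_pred 0.
Proof. by exists 0; split; [exact: span0 | rewrite linear0]. Qed.
Fact m_P a x y : m_pred x -> m_pred y -> m_pred (a *: x + y).
Proof.
move=> [u [hu ->]] [v [hv ->]]; exists (a *: u + v).
by split; [apply: span_closed | rewrite linearP].
Qed.
Definition monster_lie : submodule P1_quot := Submodule m_0 m_P.

Definition m_deg_pred (a : 'rV[int]_2) (q : sub_of monster_lie) : Prop :=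
  exists x : sub_of P1,
    [/\ W (val x), WQ_deg a (val x) & val q = quot_pi P1_ker x].

Fact m_deg0 a : m_deg_pred a 0.
Proof. by exists 0; split; [exact: span0 | exact: span0 | rewrite linear0]. Qed.
Fact m_degP a c x y : m_deg_pred a x -> m_deg_pred a y -> m_deg_pred a (c *: x + y).
Proof.
move=> [u [hu du eu]] [v [hv dv ev]]; exists (c *: u + v).
split; [exact: span_closed | exact: span_closed |].
by rewrite [RHS]linearP /= -eu -ev.
Qed.
Definition m_deg (a : 'rV[int]_2) : submodule (sub_of monster_lie) :=
  Submodule (@m_deg0 a) (@m_degP a).

Definition m_deg_form (a : 'rV[int]_2) (x y : sub_of (m_deg a)) : rat :=
  P1_quot_form (val (val x)) (val (val y)).

Section Action.
Variable g : G.

Fact act_linear_V k v : V_ k v -> V_ k (mva_act V g v).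
Proof.
rewrite /= /wt_piece_pred /vir_mode => h.
by rewrite -{1}(mva_act_omega V g) -mva_act_Y h linearZ.
Qed.

Definition V_act k : sub_of (V_ k) -> sub_of (V_ k) := sub_map (@act_linear_V k).
Arguments V_act : clear implicits.
HB.instance Definition _ k := GRing.Linear.on (V_act k).

Fact W_act_E v x : W_act g (tens v x) = tens (mva_act V g v) x.
Proof. exact: tensor_mapE. Qed.

Fact W_actD x y : W_act g (x + y) = W_act g x + W_act g y.
Proof. exact: linearD. Qed.
Fact W_actP a x y : W_act g (a *: x + y) = a *: W_act g x + W_act g y.
Proof. exact: linearP. Qed.
Fact W_LD n x y : W_L n (x + y) = W_L n x + W_L n y.
Proof. exact: linearD. Qed.

Fact W_act_L n w : W_L n (W_act g w) = W_act g (W_L n w).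
Proof.
elim/(@tensor_ind _ V (restr F)): w => [|v x w ih]; first by rewrite !linear0.
rewrite W_actD !W_LD W_actD ih; congr (_ + _).
rewrite W_act_E /W_L !tensor_mapE W_actD !W_act_E /=; congr (tens _ _ + _).
by rewrite /V_L /vir_mode mva_act_Y mva_act_omega.
Qed.

Fact W_act_P1 w : P1 w -> P1 (W_act g w).
Proof.
move=> [h0 h]; split=> [|i hi]; rewrite W_act_L ?h0 //.
by rewrite h // linear0.
Qed.

Fact W_formDl w1 w2 w : W_form (w1 + w2) w = W_form w1 w + W_form w2 w.
Proof. by have := W_form_bilinear.1 w 1 w1 w2; rewrite !scale1r. Qed.
Fact W_formDr w w1 w2 : W_form w (w1 + w2) = W_form w w1 + W_form w w2.
Proof. by have := W_form_bilinear.2 w 1 w1 w2; rewrite !scale1r. Qed.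
Fact W_form0l w : W_form 0 w = 0.
Proof. by apply: (addrI (W_form 0 w)); rewrite -W_formDl !addr0. Qed.
Fact W_form0r w : W_form w 0 = 0.
Proof. by apply: (addrI (W_form w 0)); rewrite -W_formDr !addr0. Qed.

Fact W_act_form w w' : W_form (W_act g w) (W_act g w') = W_form w w'.
Proof.
elim/(@tensor_ind _ V (restr F)): w => [|v x w ih]; first by rewrite linear0 !W_form0l.
rewrite W_actD !W_formDl {}ih; congr (_ + _).
elim/(@tensor_ind _ V (restr F)): w' => [|v' x' w' ih']; first by rewrite linear0 !W_form0r.
rewrite W_actD !W_formDr; congr (_ + _).
  by rewrite !W_act_E !W_formE mva_form_inv.
exact: ih'.
Qed.

Fact W_act_W w : W w -> W (W_act g w).
Proof.
elim=> [|a u w' [v [x [hx ->]]] _ ih]; first by rewrite linear0; exact: span0.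
rewrite W_actP W_act_E; apply: spanP => //.
by exists (mva_act V g v), x.
Qed.

Fact W_act_deg a w : WQ_deg a w -> WQ_deg a (W_act g w).
Proof.
elim=> [|c u w' [v [x [hx ->]]] _ ih]; first by rewrite linear0; exact: span0.
rewrite W_actP W_act_E; apply: spanP => //.
by exists (mva_act V g v), x.
Qed.

Definition P1_act : sub_of P1 -> sub_of P1 := sub_map W_act_P1.
HB.instance Definition _ := GRing.Linear.on P1_act.
End Action.

Fact W_actK g w : W_act g (W_act g^-1%g w) = w.
Proof.
elim/(@tensor_ind _ V (restr F)): w => [|v x w ih]; first by rewrite !linear0.
by rewrite !W_actD ih !W_act_E -mva_actM mulgV mva_act1.
Qed.

Fact P1_act_ker g x : P1_ker x -> P1_ker (P1_act g x).
Proof.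
move=> h y; have := h (P1_act g^-1%g y).
by rewrite /= -[X in _ -> W_form _ X = _](W_actK g) W_act_form.
Qed.

Definition P1_quot_act g : P1_quot -> P1_quot := quot_map (@P1_act_ker g).
HB.instance Definition _ g := GRing.Linear.on (P1_quot_act g).

Fact P1_quot_act_m g q : monster_lie q -> monster_lie (P1_quot_act g q).
Proof.
move=> [x [hx ->]]; exists (P1_act g x); split; first exact: W_act_W.
exact: quot_mapE.
Qed.

Definition m_act g : sub_of monster_lie -> sub_of monster_lie :=
  sub_map (@P1_quot_act_m g).
HB.instance Definition _ g := GRing.Linear.on (m_act g).

Fact m_act_deg g a x : m_deg a x -> m_deg a (m_act g x).
Proof.
move=> [u [hu du eu]]; exists (P1_act g u).
split; [exact: W_act_W | exact: W_act_deg |].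
by rewrite /= eu; apply: quot_mapE.
Qed.

Definition m_deg_act g a : sub_of (m_deg a) -> sub_of (m_deg a) :=
  sub_map (@m_act_deg g a).
Arguments m_deg_act : clear implicits.
HB.instance Definition _ g a := GRing.Linear.on (m_deg_act g a).

End MonsterLieAlgebra.

Arguments V_act {G} V g k _.
Arguments m_deg_act {G} V g a _.
Arguments m_deg_form {G} V a x y.

Section PadicExtension.
Context {p : nat} (p_odd : odd p).

Definition padic_ext (N : lmodType Zhalf) : lmodType (padicZ p) :=
  base_change (Zhalf_to_padic p_odd) N.

Definition padic_map (N N' : lmodType Zhalf) (f : {linear N -> N'}) :
  padic_ext N -> padic_ext N' := base_map (h := Zhalf_to_padic p_odd) f.

(* B is the Z_p-bilinear extension to N (x) Z_p of the Q-valued form b on N,   *)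
(* which therefore has to take values in Z[1/2].                               *)
Definition is_padic_extension (N : lmodType Zhalf) (b : N -> N -> rat)
    (B : padic_ext N -> padic_ext N -> padicZ p) : Prop :=
  [/\ bilinear_form B
    & forall x y, exists2 c : Zhalf, Zhalf_val c = b x y &
        B (base_tens _ 1 x) (base_tens _ 1 y) = Zhalf_to_padic p_odd c].
End PadicExtension.
Arguments is_padic_extension {p} p_odd {N} b B.
Arguments padic_map {p} p_odd {N N'} f _.

(* Main.v *)
(* Let a = (m, n) and let w be a null basis vector of II_(1,1) for which         *)
(* c = (w, a) is prime to p. If e_k are the modes of e^b in a lattice vertex     *)
(* algebra and sum_i B_i z^i is a power series in the oscillators of w that      *)
(* transforms as a field of the complementary conformal weight, then             *)
(* sum_i e_(k+i) (x) B_i commutes with the L_n, n > 0. Such series exist over    *)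
(* Z[1/c], as the exponential of w(z)/c transforms like the variable z. Applied  *)
(* to the vacuum times e^a, these operators show that for u of weight h in the   *)
(* Leech lattice vertex algebra some c^N u e^a becomes, after the addition of    *)
(* terms with oscillators of w, an integral vector killed by the L_n, n > 0.     *)
(* Averaging over theta carries this to V^z, and as V is the sum of V^z, V^z'    *)
(* and V^zz', to V: there is a lift tau of c^N V_mn to W cap P^1. Oscillators    *)
(* of w are orthogonal to each other, so (tau u, tau v) = c^2N (u, v).           *)
(*   As in the no-ghost theorem, the part of P^1 of degree a is the sum of null  *)
(* vectors and of vectors killed by the positive modes of w; the latter are      *)
(* polynomials in the oscillators of w times e^a, and pair through their         *)
(* constant terms. So an element x of the degree a piece of the Lie algebra is   *)
(* determined by the functional (x, tau v) of v, which is (f x, v) for some f x  *)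
(* in the self-dual V_mn. Then f tau = tau f = c^2N, a unit of Z_p.              *)

(* Let a = (m, n) and let w be a null basis vector of the hyperbolic lattice. Then c = (w, a) is -m
   or -n, and w can be chosen so that c is prime to p. The degree a piece of the Lie algebra and
   V_mn are compared up to powers of c, which become units over Z_p ([padic_int_unit]).

   Lower bound: integral primary vectors are constructed. The vectors v e^a with v in V_mn are not
   primary and have to be corrected. In a lattice vertex algebra the modes of the e^b generate the
   integral form from the vacuum ([Zf_gen]), so it suffices to correct these modes. [field_exists]
   gives series in the oscillators of w, integral over Z[1/c], of every weight -h; multiplied by the
   field of e^b of weight h + 1 they give a field of weight 1, whose residue commutes with the L_n
   ([AK_LT]). This yields [ZE_Good] for the Leech lattice. [fixed_good] carries it to the fixed
   points of an involution of the monster, which V shares with the lattice algebra, and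
   [decomposition_good] to all of V ([monster_good]).

   Upper bound: by [no_ghost], where central charge 26 enters, a primary vector of weight 1 and
   degree a is a spurious vector, orthogonal to everything primary, plus a primary vector killed by
   the positive modes of w. The latter is a polynomial in the oscillators of w times e^a, and two
   such vectors pair through their constant terms ([Wf_TK]), which lie in the rational span of V_mn
   ([primary_cpr]). Hence an element of the piece is determined by its pairings with the lifts
   ([Wf_tau_ker]).

   As V_mn is self-dual, these pairings define a map f from the piece to V_mn; the lift gives a map
   g back, and f g = g f = c^2N, (f x, f y) = c^2N (x, y) ([comparison_maps]). Over Z_p the map f is
   therefore an equivariant isomorphism, and the natural form is a unit times the pullback of a
   self-dual one ([base_map_dual]). *)
From HB Require Import structures.
From mathcomp Require Import all_boot all_order all_fingroup all_algebra.
From mathcomp Require Import ring lra zify generic_quotient finmap boolp.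
From mathcomp.multinomials Require Import monalg.
Require Import Defs.

Set Implicit Arguments.
Unset Strict Implicit.
Unset Printing Implicit Defensive.

Import Order.TTheory GRing.Theory Num.Theory.

Local Open Scope ring_scope.

(** * Linear combinations *)

(* Decides equations between linear combinations in a module, up to equations  *)
(* between the coefficients of the atoms, which are left to [ring].            *)
Section LinearCombinations.
Variables (R : nzRingType) (M : lmodType R).

Inductive lexp :=
  LAtom of nat | LZero | LAdd of lexp & lexp | LOpp of lexp | LScale of R & lexp.

Fixpoint leval (env : seq M) e : M :=
  match e with
  | LAtom i => nth 0 env i
  | LZero => 0
  | LAdd a b => leval env a + leval env b
  | LOpp a => - leval env a
  | LScale c a => c *: leval env a
  end.

Fixpoint lcoef e (i : nat) : R :=
  match e with
  | LAtom j => if Nat.eqb j i then 1 else 0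
  | LZero => 0
  | LAdd a b => lcoef a i + lcoef b i
  | LOpp a => - lcoef a i
  | LScale c a => c * lcoef a i
  end.

Lemma leval_coef env e : leval env e = \sum_(i < size env) lcoef e i *: nth 0 env i.
Proof.
elim: e => [j||a ha b hb|a ha|c a ha] /=.
- have eqbE i : Nat.eqb j i = (j == i) by [].
  have [lt|le] := ltnP j (size env); last first.
    rewrite nth_default // big1 // => i _; rewrite eqbE ifF ?scale0r //.
    by apply/eqP => e; move: le; rewrite e leqNgt ltn_ord.
  rewrite (bigD1 (Ordinal lt)) //= eqbE eqxx scale1r big1 ?addr0 // => i ne.
  rewrite eqbE ifF ?scale0r //; apply: contraNF ne => /eqP e.
  by apply/eqP/val_inj.
- by rewrite big1 // => i _; rewrite scale0r.
- by rewrite ha hb -big_split; apply: eq_bigr => i _; rewrite scalerDl.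
- by rewrite ha -sumrN; apply: eq_bigr => i _; rewrite scaleNr.
- by rewrite ha scaler_sumr; apply: eq_bigr => i _; rewrite scalerA.
Qed.

Fixpoint lcoefs_eq n a b : Prop :=
  if n is n'.+1 then (lcoef a n' = lcoef b n') /\ lcoefs_eq n' a b else True.

Lemma leval_eq n env a b : size env = n -> lcoefs_eq n a b -> leval env a = leval env b.
Proof.
move=> <- h; rewrite !leval_coef; apply: eq_bigr => -[i lt] _ /=; congr (_ *: _).
elim: (size env) i lt h => // n' ih i; rewrite ltnS leq_eqVlt => /orP[/eqP ->|lt] [e h] //.
exact: ih.
Qed.
End LinearCombinations.

(** Atoms are identified when they are syntactically equal or, failing that, when they unify, so
    that terms that are merely convertible share a coefficient. *)
Ltac lin_same t u :=
  match constr:(Set) with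
  | _ => let _ := match constr:(Set) with _ => constr_eq t u end in constr:(true)
  | _ => let _ := match constr:(Set) with _ => unify t u end in constr:(true)
  | _ => constr:(false)
  end.
Ltac lin_index t env :=
  lazymatch env with
  | ?u :: ?env' => lazymatch lin_same t u with
      | true => constr:(0%N)
      | false => let i := lin_index t env' in constr:(i.+1)
      end
  end.
Ltac lin_mem t env :=
  lazymatch env with
  | nil => constr:(false)
  | ?u :: ?env' => lazymatch lin_same t u with
      | true => constr:(true)
      | false => lin_mem t env'
      end
  end.
Ltac lin_atoms t env :=
  lazymatch t with
  | @GRing.add _ ?a ?b => let e := lin_atoms a env in lin_atoms b e
  | @GRing.opp _ ?a => lin_atoms a env
  | @GRing.scale _ _ _ ?a => lin_atoms a env
  | @GRing.zero _ => env
  | _ => lazymatch lin_mem t env with true => env | false => constr:(t :: env) end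
  end.
Ltac lin_reify R t env :=
  lazymatch t with
  | @GRing.add _ ?a ?b =>
      let x := lin_reify R a env in let y := lin_reify R b env in constr:(LAdd x y)
  | @GRing.opp _ ?a => let x := lin_reify R a env in constr:(LOpp x)
  | @GRing.scale _ _ ?c ?a => let x := lin_reify R a env in constr:(@LScale R c x)
  | @GRing.zero _ => constr:(@LZero R)
  | _ => let i := lin_index t env in constr:(@LAtom R i)
  end.
Ltac lin_prep R M a b :=
  let env := lin_atoms a (@nil M) in
  let env := lin_atoms b env in
  let x := lin_reify R a env in
  let y := lin_reify R b env in
  let n := eval cbv in (size env) in
  refine (@leval_eq R M n env x y erefl _);
  cbv [lcoefs_eq lcoef Nat.eqb].
Ltac lin_solve := repeat (apply: conj; first by [ring|field]); exact: I.
Ltac lin_combine R M :=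
  lazymatch goal with |- @eq _ ?a ?b => lin_prep R M a b end; lin_solve.

(** * Exponential series *)

Lemma big_ord_triangle (R : nmodType) n (F : nat -> nat -> R) :
  \sum_(j < n.+1) \sum_(i < (n - j).+1) F j i
  = \sum_(i < n.+1) \sum_(j < (n - i).+1) F j i.
Proof.
have h (G : nat -> nat -> R) : \sum_(j < n.+1) \sum_(i < (n - j).+1) G j i
    = \sum_(j < n.+1) \sum_(i < n.+1 | (i + j <= n)%N) G j i.
  apply: eq_bigr => j _; rewrite (big_ord_widen n.+1 (G j)) ?ltnS ?leq_subr //.
  by apply: eq_bigl => i; have := ltn_ord j; lia.
rewrite (h F) (h (fun i j => F j i)) /= (exchange_big_dep predT) //=.
by apply: eq_bigr => i _; apply: eq_bigl => j; rewrite addnC.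
Qed.

Lemma big_ord_antidiag (R : nmodType) n (F : nat -> nat -> R) :
  \sum_(j < n.+1) \sum_(i < (n - j).+1) F j i
  = \sum_(s < n.+1) \sum_(i < s.+1) F (s - i)%N i.
Proof.
elim: n => [|n ih]; first by rewrite !big_ord1.
rewrite [RHS]big_ord_recr -ih /= [LHS]big_ord_recr /= subnn big_ord1.
under eq_bigr => j _ do rewrite subSn -1?ltnS // big_ord_recr /=.
rewrite big_split /= -addrA; congr (_ + _).
rewrite [RHS](reindex_inj rev_ord_inj) [RHS]big_ord_recr /= subnn subn0; congr (_ + _).
by apply: eq_bigr => j _; have lt_jn := ltn_ord j; congr (F _ _); lia.
Qed.

Section ExponentialSeries.
Variables (M : lmodType rat) (X : nat -> {linear M -> M}).

(** The logarithmic derivative of the exponential gives (k+1) S_(k+1) = sum_j X_j S_(k-j). Each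
    value calls all earlier ones, so the list of them is what is built. *)
Fixpoint sch_seq (y : M) n : seq M :=
  if n is n'.+1 then
    let s := sch_seq y n' in
    rcons s (n'.+1%:R^-1 *: \sum_(j < n'.+1) X j (nth 0 s (n' - j)))
  else [:: y].

(* The coefficient of z^k in exp (sum_j X_j z^(j+1) / (j+1)).                  *)
Definition sch k (y : M) : M := nth 0 (sch_seq y k) k.

Lemma size_sch_seq y n : size (sch_seq y n) = n.+1.
Proof. by elim: n => //= n ih; rewrite size_rcons ih. Qed.

Lemma nth_sch_seq y n k : (k <= n)%N -> nth 0 (sch_seq y n) k = sch k y.
Proof.
elim: n => [|n ih]; first by rewrite leqn0 => /eqP ->.
rewrite leq_eqVlt => /orP[/eqP -> //|le_kn].
by rewrite /= nth_rcons size_sch_seq le_kn; apply: ih.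
Qed.

Lemma sch0 y : sch 0 y = y. Proof. by []. Qed.

Lemma schS k y : sch k.+1 y = k.+1%:R^-1 *: \sum_(j < k.+1) X j (sch (k - j) y).
Proof.
rewrite [LHS]/sch /= nth_rcons size_sch_seq ltnn eqxx; congr (_ *: _).
by apply: eq_bigr => j _; rewrite nth_sch_seq // leq_subr.
Qed.

Lemma schSM k y : k.+1%:R *: sch k.+1 y = \sum_(j < k.+1) X j (sch (k - j) y).
Proof. by rewrite schS scalerA divff ?scale1r // pnatr_eq0. Qed.

(** An exponential series is determined by its differential equation; linearity, [sch_intertwine]
    and the addition rule [Sfr_add] are proved by checking that equation. *)
Lemma sch_uniq (E : nat -> M) :
  (forall k, k.+1%:R *: E k.+1 = \sum_(j < k.+1) X j (E (k - j)%N)) ->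
  forall k, E k = sch k (E 0%N).
Proof.
move=> h; elim/ltn_ind => -[//|k] ih.
apply: (@scalerI _ _ k.+1%:R); rewrite ?pnatr_eq0 // h schSM.
by apply: eq_bigr => j _; rewrite ih // ltnS leq_subr.
Qed.

Fact sch_linear k : linear (sch k).
Proof.
move=> a x y; rewrite -[a *: x + y]/(a *: sch 0 x + sch 0 y).
rewrite -(@sch_uniq (fun k => a *: sch k x + sch k y)) // => {}k.
rewrite scalerDr scalerA mulrC -scalerA !schSM scaler_sumr -big_split /=.
by apply: eq_bigr => j _; rewrite linearP.
Qed.
HB.instance Definition _ k := GRing.isLinear.Build rat M M _ (sch k) (sch_linear k).

Lemma sch_comm (T : {additive M -> M}) :
  (forall j y, T (X j y) = X j (T y)) -> forall k y, T (sch k y) = sch k (T y).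
Proof.
move=> h; elim/ltn_ind => -[//|k] ih y.
apply: (@scalerI _ _ k.+1%:R); rewrite ?pnatr_eq0 // schSM scaler_nat -raddfMn.
rewrite -scaler_nat schSM raddf_sum; apply: eq_bigr => j _.
by rewrite h ih // ltnS leq_subr.
Qed.

End ExponentialSeries.

(* The coefficients of (1 - z)^(-n).                                           *)
Definition rbin (n : int) (i : nat) : int :=
  if n is Posz n' then 'C(n' + i - 1, i)%:Z else
  (-1) ^+ i * 'C(`|n|%N, i)%:Z.

Lemma rbin0 n : rbin n 0 = 1.
Proof. by case: n => n; rewrite /rbin bin0 ?expr0 ?mul1r. Qed.

Lemma rbinS n i : i.+1%:Z * rbin n i.+1 = (n + i%:Z) * rbin n i.
Proof.
case: n => [[|n]|n]; rewrite /rbin.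
- by case: i => [|i]; rewrite ?mul0r // !bin_small ?mulr0 // !add0n subn1.
- rewrite addnS subn1 /= addSn subn1 /=.
  by have := mul_bin_diag (n + i).+1 i; rewrite /=; lia.
- rewrite NegzE abszN /= exprS; have := mul_bin_left n.+1 i.
  have [le|lt] := leqP i n.+1; last by rewrite !bin_small // ?(ltn_trans lt) // !mulr0.
  move: ((-1) ^+ i) ('C(n.+1, i)) ('C(n.+1, i.+1)) => e a b h.
  by have {}h := congr1 Posz h; rewrite !PoszM -subzn // in h; rewrite mulN1r mulNr mulrN mulrCA h; ring.
Qed.

(** Coefficientwise this is z d/dz (1 - z)^(-n) = n z (1 - z)^(-1) (1 - z)^(-n). *)
Lemma rbin_sum n s : n * \sum_(i < s) rbin n i = s%:Z * rbin n s.
Proof.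
elim: s => [|s ih]; first by rewrite big_ord0 mulr0 mul0r.
by rewrite big_ord_recr /= mulrDr ih rbinS -mulrDl addrC.
Qed.

(* exp (sum_j X_j z^(j+1) / (j+1)) E(w) = (1 - z / w)^n E(w) exp (..), in modes *)
Lemma sch_twist (M : lmodType rat) (X : nat -> {linear M -> M})
    (E : int -> {linear M -> M}) (n : int) :
  (forall k j y, E k (X j y) = X j (E k y) + n%:~R *: E (k - j.+1%:Z) y) ->
  forall l k y, E k (sch X l y)
    = \sum_(i < l.+1) (rbin n i)%:~R *: sch X (l - i) (E (k - i%:Z) y).
Proof.
move=> hE; elim/ltn_ind => -[|l] ih k y.
  by rewrite big_ord1 rbin0 scale1r subr0.
apply: (@scalerI _ _ l.+1%:R); rewrite ?pnatr_eq0 // -linearZ /= schSM linear_sum /=.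
under eq_bigr => j _ do rewrite hE !ih ?ltnS ?leq_subr // linear_sum /= scaler_sumr.
rewrite big_split /=.
(* In these terms [X j] has moved to the left of [E]; for fixed [i] the recursion sums them to
   [l.+1 - i] times [sch X (l.+1 - i)]. *)
have -> : \sum_(j < l.+1) \sum_(i < (l - j).+1)
    X j ((rbin n i)%:~R *: sch X (l - j - i) (E (k - i%:Z) y))
  = \sum_(i < l.+1) (rbin n i * (l.+1 - i)%N%:Z)%:~R *: sch X (l.+1 - i) (E (k - i%:Z) y).
  rewrite (big_ord_triangle l
    (fun j i => X j ((rbin n i)%:~R *: sch X (l - j - i) (E (k - i%:Z) y)))).
  apply: eq_bigr => i _; have le_il : (i <= l)%N by rewrite -ltnS.
  rewrite subSn // intrM -scalerA -pmulrn schSM scaler_sumr; apply: eq_bigr => j _.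
  by rewrite linearZ /= subnAC.
rewrite (big_ord_antidiag l (fun j i => n%:~R *:
  ((rbin n i)%:~R *: sch X (l - j - i) (E (k - j.+1%:Z - i%:Z) y)))).
rewrite [RHS]scaler_sumr [RHS]big_ord_recl /= [X in X + _]big_ord_recl /=.
rewrite -addrA rbin0 mul1r scale1r subn0; congr (_ + _).
rewrite [in RHS]big_ord_recr [in X in _ + X]big_ord_recr /= addrA -big_split /=.
(* The commutator terms in which the index of [E] has dropped by s+1 in all are summed by
   [rbin_sum]. Their factor s+1 and the factor l-s of the other terms then add up to l+1. *)
have aux (s : nat) : (s <= l)%N -> \sum_(i < s.+1)
     n%:~R *: ((rbin n i)%:~R *:
       sch X (l - (s - i) - i) (E (k - (s - i).+1%:Z - i%:Z) y))
   = (s.+1%:Z * rbin n s.+1)%:~R *: sch X (l - s) (E (k - s.+1%:Z) y).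
  move=> le_sl; rewrite -rbin_sum mulr_sumr rmorph_sum scaler_suml.
  apply: eq_bigr => i _; rewrite scalerA -intrM; have lt_is := ltn_ord i.
  by congr (_ *: sch _ _ (E _ _)); lia.
rewrite aux //; congr (_ + _); last by rewrite scalerA intrM.
apply: eq_bigr => s _; rewrite aux ?(ltnW (ltn_ord s)) //.
rewrite /bump /= add1n subSS -scalerDl scalerA (pmulrn _ l.+1) -intrD -intrM.
by congr (_%:~R *: _); have := ltn_ord s; lia.
Qed.

(** * Fock spaces *)

Lemma scalerC (R : comNzRingType) (M : lmodType R) (a b : R) (x : M) :
  a *: (b *: x) = b *: (a *: x).
Proof. by rewrite !scalerA mulrC. Qed.

Lemma scaler_reg (R : nzRingType) (a : R) (b : R^o) : a *: b = a * b.
Proof. by []. Qed.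

Section MalgTheory.
Variables (K : choiceType) (R : nzRingType).

Lemma malg_sum (g : {malg R[K]}) : g = \sum_(k <- msupp g) g@_k *: << 1 *g k >>.
Proof.
rewrite {1}[g]monalgE; apply: eq_bigr => k _; apply/malgP => k'.
by rewrite mcoeffZ !mcoeffU mulrnAr mulr1.
Qed.

Lemma mcoeff_single (k k' : K) : (<< 1 *g k >> : {malg R[K]})@_k' = (k == k')%:R.
Proof. exact: mcoeffU. Qed.

Lemma msupp_single (k : K) : msupp (<< 1 *g k >> : {malg R[K]}) = [fset k]%fset.
Proof. by rewrite msuppU oner_eq0. Qed.
End MalgTheory.

(* The Fock space through its universal property, as the Q-vector space with    *)
(* basis the pairs (a, m). Working with an abstract such space hides the       *)
(* construction of [fock r] from unification.                                  *)
Record fock_model (r : nat) := FockModel {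
  fock_space :> lmodType rat;
  vec : 'rV[int]_r -> {cmonom ('I_r * nat)%type} -> fock_space;
  ext : forall P : lmodType rat, ('rV[int]_r -> {cmonom ('I_r * nat)%type} -> P) ->
    {linear fock_space -> P};
  ext_vec : forall (P : lmodType rat) (f : _ -> _ -> P) a m, ext f (vec a m) = f a m;
  vec_ind : forall Q : fock_space -> Prop, Q 0 ->
    (forall c a m x, Q x -> Q (c *: vec a m + x)) -> forall x, Q x }.

Section FockModel.
Variable r : nat.

Definition fock_ext (P : lmodType rat) (f : 'rV[int]_r -> {cmonom ('I_r * nat)%type} -> P)
    (x : fock r) : P := \sum_(k <- msupp x) x@_k *: f k.1 k.2.

Fact fock_ext_linear (P : lmodType rat) f : linear (@fock_ext P f).
Proof. exact: (@sum_supp_linear r P (fun k => f k.1 k.2)). Qed.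
HB.instance Definition _ (P : lmodType rat) f :=
  GRing.isLinear.Build rat (fock r) P _ (@fock_ext P f) (@fock_ext_linear P f).

Fact fock_ext_bvec (P : lmodType rat) (f : _ -> _ -> P) a m : fock_ext f (bvec a m) = f a m.
Proof.
rewrite /fock_ext /bvec (@msupp_single (fock_basis r) rat) big_seq_fset1.
by rewrite (@mcoeff_single (fock_basis r) rat) eqxx scale1r.
Qed.

Fact fock_bvec_ind (Q : fock r -> Prop) : Q 0 ->
  (forall c a m x, Q x -> Q (c *: bvec a m + x)) -> forall x, Q x.
Proof.
move=> h0 hS x; rewrite [x](@malg_sum _ rat).
elim: (msupp x : seq _) => [|[a m] s ih]; first by rewrite big_nil.
by rewrite big_cons; apply: hS.
Qed.

Definition fock_mod : fock_model r :=
  @FockModel r (fock r : lmodType rat) (@bvec r) (fun P f => @fock_ext P f)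
    fock_ext_bvec fock_bvec_ind.
End FockModel.

HB.lock Definition coef (r : nat) (F : fock_model r) (a : 'rV[int]_r)
    (m : {cmonom ('I_r * nat)%type}) : {linear F -> rat^o} :=
  ext F (fun b m' => ((b == a) && (m' == m))%:R : rat^o).
HB.lock Definition mulv (r : nat) (F : fock_model r) (v : 'I_r * nat) : {linear F -> F} :=
  ext F (fun a m => vec F a (mon_mul v m)).
HB.lock Definition derv (r : nat) (F : fock_model r) (v : 'I_r * nat) : {linear F -> F} :=
  ext F (fun a m => (m v)%:R *: vec F a (mon_div m v)).
HB.lock Definition fD (r : nat) (F : fock_model r) : {linear F -> F} :=
  ext F (fun a m =>
  \sum_(v <- finsupp m)
     (m v * v.2.+1)%:R *: vec F a (mon_mul (v.1, v.2.+1) (mon_div m v))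
  + \sum_(i < r) (a 0 i)%:~R *: vec F a (mon_mul (i, 0%N) m)).
HB.lock Definition fmulr (r : nat) (F : fock_model r) (A : 'M[int]_r) (y : F) :
    {linear F -> F} :=
  ext F (fun a m => ext F (fun b m' => cocycle A a b *: vec F (a + b) (mulcm m m')) y).
Arguments coef {r F} a m.
Arguments mulv {r F} v.
Arguments derv {r F} v.
Arguments fD {r F}.
Arguments fmulr {r F} A y.

Section FockCalculus.
Variables (r : nat) (F : fock_model r).
Local Notation L := 'rV[int]_r.
Local Notation vec := (@vec r F).
Implicit Types (a b : L) (m : {cmonom ('I_r * nat)%type}) (v w : 'I_r * nat) (x y : F).

Definition expv a : F := vec a (onecm _).

Lemma coef_vec a m b m' : coef a m (vec b m') = ((b == a) && (m' == m))%:R.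
Proof. by rewrite coef.unlock ext_vec. Qed.
Lemma mulv_vec v a m : mulv v (vec a m) = vec a (mon_mul v m).
Proof. by rewrite mulv.unlock ext_vec. Qed.
Lemma derv_vec v a m : derv v (vec a m) = (m v)%:R *: vec a (mon_div m v).
Proof. by rewrite derv.unlock ext_vec. Qed.

Lemma mon_mulE v m w : mon_mul v m w = ((v == w) + m w)%N.
Proof. by rewrite mulcmE ucmE. Qed.
Lemma mon_divE v m w : mon_div m v w = (m w - (v == w))%N.
Proof. by rewrite divcmE ucmE. Qed.

Lemma mon_mulK v m : mon_div (mon_mul v m) v = m.
Proof. by apply/eqP/cmP => w; rewrite mon_divE mon_mulE addKn. Qed.
Lemma mon_divK v m : m v != 0%N -> mon_mul v (mon_div m v) = m.
Proof.
move=> h; apply/eqP/cmP => w; rewrite mon_mulE mon_divE.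
by case: eqP => [<-|_]; [rewrite subnKC // lt0n | rewrite subn0].
Qed.
Lemma mon_mulC v w m : mon_mul v (mon_mul w m) = mon_mul w (mon_mul v m).
Proof. by apply/eqP/cmP => u; rewrite !mon_mulE addnCA. Qed.

(** Basis vectors arise from exponentials by adding one oscillator at a time, so an operator
    identity need only be checked on [expv a] and carried past [mulv]. *)
Lemma fock_ind (Q : F -> Prop) :
  (forall c x y, Q x -> Q y -> Q (c *: x + y)) ->
  (forall a, Q (expv a)) -> (forall v y, Q y -> Q (mulv v y)) -> forall x, Q x.
Proof.
move=> hQ he hm x.
have q0 : Q 0 by rewrite -(subrr (expv 0)) -scaleN1r addrC; apply: hQ.
elim/vec_ind: x => // c a m x qx; apply: hQ => // {x qx}.
move: {2}(mdeg m) (erefl (mdeg m)) => n; elim: n m => [|n ih] m dm.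
  by have /eqP := dm; rewrite mdeg_eq0 => /eqP ->; apply: he.
have [v mv] : exists v, m v != 0%N.
  have : finsupp m != fset0.
    by apply/negP => /eqP e; move: dm; rewrite mdegE e big_seq_fset0.
  by case/fset0Pn => v; rewrite -cmE_neq0; exists v.
rewrite -(mon_divK mv) -mulv_vec; apply/hm/ih.
move: dm; rewrite -{1}(mon_divK mv) mdegM mdegU add1n; case=> ->; lia.
Qed.

Lemma fock_eq (M : lmodType rat) (f g : {linear F -> M}) :
  (forall a m, f (vec a m) = g (vec a m)) -> f =1 g.
Proof.
move=> h x; elim/vec_ind: x => [|c a m x ih]; first by rewrite !linear0.
by rewrite !linearP h ih.
Qed.

Lemma mulvC v w y : mulv v (mulv w y) = mulv w (mulv v y).
Proof.
elim/vec_ind: y => [|c a m y ih]; first by rewrite !linear0.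
by rewrite !linearP ih !mulv_vec mon_mulC.
Qed.

Lemma derv_mulv v w y : derv v (mulv w y) = mulv w (derv v y) + (v == w)%:R *: y.
Proof.
elim/vec_ind: y => [|c a m y ih]; first by rewrite !linear0 ?scaler0 addr0.
rewrite !linearP ih addrACA -scalerDr; congr (_ *: _ + _); rewrite mulv_vec !derv_vec linearZ /= mulv_vec mon_mulE.
have [<-|ne] := eqVneq v w.
  rewrite mon_mulK natrD scalerDl addrC; congr (_ + _).
  have [->|h] := eqVneq (m v) 0%N; first by rewrite (mulr0n 1) !scale0r.
  by rewrite mon_divK.
rewrite mulr0n scale0r addr0 add0n.
congr (_ *: vec _ _); apply/eqP/cmP => u.
rewrite mon_divE !mon_mulE mon_divE.
by have [e|//] := eqVneq w u; have [e'|//] := eqVneq v u;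
   [rewrite e e' eqxx in ne | rewrite !subn0].
Qed.

Lemma derv_expv v a : derv v (expv a) = 0.
Proof. by rewrite derv_vec onecmE scale0r. Qed.

Lemma dervC v w y : derv v (derv w y) = derv w (derv v y).
Proof.
elim/fock_ind: y => [c x y hx hy|a|u y ih]; first by rewrite 4!linearP /= hx hy.
  by rewrite !derv_expv !linear0.
rewrite !derv_mulv !linearD !derv_mulv ih !linearZ /= -!addrA; congr (_ + _).
exact: addrC.
Qed.

Lemma mon_neq1 m : m != onecm _ -> exists v, m v != 0%N.
Proof.
move=> m1; have : finsupp m != fset0.
  by apply: contra m1 => /eqP e; rewrite -mdeg_eq0 mdegE e big_seq_fset0.
by case/fset0Pn => v; rewrite -cmE_neq0; exists v.
Qed.

Lemma coef_derv a m v y : coef a m (derv v y) = (m v).+1%:R * coef a (mon_mul v m) y.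
Proof.
elim/vec_ind: y => [|c a' m' y ih]; first by rewrite !linear0 mulr0.
rewrite !linearP ih /= mulrDr; congr (_ + _).
rewrite derv_vec linearZ /= !coef_vec [RHS]mulrCA; congr (c * _).
have [e|ne] := eqVneq m' (mon_mul v m).
  by rewrite e mon_mulK eqxx mon_mulE eqxx add1n.
rewrite andbF mulr0 scaler_reg.
have [->|h] := eqVneq (m' v) 0%N; first by rewrite mul0r.
rewrite (_ : mon_div m' v == m = false) ?andbF ?mulr0 //.
by apply: contraNF ne => /eqP <-; rewrite mon_divK.
Qed.

Lemma coef_inj x y : (forall a m, coef a m x = coef a m y) -> x = y.
Proof.
move=> h; apply/eqP; rewrite -subr_eq0; apply/eqP; set z := x - y.
have hz a m : coef a m z = 0 by rewrite linearB /= h subrr.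
(* The abstract model comes without supports; a finite index set for the expansion of z is built by
   induction on z. Allowing any larger set makes two such sets compatible. *)
suff [s hs] : exists s : {fset fock_basis r}, forall s' : {fset fock_basis r},
    (s `<=` s')%fset -> z = \sum_(k <- s') coef k.1 k.2 z *: vec k.1 k.2.
  by rewrite (hs s) // big1 // => k _; rewrite hz scale0r.
elim/vec_ind: (z) => [|c a m {hz}w [s ih]].
  by exists fset0 => s' _; rewrite big1 // => k _; rewrite linear0 scale0r.
exists ((a, m) |` s)%fset => s' /fsubUsetP[]; rewrite fsub1set => ins le.
under eq_bigr => k _ do rewrite linearP scalerDl -[_ *: coef _ _ _]/(c * _) -scalerA.
rewrite big_split -ih // -scaler_sumr; congr (_ *: _ + _).
rewrite (bigD1_seq (a, m)) ?fset_uniq //= big1 => [|[b m'] ne].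
  by rewrite coef_vec !eqxx scale1r addr0.
by rewrite coef_vec -xpair_eqE eq_sym (negbTE ne) scale0r.
Qed.

Lemma fD_expv a :
  fD (expv a) = \sum_(i < r) (a 0 i)%:~R *: mulv (i, 0%N) (expv a).
Proof.
rewrite fD.unlock ext_vec mdom1 big_seq_fset0 add0r.
by apply: eq_bigr => i _; rewrite mulv_vec.
Qed.

Lemma fD_mulv v y :
  fD (mulv v y) = mulv v (fD y) + v.2.+1%:R *: mulv (v.1, v.2.+1) y.
Proof.
elim/vec_ind: y => [|c a m y ih]; first by rewrite !linear0 ?scaler0 addr0.
rewrite !linearP ih addrACA -scalerDr.
congr (_ *: _ + _); rewrite !mulv_vec fD.unlock !ext_vec linearD /=.
rewrite !linear_sum /= addrAC; congr (_ + _); last first.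
  by apply: eq_bigr => i _; rewrite linearZ /= mulv_vec mon_mulC.
pose d := (v |` finsupp m)%fset.
have big_d (m' : {cmonom ('I_r * nat)%type}) (G : 'I_r * nat -> F) :
    (forall w, m' w != 0%N -> w \in d) ->
    \sum_(w <- finsupp m') (m' w * w.2.+1)%:R *: G w
    = \sum_(w <- d) (m' w * w.2.+1)%:R *: G w.
  move=> h; apply: big_fset_incl => [|w _]; last first.
    by rewrite -cmE_eq0 => /eqP ->; rewrite mul0n scale0r.
  by apply/fsubsetP => w; rewrite -cmE_neq0; apply: h.
under [in RHS]eq_bigr => w _ do rewrite linearZ /= mulv_vec.
rewrite !big_d => [||w]; first last.
- by rewrite mon_mulE !inE -cmE_neq0 (eq_sym v); case: (w == v).
- by move=> w; rewrite cmE_neq0 !inE => ->; rewrite orbT.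
have vd : v \in d by rewrite fset1U1.
rewrite (big_fsetD1 v vd) [X in _ = X + _](big_fsetD1 v vd) /= [RHS]addrAC.
congr (_ + _).
  rewrite mon_mulE eqxx mon_mulK mulnDl mul1n natrD scalerDl addrC; congr (_ + _).
  have [->|h] := eqVneq (m v) 0%N; first by rewrite mul0n !scale0r.
  by rewrite mon_mulC mon_divK.
apply: eq_big_seq => w; rewrite !inE => /andP[ne _].
rewrite mon_mulE eq_sym (negbTE ne) add0n.
congr (_ *: vec _ _); apply/eqP/cmP => u.
rewrite !(mon_mulE, mon_divE); have [e|_] := eqVneq v u; last by [].
by rewrite -e (negbTE ne) !subn0 addnCA.
Qed.

Section WithGram.
Variable A : 'M[int]_r.

Definition fmul x y : F := fmulr A y x.

Lemma fmulDl x x' y : fmul (x + x') y = fmul x y + fmul x' y.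
Proof. exact: linearD. Qed.
Lemma fmulZl c x y : fmul (c *: x) y = c *: fmul x y.
Proof. exact: linearZ. Qed.
Lemma fmul0l y : fmul 0 y = 0.
Proof. exact: linear0. Qed.

Lemma fmul_suml I (s : seq I) (P : pred I) (f : I -> F) y :
  fmul (\sum_(i <- s | P i) f i) y = \sum_(i <- s | P i) fmul (f i) y.
Proof. exact: linear_sum. Qed.

Fact fmul_linear x : linear (fmul x).
Proof.
move=> c y y'; elim/vec_ind: x => [|d a m x ih].
  by rewrite !fmul0l scaler0 addr0.
rewrite !fmulDl !fmulZl ih scalerDr addrACA; congr (_ + _).
by rewrite /fmul fmulr.unlock !ext_vec linearP scalerDr !scalerA mulrC.
Qed.
HB.instance Definition _ x := GRing.isLinear.Build rat F F _ (fmul x) (fmul_linear x).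

Lemma fmul_vec a m b m' :
  fmul (vec a m) (vec b m') = cocycle A a b *: vec (a + b) (mulcm m m').
Proof. by rewrite /fmul fmulr.unlock !ext_vec. Qed.

Lemma fmul_expv a b : fmul (expv a) (expv b) = cocycle A a b *: expv (a + b).
Proof. by rewrite fmul_vec mul0cm. Qed.

Lemma fmul_mulvl v x y : fmul (mulv v x) y = mulv v (fmul x y).
Proof.
elim/vec_ind: x => [|c a m x ih]; first by rewrite !linear0 !fmul0l linear0.
rewrite !linearD !linearZ /= !fmulDl !fmulZl !linearD !linearZ /= ih; congr (_ *: _ + _).
elim/vec_ind: y {ih} => [|d b m' y ihy]; first by rewrite !linear0.
rewrite !linearP /= ?linearP ihy; congr (_ *: _ + _).
by rewrite mulv_vec !fmul_vec linearZ /= mulv_vec /mon_mul mulcmA.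
Qed.

Lemma fmul_mulvr v x y : fmul x (mulv v y) = mulv v (fmul x y).
Proof.
elim/vec_ind: x => [|c a m x ih]; first by rewrite !fmul0l linear0.
rewrite !fmulDl !fmulZl !linearD !linearZ /= ih; congr (_ *: _ + _).
elim/vec_ind: y {ih} => [|d b m' y ihy]; first by rewrite !linear0.
rewrite !linearP /= ?linearP ihy; congr (_ *: _ + _).
by rewrite mulv_vec !fmul_vec linearZ /= mulv_vec /mon_mul mulcmA (mulcmC m) mulcmA.
Qed.

(** The twist does not spoil the Leibniz rule: the cocycle is a scalar, and D e^a = a(1) e^a is
    additive in a. *)
Lemma fD_mul x y : fD (fmul x y) = fmul (fD x) y + fmul x (fD y).
Proof.
elim/fock_ind: x => [c x x' hx hx'|a|v x ih].
- rewrite !linearD !linearZ /= !fmulDl !fmulZl !linearD !linearZ /= hx hx'.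
  by rewrite scalerDr addrACA.
- elim/fock_ind: y => [c y y' hy hy'|b|v y ih].
  + by rewrite !linearP hy hy' scalerDr addrACA.
  + rewrite fmul_expv linearZ /= !fD_expv linear_sum /=.
    rewrite fmul_suml linear_sum -big_split; apply: eq_bigr => i _ /=.
    rewrite fmulZl !linearZ /= fmul_mulvl fmul_mulvr fmul_expv.
    by rewrite -scalerDl mxE intrD !linearZ /= scalerA mulrC -scalerA.
  + by rewrite fmul_mulvr !fD_mulv ih !linearD /= linearZ /= !fmul_mulvr addrA.
- by rewrite fmul_mulvl !fD_mulv ih linearD fmulDl fmulZl !fmul_mulvl addrAC.
Qed.

End WithGram.
End FockCalculus.

(** * Heisenberg operators *)

Section ExponentialSeriesMore.
Variables (M : lmodType rat) (X : nat -> {linear M -> M}).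

(** Zero in negative degrees, so that rules that lower the index need no side conditions. *)
Definition schz (k : int) (y : M) : M := if k is Posz k' then sch X k' y else 0.

Fact schz_linear k : linear (schz k).
Proof. by case: k => k a x y; [apply: linearP | rewrite /= scaler0 addr0]. Qed.
HB.instance Definition _ k := GRing.isLinear.Build rat M M _ (schz k) (schz_linear k).

Lemma schzE k y : k%:~R *: schz k y = \sum_(j < `|k|%N) X j (schz (k - j.+1%:Z) y).
Proof.
case: k => [[|k]|k]; first by rewrite big_ord0 scale0r.
  rewrite /= [LHS]schSM; apply: eq_bigr => j _; congr (X j _).
  have -> : k.+1%:Z - j.+1%:Z = (k - j)%N%:Z by have := ltn_ord j; lia.
  by [].
rewrite scaler0 big1 // => j _.
have -> : Negz k - j.+1%:Z = Negz (k + j.+1) by lia.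
exact: linear0.
Qed.

Lemma schz_sum n k y : (`|k| <= n)%N ->
  \sum_(j < n) X j (schz (k - j.+1%:Z) y) = k%:~R *: schz k y.
Proof.
move=> le; rewrite schzE [RHS](big_ord_widen n (fun j => X j (schz (k - j.+1%:Z) y))) //.
rewrite [RHS]big_mkcond; apply: eq_bigr => j _; case: ifP => // /negbT; rewrite -leqNgt => h.
have -> : k - j.+1%:Z = Negz (absz (k - j.+1%:Z)%R).-1 by lia.
exact: linear0.
Qed.

(** Up to a factor, [T] is the partial derivative in the variable [X i]; from the exponential it
    brings down d z^(i+1). *)
Lemma sch_shift (T : {linear M -> M}) (d : rat) i :
  (forall j y, T (X j y) = X j (T y) + ((j == i)%:R * (i.+1%:R * d)) *: y) ->
  forall k y, T (sch X k y) = sch X k (T y) + d *: schz (k%:Z - i.+1%:Z) y.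
Proof.
move=> hT; elim/ltn_ind => -[|k] ih y; first by rewrite scaler0 addr0.
apply: (@scalerI _ _ k.+1%:R); rewrite ?pnatr_eq0 // -linearZ /= schSM linear_sum /=.
under eq_bigr => j _ do rewrite hT ih ?ltnS ?leq_subr // linearD linearZ /=.
rewrite !big_split /= -schSM -addrA scalerDr; congr (_ + _).
rewrite -scaler_sumr scalerA mulrC -scalerA.
have -> : \sum_(j < k.+1) X j (schz ((k - j)%N%:Z - i.+1%:Z) y)
    = (k%:Z - i%:Z)%:~R *: schz (k%:Z - i%:Z) y.
  rewrite -(@schz_sum (k + i.+1)%N); last by lia.
  rewrite (big_ord_widen (k + i.+1) (fun j => X j (schz ((k - j)%N%:Z - i.+1%:Z) y))); last by lia.
  rewrite big_mkcond; apply: eq_bigr => j _; case: ifP => [lt|/negbT ge].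
    by congr (X j (schz _ y)); lia.
  have -> : k%:Z - i%:Z - j.+1%:Z = Negz (absz (k%:Z - i%:Z - j.+1%:Z)%R).-1 by lia.
  by rewrite linear0.
have -> : k.+1%:Z - i.+1%:Z = k%:Z - i%:Z by lia.
have [le|lt] := leqP i k; last first.
  have -> : k%:Z - i%:Z = Negz (i - k).-1 by lia.
  rewrite !scaler0 add0r big1 // => j _; have -> : (j == i :> nat) = false by have := ltn_ord j; lia.
  by rewrite mul0r scale0r.
rewrite (bigD1 (Ordinal (n := k.+1) (m := i) le)) //= big1 => [|j]; last first.
  by rewrite -val_eqE /= => /negbTE ->; rewrite mul0r scale0r.
have -> : k%:Z - i%:Z = (k - i)%N%:Z by lia.
rewrite addr0 eqxx mul1r -!scalerA -!scalerDr [RHS]scalerC; congr (d *: _).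
by rewrite -pmulrn -scalerDl -natrD; congr (_%:R *: _); lia.
Qed.

Lemma schz_comm (Y : {linear M -> M}) (d : rat) i :
  (forall j y, X j (Y y) = Y (X j y) + ((j == i)%:R * (i.+1%:R * d)) *: y) ->
  (forall j k y, X j (X k y) = X k (X j y)) ->
  forall k y, schz k (Y y) = Y (schz k y) + d *: schz (k - i.+1%:Z) y.
Proof.
move=> hY _ [k|k] y; last first.
  have -> : Negz k - i.+1%:Z = Negz (k + i.+1) by lia.
  by rewrite /= linear0 scaler0 addr0.
have h j z : Y (X j z) = X j (Y z) + ((j == i)%:R * (i.+1%:R * - d)) *: z.
  by rewrite hY -addrA -scalerDl !mulrN addrN scale0r addr0.
by rewrite /= (sch_shift h) scaleNr subrK.
Qed.

(** On the exponent sum_j X_j z^(j+1) / (j+1) the operator [T] acts like d/dz, except that it does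
    not produce the term [X 0]; hence the subtraction. *)
Lemma sch_deriv (T : {linear M -> M}) :
  (forall j k y, X j (X k y) = X k (X j y)) ->
  (forall j y, T (X j y) = X j (T y) + j.+1%:R *: X j.+1 y) ->
  forall k y, T (sch X k y) = sch X k (T y) + k.+1%:R *: sch X k.+1 y - X 0%N (sch X k y).
Proof.
move=> XC hT; elim/ltn_ind => -[|k] ih y.
  by rewrite !sch0 schSM big_ord1 subnn sch0 addrK.
apply: (@scalerI _ _ k.+1%:R); rewrite ?pnatr_eq0 //.
have -> : k.+1%:R *: T (sch X k.+1 y) = \sum_(j < k.+1) T (X j (sch X (k - j) y)).
  by rewrite -linear_sum -schSM linearZ.
under eq_bigr => j _ do rewrite hT ih ?ltnS ?leq_subr // linearB linearD linearZ /= XC.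
rewrite !big_split /= sumrN -schSM -linear_sum /= -schSM linearZ /= scalerBr scalerDr.
rewrite -!addrA; congr (_ + _); rewrite [- _ + _]addrC addrA; congr (_ - _).
rewrite schSM scaler_sumr [RHS]big_ord_recr /= subnn.
under eq_bigr => j _ do rewrite -subSn -1?ltnS //.
rewrite big_ord_recl [X in _ + X]big_ord_recr /= !subn0 addrACA.
rewrite [in RHS]big_ord_recl /= !subn0 -!addrA; congr (_ + _).
rewrite subnn addrA -big_split /=; congr (_ + _).
rewrite /bump /=; apply: eq_bigr => j _; rewrite add1n subSS -scalerDl -natrD.
by have lt := ltn_ord j; congr (_%:R *: _); lia.
Qed.

Lemma schC (Y : nat -> {linear M -> M}) :
  (forall j k y, X j (Y k y) = Y k (X j y)) ->
  forall k l y, sch X k (sch Y l y) = sch Y l (sch X k y).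
Proof.
move=> h k l y; apply: sch_comm => j z; symmetry; apply: sch_comm => i {}z.
by rewrite h.
Qed.

Lemma sch_adj (Y : nat -> {linear M -> M}) (B : M -> M -> rat) :
  (forall y c x x', B (c *: x + x') y = c * B x y + B x' y) ->
  (forall x c y y', B x (c *: y + y') = c * B x y + B x y') ->
  (forall j k y, Y j (Y k y) = Y k (Y j y)) ->
  (forall j x y, B (X j x) y = B x (Y j y)) ->
  forall k x y, B (sch X k x) y = B x (sch Y k y).
Proof.
move=> Bl Br YC hB; elim/ltn_ind => -[//|k] ih x y.
have Bl0 z : B 0 z = 0 by have := Bl z (-1) x x; rewrite scaleN1r addNr mulN1r addNr.
have Br0 z : B z 0 = 0 by have := Br z (-1) y y; rewrite scaleN1r addNr mulN1r addNr.
have BlD z : {morph B^~ z : u v / u + v} by move=> u v; have := Bl z 1 u v; rewrite scale1r mul1r.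
have BrD z : {morph B z : u v / u + v} by move=> u v; have := Br z 1 u v; rewrite scale1r mul1r.
have h : k.+1%:R * B (sch X k.+1 x) y = k.+1%:R * B x (sch Y k.+1 y).
  have := Bl y k.+1%:R (sch X k.+1 x) 0; rewrite addr0 Bl0 addr0 => <-.
  have := Br x k.+1%:R (sch Y k.+1 y) 0; rewrite addr0 Br0 addr0 => <-.
  rewrite !schSM (big_morph (B^~ y) (BlD y) (Bl0 y)) (big_morph (B x) (BrD x) (Br0 x)).
  apply: eq_bigr => j _; rewrite hB ih ?ltnS ?leq_subr //; congr (B x _).
  by rewrite (sch_comm (X := Y) (T := Y j)) // => i z; apply: YC.
by move: h; apply: mulfI; rewrite pnatr_eq0.
Qed.
End ExponentialSeriesMore.

(** The mode b(n) of an arbitrary lattice vector, where [heis] only has basis vectors; the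
    commutation relations become free of coordinates. *)
HB.lock Definition hv (r : nat) (F : fock_model r) (A : 'M[int]_r) (b : 'rV[int]_r) (n : int) :
    {linear F -> F} :=
  ext F (fun a m => match n with
    | Posz 0 => (pairing A b a)%:~R *: vec F a m
    | Posz j.+1 => \sum_(k < r) (j.+1%:R * ((b *m A) 0 k)%:~R) *: derv (k, j) (vec F a m)
    | Negz j => \sum_(i < r) (b 0 i)%:~R *: mulv (i, j) (vec F a m)
    end).
Arguments hv {r F} A b n.

Section Heisenberg.
Variables (r : nat) (F : fock_model r) (A : 'M[int]_r).
Local Notation L := 'rV[int]_r.
Implicit Types (a b c : L) (x y : F).
Local Notation pr := (pairing A).
Local Notation fmul := (fmul A).
Local Notation expv := (expv F).

Lemma pairingE a b : pr a b = \sum_k (a *m A) 0 k * b 0 k.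
Proof. by rewrite /pairing [LHS]mxE; apply: eq_bigr => k _; rewrite [b^T _ _]mxE. Qed.
Lemma pairingDl a a' b : pr (a + a') b = pr a b + pr a' b.
Proof. by rewrite /pairing !mulmxDl mxE. Qed.
Lemma pairingDr a b b' : pr a (b + b') = pr a b + pr a b'.
Proof. by rewrite /pairing linearD /= mulmxDr mxE. Qed.
Lemma pairingNr a b : pr a (- b) = - pr a b.
Proof. by rewrite /pairing linearN /= mulmxN mxE. Qed.

Lemma hv_neg b j y : hv A b (Negz j) y = \sum_(i < r) (b 0 i)%:~R *: mulv (i, j) y.
Proof.
elim/vec_ind: y => [|d a m y ih]; first by rewrite linear0 big1 // => i _; rewrite !linear0.
rewrite linearP ih [in LHS]hv.unlock ext_vec scaler_sumr -big_split.
by apply: eq_bigr => i _ /=; rewrite !linearP.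
Qed.

Lemma hv_pos b j y : hv A b (Posz j.+1) y
  = \sum_(k < r) (j.+1%:R * ((b *m A) 0 k)%:~R) *: derv (k, j) y.
Proof.
elim/vec_ind: y => [|d a m y ih]; first by rewrite linear0 big1 // => i _; rewrite !linear0.
rewrite linearP ih [in LHS]hv.unlock ext_vec scaler_sumr -big_split.
by apply: eq_bigr => i _ /=; rewrite !linearP.
Qed.

Lemma hv0_vec b a m : hv A b 0 (vec F a m) = (pr b a)%:~R *: vec F a m.
Proof. by rewrite hv.unlock ext_vec. Qed.

Lemma hv0_expv b a : hv A b 0 (expv a) = (pr b a)%:~R *: expv a.
Proof. exact: hv0_vec. Qed.

Lemma hv_expv b a j : hv A b (Posz j.+1) (expv a) = 0.
Proof. by rewrite hv_pos big1 // => k _; rewrite derv_expv scaler0. Qed.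

Lemma hv0_mulv b v y : hv A b 0 (mulv v y) = mulv v (hv A b 0 y).
Proof.
elim/vec_ind: y => [|d a m y ih]; first by rewrite !linear0.
by rewrite !linearP /= ih mulv_vec !hv0_vec [mulv v (_ *: _)]linearZ /= mulv_vec.
Qed.

Lemma hv0_derv b v y : hv A b 0 (derv v y) = derv v (hv A b 0 y).
Proof.
elim/vec_ind: y => [|d a m y ih]; first by rewrite !linear0.
rewrite !linearP /= ih derv_vec !hv0_vec [hv _ _ _ (_ *: _)]linearZ.
congr (_ *: _ + _).
by rewrite [derv v (_ *: _)]linearZ /= derv_vec hv0_vec scalerC.
Qed.

Lemma hv_negC b c i j y : hv A b (Negz i) (hv A c (Negz j) y) = hv A c (Negz j) (hv A b (Negz i) y).
Proof.
rewrite (hv_neg b i) (hv_neg c j (hv _ _ _ _)); under eq_bigr => k _ do rewrite hv_neg linear_sum scaler_sumr /=.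
under [RHS]eq_bigr => k _ do rewrite hv_neg linear_sum scaler_sumr /=.
rewrite exchange_big /=; apply: eq_bigr => k _; apply: eq_bigr => l _.
by rewrite !linearZ /= mulvC !scalerA mulrC.
Qed.

Lemma hv_posC b c i j y :
  hv A b (Posz i.+1) (hv A c (Posz j.+1) y) = hv A c (Posz j.+1) (hv A b (Posz i.+1) y).
Proof.
rewrite (hv_pos b i) (hv_pos c j (hv _ _ _ _)); under eq_bigr => k _ do rewrite hv_pos linear_sum scaler_sumr /=.
under [RHS]eq_bigr => k _ do rewrite hv_pos linear_sum scaler_sumr /=.
rewrite exchange_big /=; apply: eq_bigr => k _; apply: eq_bigr => l _.
by rewrite !linearZ /= dervC !scalerA mulrC.
Qed.

Lemma hv0C b c n y : hv A b 0 (hv A c n y) = hv A c n (hv A b 0 y).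
Proof.
case: n => [[|j]|j].
- elim/vec_ind: y => [|d a m y ih]; first by rewrite !linear0.
  rewrite !linearP /= ih !hv0_vec; congr (_ *: _ + _).
  by rewrite ![hv _ _ _ (_ *: _)]linearZ /= !hv0_vec scalerC.
- rewrite !hv_pos linear_sum; apply: eq_bigr => k _ /=.
  by rewrite linearZ /= hv0_derv.
- rewrite !hv_neg linear_sum; apply: eq_bigr => k _ /=.
  by rewrite linearZ /= hv0_mulv.
Qed.

Lemma hv_pos_neg b c i j y : hv A b (Posz i.+1) (hv A c (Negz j) y)
  = hv A c (Negz j) (hv A b (Posz i.+1) y) + ((i == j)%:R * (i.+1%:R * (pr b c)%:~R)) *: y.
Proof.
rewrite (hv_pos b) [in RHS](hv_neg c).
under eq_bigr => k _ do rewrite hv_neg linear_sum scaler_sumr /=.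
under [in RHS]eq_bigr => k _ do rewrite hv_pos linear_sum scaler_sumr /=.
rewrite [X in _ = X + _]exchange_big /= pairingE rmorph_sum !mulr_sumr scaler_suml -big_split.
apply: eq_bigr => k _ /=.
under eq_bigr => l _ do rewrite linearZ /= derv_mulv !scalerDr.
rewrite big_split; congr (_ + _).
  by apply: eq_bigr => l _ /=; rewrite [mulv _ (_ *: _)]linearZ /= scalerC.
rewrite (bigD1 k) //= big1 => [|l ne]; last first.
  by rewrite xpair_eqE eq_sym (negbTE ne) scale0r !scaler0.
by rewrite addr0 xpair_eqE eqxx /= !scalerA intrM; congr (_ *: _); ring.
Qed.

Lemma coef_hv0 b a m y : coef a m (hv A b 0 y) = (pr b a)%:~R * coef a m y.
Proof.
elim/vec_ind: y => [|d a' m' y ih]; first by rewrite !linear0 mulr0.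
rewrite !linearP ih /= mulrDr; congr (_ + _).
rewrite hv0_vec linearZ /= coef_vec; have [->|_] := eqVneq a' a; first by rewrite !scaler_reg mulrCA.
by rewrite /= !(scaler_reg, mulr0).
Qed.

Hypothesis A_sym : A^T = A.

Lemma pairingC a b : pr a b = pr b a.
Proof.
have -> : pr a b = ((a *m A *m b^T)^T) 0 0 by rewrite mxE.
by rewrite trmx_mul trmxK trmx_mul A_sym mulmxA.
Qed.

Lemma hvC b c m n y : hv A b m (hv A c n y)
  = hv A c n (hv A b m y) + (if m + n == 0 then (m * pr b c)%:~R else 0) *: y.
Proof.
case: m n => [[|i]|i] n.
- by rewrite hv0C mul0r if_same scale0r addr0.
- case: n => [[|j]|j]; first by rewrite -hv0C addr0 scale0r addr0.
    by rewrite hv_posC scale0r addr0.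
  have -> : (i.+1%:Z + Negz j == 0) = (i == j) by lia.
  by rewrite hv_pos_neg; case: eqP => _; rewrite ?mul0r ?scale0r // mul1r intrM -pmulrn.
- case: n => [[|j]|j]; first by rewrite -hv0C scale0r addr0.
    rewrite hv_pos_neg -addrA; have -> : (Negz i + j.+1%:Z == 0) = (j == i) by lia.
    case: eqP => [->|_]; rewrite ?mul0r ?scale0r ?addr0 //.
    by rewrite mul1r pairingC NegzE mulNr intrN intrM -pmulrn scaleNr subrr addr0.
  by rewrite hv_negC scale0r addr0.
Qed.

(** Irreducibility of the Heisenberg modules: for a nondegenerate Gram matrix the positive modes
    span all partial derivatives, so y is constant in the oscillators, and the zero modes fix its
    degree. *)
Lemma vacuum_vec a y : \det A != 0 ->
  (forall b j, hv A b (Posz j.+1) y = 0) -> (forall b, hv A b 0 y = (pr b a)%:~R *: y) ->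
  y = coef a (onecm _) y *: expv a.
Proof.
move=> det hpos h0.
have hd v : derv v y = 0.
  (* The modes are indexed by integral vectors, so the adjugate stands in for the inverse of A, at
     the price of a factor det A. *)
  pose B : L := delta_mx 0 v.1 *m \adj A.
  have e : B *m A = \det A *: delta_mx 0 v.1.
    by rewrite /B -mulmxA mul_adj_mx scalar_mxC mul_scalar_mx.
  have := hpos B v.2; rewrite hv_pos e (bigD1 v.1) //= big1 => [|k ne]; last first.
    by rewrite !mxE eqxx (negbTE ne) mulr0 mulr0 scale0r.
  rewrite addr0 !mxE !eqxx mulr1 -surjective_pairing => /eqP; rewrite scaler_eq0.
  by rewrite mulf_eq0 pnatr_eq0 intr_eq0 (negbTE det) => /eqP.
apply: coef_inj => b m; rewrite linearZ /= coef_vec.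
rewrite [onecm _ == m]eq_sym; have [->|m1] := eqVneq m (onecm _); last first.
  rewrite andbF scaler_reg mulr0.
  have [v mv] := mon_neq1 m1; have := coef_derv b (mon_div m v) v y.
  rewrite hd linear0 mon_divK // => /esym/eqP; rewrite mulf_eq0 pnatr_eq0 /=.
  by move=> /eqP.
rewrite [a == b]eq_sym; have [->|ne] := eqVneq b a; first by rewrite scaler_reg mulr1.
rewrite scaler_reg mulr0; apply/eqP/negPn/negP => cn0; move/negP: ne; apply.
have hh c : pr c (b - a) = 0.
  apply/eqP; rewrite pairingDr pairingNr subr_eq0.
  have e : (pr c a)%:~R * (coef b (onecm _) y : rat) = (pr c b)%:~R * coef b (onecm _) y.
    by rewrite -coef_hv0 h0 linearZ.
  by rewrite (intr_inj (mulIf cn0 e)).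
rewrite -subr_eq0; apply/eqP/rowP => i; have := hh (delta_mx 0 i *m \adj A).
rewrite /pairing -(mulmxA _ (\adj A)) mul_adj_mx.
rewrite scalar_mxC mul_scalar_mx -scalemxAl mxE => /eqP.
rewrite mulf_eq0 (negbTE det) /= mxE (bigD1 i) //= big1 => [|k ne].
  by rewrite !mxE !eqxx mul1r addr0 => /eqP.
by rewrite !mxE eqxx (negbTE ne) mul0r.
Qed.
End Heisenberg.

(** * The integral form and the contravariant form *)

Section ZSpan.
Variable M : zmodType.
Implicit Type P : M -> Prop.

Inductive zspan P : M -> Prop :=
| zspan_gen x : P x -> zspan P x
| zspan_0 : zspan P 0
| zspan_B x y : zspan P x -> zspan P y -> zspan P (x - y).

Variable P : M -> Prop.
Lemma zspanN x : zspan P x -> zspan P (- x).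
Proof. by move=> h; rewrite -sub0r; apply: zspan_B => //; apply: zspan_0. Qed.
Lemma zspanD x y : zspan P x -> zspan P y -> zspan P (x + y).
Proof. by move=> hx hy; rewrite -[y]opprK; apply: zspan_B => //; apply: zspanN. Qed.
Lemma zspanMn x n : zspan P x -> zspan P (x *+ n).
Proof.
move=> hx; elim: n => [|n ih]; first by rewrite mulr0n; apply: zspan_0.
by rewrite mulrS; apply: zspanD.
Qed.
Lemma zspanMz x (n : int) : zspan P x -> zspan P (x *~ n).
Proof. by case: n => n hx; [apply: zspanMn | apply/zspanN/zspanMn]. Qed.
Lemma zspan_sum I (s : seq I) (Q : pred I) (f : I -> M) :
  (forall i, Q i -> zspan P (f i)) -> zspan P (\sum_(i <- s | Q i) f i).
Proof. by move=> h; elim/big_ind: _ => //; [apply: zspan_0 | apply: zspanD]. Qed.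
End ZSpan.

Lemma zspanZ (M : lmodType rat) (P : M -> Prop) (n : int) (x : M) :
  zspan P x -> zspan P (n%:~R *: x).
Proof. by rewrite scaler_int; apply: zspanMz. Qed.

Lemma zspan_map (M N : zmodType) (f : M -> N) (P : M -> Prop) (Q : N -> Prop) x :
  zmod_morphism f -> (forall x, P x -> zspan Q (f x)) -> zspan P x -> zspan Q (f x).
Proof.
move=> fB h; elim=> [y|| y z _ hy _ hz]; first exact: h.
- by rewrite -(subrr 0) fB subrr; apply: zspan_0.
- by rewrite fB; apply: zspan_B.
Qed.

Section DividedPowers.
Variables (M : lmodType rat) (T : {linear M -> M}).

Definition dpow i (x : M) : M := i`!%:R^-1 *: iter i T x.

Fact dpow_linear i : linear (dpow i).
Proof.
move=> c x y; rewrite /dpow; have -> : iter i T (c *: x + y) = c *: iter i T x + iter i T y.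
  by elim: i => //= i ->; rewrite linearP.
by rewrite scalerDr scalerC.
Qed.
HB.instance Definition _ i := GRing.isLinear.Build rat M M _ (dpow i) (dpow_linear i).

Lemma dpow0 x : dpow 0 x = x. Proof. by rewrite /dpow invr1 scale1r. Qed.

Lemma dpowS i x : i.+1%:R *: dpow i.+1 x = T (dpow i x).
Proof.
rewrite /dpow [T (_ *: _)]linearZ /= scalerA factS natrM invfM mulrA divff ?mul1r //.
by rewrite pnatr_eq0.
Qed.

Lemma dpow_uniq (E : nat -> M) : (forall i, i.+1%:R *: E i.+1 = T (E i)) ->
  forall i, E i = dpow i (E 0%N).
Proof.
move=> h; elim=> [|i ih]; first by rewrite dpow0.
by apply: (@scalerI _ _ i.+1%:R); rewrite ?pnatr_eq0 // h dpowS ih.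
Qed.

Lemma dpowM i j x : dpow i (dpow j x) = 'C(i + j, i)%:R *: dpow (i + j) x.
Proof.
rewrite {1}/dpow {1}/dpow.
have -> : iter i T (j`!%:R^-1 *: iter j T x) = j`!%:R^-1 *: iter (i + j) T x.
  by rewrite iterD; elim: i => //= i ->; rewrite linearZ.
rewrite /dpow !scalerA; congr (_ *: _).
have := bin_fact (leq_addr j i); rewrite addKn => /(congr1 (fun k => k%:R : rat)).
rewrite !natrM => <-; have : (i`!%:R : rat) != 0 by rewrite pnatr_eq0 -lt0n fact_gt0.
have : (j`!%:R : rat) != 0 by rewrite pnatr_eq0 -lt0n fact_gt0.
have : ('C(i + j, i)%:R : rat) != 0 by rewrite pnatr_eq0 -lt0n bin_gt0 leq_addr.
by move: (_%:R) (_%:R) (_%:R) => a b c ha hb hc; field; rewrite ha hb hc.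
Qed.
End DividedPowers.

Section IntegralForm.
Variables (r : nat) (F : fock_model r) (A : 'M[int]_r).
Local Notation L := 'rV[int]_r.
Implicit Types (a b c : L) (x y : F) (ls : seq (L * nat)).
Local Notation pr := (pairing A).
Local Notation fmul := (fmul A).
Local Notation expv := (expv F).

Definition cre a j : {linear F -> F} := hv A a (Negz j).
Definition ann a j : {linear F -> F} := hv A a (Posz j.+1).

(* The Schur polynomials in the a(j), acting by multiplication, and their      *)
(* adjoints.                                                                   *)
Definition Sop a k : {linear F -> F} := sch (cre a) k.
Definition Dop a k : {linear F -> F} := schz (ann a) k.

(** The integral form is given as a closure; these products of Schur polynomials of varying lattice
    vectors with e^a will be an explicit additive spanning set of it ([Zform_schv]). *)
Definition schv a ls : F := foldr (fun p y => Sop p.1 p.2 y) (expv a) ls.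
Definition is_schv x := exists a ls, x = schv a ls.

Lemma SopC a b k l y : Sop a k (Sop b l y) = Sop b l (Sop a k y).
Proof. by apply: schC => i j z; apply: hv_negC. Qed.

Lemma mulv_cre v y : mulv v y = cre (delta_mx 0 v.1) v.2 y.
Proof.
rewrite /cre hv_neg (bigD1 v.1) //= big1 => [|i ne].
  by rewrite mxE !eqxx scale1r addr0 -surjective_pairing.
by rewrite mxE (negbTE ne) andbF scale0r.
Qed.

Lemma fmul_crel a j x y : fmul (cre a j x) y = cre a j (fmul x y).
Proof.
rewrite /cre !hv_neg fmul_suml; apply: eq_bigr => i _.
by rewrite fmulZl fmul_mulvl.
Qed.
Lemma fmul_crer a j x y : fmul x (cre a j y) = cre a j (fmul x y).
Proof.
rewrite /cre !hv_neg linear_sum; apply: eq_bigr => i _.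
by rewrite linearZ /= fmul_mulvr.
Qed.

Lemma fmul_Sopl a k x y : fmul (Sop a k x) y = Sop a k (fmul x y).
Proof.
by apply: (sch_comm (X := cre a) (T := fmulr A y)) => j z; apply: fmul_crel.
Qed.
Lemma fmul_Sopr a k x y : fmul x (Sop a k y) = Sop a k (fmul x y).
Proof. by apply: (sch_comm (X := cre a) (T := fmul x)) => j z; apply: fmul_crer. Qed.

Lemma fmul_schv a b ls ls' :
  fmul (schv a ls) (schv b ls') = cocycle A a b *: schv (a + b) (ls ++ ls').
Proof.
elim: ls => [|p ls ih] /=; last by rewrite fmul_Sopl ih linearZ.
elim: ls' => [|p ls' ih] /=; last by rewrite fmul_Sopr ih linearZ.
exact: fmul_expv.
Qed.

Lemma fD_cre a j y : fD (cre a j y) = cre a j (fD y) + j.+1%:R *: cre a j.+1 y.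
Proof.
rewrite /cre !hv_neg linear_sum scaler_sumr -big_split; apply: eq_bigr => i _ /=.
by rewrite linearZ /= fD_mulv scalerDr [in RHS]scalerC.
Qed.

Lemma fD_expv_cre a : fD (expv a) = cre a 0 (expv a).
Proof. by rewrite fD_expv /cre hv_neg. Qed.

(** Formally exp(z D) e^a = exp(sum_j a(j) z^j / j) e^a: in [sch_deriv] the term [X 0] cancels
    against D e^a = a(1) e^a. *)
Lemma dpow_expv a i : dpow fD i (expv a) = Sop a i (expv a).
Proof.
rewrite -[expv a in LHS]/(Sop a 0 (expv a)).
rewrite -(dpow_uniq (T := fD) (E := fun i => Sop a i (expv a))) // => {}i.
rewrite (sch_deriv (X := cre a) (T := fD)) => [||j y]; last exact: fD_cre.
  rewrite fD_expv_cre -(sch_comm (T := cre a 0%N)) => [|j y]; last exact: hv_negC.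
  by rewrite addrAC subrr add0r.
by move=> j k y; apply: hv_negC.
Qed.

Lemma fmulZr k x y : fmul x (k *: y) = k *: fmul x y.
Proof. exact: linearZ. Qed.

Lemma fD_leibniz i x y :
  dpow fD i (fmul x y) = \sum_(j < i.+1) fmul (dpow fD j x) (dpow fD (i - j) y).
Proof.
pose E i := \sum_(j < i.+1) fmul (dpow fD j x) (dpow fD (i - j) y).
have -> : fmul x y = E 0%N by rewrite /E big_ord1 !dpow0.
rewrite -(dpow_uniq (T := fD) (E := E)) // => {}i.
rewrite /E scaler_sumr [RHS]linear_sum /=.
under [RHS]eq_bigr => j _ do rewrite fD_mul -!dpowS fmulZl fmulZr -subSn -1?ltnS //.
rewrite big_split /= [X in X + _](eq_bigr (fun j : 'I_i.+1 =>
   (bump 0 j)%:R *: fmul (dpow fD (bump 0 j) x) (dpow fD (i.+1 - bump 0 j) y))) //.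
rewrite big_ord_recl [in RHS]addrC [in RHS]big_ord_recl /= subn0 -addrA; congr (_ + _).
rewrite [LHS]big_ord_recr [X in _ = _ + X]big_ord_recr addrA -big_split /=.
congr (_ + _); apply: eq_bigr => j _; rewrite -scalerDl -natrD.
by congr (_%:R *: _); have := ltn_ord j; rewrite /bump /=; lia.
Qed.

Lemma cocycle_sqr a b : cocycle A a b * cocycle A a b = 1.
Proof. by rewrite /cocycle -expr2 sqrr_sign. Qed.
Lemma cocycle_int a b : exists n : int, cocycle A a b = n%:~R.
Proof. by exists ((-1) ^+ absz (\sum_(i < r) \sum_(j < r | (i < j)%N) a 0 i * A i j * b 0 j)); rewrite rmorphXn. Qed.

(** A Schur factor is traded for a divided power of e^a, up to a sign and a shift of the degree of
    the rest. Closure under divided powers then follows from the Leibniz rule. *)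
Lemma schv_cons a b k ls : schv b ((a, k) :: ls)
  = cocycle A a (b - a) *: fmul (dpow fD k (expv a)) (schv (b - a) ls).
Proof.
rewrite dpow_expv fmul_Sopl (fmul_schv a (b - a) [::]) linearZ scalerA cocycle_sqr.
by rewrite scale1r [a + _]addrC subrK.
Qed.

Lemma zspan_Sop a k x : zspan is_schv x -> zspan is_schv (Sop a k x).
Proof.
apply: (zspan_map (f := Sop a k)) => [|y [b [ls ->]]]; first exact: raddfB.
apply: zspan_gen.
by exists b, ((a, k) :: ls).
Qed.

Lemma zspan_fmul x y : zspan is_schv x -> zspan is_schv y -> zspan is_schv (fmul x y).
Proof.
move=> hx hy; apply: (zspan_map (f := fmul^~ y)) hx => [u v|_ [a [ls ->]]]; first exact: raddfB.
apply: (zspan_map (f := fmul (schv a ls))) hy => [|_ [b [ls' ->]]]; first exact: raddfB.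
rewrite fmul_schv; have [n ->] := cocycle_int a b.
by apply/zspanZ/zspan_gen; exists (a + b), (ls ++ ls').
Qed.

Lemma zspan_dpow i x : zspan is_schv x -> zspan is_schv (dpow fD i x).
Proof.
apply: (zspan_map (f := dpow fD i)) => [|_ [b [ls ->]]]; first exact: raddfB.
elim: ls i b => [|[a k] ls ih] i b.
  by rewrite [schv _ _]/= dpow_expv; apply: zspan_gen; exists b, [:: (b, i)].
rewrite schv_cons linearZ /= fD_leibniz.
have [n ->] := cocycle_int a (b - a); apply: zspanZ; apply: zspan_sum => j _.
(* A product of two divided powers of D is a binomial multiple of a divided power. *)
apply: zspan_fmul => //; rewrite dpowM dpow_expv (pmulrn _ 'C(_, _)).
by apply: zspanZ; apply: zspan_gen; exists a, [:: (a, (j + k)%N)].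
Qed.

Inductive Zform : F -> Prop :=
| Zf_exp a : Zform (expv a)
| Zf_sub x y : Zform x -> Zform y -> Zform (x - y)
| Zf_mul x y : Zform x -> Zform y -> Zform (fmul x y)
| Zf_D i x : Zform x -> Zform (dpow fD i x).

Lemma Zform_schv x : Zform x <-> zspan is_schv x.
Proof.
split=> [|].
  elim=> [a|u v _ hu _ hv|u v _ hu _ hv|i u _ hu]; first by apply: zspan_gen; exists a, [::].
  - exact: zspan_B.
  - exact: zspan_fmul.
  - exact: zspan_dpow.
have Z0 : Zform 0 by rewrite -(subrr (expv 0)); apply: Zf_sub; apply: Zf_exp.
elim=> [_ [a [ls ->]]|//|u v _ hu _ hv]; last exact: Zf_sub.
elim: ls a => [|[b k] ls ih] a; first exact: Zf_exp.
rewrite schv_cons /cocycle -signr_odd; move: (odd _) => e.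
have hz : Zform (fmul (dpow fD k (expv b)) (schv (a - b) ls)).
  by apply: Zf_mul (ih _); apply/Zf_D/Zf_exp.
by case: e; rewrite ?scaleN1r ?scale1r // -sub0r; apply: Zf_sub.
Qed.

Lemma Dop_cre b a k j y :
  Dop b k (cre a j y) = cre a j (Dop b k y) + (pr b a)%:~R *: Dop b (k - j.+1%:Z) y.
Proof.
apply: (schz_comm (X := ann b) (Y := cre a j)) => [i z|i l z].
  by rewrite /ann /cre hv_pos_neg; case: eqP => [->|_] //; rewrite !mul0r.
exact: hv_posC.
Qed.

Lemma ann_expv b j a : ann b j (expv a) = 0.
Proof. exact: hv_expv. Qed.

Lemma Dop_expv b a k : Dop b k (expv a) = (k == 0)%:R *: expv a.
Proof.
case: k => [[|k]|k]; rewrite ?scale1r ?scale0r // /Dop.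
rewrite [LHS]schS big1 ?scaler0 // => j _.
rewrite (sch_comm (T := ann b j)) => [|i z].
  by rewrite /= ann_expv linear0.
exact: hv_posC.
Qed.

(** Passing a Schur factor of c only introduces coefficients of (1 - z)^(-(b, c)), which are
    integers ([sch_twist]). *)
Lemma Dop_schv b k x : zspan is_schv x -> zspan is_schv (Dop b k x).
Proof.
apply: (zspan_map (f := Dop b k)) => [|_ [a [ls ->]]]; first exact: raddfB.
elim: ls k => [|[c l] ls ih] k.
  by rewrite [schv _ _]/= Dop_expv; apply: (@zspanZ _ _ (k == 0)); apply: zspan_gen; exists a, [::].
rewrite [schv _ _]/= /Sop (sch_twist (E := Dop b) (n := pr b c)); last by move=> *; apply: Dop_cre.
by apply: zspan_sum => i _; apply: zspanZ; apply: zspan_Sop.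
Qed.

Definition annih (m : {cmonom ('I_r * nat)%type}) (y : F) : F :=
  foldr (fun v => iter (m v) (ann (delta_mx 0 v.1) v.2)) y (finsupp m).

Fact annih_linear m : linear (annih m).
Proof.
rewrite /annih; elim: (finsupp m : seq _) => [|v s ih] a x y //=.
rewrite ih; elim: (m v) => [|k ihk] //=.
by rewrite ihk linearP.
Qed.
HB.instance Definition _ m := GRing.isLinear.Build rat F F _ (annih m) (annih_linear m).

Definition formr (y : F) : {linear F -> rat^o} :=
  ext F (fun a m => coef a (onecm _) (annih m y)).
Definition form (x y : F) : rat := formr y x.

Lemma form_vec a m y : form (vec F a m) y = coef a (onecm _) (annih m y).
Proof. by rewrite /form /formr ext_vec. Qed.

Lemma form_linl (k : rat) x x' y : form (k *: x + x') y = k * form x y + form x' y.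
Proof. exact: linearP. Qed.
Lemma form0l y : form 0 y = 0. Proof. exact: linear0. Qed.

Fact form_linear x : linear (form x : F -> rat^o).
Proof.
move=> c y y'; elim/vec_ind: x => [|d a m x ih]; first by rewrite !form0l scaler0 addr0.
rewrite !form_linl ih !form_vec [annih _ _]linearP [coef _ _ _]linearP /= !scaler_reg.
by ring.
Qed.
HB.instance Definition _ x := GRing.isLinear.Build rat F rat^o _ (form x) (form_linear x).

Lemma foldr_perm (T : eqType) (op : T -> F -> F) (s t : seq T) y :
  (forall u v z, op u (op v z) = op v (op u z)) -> perm_eq s t ->
  foldr op y s = foldr op y t.
Proof.
move=> opC; elim: s t => [|v s ih] t; first by rewrite perm_sym => /perm_nilP ->.
move=> p; have vt : v \in t by rewrite -(perm_mem p) mem_head.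
have -> : foldr op y t = op v (foldr op y (rem v t)).
  elim: {p}t vt => //= u t iht; rewrite inE eq_sym; case: eqP => [-> //|_] /= vt.
  by rewrite iht // opC.
rewrite /= (ih (rem v t)) //; rewrite -(perm_cons v).
exact: perm_trans p (perm_to_rem vt).
Qed.

(** The modes commute, so both folds may run over the support of the larger monomial, in which a
    single exponent differs by one. *)
Lemma annih_mulv v m y : annih (mon_mul v m) y = annih m (ann (delta_mx 0 v.1) v.2 y).
Proof.
pose T w : F -> F := ann (delta_mx 0 w.1) w.2.
have TC u w z : T u (T w z) = T w (T u z) by apply: hv_posC.
have iterC u n (f : F -> F) z : (forall z, f (T u z) = T u (f z)) ->
    f (iter n (T u) z) = iter n (T u) (f z).
  by move=> h; elim: n => //= n ih; rewrite h ih.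
have opC (m' : {cmonom ('I_r * nat)%type}) u w z :
    iter (m' u) (T u) (iter (m' w) (T w) z) = iter (m' w) (T w) (iter (m' u) (T u) z).
  by rewrite iterC // => z'; rewrite -iterC.
pose d : seq ('I_r * nat) := finsupp (mon_mul v m).
have -> : annih m (T v y) = foldr (fun w => iter (m w) (T w)) (T v y) d.
  rewrite /annih (@foldr_perm _ (fun w => iter (m w) (T w)) _ [seq w <- d | m w != 0%N]) //.
    by elim: d => //= w d ih; case: ifP => [_|/negbFE/eqP ->] /=; rewrite ih.
  apply: uniq_perm; rewrite ?filter_uniq ?fset_uniq // => w.
  by rewrite mem_filter -!cmE_neq0 mon_mulE addn_eq0; case: (m w) => //= n; rewrite andbF.
rewrite /annih -/d; have vd : v \in d by rewrite -cmE_neq0 mon_mulE eqxx.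
have ud : uniq d by rewrite fset_uniq.
elim: d vd ud => //= w d ih; rewrite inE => h /andP[wd ud].
rewrite mon_mulE; have [e|ne] := eqVneq v w; last first.
  by rewrite add0n ih //; case/orP: h => // /eqP e; rewrite e eqxx in ne.
move: e h wd => <- h wd; rewrite add1n iterSr; congr (iter _ _ _); rewrite -/(T v).
elim: d wd {ud ih h} => //= u d ih; rewrite inE negb_or => /andP[vu vd].
by rewrite mon_mulE (negbTE vu) add0n -ih // (iterC u _ (T v)).
Qed.

Lemma form_expv a y : form (expv a) y = coef a (onecm _) y.
Proof. by rewrite form_vec /annih mdom1. Qed.

Lemma form_mulv v x y : form (mulv v x) y = form x (ann (delta_mx 0 v.1) v.2 y).
Proof.
elim/vec_ind: x => [|c a m x ih]; first by rewrite linear0 !form0l.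
by rewrite linearP !form_linl ih mulv_vec !form_vec annih_mulv.
Qed.

Lemma form_linr x (c : rat) y y' : form x (c *: y + y') = c * form x y + form x y'.
Proof. exact: linearP. Qed.
Lemma formZl (c : rat) x y : form (c *: x) y = c * form x y.
Proof. by have := form_linl c x 0 y; rewrite !addr0 form0l addr0. Qed.
Lemma formZr x (c : rat) y : form x (c *: y) = c * form x y.
Proof. by rewrite [LHS]linearZ. Qed.
Lemma form_sumr x n (G : 'I_n -> F) : form x (\sum_i G i) = \sum_i form x (G i).
Proof. exact: linear_sum. Qed.

Lemma coef1_mulv a v y : coef a (onecm _) (mulv v y) = 0.
Proof.
elim/vec_ind: y => [|c b m y ih]; first by rewrite !linear0.
rewrite !linearP ih addr0 mulv_vec coef_vec (_ : mon_mul v m == _ = false).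
  by rewrite andbF scaler0.
apply/negP => /eqP /(congr1 (fun m : {cmonom ('I_r * nat)%type} => m v)).
by rewrite mon_mulE eqxx onecmE.
Qed.

Lemma coef1_cre a b j y : coef a (onecm _) (cre b j y) = 0.
Proof. by rewrite /cre hv_neg linear_sum big1 // => i _; rewrite linearZ /= coef1_mulv scaler0. Qed.

Lemma form_cre b j x y : form (cre b j x) y = form x (ann b j y).
Proof.
rewrite /cre /ann hv_neg hv_pos.
have -> (G : 'I_r -> F) : form (\sum_i G i) y = \sum_i form (G i) y by apply: linear_sum.
under eq_bigr => i _ do rewrite formZl form_mulv /ann hv_pos.
under eq_bigr => i _ do rewrite form_sumr mulr_sumr.
rewrite form_sumr exchange_big; apply: eq_bigr => k _ /=.
under eq_bigr => i _ do rewrite formZr mulrA.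
rewrite formZr -mulr_suml; congr (_ * _).
rewrite [(b *m A) _ _]mxE rmorph_sum mulr_sumr; apply: eq_bigr => i _ /=.
by rewrite -rowE [row _ _ _ _]mxE intrM; ring.
Qed.

Hypothesis A_sym : A^T = A.

Lemma form_hv b n x y : form (hv A b n x) y = form x (hv A b (- n) y).
Proof.
case: n => [[|n]|n]; last exact: form_cre.
- elim/fock_ind: x => [c x x' hx hx'|a|v x ih] in y *.
  + by rewrite linearP !form_linl hx hx'.
  + by rewrite hv0_expv formZl !form_expv coef_hv0.
  + by rewrite hv0_mulv !form_mulv ih /ann hv0C.
- elim/fock_ind: x => [c x x' hx hx'|a|v x ih] in y *.
  + by rewrite linearP !form_linl hx hx'.
  + by rewrite hv_expv /form linear0 -/(form _ _) form_expv coef1_cre.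
  + rewrite mulv_cre /cre hvC // -[_ + _ *: x]addrC form_linl.
    rewrite [form (hv _ _ (Negz _) _) _]form_cre ih -[form (hv _ _ (Negz _) x) _]/(form (cre _ _ x) _).
    have := hvC A_sym (delta_mx 0 v.1) b v.2.+1 (- n.+1%:Z) y; rewrite [_ + _ *: y]addrC => e.
    rewrite form_cre /ann e form_linr; congr (_ * _ + _).
    rewrite NegzE (pairingC A_sym b); case: eqP => [h|h].
      by rewrite ifT; [congr (_ * _)%:~R; lia | apply/eqP; lia].
    by rewrite ifF //; apply/eqP; lia.
Qed.

Lemma form_sym x y : form x y = form y x.
Proof.
elim/fock_ind: x => [c x x' hx hx'|a|v x ih] in y *.
- by rewrite form_linl form_linr hx hx'.
- elim/fock_ind: y => [c x x' hx hx'|b|v y ih].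
  + by rewrite form_linl form_linr hx hx'.
  + by rewrite !form_expv !coef_vec !eqxx !andbT eq_sym.
  + rewrite form_expv coef1_mulv form_mulv /ann hv_expv.
    by rewrite linear0.
- by rewrite form_mulv ih mulv_cre /cre form_hv.
Qed.

Lemma coef_schv a b ls : exists n : int, coef a (onecm _) (schv b ls) = n%:~R :> rat.
Proof.
elim: ls => [|[c [|k]] ls [n hn]] /=; first by exists (Posz ((b == a) && (onecm ('I_r * nat)%type == onecm _))); rewrite coef_vec pmulrn.
  by exists n.
exists 0; rewrite /Sop /= schS linearZ /= linear_sum big1 ?scaler0 // => j _.
exact: coef1_cre.
Qed.

(** The Schur factors of x are moved to y as their adjoints, which preserve the integral form, until
    only a coefficient of some e^a is left. *)
Lemma form_int x y : zspan is_schv x -> zspan is_schv y -> exists n : int, form x y = n%:~R.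
Proof.
move=> hx; elim: hx y => [_ [a [ls ->]]|y _|u v _ hu _ hv y hy].
- elim: ls => [|[b k] ls ih] y hy.
    rewrite form_expv; elim: hy => [_ [b [ls ->]]||u v _ [n1 h1] _ [n2 h2]].
    + exact: coef_schv.
    + by exists 0; rewrite linear0.
    + by exists (n1 - n2); rewrite linearB /= h1 h2 intrB.
  have -> : form (schv a ((b, k) :: ls)) y = form (schv a ls) (Dop b k y).
    apply: (sch_adj (X := cre b) (Y := ann b)) => [z c x1 x2|x1 c z z'|j l z|j x1 z].
    + exact: form_linl.
    + exact: form_linr.
    + exact: hv_posC.
    + exact: form_cre.
  by apply: ih; apply: Dop_schv.
- by exists 0; rewrite /form linear0.
- have [n1 h1] := hu y hy; have [n2 h2] := hv y hy.
  by exists (n1 - n2); rewrite /form linearB /= -!/(form _ _) h1 h2 intrB.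
Qed.
End IntegralForm.

(** * Virasoro operators *)

Lemma big_sym_recr (R : zmodType) M (G : int -> R) :
  \sum_(t < (2 * M.+1).+1) G (t%:Z - M.+1%:Z)
  = G (- M.+1%:Z) + \sum_(t < (2 * M).+1) G (t%:Z - M%:Z) + G M.+1%:Z.
Proof.
have -> : (2 * M.+1).+1 = (2 * M).+1.+2 by lia.
rewrite big_ord_recr big_ord_recl /=; congr (G _ + _ + G _); try lia.
by apply: eq_bigr => t _; congr G; rewrite /bump /=; lia.
Qed.

Lemma big_sym_widen (R : zmodType) N M (G : int -> R) : (N <= M)%N ->
  (forall s : int, (N < absz s)%N -> G s = 0) ->
  \sum_(t < (2 * M).+1) G (t%:Z - M%:Z) = \sum_(t < (2 * N).+1) G (t%:Z - N%:Z).
Proof.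
elim: M => [|M ih] le G0; first by move: le; rewrite leqn0 => /eqP ->.
move: le; rewrite leq_eqVlt => /orP[/eqP -> //|le].
by rewrite big_sym_recr ih // !G0 ?add0r ?addr0 //; lia.
Qed.

Lemma big_sym_delta (R : zmodType) M (s : int) (G : int -> R) : (absz s <= M)%N ->
  \sum_(t < (2 * M).+1) (if t%:Z - M%:Z == s then G (t%:Z - M%:Z) else 0) = G s.
Proof.
move=> le; have lt : (absz (s + M%:Z)%R < (2 * M).+1)%N by lia.
rewrite (bigD1 (Ordinal lt)) //= big1 => [|t]; last first.
  move=> ne; rewrite ifF //; apply: contraNF ne => /eqP e.
  by apply/eqP/val_inj => /=; lia.
have e : (absz (s + M%:Z)%R)%:Z - M%:Z = s by lia.
by rewrite e eqxx addr0.
Qed.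

Section Virasoro.
Variables (r : nat) (F : fock_model r) (A : 'M[int]_r).
Local Notation L := 'rV[int]_r.
Implicit Types (a b c : L) (x y : F).
Local Notation pr := (pairing A).
Local Notation expv := (expv F).
Local Notation bs i := (delta_mx 0 i : L).
Local Notation ginv := (gram_inv A).
Local Notation form := (form A).

Definition nordF (i j : 'I_r) (k l : int) (y : F) : F :=
  if k <= l then hv A (bs i) k (hv A (bs j) l y) else hv A (bs j) l (hv A (bs i) k y).

Fact nordF_linear i j k l : linear (nordF i j k l).
Proof. by move=> c x y; rewrite /nordF; case: ifP => _; rewrite !linearP. Qed.
HB.instance Definition _ i j k l :=
  GRing.isLinear.Build rat F F _ (nordF i j k l) (nordF_linear i j k l).

(** L_n with its infinite sum cut off at |k| <= M. With one large M for all vectors involved,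
    identities for L_n become identities of finite sums. *)
Definition QL (M : nat) (n : int) (y : F) : F :=
  \sum_(i < r) \sum_(j < r) (ginv i j / 2) *:
    \sum_(t < (2 * M).+1) nordF i j (t%:Z - M%:Z) (n - (t%:Z - M%:Z)) y.

Fact QL_linear M n : linear (QL M n).
Proof.
move=> c x y; rewrite /QL scaler_sumr -big_split; apply: eq_bigr => i _ /=.
rewrite scaler_sumr -big_split; apply: eq_bigr => j _ /=.
under eq_bigr => t _ do rewrite linearP.
by rewrite big_split -scaler_sumr /= scalerDr scalerC.
Qed.
HB.instance Definition _ M n := GRing.isLinear.Build rat F F _ (QL M n) (QL_linear M n).

Definition bounded W y := forall b (n : nat), (W < n)%N -> hv A b n y = 0.

Lemma vec_bounded a m : bounded (osc_wt m) (vec F a m).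
Proof.
move=> b [//|j] lt; rewrite hv_pos big1 // => k _; rewrite derv_vec.
suff -> : m (k, j) = 0%N by rewrite scale0r scaler0.
apply/eqP; rewrite cmE_eq0; apply/negP => h; move: lt.
rewrite /osc_wt (bigD1_seq (k, j)) ?fset_uniq //= ltnNge => /negP; apply.
rewrite (leq_trans _ (leq_addr _ _)) // leq_pmull // lt0n.
by rewrite cmE_neq0.
Qed.

Lemma QL_stab W M n y : bounded W y -> (W + absz n <= M)%N ->
  QL M n y = QL (W + absz n) n y.
Proof.
move=> hW le; apply: eq_bigr => i _; apply: eq_bigr => j _; congr (_ *: _).
apply: (big_sym_widen (G := fun s => nordF i j s (n - s) y)) => // s lt.
have bd b (k : int) : (W%:Z < k)%R -> hv A b k y = 0.
  by case: k => // k h; apply: hW; lia.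
rewrite /nordF; case: ifP => h; rewrite bd ?linear0 //; lia.
Qed.

Definition Lv n : {linear F -> F} :=
  ext F (fun a m => QL (osc_wt m + absz n) n (vec F a m)).

Lemma Lv_QL y : exists2 W, bounded W y &
  forall n M, (W + absz n <= M)%N -> Lv n y = QL M n y.
Proof.
elim/vec_ind: y => [|c a m y [W hW h]].
  by exists 0%N => [b n _|n M _]; rewrite !linear0.
exists (maxn (osc_wt m) W) => [b n|n M] le; rewrite !linearP /=.
  by rewrite (@vec_bounded a m) ?hW ?scaler0 ?addr0 //; lia.
rewrite (h n M); last by lia.
congr (_ *: _ + _); rewrite ext_vec (@QL_stab (osc_wt m) M) //; last by lia.
exact: vec_bounded.
Qed.

Hypotheses (A_sym : A^T = A) (A_det : \det A != 0).

Lemma pairing_sum b a : pr b a = \sum_i b 0 i * pr (bs i) a.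
Proof.
rewrite pairingE; under [RHS]eq_bigr => i _ do rewrite pairingE mulr_sumr.
rewrite exchange_big; apply: eq_bigr => k _ /=; rewrite [(b *m A) _ _]mxE mulr_suml.
by apply: eq_bigr => i _; rewrite -rowE [row _ _ _ _]mxE mulrA.
Qed.

Lemma hv_sum b n y : hv A b n y = \sum_(i < r) (b 0 i)%:~R *: hv A (bs i) n y.
Proof.
case: n => [[|n]|n].
- elim/vec_ind: y => [|c a m y ih]; first by rewrite linear0 big1 // => i _; rewrite linear0 scaler0.
  rewrite linearP ih; under [RHS]eq_bigr => i _ do rewrite linearP scalerDr.
  rewrite big_split; congr (_ + _); rewrite hv0_vec pairing_sum rmorph_sum scaler_suml scaler_sumr.
  by apply: eq_bigr => i _ /=; rewrite [RHS]scalerC; congr (c *: _); rewrite hv0_vec scalerA intrM.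
- rewrite hv_pos; under [RHS]eq_bigr => i _ do rewrite hv_pos scaler_sumr.
  rewrite exchange_big; apply: eq_bigr => k _ /=.
  under eq_bigr => i _ do rewrite scalerA.
  rewrite -scaler_suml; congr (_ *: _); rewrite [(b *m A) _ _]mxE rmorph_sum mulr_sumr.
  by apply: eq_bigr => i _ /=; rewrite -rowE [row _ _ _ _]mxE intrM; ring.
- rewrite hv_neg; apply: eq_bigr => i _; rewrite (mulv_cre A) /=.
  by rewrite /cre.
Qed.

Lemma ginvl b j : \sum_(i < r) ginv i j * (pr b (bs i))%:~R = (b 0 j)%:~R :> rat.
Proof.
have AU : (map_mx intr A : 'M[rat]_r) \in unitmx by rewrite unitmxE det_map_mx unitfE intr_eq0.
have e : map_mx intr b *m map_mx intr A *m ginv = map_mx intr b :> 'rV[rat]_r.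
  by rewrite -mulmxA mulmxV // mulmx1.
have := congr1 (fun M : 'rV_r => M 0 j) e; rewrite [RHS]mxE => <-; rewrite mxE.
apply: eq_bigr => i _; rewrite mulrC -map_mxM [map_mx _ _ _ _]mxE; congr (_%:~R * _).
rewrite pairingE (bigD1 i) //= big1 => [|k ne].
  by rewrite [delta_mx _ _ _ _]mxE !eqxx mulr1 addr0.
by rewrite [delta_mx _ _ _ _]mxE (negbTE ne) andbF mulr0.
Qed.

Lemma ginv_sym i j : ginv i j = ginv j i.
Proof.
have e : ginv^T = ginv.
  rewrite /gram_inv trmx_inv; congr (invmx _); apply/matrixP => k l.
  by rewrite !mxE -[in LHS]A_sym mxE.
by rewrite -[in LHS]e mxE.
Qed.

Lemma ginvr b i : \sum_(j < r) ginv i j * (pr b (bs j))%:~R = (b 0 i)%:~R :> rat.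
Proof. by rewrite -(ginvl b i); apply: eq_bigr => j _; rewrite ginv_sym. Qed.

(** By the symmetry of the inverse Gram matrix the two summands contribute equally, which undoes the
    factor 1/2 in L_n. *)
Lemma ginv_contract b (G : 'I_r -> F) : 
  \sum_(i < r) \sum_(j < r) (ginv i j / 2) *:
     ((pr b (bs i))%:~R *: G j + (pr b (bs j))%:~R *: G i)
  = \sum_(i < r) (b 0 i)%:~R *: G i.
Proof.
have e1 : \sum_(i < r) \sum_(j < r) (ginv i j / 2) *: ((pr b (bs i))%:~R *: G j)
    = (2^-1 : rat) *: \sum_(i < r) (b 0 i)%:~R *: G i.
  rewrite exchange_big scaler_sumr; apply: eq_bigr => j _ /=.
  rewrite -(ginvl b j) scaler_suml scaler_sumr; apply: eq_bigr => i _.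
  by rewrite !scalerA; congr (_ *: _); ring.
have e2 : \sum_(i < r) \sum_(j < r) (ginv i j / 2) *: ((pr b (bs j))%:~R *: G i)
    = (2^-1 : rat) *: \sum_(i < r) (b 0 i)%:~R *: G i.
  rewrite scaler_sumr; apply: eq_bigr => i _ /=.
  rewrite -(ginvr b i) scaler_suml scaler_sumr; apply: eq_bigr => j _.
  by rewrite !scalerA; congr (_ *: _); ring.
under eq_bigr => i _ do (under eq_bigr => j _ do rewrite scalerDr; rewrite big_split /=).
rewrite big_split /= e1 e2 -scalerDl -[RHS]scale1r; congr (_ *: _); lra.
Qed.

Lemma nordF_comm b q i j k l y : hv A b q (nordF i j k l y) = nordF i j k l (hv A b q y)
  + ((if q + k == 0 then (q * pr b (bs i))%:~R else 0) *: hv A (bs j) l y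
     + (if q + l == 0 then (q * pr b (bs j))%:~R else 0) *: hv A (bs i) k y).
Proof.
rewrite /nordF; case: ifP => _; rewrite hvC // [X in hv _ _ _ X](hvC A_sym b) linearD linearZ /=.
  by rewrite addrAC -addrA addrA -addrA [_ *: _ + _]addrC.
by rewrite -addrA.
Qed.

(** A normally ordered product in L_n can fail to commute with b(q) only at k = -q and at k = n + q;
    the bounds keep both inside the cutoff. *)
Lemma hv_QL b q M n y : (absz q <= M)%N -> (absz (n + q)%R <= M)%N ->
  hv A b q (QL M n y) = QL M n (hv A b q y) + q%:~R *: hv A b (n + q) y.
Proof.
move=> le1 le2; rewrite /QL linear_sum /=.
under eq_bigr => i _ do (rewrite linear_sum; under eq_bigr => j _ do
  (rewrite linearZ /= linear_sum; under eq_bigr => t _ do rewrite nordF_comm;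
   rewrite big_split /= scalerDr); rewrite big_split /=).
rewrite big_split /=; congr (_ + _).
rewrite (hv_sum b) -(ginv_contract b (fun i => hv A (bs i) (n + q) y)) scaler_sumr.
apply: eq_bigr => i _; rewrite scaler_sumr; apply: eq_bigr => j _.
rewrite [RHS]scalerC big_split /=; congr (_ *: _); rewrite scalerDr; congr (_ + _).
  have -> : n + q = n - (- q) by rewrite opprK.
  rewrite -(@big_sym_delta _ M (- q)
    (fun s => q%:~R *: ((pr b (bs i))%:~R *: hv A (bs j) (n - s) y))) ?abszN //.
  apply: eq_bigr => t _; have -> : (q + (t%:Z - M%:Z) == 0) = (t%:Z - M%:Z == - q).
    by rewrite addrC addr_eq0.
  by case: ifP => _; rewrite ?scale0r // intrM scalerA.
rewrite -(@big_sym_delta _ M (n + q)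
    (fun s => q%:~R *: ((pr b (bs j))%:~R *: hv A (bs i) s y))) //.
apply: eq_bigr => t _.
have -> : (q + (n - (t%:Z - M%:Z)) == 0) = (t%:Z - M%:Z == n + q).
  by rewrite addrA subr_eq0 eq_sym [q + n]addrC.
by case: ifP => _; rewrite ?scale0r // intrM scalerA.
Qed.

Lemma hv_Lv b q n y : hv A b q (Lv n y) = Lv n (hv A b q y) + q%:~R *: hv A b (n + q) y.
Proof.
have [W1 _ h1] := Lv_QL y; have [W2 _ h2] := Lv_QL (hv A b q y).
pose M := (W1 + W2 + absz n + absz q)%N.
by rewrite (h1 n M) ?(h2 n M) ?hv_QL //; rewrite /M; lia.
Qed.

Lemma Lv_hv b q n y : Lv n (hv A b q y) = hv A b q (Lv n y) - q%:~R *: hv A b (n + q) y.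
Proof. by rewrite hv_Lv addrK. Qed.

Lemma Lv_expv n a : 0 < n -> Lv n (expv a) = 0.
Proof.
move=> n0; rewrite ext_vec; apply: big1 => i _; apply: big1 => j _.
rewrite big1 ?scaler0 // => t _; rewrite /nordF.
have hp b (k : int) : 0 < k -> hv A b k (expv a) = 0 by case: k => [[|k]|k] // _; apply: hv_expv.
by case: ifP => h; rewrite hp ?linear0 //; lia.
Qed.

Lemma osc_wt1 : osc_wt (onecm ('I_r * nat)%type) = 0%N.
Proof. by rewrite /osc_wt mdom1 big_seq_fset0. Qed.

Lemma L0_expv a : Lv 0 (expv a) = ((pr a a)%:~R / 2) *: expv a.
Proof.
rewrite ext_vec osc_wt1 /QL.
under eq_bigr => i _ do under eq_bigr => j _ do
  (rewrite big_ord1 /= /nordF lexx !subr0 hv0_expv linearZ /= hv0_expv scalerA).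
have e : \sum_(i < r) (a 0 i)%:~R *: ((pr a (bs i))%:~R *: expv a) = (pr a a)%:~R *: expv a.
  rewrite [in RHS]pairing_sum rmorph_sum scaler_suml; apply: eq_bigr => i _.
  by rewrite scalerA /= intrM [pr (bs i) a]pairingC.
rewrite mulrC -scalerA -e -(ginv_contract a (fun i => (pr a (bs i))%:~R *: expv a)) scaler_sumr.
apply: eq_bigr => i _; rewrite scaler_sumr; apply: eq_bigr => j _.
rewrite !scalerA -!scalerDl !scalerA ![pr (bs _) a]pairingC //; congr (_ *: _).
by move: (ginv i j) (pr a (bs i))%:~R (pr a (bs j))%:~R => u v w; field.
Qed.

Lemma Lm1_expv a : Lv (-1) (expv a) = hv A a (-1) (expv a).
Proof.
rewrite ext_vec osc_wt1 /QL (hv_sum a).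
rewrite -(ginv_contract a (fun i => hv A (bs i) (-1) (expv a))).
apply: eq_bigr => i _; apply: eq_bigr => j _; congr (_ *: _).
rewrite (_ : (0 + absz (-1)%R)%N = 1%N) //.
rewrite (big_sym_recr 0 (fun s => nordF i j s (-1 - s) (expv a))) big_ord1 /nordF /=.
have -> : -1 - -1%Z = 0 :> int by [].
rewrite !subr0 [hv A (bs j) 0 _]hv0_expv linearZ /= [hv A (bs i) 0 _]hv0_expv linearZ /=.
rewrite [hv A (bs i) 1 _]hv_expv linear0 addr0 addrC.
by rewrite ![pr (bs _) a]pairingC.
Qed.

Lemma Lm2_expv a : Lv (-2) (expv a) = hv A a (-2) (expv a)
  + \sum_(i < r) \sum_(j < r) (ginv i j / 2) *: hv A (bs i) (-1) (hv A (bs j) (-1) (expv a)).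
Proof.
rewrite ext_vec osc_wt1 /QL (hv_sum a).
rewrite -(ginv_contract a (fun i => hv A (bs i) (-2) (expv a))) -big_split.
apply: eq_bigr => i _; rewrite -big_split; apply: eq_bigr => j _ /=.
rewrite -scalerDr; congr (_ *: _).
rewrite (_ : (0 + absz (-2)%R)%N = 2%N) //.
rewrite (big_sym_recr 1 (fun s => nordF i j s (-2 - s) (expv a))).
rewrite (big_sym_recr 0 (fun s => nordF i j s (-2 - s) (expv a))) big_ord1 /nordF /=.
have -> : -2 - -2%Z = 0 :> int by [].
have -> : -2 - -1%Z = -1 :> int by [].
rewrite !subr0 [hv A (bs j) 0 _]hv0_expv linearZ /= [hv A (bs i) 0 _]hv0_expv linearZ /=.
rewrite [hv A (bs i) 1 _]hv_expv [hv A (bs i) 2 _]hv_expv !linear0 !addr0.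
rewrite ![pr (bs _) a]pairingC //.
by lin_combine rat (fock_space F).
Qed.

Lemma form_QL M n x y : form (QL M n x) y = \sum_(i < r) \sum_(j < r) (ginv i j / 2) *
   \sum_(t < (2 * M).+1) form (nordF i j (t%:Z - M%:Z) (n - (t%:Z - M%:Z)) x) y.
Proof.
rewrite form_sym // form_sumr; apply: eq_bigr => i _; rewrite form_sumr; apply: eq_bigr => j _.
by rewrite formZr form_sumr; congr (_ * _); apply: eq_bigr => t _; rewrite form_sym.
Qed.

Lemma form_nordF i j k l x y : form (nordF i j k l x) y = form x (nordF i j (- k) (- l) y).
Proof.
rewrite /nordF lerN2; case: (ltgtP k l) => [kl|kl|<-]; rewrite !form_hv //.
case: (eqVneq k 0) => [->|k0]; first by rewrite oppr0 hv0C.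
by rewrite hvC // -opprD oppr_eq0 -mulr2n mulrn_eq0 /= (negbTE k0) scale0r addr0.
Qed.

Lemma form_Lv n x y : form (Lv n x) y = form x (Lv (- n) y).
Proof.
have [W1 _ h1] := Lv_QL x; have [W2 _ h2] := Lv_QL y.
pose M := (W1 + W2 + absz n)%N.
rewrite (h1 n M) ?(h2 (- n) M); try by rewrite /M ?abszN; lia.
rewrite form_QL form_sumr; apply: eq_bigr => i _; rewrite form_sumr; apply: eq_bigr => j _.
rewrite formZr form_sumr; congr (_ * _).
rewrite (reindex_inj rev_ord_inj) /=; apply: eq_bigr => t _; rewrite form_nordF.
by congr (form x (nordF i j _ _ y)); case: t => t /= lt; lia.
Qed.

(** The defect of the centreless Virasoro relation. It commutes with all Heisenberg modes, hence is
    a scalar on each e^a, and the scalar can be read off from the form. No two double sums of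
    normally ordered products have to be commuted. *)
Definition comL m n y : F := Lv m (Lv n y) - Lv n (Lv m y) - (m - n)%:~R *: Lv (m + n) y.

Lemma hv_comL b q m n y : hv A b q (comL m n y) = comL m n (hv A b q y).
Proof.
have e k l : hv A b q (Lv k (Lv l y)) = Lv k (Lv l (hv A b q y))
    + q%:~R *: (Lv k (hv A b (l + q) y) + Lv l (hv A b (k + q) y))
    + (q * (k + q))%:~R *: hv A b (l + k + q) y.
  rewrite hv_Lv hv_Lv [Lv k (_ + _)]linearD [Lv k (_ *: _)]linearZ /= hv_Lv.
  rewrite -[l + k + q]addrA. lin_combine rat (fock_space F).
rewrite /comL !linearB /= !e [hv A b q (_ *: _)]linearZ /= hv_Lv.
rewrite [n + m]addrC; lin_combine rat (fock_space F).
Qed.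

Lemma comL_expv m n a : comL m n (expv a) = form (expv a) (comL m n (expv a)) *: expv a.
Proof.
rewrite form_expv; apply: (@vacuum_vec _ _ A) => // [b j|b]; rewrite hv_comL.
  by rewrite hv_expv /comL !linear0; lin_combine rat (fock_space F).
rewrite hv0_expv /comL !linearZ /= scalerC; lin_combine rat (fock_space F).
Qed.

Lemma comL_eq0 m n : (forall a, form (expv a) (comL m n (expv a)) = 0) ->
  forall y, comL m n y = 0.
Proof.
move=> h; elim/fock_ind => [c x y hx hy|a|v y ih].
- have -> : comL m n (c *: x + y) = c *: comL m n x + comL m n y.
    rewrite /comL !linearP /=; lin_combine rat (fock_space F).
  by rewrite hx hy scaler0 addr0.
- by rewrite comL_expv h scale0r.
- by rewrite (mulv_cre A) /cre -hv_comL ih linear0.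
Qed.

Lemma form_Lv_expv n a : n != 0 -> form (expv a) (Lv n (expv a)) = 0.
Proof.
move=> n0; case: (ltgtP n 0) n0 => // h _.
  by rewrite -[n]opprK -form_Lv Lv_expv ?form0l // oppr_gt0.
by rewrite Lv_expv // -[0](scale0r (expv a)) formZr mul0r.
Qed.

Lemma form_comL m n x y : form x (comL m n y) = form (Lv (- m) x) (Lv n y)
  - form (Lv (- n) x) (Lv m y) - (m - n)%:~R * form x (Lv (m + n) y).
Proof. by rewrite /comL !linearB /= formZr !form_Lv !opprK. Qed.

Lemma L0_Lv n y : Lv 0 (Lv n y) = Lv n (Lv 0 y) - n%:~R *: Lv n y.
Proof.
have : comL 0 n y = 0.
  apply: comL_eq0 => a; rewrite form_comL oppr0 L0_expv formZr formZl form_Lv opprK.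
  case: (eqVneq n 0) => [->|n0]; first by rewrite subrr mul0r subr0; ring.
  by rewrite !add0r subrr form_Lv_expv // mulr0 subrr.
rewrite /comL sub0r add0r => h; apply/eqP; rewrite -subr_eq0 -[X in _ == X]h; apply/eqP.
lin_combine rat (fock_space F).
Qed.

(** The defect shifts the L_0-weight by -(m + n) and yet maps e^a to a multiple of itself. *)
Lemma comL_weight m n a :
  (m + n)%:~R *: comL m n (expv a) = 0.
Proof.
have : Lv 0 (comL m n (expv a)) = ((pr a a)%:~R / 2) *: comL m n (expv a).
  by rewrite comL_expv linearZ /= L0_expv scalerC.
have e k l : Lv 0 (Lv k (Lv l (expv a))) = ((pr a a)%:~R / 2 - k%:~R - l%:~R) *: Lv k (Lv l (expv a)).
  rewrite L0_Lv L0_Lv L0_expv [Lv k (_ - _)]linearB [Lv l (_ *: _)]linearZ !linearZ /=.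
  lin_combine rat (fock_space F).
rewrite /comL !linearB /= !e [Lv 0 (_ *: _)]linearZ /= L0_Lv L0_expv [Lv (m + n) (_ *: _)]linearZ /=.
move=> h; apply/eqP; rewrite -oppr_eq0; apply/eqP.
move/eqP: h; rewrite -subr_eq0 => /eqP h; rewrite -[RHS]h.
lin_combine rat (fock_space F).
Qed.

Lemma Lv_comm m n y : m + n != 0 ->
  Lv m (Lv n y) = Lv n (Lv m y) + (m - n)%:~R *: Lv (m + n) y.
Proof.
move=> mn; have : comL m n y = 0.
  apply: comL_eq0 => a; have /eqP := comL_weight m n a.
  rewrite scaler_eq0 intr_eq0 (negbTE mn) => /eqP ->.
  by rewrite -[0](scale0r (expv a)) formZr mul0r.
rewrite /comL => h; apply/eqP; rewrite -subr_eq0 -[X in _ == X]h; apply/eqP.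
lin_combine rat (fock_space F).
Qed.

Lemma form_expvv a : form (expv a) (expv a) = 1.
Proof. by rewrite form_expv coef_vec !eqxx. Qed.

Lemma Lv_comm1 y : Lv 1 (Lv (-1) y) = Lv (-1) (Lv 1 y) + (2 : rat) *: Lv 0 y.
Proof.
have : comL 1 (-1) y = 0.
  apply: comL_eq0 => a; rewrite form_comL [Lv 1 _]Lv_expv // !Lm1_expv L0_expv formZr form_expvv.
  rewrite form_hv // hvC // [hv A a _ (expv a)]hv_expv linear0 add0r formZr form_expvv.
  by rewrite form0l; field.
rewrite /comL => h; apply/eqP; rewrite -subr_eq0 -[X in _ == X]h; apply/eqP.
lin_combine rat (fock_space F).
Qed.

Lemma ginv_trace : \sum_(i < r) \sum_(j < r) ginv i j * (pr (bs i) (bs j))%:~R = r%:R.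
Proof.
under eq_bigr => i _ do rewrite ginvr mxE !eqxx.
by rewrite sumr_const card_ord.
Qed.

(** At m = 2 the central term (m^3 - m) / 12 times the central charge is half the central charge,
    which is r, the trace of A^-1 A ([ginv_trace]). *)
Lemma Lv_comm2 y : Lv 2 (Lv (-2) y) = Lv (-2) (Lv 2 y) + (4 : rat) *: Lv 0 y + (r%:R / 2) *: y.
Proof.
pose C y := comL 2 (-2) y - (r%:R / 2) *: y.
suff : C y = 0.
  rewrite /C /comL => h; apply/eqP; rewrite -subr_eq0 -[X in _ == X]h; apply/eqP.
  lin_combine rat (fock_space F).
elim/fock_ind: y => [c x y hx hy|a|v y ih].
- have -> : C (c *: x + y) = c *: C x + C y.
    rewrite /C /comL !linearP /=; lin_combine rat (fock_space F).
  by rewrite hx hy scaler0 addr0.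
- rewrite /C comL_expv form_comL [Lv 2 _]Lv_expv // L0_expv -scalerBl -[RHS](scale0r (expv a)).
  congr (_ *: _); rewrite formZr form_expvv form0l form_Lv opprK.
  have -> : form (expv a) (Lv 2 (Lv (-2) (expv a))) = (2 * pr a a)%:~R + r%:R / 2.
    rewrite Lm2_expv linearD /= Lv_hv [Lv 2 (expv _)]Lv_expv // linear0 hv0_expv sub0r.
    rewrite linear_sum -ginv_trace; under eq_bigr => i _ do (rewrite linear_sum /=;
      under eq_bigr => j _ do (rewrite [Lv 2 (_ *: _)]linearZ /= Lv_hv Lv_hv [Lv 2 (expv _)]Lv_expv //
        linear0 [hv A _ (2 - 1) _]hv_expv sub0r scaler0 oppr0 linear0 sub0r /= hvC //
        [hv A _ (2 - 1) _]hv_expv linear0 add0r /=)).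
    rewrite [form _ _]linearD /= -scalerN -scaleNr formZr formZr form_expvv form_sumr mulr_suml.
    congr (_ + _); first by ring.
    apply: eq_bigr => i _; rewrite form_sumr mulr_suml; apply: eq_bigr => j _.
    by rewrite -scaleNr !formZr form_expvv; field.
  by field.
by rewrite (mulv_cre A) /cre /C -hv_comL -[_ *: hv _ _ _ _]linearZ -linearB /= -/(C y) ih linear0.
Qed.
End Virasoro.
Arguments Lv {r F} A n : simpl never.

(** * The automorphism theta *)

Lemma sch_intertwine (M N : lmodType rat) (X : nat -> {linear M -> M}) (Y : nat -> {linear N -> N})
    (T : {linear M -> N}) : (forall j y, T (X j y) = Y j (T y)) ->
  forall k y, T (sch X k y) = sch Y k (T y).
Proof.
move=> h k y; rewrite -[y in RHS](sch0 X).
apply: (sch_uniq (E := fun k => T (sch X k y))) => {}k.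
by rewrite -linearZ schSM linear_sum; apply: eq_bigr => j _; rewrite h.
Qed.

HB.lock Definition thetaF (r : nat) (F : fock_model r) : {linear F -> F} :=
  ext F (fun a m => (-1) ^+ mdeg m *: vec F (- a) m).
Arguments thetaF {r F}.

Section Theta.
Variables (r : nat) (F : fock_model r) (A : 'M[int]_r).
Local Notation L := 'rV[int]_r.
Implicit Types (a b : L) (x y : F).
Local Notation expv := (expv F).

Lemma theta_vec a m : thetaF (vec F a m) = (-1) ^+ mdeg m *: vec F (- a) m.
Proof. by rewrite thetaF.unlock ext_vec. Qed.

Lemma theta_expv a : thetaF (expv a) = expv (- a).
Proof. by rewrite theta_vec mdeg1 expr0 scale1r. Qed.

Lemma theta_mulv v y : thetaF (mulv v y) = - mulv v (thetaF y).
Proof.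
elim/vec_ind: y => [|c a m y ih]; first by rewrite !linear0.
have -> : thetaF (mulv v (c *: vec F a m + y)) = c *: thetaF (mulv v (vec F a m)) + thetaF (mulv v y).
  by rewrite !linearP.
have -> : mulv v (thetaF (c *: vec F a m + y)) = c *: mulv v (thetaF (vec F a m)) + mulv v (thetaF y).
  by rewrite !linearP.
rewrite ih opprD -scalerN; congr (_ *: _ + _).
rewrite mulv_vec !theta_vec [mulv _ (_ *: _)]linearZ /= mulv_vec mdegM mdegU exprD expr1.
by rewrite mulN1r scaleNr.
Qed.

Lemma theta_derv v y : thetaF (derv v y) = - derv v (thetaF y).
Proof.
elim/fock_ind: y => [c x y hx hy|a|w y ih].
- rewrite !linearP /= hx hy; lin_combine rat (fock_space F).
- by rewrite theta_expv !derv_expv linear0 oppr0.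
- rewrite derv_mulv [thetaF (_ + _)]linearD [thetaF (_ *: _)]linearZ /= !theta_mulv ih.
  rewrite [derv v (- _)]linearN /= derv_mulv [mulv w (- _)]linearN /=.
  lin_combine rat (fock_space F).
Qed.

Lemma theta_hv b n y : thetaF (hv A b n y) = - hv A b n (thetaF y).
Proof.
case: n => [[|n]|n].
- elim/vec_ind: y => [|c a m y ih]; first by rewrite !linear0.
  have -> : thetaF (hv A b 0 (c *: vec F a m + y)) = c *: thetaF (hv A b 0 (vec F a m)) + thetaF (hv A b 0 y).
    by rewrite !linearP.
  have -> : hv A b 0 (thetaF (c *: vec F a m + y)) = c *: hv A b 0 (thetaF (vec F a m)) + hv A b 0 (thetaF y).
    by rewrite !linearP.
  rewrite ih opprD -scalerN; congr (_ *: _ + _).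
  rewrite hv0_vec theta_vec linearZ /= theta_vec [hv _ _ _ (_ *: _)]linearZ /= hv0_vec pairingNr.
  by move: ((-1) ^+ mdeg m) => s; lin_combine rat (fock_space F).
- rewrite !hv_pos linear_sum -sumrN; apply: eq_bigr => i _ /=.
  by rewrite linearZ /= theta_derv scalerN.
- rewrite !hv_neg linear_sum -sumrN; apply: eq_bigr => i _ /=.
  by rewrite linearZ /= theta_mulv scalerN.
Qed.

Lemma theta_Lv n y : thetaF (Lv A n y) = Lv A n (thetaF y).
Proof.
have [W1 _ h1] := Lv_QL A y; have [W2 _ h2] := Lv_QL A (thetaF y).
pose M := (W1 + W2 + absz n)%N.
rewrite (h1 n M) ?(h2 n M); try by rewrite /M; lia.
rewrite /QL linear_sum; apply: eq_bigr => i _ /=; rewrite linear_sum; apply: eq_bigr => j _ /=.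
rewrite linearZ /= linear_sum; congr (_ *: _); apply: eq_bigr => t _ /=.
by rewrite /nordF; case: ifP => _; rewrite !theta_hv linearN /= opprK.
Qed.

Lemma thetaK y : thetaF (thetaF y) = y.
Proof.
elim/fock_ind: y => [c x y hx hy|a|w y ih]; first by rewrite !linearP /= hx hy.
  by rewrite !theta_expv opprK.
by rewrite theta_mulv linearN /= theta_mulv ih opprK.
Qed.

Lemma hvNb b n y : hv A (- b) n y = - hv A b n y.
Proof.
rewrite hv_sum [in RHS]hv_sum -sumrN; apply: eq_bigr => i _.
by rewrite mxE rmorphN /= scaleNr.
Qed.

Lemma hv0_delta i a m :
  hv A (delta_mx 0 i) 0 (vec F a m) = (\sum_j A i j * a 0 j)%:~R *: vec F a m.
Proof.
rewrite hv0_vec; congr (_%:~R *: _).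
by rewrite pairingE; apply: eq_bigr => k _; rewrite -rowE mxE.
Qed.

Lemma hv_pos_delta i j a m : hv A (delta_mx 0 i) (Posz j.+1) (vec F a m) =
  \sum_(v <- finsupp m | v.2 == j)
     ((j.+1 * m v)%:R * (A i v.1)%:~R) *: vec F a (mon_div m v).
Proof.
rewrite hv_pos.
transitivity (\sum_(v <- finsupp m) \sum_(k < r)
   if v == (k, j) then ((j.+1 * m v)%:R * (A i v.1)%:~R) *: vec F a (mon_div m v) else 0).
  rewrite exchange_big; apply: eq_bigr => k _ /=; rewrite derv_vec -rowE mxE.
  case: (boolP ((k, j) \in finsupp m)) => hk.
    rewrite (bigD1_seq (k, j)) ?fset_uniq //= eqxx big1 => [|v /negbTE -> //].
    by rewrite addr0 scalerA natrM -!mulrA [_%:R * _%:~R]mulrC.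
  rewrite big_seq_cond big1 => [|v /andP[hv _]]; last first.
    by case: eqP => // e; rewrite -e hv in hk.
  by move: hk; rewrite -cmE_eq0 => /eqP ->; rewrite scale0r scaler0.
rewrite [RHS]big_mkcond /=; apply: eq_bigr => -[k l] _ /=.
case: eqP => [->|ne]; last first.
  by rewrite big1 // => k' _; case: eqP => // -[_ e]; case: ne.
rewrite (bigD1 k) //= eqxx big1 ?addr0 // => k' ne.
by rewrite ifF //; apply/negP => /eqP[e]; rewrite e eqxx in ne.
Qed.

(** No signs appear, because theta takes the Schur polynomials of b to those of -b. *)
Lemma theta_schv a ls :
  thetaF (schv F A a ls) = schv F A (- a) [seq (- p.1, p.2) | p <- ls].
Proof.
elim: ls => [|[b k] ls ih] /=; first by rewrite theta_expv.
rewrite -ih; apply: (sch_intertwine (X := cre F A b) (Y := cre F A (- b)) (T := thetaF)).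
by move=> j y; rewrite /cre theta_hv hvNb.
Qed.

Lemma theta_Zform x : zspan (is_schv A) x -> zspan (is_schv A) (thetaF x).
Proof.
apply: (zspan_map (f := thetaF)) => [|_ [a [ls ->]]]; first exact: raddfB.
by rewrite theta_schv; apply: zspan_gen; exists (- a), [seq (- p.1, p.2) | p <- ls].
Qed.
End Theta.

(** * Identification of the abstract operators with those on [fock r] *)

Section Concrete.
Variables (r : nat) (A : 'M[int]_r).
Local Notation F := (fock_mod r).
Implicit Types x y : F.

Lemma lin_ext_fock (f : 'rV[int]_r -> {cmonom ('I_r * nat)%type} -> fock r) (x : F) :
  lin_ext f x = ext F (f : _ -> _ -> F) x.
Proof. by []. Qed.

Lemma lin_ext_eq (f : 'rV[int]_r -> {cmonom ('I_r * nat)%type} -> fock r)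
    (g : {linear F -> F}) (x : F) :
  (forall a m, f a m = g (vec F a m)) -> lin_ext f x = g x.
Proof.
move=> fg; rewrite lin_ext_fock; apply: (@fock_eq _ F _ (ext F (f : _ -> _ -> F)) g) => a m.
by rewrite ext_vec fg.
Qed.

Lemma coefE a m x : coef a m x = (x : fock r)@_((a, m) : fock_basis r).
Proof.
elim/vec_ind: x => [|c b m' x ih].
  by rewrite linear0 mcoeff0.
rewrite linearP /= ih coef_vec mcoeffD mcoeffZ mcoeff_single; congr (c * _ + _).
Qed.

Lemma heisE i n x : heis A i n x = hv A (delta_mx 0 i) n x.
Proof.
apply: lin_ext_eq => a m; case: n => [[|j]|j].
- have -> : hv A (delta_mx 0 i) 0 (vec F a m) = (\sum_j A i j * a 0 j)%:~R *: vec F a m.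
    exact: hv0_delta.
  exact: erefl.
- have -> : hv A (delta_mx 0 i) (Posz j.+1) (vec F a m) =
      \sum_(v <- finsupp m | v.2 == j)
        ((j.+1 * m v)%:R * (A i v.1)%:~R) *: vec F a (mon_div m v).
    exact: hv_pos_delta.
  exact: erefl.
- have -> : hv A (delta_mx 0 i) (Negz j) (vec F a m) = vec F a (mon_mul (i, j) m).
    rewrite hv_neg (bigD1 i) //= big1 => [|k ne].
      by rewrite mxE !eqxx scale1r addr0 mulv_vec.
    by rewrite mxE (negbTE ne) andbF scale0r.
  exact: erefl.
Qed.

Lemma fock_thetaE x : fock_theta (x : fock r) = thetaF x.
Proof. by rewrite thetaF.unlock. Qed.

Lemma fock_DE x : fock_D (x : fock r) = fD x.
Proof. by rewrite fD.unlock. Qed.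

Lemma fock_mulE x y : fock_mul A x y = fmul A x y.
Proof. by rewrite /fmul fmulr.unlock. Qed.

Lemma fock_virE n x : fock_vir A n x = Lv A n x.
Proof.
apply: lin_ext_eq => a m; rewrite /Lv ext_vec /QL.
have -> : nordF A = fun i j k l (y : F) => (nord A i j k l y : F).
  apply/funext => i; apply/funext => j; apply/funext => k; apply/funext => l.
  by apply/funext => y; rewrite /nord /nordF !heisE.
exact: erefl.
Qed.

Lemma lattice_ZformE x : lattice_Zform A x <-> zspan (is_schv A) x.
Proof.
rewrite -Zform_schv; split; elim=> {x}.
- exact: Zf_exp.
- by move=> x y _ hx _ hy; apply: Zf_sub.
- by move=> x y _ hx _ hy; rewrite fock_mulE; apply: Zf_mul.
- move=> i x _ hx; rewrite (_ : _ *: _ = dpow fD i (x : F)); first exact: Zf_D.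
  by rewrite /dpow; congr (_ *: _); elim: i => // i ih; rewrite /= ih fock_DE.
- exact: Zform_exp.
- by move=> x y _ hx _ hy; apply: Zform_sub.
- by move=> x y _ hx _ hy; rewrite -fock_mulE; apply: Zform_mul.
- move=> i x _ hx; rewrite (_ : dpow fD i x = i`!%:R^-1 *: iter i (@fock_D r) x); first exact: Zform_D.
  by rewrite /dpow; congr (_ *: _); elim: i => // i ih; rewrite /= -ih fock_DE.
Qed.

Lemma fock_formE x y : fock_form A x y = form A x y.
Proof.
rewrite /form /formr.
rewrite -[ext F _ _]/(\sum_(k <- msupp (x : fock r)) (x : fock r)@_k *: (coef k.1 (onecm _) (annih A k.2 y) : rat^o)).
apply: eq_bigr => k _; rewrite scaler_reg coefE; congr (_ * (_ : fock r)@__).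
rewrite /annihilate /annih; elim: (finsupp k.2 : seq _) => //= v s ->.
by elim: (k.2 v) => //= n ->; rewrite heisE.
Qed.
End Concrete.

(** * The no-ghost argument *)

Section InverseSeries.
Variables (M : lmodType rat) (X : nat -> {linear M -> M}).

Fixpoint iser_seq (y : M) n : seq M :=
  if n is n'.+1 then
    let s := iser_seq y n' in
    rcons s (- \sum_(j < n'.+1) X j (nth 0 s (n' - j)))
  else [:: y].

(* The coefficient of z^k in 1 / (1 + sum_j X_j z^(j+1)).                      *)
Definition iser k (y : M) : M := nth 0 (iser_seq y k) k.

Lemma size_iser_seq y n : size (iser_seq y n) = n.+1.
Proof. by elim: n => //= n ih; rewrite size_rcons ih. Qed.

Lemma nth_iser_seq y n k : (k <= n)%N -> nth 0 (iser_seq y n) k = iser k y.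
Proof.
elim: n => [|n ih]; first by rewrite leqn0 => /eqP ->.
rewrite leq_eqVlt => /orP[/eqP -> //|le_kn].
by rewrite /= nth_rcons size_iser_seq le_kn; apply: ih.
Qed.

Lemma iser0 y : iser 0 y = y. Proof. by []. Qed.

Lemma iserS k y : iser k.+1 y = - \sum_(j < k.+1) X j (iser (k - j) y).
Proof.
rewrite [LHS]/iser /= nth_rcons size_iser_seq ltnn eqxx; congr (- _).
by apply: eq_bigr => j _; rewrite nth_iser_seq // leq_subr.
Qed.

Lemma iser_uniq (E : nat -> M) : (forall k, E k.+1 = - \sum_(j < k.+1) X j (E (k - j)%N)) ->
  forall k, E k = iser k (E 0%N).
Proof.
move=> h; elim/ltn_ind => -[//|k] ih; rewrite h iserS; congr (- _).
by apply: eq_bigr => j _; rewrite ih // ltnS leq_subr.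
Qed.

Fact iser_linear k : linear (iser k).
Proof.
move=> a x y; rewrite -[a *: x + y]/(a *: iser 0 x + iser 0 y).
rewrite -(@iser_uniq (fun k => a *: iser k x + iser k y)) // => {}k.
rewrite !iserS scalerN scaler_sumr -opprD -big_split /=; congr (- _).
by apply: eq_bigr => j _; rewrite linearP.
Qed.
HB.instance Definition _ k := GRing.isLinear.Build rat M M _ (iser k) (iser_linear k).

Lemma iser_stable (Q : M -> Prop) :
  (forall a x y, Q x -> Q y -> Q (a *: x + y)) ->
  (forall j x, Q x -> Q (X j x)) -> forall k x, Q x -> Q (iser k x).
Proof.
move=> hQ hX; elim/ltn_ind => -[//|k] ih x qx.
have q0 : Q 0 by rewrite -(subrr x) -scaleN1r addrC; apply: hQ.
rewrite iserS -scaleN1r -[_ *: _]addr0; apply: (hQ) => //.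
elim/big_ind: _ => [|u v qu qv|j _] //; first by rewrite -[u]scale1r; apply: hQ.
by apply/hX/ih => //; rewrite ltnS leq_subr.
Qed.
End InverseSeries.

Lemma iser_intertwine (M N : lmodType rat) (X : nat -> {linear M -> M}) (Y : nat -> {linear N -> N})
    (T : {linear M -> N}) : (forall j y, T (X j y) = Y j (T y)) ->
  forall k y, T (iser X k y) = iser Y k (T y).
Proof.
move=> h k y; rewrite -[y in RHS](iser0 X).
apply: (iser_uniq (E := fun k => T (iser X k y))) => {}k.
by rewrite iserS linearN linear_sum; congr (- _); apply: eq_bigr => j _; rewrite h.
Qed.

(* The part of the no-ghost theorem that is needed: w is a null vector, K is   *)
(* the space of vectors killed by its positive modes, and S is the span of the *)
(* images of the L_-n, n > 0. The space is the sum of K and S, and the sum is  *)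
(* direct; both facts are proved along the filtration Fp.                      *)
Section NoGhost.
Variables (H : lmodType rat) (w Lo : int -> {linear H -> H}) (c : rat).
Hypothesis c0 : c != 0.
Hypothesis wC : forall k l h, w k (w l h) = w l (w k h).
Hypothesis w0 : forall h, w 0 h = c *: h.
Hypothesis Lw : forall n k h, Lo n (w k h) = w k (Lo n h) - k%:~R *: w (n + k) h.
Hypothesis LL : forall (m n : int) h, m + n != 0 ->
  Lo m (Lo n h) = Lo n (Lo m h) + (m - n)%:~R *: Lo (m + n) h.
Hypothesis LL1 : forall h, Lo 1 (Lo (-1) h) = Lo (-1) (Lo 1 h) + (2 : rat) *: Lo 0 h.
Hypothesis LL2 : forall h,
  Lo 2 (Lo (-2) h) = Lo (-2) (Lo 2 h) + (4 : rat) *: Lo 0 h + (13 : rat) *: h.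
Hypothesis w_fin : forall h, exists J, forall j, (J <= j)%N -> w j%:Z h = 0.

(** The filtration by degree in the variables dual to the positive modes of w; its first step [Fp 1]
    is K. *)
Fixpoint Fp (d : nat) (h : H) : Prop :=
  if d is d'.+1 then forall k : nat, Fp d' (w k.+1%:Z h) else h = 0.
Hypothesis Fp_exh : forall h, exists d, Fp d h.

Lemma Fp_lin d a x y : Fp d x -> Fp d y -> Fp d (a *: x + y).
Proof.
elim: d x y => [|d ih] x y /=; first by move=> -> ->; rewrite scaler0 addr0.
by move=> hx hy k; rewrite linearP; apply: ih.
Qed.
Lemma Fp0 d : Fp d 0.
Proof. by elim: d => //= d ih k; rewrite linear0. Qed.
Lemma FpD d x y : Fp d x -> Fp d y -> Fp d (x + y).
Proof. by rewrite -{2}[x]scale1r; apply: Fp_lin. Qed.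
Lemma FpZ d a x : Fp d x -> Fp d (a *: x).
Proof. by move=> hx; rewrite -[_ *: _]addr0; apply: Fp_lin => //; apply: Fp0. Qed.
Lemma Fp_sum d I (s : seq I) (P : pred I) (f : I -> H) :
  (forall i, P i -> Fp d (f i)) -> Fp d (\sum_(i <- s | P i) f i).
Proof. by move=> h; elim/big_ind: _ => //; [apply: Fp0 | apply: FpD]. Qed.
Lemma Fp_w d k x : Fp d x -> Fp d (w k x).
Proof.
elim: d x => [|d ih] x /=; first by move=> ->; rewrite linear0.
by move=> hx j; rewrite wC; apply: ih.
Qed.
Lemma FpS d x : Fp d x -> Fp d.+1 x.
Proof. by move=> h k; apply: Fp_w. Qed.

Definition wser (j : nat) : {linear H -> H} := c^-1 \*: w (- j.+1%:Z).
(** The coefficients of the inverse of sum_(k >= 0) w(-k) z^k, which exists as w(0) is the nonzero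
    scalar c ([bet_inv]). *)
Definition bet n (h : H) : H := c^-1 *: iser wser n h.
Fact bet_linear n : linear (bet n).
Proof. by move=> a x y; rewrite /bet linearP scalerDr scalerC. Qed.
HB.instance Definition _ n := GRing.isLinear.Build rat H H _ (bet n) (bet_linear n).

Lemma betE n h : bet n h = c^-1 *: iser wser n h. Proof. by []. Qed.

Lemma bet_stable (Q : H -> Prop) : (forall a x y, Q x -> Q y -> Q (a *: x + y)) ->
  (forall k x, Q x -> Q (w k x)) -> forall n x, Q x -> Q (bet n x).
Proof.
move=> hQ hX n x qx; have q0 : Q 0 by rewrite -(subrr x) -scaleN1r addrC; apply: hQ.
rewrite betE -[_ *: _]addr0; apply: (hQ) => //; apply: (iser_stable hQ) => // j y qy.
by rewrite -[wser j y]addr0; apply: (hQ) => //; apply: hX.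
Qed.

Lemma Fp_bet d n x : Fp d x -> Fp d (bet n x).
Proof. by apply: bet_stable => [a u v|k u]; [apply: Fp_lin | apply: Fp_w]. Qed.

Lemma w_bet k n h : w k (bet n h) = bet n (w k h).
Proof.
rewrite !betE linearZ /=; congr (_ *: _).
by apply: iser_intertwine => j y; rewrite /wser /= linearZ /= wC.
Qed.

Lemma bet_inv s h : \sum_(i < s.+1) w (i%:Z - s%:Z) (bet i h) = (s == 0%N)%:R *: h.
Proof.
case: s => [|s]; first by rewrite big_ord1 subrr w0 betE iser0 scalerA divff.
rewrite scale0r big_ord_recr /= subrr w0 betE iserS scalerA divff // scale1r.
rewrite (reindex_inj rev_ord_inj) /=; apply/eqP; rewrite subr_eq0; apply/eqP.
apply: eq_bigr => i _; rewrite /wser /= betE linearZ /= subSS; congr (_ *: w _ _).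
by case: i => i /= lt; lia.
Qed.

Lemma bet_inv_shift k j J h : (k <= j)%N -> (j < J)%N ->
  \sum_(m < J | (k <= m)%N && (m <= j)%N) w (k%:Z - m%:Z) (bet (j - m) h) = (j == k)%:R *: h.
Proof.
move=> kj jJ; have -> : (j == k) = ((j - k)%N == 0%N) by apply/eqP/eqP; lia.
rewrite -bet_inv [RHS](reindex_inj rev_ord_inj) /=.
rewrite -(big_mkord (fun m => (k <= m)%N && (m <= j)%N) (fun m => w (k%:Z - m%:Z) (bet (j - m) h))).
rewrite (big_cat_nat (n := j.+1)) //= [X in _ + X]big_nat_cond [X in _ + X]big1 ?addr0; last by move=> m; lia.
rewrite (big_cat_nat (n := k)) //=; last by lia.
rewrite big_nat_cond big1 ?add0r => [|m]; last by lia.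
rewrite -{1}[k]add0n big_addn; have -> : (j.+1 - k = (j - k).+1)%N by lia.
rewrite big_mkord; apply: eq_big => [m|m _]; first by case: m => m /=; lia.
by congr (w _ (bet _ _)); case: m => m /=; lia.
Qed.

(** To leading order this is the partial derivative with respect to L_-m: moving w(j) past L_-n
    leaves j w(j - n), the factor 1/j cancels, and the inverse series reduces the sum to delta_mn
    plus positive modes ([wl_L]). J only makes the sum finite. *)
Definition wl J m (h : H) : H :=
  \sum_(j < J | (m <= j)%N) j%:R^-1 *: bet (j - m) (w j%:Z h).
Fact wl_linear J m : linear (wl J m).
Proof.
move=> a x y; rewrite /wl scaler_sumr -big_split; apply: eq_bigr => j _ /=.
by rewrite linearP linearP scalerDr scalerC.
Qed.
HB.instance Definition _ J m := GRing.isLinear.Build rat H H _ (wl J m) (wl_linear J m).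

Lemma w_wl k J m h : w k (wl J m h) = wl J m (w k h).
Proof.
rewrite linear_sum; apply: eq_bigr => j _; rewrite linearZ /= w_bet wC.
by [].
Qed.

Lemma Fp_wl d J m h : (0 < m)%N -> Fp d.+1 h -> Fp d (wl J m h).
Proof.
move=> m0 hh; apply: Fp_sum => -[[|j] lt] /= mj; first by rewrite leqNgt m0 in mj.
by apply/FpZ/Fp_bet/hh.
Qed.

Lemma wL k n h : w k (Lo n h) = Lo n (w k h) + k%:~R *: w (n + k) h.
Proof. by rewrite Lw subrK. Qed.

Lemma bet_delta m n J h : (m < J)%N -> (n < J)%N ->
  \sum_(j < J | (m <= j)%N) bet (j - m) (w (j%:Z - n%:Z) h)
  = (m == n)%:R *: h + \sum_(j < J | (m <= j)%N && (n < j)%N) bet (j - m) (w (j%:Z - n%:Z) h).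
Proof.
move=> mJ nJ; rewrite (bigID (fun j : 'I_J => (n < j)%N)) /= addrC; congr (_ + _).
have [le|lt] := leqP m n; last first.
  rewrite big1 => [|j /andP[h1 h2]]; last by lia.
  by rewrite (gtn_eqF lt) scale0r.
have -> : (m == n) = ((n - m)%N == 0%N) by apply/eqP/eqP; lia.
rewrite -bet_inv -(big_mkord xpredT (fun i => w (i%:Z - (n - m)%:Z) (bet i h))).
rewrite -(big_mkord (fun j => (m <= j)%N && ~~ (n < j)%N) (fun j => bet (j - m) (w (j%:Z - n%:Z) h))).
rewrite (big_cat_nat (n := n.+1)) //= [X in _ + X]big_nat_cond [X in _ + X]big1 ?addr0; last first.
  by move=> j /andP[/andP[h1 _] /andP[_ h2]]; rewrite h1 in h2.
rewrite (big_cat_nat (n := m)) //=; last by lia.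
rewrite big_nat_cond big1 ?add0r => [|j]; last by lia.
rewrite -{1}[m]add0n big_addn; have -> : (n.+1 - m = (n - m).+1)%N by lia.
rewrite big_nat_cond [RHS]big_nat_cond; apply: eq_big => [j|j]; first by lia.
by move=> _; rewrite w_bet addnK; congr (bet _ (w _ _)); lia.
Qed.

(** The Euler operator in these coordinates; it acts as d on [Fp d.+1] modulo [Fp d] ([Eop_Fp]). *)
Definition Eop J (h : H) : H := \sum_(m < J | (0 < m)%N) Lo (- m%:Z) (wl J m h).
Fact Eop_linear J : linear (Eop J).
Proof.
move=> a x y; rewrite /Eop scaler_sumr -big_split; apply: eq_bigr => j _ /=.
by rewrite !linearP.
Qed.
HB.instance Definition _ J := GRing.isLinear.Build rat H H _ (Eop J) (Eop_linear J).

Definition bd J h := forall j, (J <= j)%N -> w j%:Z h = 0.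

Lemma bd_w J k h : bd J h -> bd J (w k h).
Proof. by move=> hb j le; rewrite wC hb // linear0. Qed.
Lemma bdW J J' h : (J <= J')%N -> bd J h -> bd J' h.
Proof. by move=> le hb j le'; apply: hb; apply: leq_trans le'. Qed.

Lemma Eop_comm J d k h : Fp d.+2 h -> bd J h ->
  exists2 z, Fp d z & w k.+1%:Z (Eop J h) = Eop J (w k.+1%:Z h) + w k.+1%:Z h + z.
Proof.
move=> hF hb.
pose z := \sum_(m < J | (0 < m)%N && (m < k.+1)%N) k.+1%:R *: w (k.+1%:Z - m%:Z) (wl J m h).
exists z.
  apply: Fp_sum => m /andP[m0 mk]; apply: FpZ; rewrite w_wl; apply: Fp_wl => //.
  have -> : k.+1%:Z - m%:Z = (k - m).+1%:Z by lia.
  exact: hF.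
rewrite linear_sum /=; under eq_bigr => m m0 do rewrite wL w_wl.
rewrite big_split -addrA /=; congr (_ + _).
have [lt|le] := ltnP k.+1 J; last first.
  rewrite hb // add0r; apply: eq_big => [m|m _]; last by rewrite addrC.
  by rewrite (leq_trans (ltn_ord m) le) andbT.
(* The terms with m <= k contain the further positive mode w(k+1-m) and form z; those with m > k are
   summed to w(k+1) h by [bet_inv_shift]. *)
rewrite (bigID (fun m : 'I_J => (m < k.+1)%N)) /= addrC; congr (_ + _); last first.
  by apply: eq_bigr => m _; rewrite addrC.
under eq_bigr => m _ do rewrite /wl linear_sum scaler_sumr.
rewrite (exchange_big_dep (fun j : 'I_J => (k.+1 <= j)%N)) /=; last by lia.
transitivity (\sum_(j < J | (k.+1 <= j)%N) (k.+1%:R / j%:R) *: ((j == k.+1 :> nat)%:R *: w j%:Z h)).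
  apply: eq_bigr => j kj; rewrite -(@bet_inv_shift k.+1 j J) // scaler_sumr.
  apply: eq_big => [m|m _]; first by rewrite -leqNgt; lia.
  by rewrite [w _ (_ *: _)]linearZ /= scalerA [_ + k.+1%:Z]addrC.
rewrite (bigD1 (Ordinal lt)) //= eqxx scale1r divff ?pnatr_eq0 // scale1r big1 ?addr0 //.
move=> j /andP[_ ne]; rewrite (_ : (j == k.+1 :> nat) = false) ?scale0r ?scaler0 //.
by apply: contraNF ne => /eqP e; apply/eqP/val_inj.
Qed.

Lemma Eop_Fp J d h : Fp d.+1 h -> bd J h -> Fp d (Eop J h - d%:R *: h).
Proof.
elim: d h => [|d ih] h hF hb.
  by rewrite scale0r subr0 /Eop big1 // => m m0; rewrite (Fp_wl (d := 0) _ m0 hF) linear0.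
move=> k; have [z hz e] := Eop_comm k hF hb.
rewrite linearB [w _ (_ *: _)]linearZ /= e.
have := ih _ (hF k) (bd_w _ hb) => h1.
have -> : Eop J (w k.+1%:Z h) + w k.+1%:Z h + z - d.+1%:R *: w k.+1%:Z h
  = (Eop J (w k.+1%:Z h) - d%:R *: w k.+1%:Z h) + z.
  rewrite -natr1; lin_combine rat H.
exact: FpD.
Qed.

(** The space S with a side condition on the summands: a filtration degree in [SFp], a weight in
    [Swt], nothing in [posK_Sp]. *)
Inductive Sp (Q : nat -> H -> Prop) : H -> Prop :=
| Sp_0 : Sp Q 0
| Sp_S n h x : Q n h -> Sp Q x -> Sp Q (Lo (- n.+1%:Z) h + x).

Lemma Sp_add Q x y : Sp Q x -> Sp Q y -> Sp Q (x + y).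
Proof.
move=> hx hy; elim: hx => [|n h z hq _ ih]; first by rewrite add0r.
by rewrite -addrA; apply: Sp_S.
Qed.
Lemma Sp_scale (Q : nat -> H -> Prop) a x : (forall n h, Q n h -> Q n (a *: h)) ->
  Sp Q x -> Sp Q (a *: x).
Proof.
move=> hQ; elim=> [|n h z hq _ ih]; first by rewrite scaler0; apply: Sp_0.
by rewrite scalerDr -linearZ; apply: Sp_S => //; apply: hQ.
Qed.
Lemma Sp_gen (Q : nat -> H -> Prop) n h : Q n h -> Sp Q (Lo (- n.+1%:Z) h).
Proof. by move=> hq; rewrite -[Lo _ _]addr0; apply: Sp_S => //; apply: Sp_0. Qed.
Lemma Sp_sub (Q Q' : nat -> H -> Prop) x : (forall n h, Q n h -> Q' n h) -> Sp Q x -> Sp Q' x.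
Proof. by move=> le; elim=> [|n h z /le hq _ ih]; [apply: Sp_0 | apply: Sp_S]. Qed.
Lemma Sp_sum Q I (s : seq I) (P : pred I) (f : I -> H) :
  (forall i, P i -> Sp Q (f i)) -> Sp Q (\sum_(i <- s | P i) f i).
Proof. by move=> h; elim/big_ind: _ => //; [apply: Sp_0 | apply: Sp_add]. Qed.

Definition posK h := forall k : nat, w k.+1%:Z h = 0.

Definition SFp d := Sp (fun _ h => Fp d h).

Lemma Sp_series d x : SFp d x -> exists J (f : nat -> H),
  [/\ forall n, Fp d (f n), forall n, bd J (f n), forall n, (J <= n)%N -> f n = 0
    & x = \sum_(n < J | (0 < n)%N) Lo (- n%:Z) (f n)].
Proof.
elim=> [|n h z hq _ [J [f [fF fb f0 ->]]]].
  exists 0%N, (fun=> 0); split=> // [n|n j _|]; [exact: Fp0 | exact: linear0 | by rewrite big_ord0].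
have [J1 hb] := w_fin h; pose J' := maxn J (maxn J1 n.+2).
exists J', (fun i => if i == n.+1 then h + f i else f i); split=> [i|i|i le|].
- by case: ifP => _ //; apply: FpD.
- have bf : bd J' (f i) by apply: bdW (fb i); rewrite leq_maxl.
  case: ifP => _ // j le; rewrite linearD /= bf // addr0; apply: hb; move: le; rewrite /J'; lia.
- by rewrite ifF ?f0 //; move: le; rewrite /J'; lia.
have lt : (n.+1 < J')%N by rewrite /J'; lia.
rewrite (bigD1 (Ordinal lt)) //= eqxx linearD -addrA; congr (_ + _).
transitivity (\sum_(i < J' | (0 < i)%N) Lo (- i%:Z) (f i)).
  rewrite -(big_mkord (fun i => 0 < i)%N (fun i => Lo (- i%:Z) (f i))).
  rewrite -(big_mkord (fun i => 0 < i)%N (fun i => Lo (- i%:Z) (f i))).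
  rewrite [RHS](big_cat_nat (n := J)) //=; last by rewrite leq_maxl.
  rewrite [X in _ + X]big_nat_cond [X in _ + X]big1 ?addr0 // => i /andP[/andP[le _] _].
  by rewrite f0 // linear0.
rewrite (bigD1 (Ordinal lt)) //=; congr (_ + _); apply: eq_bigr => i /andP[_ ne].
by rewrite ifF //; apply: contraNF ne => /eqP e; apply/eqP/val_inj.
Qed.

(** L_k may raise the filtration, but its commutators with the modes of w are modes of w again, and
    these do not. *)
Lemma bet_L d n k y : Fp d y -> Fp d (bet n (Lo k y) - Lo k (bet n y)).
Proof.
move=> hy; elim/ltn_ind: n => -[|n] ih.
  by rewrite !betE !iser0 linearZ subrr; apply: Fp0.
have e z : bet n.+1 z = - (c^-1 *: \sum_(j < n.+1) w (- j.+1%:Z) (bet (n - j) z)).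
  rewrite betE iserS scalerN scaler_sumr scaler_sumr; congr (- _); apply: eq_bigr => j _.
  by rewrite betE [w _ (_ *: _)]linearZ.
rewrite !e [Lo k (- _)]linearN /= [Lo k (_ *: _)]linearZ /=.
set P := \sum_(_ < _) _; set Q := \sum_(_ < _) _.
have -> : - (c^-1 *: P) - - (c^-1 *: Lo k Q) = (- c^-1) *: (P - Lo k Q) by lin_combine rat H.
apply: FpZ; rewrite {}/P {}/Q.
rewrite linear_sum -sumrB; apply: Fp_sum => j _.
rewrite /= [Lo k (w _ _)]Lw opprB addrCA addrA -addrA addrC -linearB -addrC.
apply: FpD; first by apply: FpZ; apply: Fp_w; apply: Fp_bet.
by apply: Fp_w; apply: ih; rewrite ltnS leq_subr.
Qed.

Lemma wl_L J m n h d : (m < J)%N -> (n < J)%N -> (0 < m)%N -> Fp d.+1 h ->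
  exists2 z, Fp d z & wl J m (Lo (- n%:Z) h) = Lo (- n%:Z) (wl J m h) + (m == n)%:R *: h + z.
Proof.
move=> mJ nJ m0 hF.
exists (\sum_(j < J | (m <= j)%N && (n < j)%N) bet (j - m) (w (j%:Z - n%:Z) h) +
  \sum_(j < J | (m <= j)%N) j%:R^-1 *:
     (bet (j - m) (Lo (- n%:Z) (w j%:Z h)) - Lo (- n%:Z) (bet (j - m) (w j%:Z h)))).
  apply: FpD; apply: Fp_sum => j; last first.
    move=> mj; apply: FpZ; apply: bet_L; have -> : j%:Z = j.-1.+1%:Z by lia.
    exact: hF.
  move=> /andP[_ nj]; apply: Fp_bet.
  have -> : j%:Z - n%:Z = (j - n).-1.+1%:Z by lia.
  exact: hF.
rewrite -addrA [(m == n)%:R *: h + _]addrA -bet_delta // -big_split /wl linear_sum -big_split.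
apply: eq_bigr => j mj /=.
rewrite wL [bet _ (_ + _)]linearD /= [bet _ (_ *: _)]linearZ /= [_ + j%:Z]addrC [Lo _ (_ *: _)]linearZ /=.
have j0 : (j%:R : rat) != 0 by rewrite pnatr_eq0; lia.
lin_combine rat H.
Qed.

(** K and S meet in 0 by a Koszul argument with the Euler operator as homotopy. If x = sum_n L_-n
    f_n lies in K with f_n in [Fp d.+1], then to leading order (f_n) is the boundary of an
    antisymmetric family; the boundary contributes only commutators of the L_-n, so x can be
    rewritten with coefficients in [Fp d]. *)
Lemma Koszul d x : posK x -> SFp d x -> x = 0.
Proof.
elim: d x => [|d ih] x hK hS.
  by elim: hS => [//|n h z /= -> _ ->]; rewrite linear0 addr0.
apply: ih => //; have [J [f [fF fb f0 ex]]] := Sp_series hS.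
have bJ n : bd J (f n) by apply: fb.
(* To leading order the boundary of g is (d+1) f: one copy of f_n comes from 0 = [wl J n x], and d
   copies from the Euler operator. *)
pose g n m := wl J m (f n) - wl J n (f m).
have gF n m : (0 < n)%N -> (0 < m)%N -> Fp d (g n m).
  move=> n0 m0; rewrite /g -scaleN1r addrC; apply: Fp_lin; exact: Fp_wl.
pose h' n := d.+1%:R *: f n - \sum_(m < J | (0 < m)%N) Lo (- m%:Z) (g n m).
have hF' n : (0 < n)%N -> (n < J)%N -> Fp d (h' n).
  move=> n0 nJ.
  have e0 : wl J n x = 0.
    apply: big1 => -[[|j] lt] /= nj; first by rewrite leqNgt n0 in nj.
    by rewrite hK !linear0.
  have e1 : exists2 z, Fp d z & wl J n x =
      \sum_(m < J | (0 < m)%N) Lo (- m%:Z) (wl J n (f m)) + f n + z.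
    have /choice[z hz] : forall m, exists z, (m < J)%N -> Fp d z /\
        wl J n (Lo (- m%:Z) (f m)) = Lo (- m%:Z) (wl J n (f m)) + (n == m)%:R *: f m + z.
      move=> m.
      have [mJ|] := ltnP m J; last by exists 0.
      by have [z h1 h2] := wl_L nJ mJ n0 (fF m); exists z.
    exists (\sum_(m < J | (0 < m)%N) z m); first by apply: Fp_sum => m _; case: (hz m).
    rewrite ex linear_sum -!addrA addrA.
    rewrite (eq_bigr (fun m : 'I_J => Lo (- m%:Z) (wl J n (f m)) + (n == m)%:R *: f m + z m)).
      rewrite big_split big_split /=; congr (_ + _ + _).
      rewrite (bigD1 (Ordinal nJ)) //= eqxx scale1r big1 ?addr0 // => m /andP[_ ne].
      rewrite (_ : (n == m :> nat) = false) ?scale0r //.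
      by apply: contraNF ne => /eqP e; apply/eqP/val_inj.
    by move=> m _; case: (hz m) => //; apply: ltn_ord.
  have [z hz e2] := e1; have hE := Eop_Fp (fF n) (bJ n).
  have -> : h' n = - (Eop J (f n) - d%:R *: f n) - z.
    have -> : z = - \sum_(m < J | (0 < m)%N) Lo (- m%:Z) (wl J n (f m)) - f n.
      move: e2; rewrite e0 => /esym/eqP; rewrite addr_eq0 => /eqP e2.
      by rewrite -[z]opprK -e2; lin_combine rat H.
    rewrite /h' /g; under eq_bigr => m _ do rewrite linearB.
    rewrite sumrB -/(Eop J (f n)) -natr1.
    move: (\sum_(m < J | _) _) (Eop J (f n)) => X Y; lin_combine rat H.
  by rewrite -opprD -[- (_ + z)]scaleN1r; apply/FpZ/FpD.
have d1 : (d.+1%:R : rat) != 0 by rewrite pnatr_eq0.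
have -> : x = d.+1%:R^-1 *: (\sum_(n < J | (0 < n)%N) Lo (- n%:Z) (h' n)
    + \sum_(n < J | (0 < n)%N) \sum_(m < J | (0 < m)%N)
        ((m%:R - n%:R) / 2) *: Lo (- n%:Z - m%:Z) (g n m)).
  (* Since g is antisymmetric, the sum of the L_-n L_-m g_nm is half a sum of commutators, that is,
     of single operators L_-(n+m). *)
  have -> : \sum_(n < J | (0 < n)%N) \sum_(m < J | (0 < m)%N)
        ((m%:R - n%:R) / 2) *: Lo (- n%:Z - m%:Z) (g n m)
     = \sum_(n < J | (0 < n)%N) \sum_(m < J | (0 < m)%N) Lo (- n%:Z) (Lo (- m%:Z) (g n m)).
    set X := RHS; have eX : X = - \sum_(n < J | (0 < n)%N) \sum_(m < J | (0 < m)%N) Lo (- m%:Z) (Lo (- n%:Z) (g n m)).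
      rewrite exchange_big -sumrN; apply: eq_bigr => n n0; rewrite -sumrN; apply: eq_bigr => m m0 /=.
      have -> : g m n = - g n m by rewrite /g opprB.
      by rewrite [Lo (- m%:Z) (- _)]linearN /= [Lo (- n%:Z) (- _)]linearN opprK.
    rewrite -[X](_ : (2^-1 : rat) *: (X + X) = X); last by lin_combine rat H.
    rewrite {2}eX /X -sumrB scaler_sumr; apply: eq_bigr => n n0.
    rewrite -sumrB scaler_sumr; apply: eq_bigr => m m0.
    rewrite LL; last by lia.
    have -> : - n%:Z - - m%:Z = m%:Z - n%:Z by lia.
    rewrite rmorphB /= -!pmulrn; lin_combine rat H.
  rewrite -big_split (eq_bigr (fun n : 'I_J => d.+1%:R *: Lo (- n%:Z) (f n))); last first.
    move=> n n0; rewrite /= /h' linearB linearZ /= linear_sum subrK.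
    by [].
  by rewrite -scaler_sumr scalerA mulVf // scale1r.
apply: Sp_scale => [n h|]; first exact: FpZ.
apply: Sp_add; apply: Sp_sum => n n0.
  have -> : - n%:Z = - n.-1.+1%:Z by lia.
  by apply: Sp_gen; apply: hF'.
apply: Sp_sum => m m0; rewrite -linearZ.
have -> : - n%:Z - m%:Z = - (n + m).-1.+1%:Z by lia.
by apply: Sp_gen; apply/FpZ/gF.
Qed.

Lemma posK_Sp x : posK x -> Sp (fun _ _ => True) x -> x = 0.
Proof.
move=> hK hS; have [d hd] : exists d, SFp d x.
  elim: hS {hK} => [|n h z _ _ [d hd]]; first by exists 0%N; apply: Sp_0.
  have [d' hd'] := Fp_exh h; exists (d + d')%N; apply: Sp_S.
    by elim: (d) => // e; apply: FpS.
  apply: Sp_sub hd => _ y hy; rewrite addnC.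
  by elim: (d') => // e; apply: FpS.
exact: Koszul hK hd.
Qed.

Definition Swt (a : rat) := Sp (fun n h => Lo 0 h = (a - n.+1%:R) *: h).

Lemma L0_L n h : Lo 0 (Lo n h) = Lo n (Lo 0 h) - n%:~R *: Lo n h.
Proof.
have [->|n0] := eqVneq n 0; first by rewrite scale0r subr0.
rewrite LL; first by rewrite !add0r rmorphN scaleNr.
by rewrite add0r.
Qed.

Lemma L0_wl a J m h : Lo 0 h = a *: h -> Lo 0 (wl J m h) = (a - m%:R) *: wl J m h.
Proof.
move=> ha; have hw b y k : Lo 0 y = b *: y -> Lo 0 (w k y) = (b - k%:~R) *: w k y.
  by move=> e; rewrite Lw e linearZ /= add0r scalerBl.
have hbet n b y : Lo 0 y = b *: y -> Lo 0 (bet n y) = (b + n%:R) *: bet n y.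
  move=> e; rewrite betE [Lo 0 _]linearZ /= [RHS]scalerC; congr (_ *: _).
  elim/ltn_ind: n => -[|n] ih; first by rewrite iser0 addr0.
  rewrite iserS linearN linear_sum scalerN scaler_sumr; congr (- _).
  apply: eq_bigr => j _ /=; rewrite [Lo 0 _]linearZ /= (hw (b + (n - j)%:R)).
    rewrite [RHS]scalerC; congr (_ *: (_ *: _)); rewrite natrB -1?ltnS //.
    rewrite rmorphN /= -pmulrn -!natr1; ring.
  by apply: ih; rewrite ltnS leq_subr.
rewrite /wl linear_sum scaler_sumr; apply: eq_bigr => j mj /=.
rewrite [Lo 0 _]linearZ /= (hbet _ (a - j%:R)); last by rewrite (hw a) // pmulrn.
by rewrite [RHS]scalerC natrB //; congr (_ *: (_ *: _)); ring.
Qed.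

(** Induction along the filtration: [Eop J h] lies in S and differs from a nonzero multiple of h by
    a vector one step lower. Weights are preserved because [wl J m] lowers what L_-m raises. *)
Lemma decompose a h : Lo 0 h = a *: h ->
  exists k s, [/\ h = k + s, posK k, Lo 0 k = a *: k & Swt a s].
Proof.
have [d hd] := Fp_exh h; move: hd => /FpS; elim: d h => [|d ih] h hF ha.
  by exists h, 0; split=> //; [rewrite addr0 | apply: Sp_0].
have [J hb] := w_fin h; have hE := Eop_Fp hF hb.
have aE : Lo 0 (Eop J h) = a *: Eop J h.
  rewrite /Eop linear_sum scaler_sumr; apply: eq_bigr => m _ /=.
  rewrite L0_L (L0_wl _ _ ha) [Lo _ (_ *: _)]linearZ /= rmorphN /= -pmulrn; lin_combine rat H.
have sE : Swt a (Eop J h).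
  apply: Sp_sum => m m0; have -> : - m%:Z = - m.-1.+1%:Z by lia.
  by apply: Sp_gen; rewrite (L0_wl _ _ ha) prednK.
have [|k [s [e hK kK hs]]] := ih _ hE.
  by rewrite linearB [Lo 0 (_ *: _)]linearZ /= aE ha; lin_combine rat H.
have d0 : (d.+1%:R : rat) != 0 by rewrite pnatr_eq0.
exists (- d.+1%:R^-1 *: k), (d.+1%:R^-1 *: (Eop J h - s)); split.
- have -> : s = Eop J h - d.+1%:R *: h - k by rewrite e; lin_combine rat H.
  by move: (d.+1%:R) d0 => D D0; lin_combine rat H.
- by move=> i; rewrite linearZ /= hK scaler0.
- by rewrite linearZ /= kK scalerC.
apply: Sp_scale => [n x|].
  by move=> hx; rewrite linearZ /= hx scalerC.
rewrite -scaleN1r; apply: Sp_add => //; apply: Sp_scale => // n x.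
by move=> hx; rewrite linearZ /= hx scalerC.
Qed.

Lemma Swt1_form x : Swt 1 x -> exists al be, [/\ x = Lo (-1) al + Lo (-2) be,
  Lo 0 al = 0 & Lo 0 be = - be].
Proof.
elim=> [|n h z hn _ [al [be [-> hal hbe]]]].
  by exists 0, 0; rewrite !linear0 addr0.
suff [a2 [b2 [-> ha hb]]] : exists a2 b2, [/\ Lo (- n.+1%:Z) h = Lo (-1) a2 + Lo (-2) b2,
    Lo 0 a2 = 0 & Lo 0 b2 = - b2].
  exists (a2 + al), (b2 + be); rewrite !linearD hal hbe ha hb addr0 opprD; split=> //.
  by rewrite addrACA.
case: n hn => [|n] hn.
  exists h, 0; rewrite !linear0 addr0; split=> //.
  by rewrite hn subrr scale0r.
elim: n h hn => [|n ih] h hn.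
  exists 0, h; rewrite !linear0 add0r; split=> //.
  by rewrite hn -scaleN1r; congr (_ *: _); ring.
have [a2 [b2 [e ha hb]]] : exists a2 b2, [/\ Lo (- n.+2%:Z) (Lo (-1) h) = Lo (-1) a2 + Lo (-2) b2,
    Lo 0 a2 = 0 & Lo 0 b2 = - b2].
  apply: ih; rewrite L0_L hn [Lo _ (_ *: _)]linearZ /= -!natr1; lin_combine rat H.
have n0 : (n.+1%:R : rat) != 0 by rewrite pnatr_eq0.
(* From [L_-1, L_-(n+2)] = (n+1) L_-(n+3): the operators L_-1 and L_-2 generate all L_-n. *)
exists (n.+1%:R^-1 *: (Lo (- n.+2%:Z) h - a2)), (- n.+1%:R^-1 *: b2); split.
- rewrite [Lo (-1) (_ *: _)]linearZ /= linearB /= LL; last by lia.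
  rewrite [Lo (-2) (_ *: _)]linearZ /= e.
  have -> : -1 - - n.+2%:Z = n.+1%:Z by lia.
  have -> : -1 + - n.+2%:Z = - n.+3%:Z by lia.
  by rewrite -pmulrn; move: (n.+1%:R) n0 => D D0; lin_combine rat H.
- rewrite linearZ /= linearB ha subr0 /= L0_L hn [Lo _ (_ *: _)]linearZ /= rmorphN /= -pmulrn -!natr1.
  by rewrite -[RHS](scale0r (Lo (- n.+2%:Z) h)); lin_combine rat H.
- by rewrite linearZ /= hb scalerN.
Qed.

Lemma posK_L (n : int) k : posK k -> 0 <= n -> posK (Lo n k).
Proof.
move=> hK n0 i; rewrite wL hK linear0 add0r.
case: n n0 => // n _; have -> : n%:Z + i.+1%:Z = (n + i)%N.+1%:Z by lia.
by rewrite hK scaler0.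
Qed.

(** L_1 k and L_2 k lie in K. They lie in S too, because p is primary and, for weight 1 and central
    charge 26, both L_1 and L_2 + 3/2 L_1^2 map s into S. As K and S meet in 0, both vanish. *)
Lemma no_ghost p : Lo 0 p = p -> (forall n : int, 0 < n -> Lo n p = 0) ->
  exists k s, [/\ p = k + s, posK k, Lo 0 k = k, forall n : int, 0 < n -> Lo n k = 0
    & Sp (fun _ _ => True) s].
Proof.
move=> p0 pn; have [|k [s [e hK k0 hs]]] := @decompose 1 p; first by rewrite scale1r.
rewrite scale1r in k0.
exists k, s; split=> //; last by apply: Sp_sub hs.
have [al [be [es hal hbe]]] := Swt1_form hs.
(* With the coefficient 3/2 and the central term 13, the multiples of L_1 ga and of be in T s
   cancel, and these are the only terms not visibly in S. *)
pose T h := Lo 2 h + (3 / 2 : rat) *: Lo 1 (Lo 1 h).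
have G1 h : Sp (fun _ _ => True) (Lo (-1) h) by apply: (Sp_gen (n := 0)).
have G2 h : Sp (fun _ _ => True) (Lo (-2) h) by apply: (Sp_gen (n := 1)).
have GZ (a : rat) h : Sp (fun _ _ => True) h -> Sp (fun _ _ => True) (a *: h) by apply: Sp_scale.
pose ga := al - (3 / 2 : rat) *: Lo (-1) be.
have es' : s = Lo (-1) ga + (Lo (-2) be + (3 / 2 : rat) *: Lo (-1) (Lo (-1) be)).
  rewrite es /ga linearB [Lo _ (_ *: _)]linearZ /=; lin_combine rat H.
have hga : Lo 0 ga = 0.
  by rewrite /ga linearB [Lo _ (_ *: _)]linearZ /= hal L0_L hbe linearN /=
     -[RHS](scale0r (Lo (-1) be)); lin_combine rat H.
have hLb : Lo 0 (Lo (-1) be) = 0.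
  by rewrite L0_L hbe linearN /= -[RHS](scale0r (Lo (-1) be)); lin_combine rat H.
have h21 h : Lo 1 (Lo (-2) h) = Lo (-2) (Lo 1 h) + (3 : rat) *: Lo (-1) h by rewrite LL.
have h12 h : Lo 2 (Lo (-1) h) = Lo (-1) (Lo 2 h) + (3 : rat) *: Lo 1 h by rewrite LL.
have k1 : Lo 1 k = 0.
  apply: posK_Sp; first exact: posK_L.
  have -> : Lo 1 k = (-1 : rat) *: Lo 1 s.
    by apply/eqP; rewrite scaleN1r -addr_eq0 -linearD -e pn.
  apply: (GZ); rewrite es' [Lo 1 (_ + _)]linearD /= [Lo 1 (_ + _)]linearD /= [Lo 1 (_ *: _)]linearZ /= !LL1 h21 hLb hga !scaler0 !addr0.
  by repeat first [apply: Sp_add | apply: (GZ) | apply: (G1) | apply: (G2)].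
have L1h h : Lo 0 (Lo 1 h) = Lo 1 (Lo 0 h) - Lo 1 h by rewrite L0_L scale1r.
have k2 : Lo 2 k = 0.
  have -> : Lo 2 k = T k by rewrite /T k1 linear0 scaler0 addr0.
  apply: posK_Sp.
    by move=> i; rewrite /T k1 linear0 scaler0 addr0; apply: posK_L.
  have -> : T k = (-1 : rat) *: T s.
    apply/eqP; rewrite scaleN1r -addr_eq0; apply/eqP.
    transitivity (T p); last by rewrite /T !pn // linear0 scaler0 addr0.
    by rewrite e /T !linearD /=; lin_combine rat H.
  apply: (GZ).
  move: ga es' hga => {al hal es} ga es hga.
  pose x1 := Lo 1 ga + (3 : rat) *: be + (3 / 2 : rat) *: Lo 1 (Lo (-1) be).
  have eq1 : Lo 1 (Lo (-1) be) = Lo (-1) (Lo 1 be) - (2 : rat) *: be.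
    by rewrite LL1 hbe scalerN.
  have e1 : Lo 1 s = Lo (-1) x1 + Lo (-2) (Lo 1 be).
    rewrite es [Lo 1 (_ + _)]linearD /= [Lo 1 (_ + _)]linearD /= [Lo 1 (_ *: _)]linearZ /=.
    rewrite h21 [Lo 1 (Lo _ ga)]LL1 hga [Lo 1 (Lo _ (Lo _ be))]LL1 hLb /x1.
    rewrite [Lo (-1) (_ + _)]linearD /= [Lo (-1) (_ + _)]linearD /= ![Lo (-1) (_ *: _)]linearZ /=.
    by lin_combine rat H.
  have hx1 : Lo 0 x1 = - x1.
    rewrite /x1 [Lo 0 (_ + _)]linearD /= [Lo 0 (_ + _)]linearD /= ![Lo 0 (_ *: _)]linearZ /=.
    by rewrite !L1h hga hbe hLb !linear0; lin_combine rat H.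
  have e11 : Lo 1 (Lo 1 s) = Lo (-1) (Lo 1 x1) - (2 : rat) *: Lo 1 ga + Lo (-2) (Lo 1 (Lo 1 be)).
    rewrite e1 linearD /= LL1 hx1 h21 {2}/x1 eq1; lin_combine rat H.
  have e2 : Lo 2 s = Lo (-1) (Lo 2 ga) + (3 : rat) *: Lo 1 ga + Lo (-2) (Lo 2 be)
      + (3 / 2 : rat) *: Lo (-1) (Lo 2 (Lo (-1) be)) + (9 / 2 : rat) *: Lo (-1) (Lo 1 be).
    rewrite es [Lo 2 (_ + _)]linearD /= [Lo 2 (_ + _)]linearD /= [Lo 2 (_ *: _)]linearZ /=.
    by rewrite [Lo 2 (Lo _ ga)]h12 LL2 [Lo 2 (Lo _ (Lo _ be))]h12 eq1 hbe; lin_combine rat H.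
  have -> : T s = Lo (-1) (Lo 2 ga) + Lo (-2) (Lo 2 be)
      + (3 / 2 : rat) *: Lo (-1) (Lo 2 (Lo (-1) be)) + (9 / 2 : rat) *: Lo (-1) (Lo 1 be)
      + (3 / 2 : rat) *: (Lo (-1) (Lo 1 x1) + Lo (-2) (Lo 1 (Lo 1 be))).
    by rewrite /T e2 e11; lin_combine rat H.
  by repeat first [apply: Sp_add | apply: (GZ) | apply: (G1) | apply: (G2)].
(* L_1 and L_2 generate the rest: [L_(n+2), L_1] = (n+1) L_(n+3). *)
suff kn (n : nat) : Lo n.+1%:Z k = 0 by case=> [[|n]|n] // _; apply: kn.
elim/ltn_ind: n => -[|[|n]] // ih.
have h : (n.+1)%:R *: Lo n.+3%:Z k = 0.
  have := @LL n.+2%:Z 1 k; rewrite k1 ih // !linear0 add0r => /(_ isT) /esym.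
  have -> : n.+2%:Z - 1 = n.+1%:Z by lia.
  by have -> : n.+2%:Z + 1 = n.+3%:Z by lia.
by move/eqP: h; rewrite scaler_eq0 pnatr_eq0 => /eqP.
Qed.
End NoGhost.

(** * Fields built from a null vector *)

HB.lock Definition dpr (r : nat) (F : fock_model r) (a : 'rV[int]_r) : {linear F -> F} :=
  ext F (fun b m => (b == a)%:R *: vec F b m).
Arguments dpr {r F} a.

Lemma big_ord_trunc (R : nmodType) n i (G : nat -> R) : (0 < n)%N ->
  \sum_(j < i.+1) (if (n <= i - j)%N then G j else 0) = \sum_(j < i.+1 - n) G j.
Proof.
move=> n0; rewrite -(big_mkord xpredT (fun j => if (n <= i - j)%N then G j else 0)).
rewrite (big_cat_nat (n := (i.+1 - n)%N)) //=; last by lia.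
rewrite [X in _ + X]big_nat_cond [X in _ + X]big1 ?addr0 => [|j]; last by case: ifP => //; lia.
rewrite big_nat_cond -big_nat_cond big_mkord; apply: eq_bigr => j _.
by have := ltn_ord j; case: ifP => //; lia.
Qed.

Lemma big_ord_drop (R : nmodType) n i (G : nat -> R) :
  \sum_(j < i.+1) (if (n <= j)%N then G j else 0) = \sum_(j < i.+1 - n) G (j + n)%N.
Proof.
case: (leqP n i) => le; last first.
  have -> : (i.+1 - n = 0)%N by lia.
  by rewrite big_ord0 big1 // => j _; case: ifP => //; have := ltn_ord j; lia.
rewrite -(big_mkord xpredT (fun j => if (n <= j)%N then G j else 0)).
rewrite (big_cat_nat (n := n)) //=; last by lia.
rewrite big_nat_cond big1 ?add0r => [|j]; last by case: ifP => //; lia.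
by rewrite -{1}[n]add0n big_addn big_mkord; apply: eq_bigr => j _; rewrite leq_addl.
Qed.

Section DegreeProjection.
Variables (r : nat) (F : fock_model r) (A : 'M[int]_r) (a : 'rV[int]_r).
Implicit Types (b : 'rV[int]_r) (x y : F).

Lemma dpr_vec b m : dpr a (vec F b m) = (b == a)%:R *: vec F b m.
Proof. by rewrite dpr.unlock ext_vec. Qed.

Lemma dpr_expv : dpr a (expv F a) = expv F a.
Proof. by rewrite dpr_vec eqxx scale1r. Qed.

Lemma dprK y : dpr a (dpr a y) = dpr a y.
Proof.
elim/vec_ind: y => [|c b m y ih]; first by rewrite !linear0.
have -> : dpr a (c *: vec F b m + y) = c *: dpr a (vec F b m) + dpr a y by rewrite linearP.
rewrite linearP /= ih dpr_vec linearZ /= dpr_vec; congr (_ *: _ + _).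
by case: eqP => _; rewrite ?scale1r ?scale0r.
Qed.

Lemma dpr_mulv v y : dpr a (mulv v y) = mulv v (dpr a y).
Proof.
elim/vec_ind: y => [|c b m y ih]; first by rewrite !linear0.
by rewrite !linearP /= ih; congr (_ + _); rewrite mulv_vec !dpr_vec !linearZ /= mulv_vec.
Qed.

Lemma dpr_derv v y : dpr a (derv v y) = derv v (dpr a y).
Proof.
elim/vec_ind: y => [|c b m y ih]; first by rewrite !linear0.
rewrite !linearP /= ih; congr (_ + _).
by rewrite derv_vec dpr_vec !linearZ /= derv_vec dpr_vec !scalerA; congr (_ *: _); ring.
Qed.

Lemma dpr_hv b n y : dpr a (hv A b n y) = hv A b n (dpr a y).
Proof.
case: n => [[|n]|n].
- elim/vec_ind: y => [|c b' m y ih]; first by rewrite !linear0.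
  rewrite !linearP /= ih; congr (_ + _).
  by rewrite hv0_vec dpr_vec !linearZ /= dpr_vec hv0_vec !scalerA; congr (_ *: _); ring.
- by rewrite !hv_pos linear_sum; apply: eq_bigr => i _ /=; rewrite linearZ /= dpr_derv.
- by rewrite !hv_neg linear_sum; apply: eq_bigr => i _ /=; rewrite linearZ /= dpr_mulv.
Qed.

Lemma dpr_Lv n y : dpr a (Lv A n y) = Lv A n (dpr a y).
Proof.
have [W1 _ h1] := Lv_QL A y; have [W2 _ h2] := Lv_QL A (dpr a y).
pose M := (W1 + W2 + absz n)%N.
rewrite (h1 n M) ?(h2 n M); try by rewrite /M; lia.
rewrite /QL linear_sum; apply: eq_bigr => i _ /=; rewrite linear_sum; apply: eq_bigr => j _ /=.
rewrite linearZ /= linear_sum; congr (_ *: _); apply: eq_bigr => t _ /=.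
by rewrite /nordF; case: ifP => _; rewrite !dpr_hv.
Qed.

Lemma hv0_dpr b y : hv A b 0 (dpr a y) = (pairing A b a)%:~R *: dpr a y.
Proof.
elim/vec_ind: y => [|c b' m y ih]; first by rewrite !linear0.
have -> : dpr a (c *: vec F b' m + y) = c *: dpr a (vec F b' m) + dpr a y by rewrite linearP.
rewrite linearP /= ih scalerDr scalerC; congr (_ *: _ + _).
rewrite dpr_vec linearZ /= hv0_vec; case: eqP => [->|_]; rewrite ?scale0r ?scaler0 //.
by rewrite scalerC.
Qed.
End DegreeProjection.

(* Multiplications by the coefficients of power series in the oscillators of a *)
(* null vector w. [L_n, B_i] = (ka + i - n + la (n + 1)) B_(i-n) says that the  *)
(* series sum_i B_i z^i is a field of weight la, up to a shift by ka.           *)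
Section NullFields.
Variables (r : nat) (F : fock_model r) (A : 'M[int]_r).
Local Notation L := 'rV[int]_r.
Implicit Types (s y : F).
Hypotheses (A_sym : A^T = A) (A_det : \det A != 0).
Local Notation Zf := (zspan (@is_schv r F A)).

Section Integrality.
Variable c : int.

(** Integrality after inverting c, with a denominator uniform in the argument. *)
Definition Jop (B : F -> F) := exists N : nat, forall s, Zf s -> Zf ((c%:~R ^+ N : rat) *: B s).

Lemma intrXz (N : nat) : (c%:~R ^+ N : rat) = (c ^+ N)%:~R.
Proof. by rewrite rmorphXn. Qed.

Lemma Jop_widen B N N' : (N <= N')%N -> (forall s, Zf s -> Zf ((c%:~R ^+ N : rat) *: B s)) ->
  forall s, Zf s -> Zf ((c%:~R ^+ N' : rat) *: B s).
Proof.
move=> le h s hs; rewrite -(subnK le) exprD -scalerA intrXz; apply: zspanZ; exact: h.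
Qed.

Lemma Jop_add B C : Jop B -> Jop C -> Jop (fun s => B s + C s).
Proof.
move=> [N hB] [N' hC]; exists (N + N')%N => s hs; rewrite scalerDr; apply: zspanD.
  by apply: Jop_widen hB s hs; rewrite leq_addr.
by apply: Jop_widen hC s hs; rewrite leq_addl.
Qed.
Lemma Jop_comp (B : {linear F -> F}) C : Jop B -> Jop C -> Jop (fun s => B (C s)).
Proof.
move=> [N hB] [N' hC]; exists (N + N')%N => s hs.
have -> : (c%:~R ^+ (N + N') : rat) *: B (C s) = (c%:~R ^+ N : rat) *: B ((c%:~R ^+ N' : rat) *: C s).
  by rewrite [B (_ *: _)]linearZ /= scalerA exprD.
exact/hB/hC.
Qed.
Lemma Jop_int (n : int) B : Jop B -> Jop (fun s => n%:~R *: B s).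
Proof. by move=> [N hB]; exists N => s hs; rewrite scalerC; apply/zspanZ/hB. Qed.
Lemma Jop_opp B : Jop B -> Jop (fun s => - B s).
Proof. by move=> [N hB]; exists N => s hs; rewrite scalerN; apply/zspanN/hB. Qed.
Lemma Jop_0 : Jop (fun=> 0).
Proof. by exists 0%N => s _; rewrite scaler0; apply: zspan_0. Qed.
Lemma Jop_id : Jop id.
Proof. by exists 0%N => s hs; rewrite scale1r. Qed.
Lemma Jop_ext B C : B =1 C -> Jop B -> Jop C.
Proof. by move=> /funext ->. Qed.
Lemma Jop_sum n (B : 'I_n -> F -> F) : (forall i, Jop (B i)) -> Jop (fun s => \sum_i B i s).
Proof.
elim: n B => [|n ih] B h; first by apply: Jop_ext Jop_0 => s; rewrite big_ord0.
apply: (@Jop_ext (fun s => \sum_(i < n) B (widen_ord (leqnSn n) i) s + B ord_max s)).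
  by move=> s; rewrite big_ord_recr.
by apply: Jop_add => //; apply: ih.
Qed.
Lemma Jop_div B : c != 0 -> Jop (fun s => c%:~R *: B s) -> Jop B.
Proof. by move=> c0 [N hB]; exists N.+1 => s hs; rewrite exprSr -scalerA; apply: hB. Qed.
Lemma Jop_divl B : c != 0 -> Jop B -> Jop (fun s => c%:~R^-1 *: B s).
Proof.
move=> c0 hB; apply: Jop_div => //; apply: Jop_ext hB => s.
by rewrite scalerA divff ?scale1r // intr_eq0.
Qed.

Variable w : L.

Lemma Jop_Sop k : Jop (Sop F A w k).
Proof. by exists 0%N => s hs; rewrite scale1r; apply: zspan_Sop. Qed.

(** Newton's identities: the oscillators are integral polynomials in the Schur polynomials. *)
Lemma Jop_cre j : Jop (cre F A w j).
Proof.
elim/ltn_ind: j => j ih.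
pose R s := \sum_(i < j) cre F A w i (Sop F A w (j - i) s).
apply: (@Jop_ext (fun s => j.+1%:~R *: Sop F A w j.+1 s + - R s)) => [s|].
  rewrite -pmulrn /Sop schSM big_ord_recr /= subnn sch0 /R /Sop.
  by move: (\sum_(_ < j) _) => X; lin_combine rat (fock_space F).
apply: Jop_add; first exact/Jop_int/Jop_Sop.
apply/Jop_opp/Jop_sum => i; apply: Jop_comp; last exact: Jop_Sop.
exact: ih.
Qed.

Definition Sser (t : rat) (j : nat) (y : F) : F := t *: cre F A w j y.
Fact Sser_linear t j : linear (Sser t j).
Proof. by move=> k x y; rewrite /Sser linearP scalerDr scalerC. Qed.
HB.instance Definition _ t j := GRing.isLinear.Build rat F F _ (Sser t j) (Sser_linear t j).

(** The coefficient of z^i in the t-th power of the Schur series of w, for rational t. *)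
Definition Sfr t i (y : F) : F := sch (Sser t) i y.
HB.instance Definition _ t i := GRing.isLinear.Build rat F F _ (Sfr t i) (sch_linear (Sser t) i).

Lemma SfrSM t k y : k.+1%:R *: Sfr t k.+1 y = \sum_(j < k.+1) Sser t j (Sfr t (k - j) y).
Proof. exact: schSM. Qed.

Lemma SfrM t d y : d%:R *: Sfr t d y = \sum_(j < d) Sser t j (Sfr t (d - j.+1) y).
Proof. by case: d => [|d]; [rewrite scale0r big_ord0 | rewrite SfrSM]. Qed.

Lemma Sser_cre t j y : Sser t j y = t *: cre F A w j y. Proof. by []. Qed.

Lemma SserC t t' j k y : Sser t j (Sser t' k y) = Sser t' k (Sser t j y).
Proof. by rewrite !Sser_cre !linearZ /= scalerC /cre hv_negC. Qed.

Lemma Sfr1 i y : Sfr 1 i y = Sop F A w i y.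
Proof.
apply: (sch_intertwine (X := Sser 1) (Y := cre F A w) (T := idfun)) => j z.
by rewrite /= Sser_cre scale1r.
Qed.

Lemma Sfr0 t y : Sfr t 0 y = y. Proof. by []. Qed.

Lemma SfrC t t' j k y : Sfr t j (Sfr t' k y) = Sfr t' k (Sfr t j y).
Proof. by apply: schC => i l z; apply: SserC. Qed.

(** One half of the product rule for S(t) S(t'): the part in which the second factor is
    differentiated. *)
Lemma Sfr_half t t' i y :
  \sum_(l < i.+1) Sfr t l ((i - l).+1%:R *: Sfr t' (i - l).+1 y)
  = \sum_(j < i.+1) Sser t' j (\sum_(l < (i - j).+1) Sfr t l (Sfr t' (i - j - l) y)).
Proof.
under eq_bigr => l _ do rewrite SfrSM linear_sum.
under [RHS]eq_bigr => j _ do rewrite linear_sum.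
rewrite (big_ord_triangle i (fun l k => Sfr t l (Sser t' k (Sfr t' (i - l - k) y)))).
apply: eq_bigr => j _; apply: eq_bigr => l _ /=.
rewrite [(i - l - j)%N]subnAC; apply/esym/(sch_comm (X := Sser t) (T := Sser t' j)) => k z.
exact: SserC.
Qed.

Lemma Sfr_add t t' i y : Sfr (t + t') i y = \sum_(l < i.+1) Sfr t l (Sfr t' (i - l) y).
Proof.
pose E i := \sum_(l < i.+1) Sfr t l (Sfr t' (i - l) y).
have e0 : y = E 0%N by rewrite /E big_ord1.
rewrite {1}e0 -/(E i); apply: esym.
apply: (sch_uniq (X := Sser (t + t')) (E := E)) => {}i.
have h1 : \sum_(l < i.+1) Sfr t l ((i - l).+1%:R *: Sfr t' (i - l).+1 y)
    = \sum_(l < i.+2) (i.+1 - l)%:R *: Sfr t l (Sfr t' (i.+1 - l) y).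
  rewrite [RHS]big_ord_recr /= subnn scale0r addr0; apply: eq_bigr => l _.
  by rewrite linearZ /= subSn // -ltnS.
have h2 : \sum_(l < i.+1) Sfr t' l ((i - l).+1%:R *: Sfr t (i - l).+1 y)
    = \sum_(l < i.+2) l%:R *: Sfr t l (Sfr t' (i.+1 - l) y).
  rewrite [RHS](reindex_inj rev_ord_inj) /= [RHS]big_ord_recr /= subnn scale0r addr0.
  apply: eq_bigr => l _; rewrite linearZ /= SfrC subSS subSn -1?ltnS //; congr (_ *: Sfr _ _ (Sfr _ _ _)).
  by have := ltn_ord l; lia.
transitivity (\sum_(l < i.+2) l%:R *: Sfr t l (Sfr t' (i.+1 - l) y) +
   \sum_(l < i.+2) (i.+1 - l)%:R *: Sfr t l (Sfr t' (i.+1 - l) y)).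
  rewrite -big_split scaler_sumr; apply: eq_bigr => l _ /=.
  by rewrite -scalerDl -natrD subnKC // -ltnS.
rewrite -h1 -h2 !Sfr_half -big_split; apply: eq_bigr => j _ /=.
rewrite !Sser_cre scalerDl; congr (_ *: cre F A w j _ + _).
rewrite /E (reindex_inj rev_ord_inj) /=; apply: eq_bigr => l _.
rewrite SfrC subSS; congr (Sfr _ _ (Sfr _ _ _)); by have := ltn_ord l; lia.
Qed.

Hypothesis c0 : c != 0.

(* S(k/d) = S(1/d)^k, so k S_i(1/d) is S_i(k/d) up to products of the S_l(1/d) *)
(* with l < i; for k = d this bounds the denominators of S_i(1/d).             *)
Lemma Jop_Sfr_root (d : nat) i : (d%:R : rat) = c%:~R \/ (d%:R : rat) = - c%:~R ->
  forall k, Jop (Sfr (k%:R / d%:R) i).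
Proof.
move=> hd; have d0 : (d%:R : rat) != 0 by case: hd => ->; rewrite ?oppr_eq0 intr_eq0.
elim/ltn_ind: i => i ih.
have [->|i0] := posnP i; first by move=> k; exact: Jop_id.
have step k : Jop (fun y => Sfr (k%:R / d%:R) i y - k%:R *: Sfr (d%:R^-1) i y).
  elim: k => [|k ihk].
    apply: Jop_ext Jop_0 => y; rewrite scale0r subr0 mul0r.
    case: i i0 {ih} => // i _; apply: (@scalerI _ _ i.+1%:R); rewrite ?pnatr_eq0 //.
    rewrite scaler0 SfrSM big1 // => j _; exact: scale0r.
  apply: (@Jop_ext (fun y => (Sfr (k%:R / d%:R) i y - k%:R *: Sfr (d%:R^-1) i y) +
      \sum_(l < i.-1) Sfr (k%:R / d%:R) l.+1 (Sfr (d%:R^-1) (i - l.+1) y))) => [y|].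
    have -> : k.+1%:R / d%:R = k%:R / d%:R + d%:R^-1 :> rat by rewrite -natr1; field.
    rewrite Sfr_add; case: i i0 {ih ihk} => // i _.
    rewrite big_ord_recr big_ord_recl /= subnn Sfr0 Sfr0 subn0 -natr1.
    by move: (\sum_(_ < i) _) => X; lin_combine rat (fock_space F).
  apply: Jop_add => //; apply: Jop_sum => l; have := ltn_ord l => lt.
  apply: Jop_comp; first by apply: ih; lia.
  rewrite -[d%:R^-1]mul1r -[1]/(1%:R); apply: ih; lia.
have h1 : Jop (Sfr (d%:R^-1) i).
  have hds : Jop (fun y => d%:R *: Sfr (d%:R^-1) i y).
    apply: (@Jop_ext (fun y => Sfr (d%:R / d%:R) i y - (Sfr (d%:R / d%:R) i y - d%:R *: Sfr (d%:R^-1) i y))).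
      by move=> y; lin_combine rat (fock_space F).
    apply: Jop_add; last exact/Jop_opp/step.
    by rewrite divff //; apply: Jop_ext (Jop_Sop i) => y; rewrite Sfr1.
  apply: Jop_div => //; case: hd => hd; rewrite hd in hds *; first exact: hds.
  apply: (@Jop_ext (fun y => - (- c%:~R *: Sfr (- c%:~R)^-1 i y))); last exact: Jop_opp.
  by move=> y; rewrite scaleNr opprK.
move=> k; apply: (@Jop_ext (fun y => (Sfr (k%:R / d%:R) i y - k%:R *: Sfr (d%:R^-1) i y)
   + k%:~R *: Sfr (d%:R^-1) i y)); first by move=> y; rewrite -pmulrn; lin_combine rat (fock_space F).
by apply: Jop_add => //; apply: Jop_int.
Qed.

Lemma Jop_iser i : Jop (iser (Sser c%:~R^-1) i).
Proof.
elim/ltn_ind: i => -[|i] ih; first exact: Jop_id.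
apply: (@Jop_ext (fun y => - \sum_(j < i.+1) c%:~R^-1 *: cre F A w j (iser (Sser c%:~R^-1) (i - j) y))).
  by move=> y; rewrite iserS.
apply/Jop_opp/Jop_sum => j; apply: Jop_divl => //; apply: Jop_comp; first exact: Jop_cre.
by apply: ih; rewrite ltnS leq_subr.
Qed.
End Integrality.

Lemma Sfr_opp w t i y : Sfr (- w) t i y = Sfr w (- t) i y.
Proof.
apply: (sch_intertwine (X := Sser (- w) t) (Y := Sser w (- t)) (T := idfun)) => j z.
by rewrite /= !Sser_cre /cre hvNb scalerN scaleNr.
Qed.

Lemma Jop_Sfr (c : int) w (k : int) i : c != 0 -> Jop c (Sfr w (k%:~R / c%:~R) i).
Proof.
move=> c0.
have h v n : Jop c (Sfr v (n%:R / (absz c)%:R) i).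
  apply: Jop_Sfr_root => //; case: (c) => m /=; first by left; rewrite pmulrn.
  by right; rewrite NegzE rmorphN opprK pmulrn.
have a0 : ((absz c)%:R : rat) != 0 by rewrite pnatr_eq0 absz_eq0.
have [s hs] : exists s : bool, (k%:~R / c%:~R : rat) = (-1) ^+ s * ((absz k)%:R / (absz c)%:R).
  have e1 (z : int) : exists s : bool, (z%:~R : rat) = (-1) ^+ s * (absz z)%:R.
    case: z => z; first by exists false; rewrite mul1r pmulrn.
    by exists true; rewrite mulN1r NegzE rmorphN /= pmulrn.
  have [s1 e] := e1 k; have [s2 e'] := e1 c; exists (s1 (+) s2).
  rewrite e e' signr_addb.
  by case: (s1); case: (s2); rewrite ?expr0 ?expr1; field.
rewrite hs; case: s {hs}; last by rewrite mul1r; apply: h.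
rewrite mulN1r; apply: Jop_ext (h (- w) (absz k)) => y; exact: Sfr_opp.
Qed.

Variables (a w : L) (c : int).
Hypotheses (w_null : pairing A w w = 0) (w_a : pairing A w a = c) (c0 : c != 0).

Definition K2 s := (forall k : nat, hv A w k.+1%:Z s = 0) /\ dpr a s = s.

Lemma hv_nullC k l y : hv A w k (hv A w l y) = hv A w l (hv A w k y).
Proof. by rewrite hvC // w_null mulr0 /=; case: ifP; rewrite scale0r addr0. Qed.

Lemma K2_hv s : K2 s -> forall k : int, 0 <= k -> hv A w k s = (if k == 0 then c%:~R else 0) *: s.
Proof.
move=> [hp ha] [[|k]|] //= _; first by rewrite -{1 2}ha hv0_dpr w_a ha.
by rewrite hp scale0r.
Qed.

Record field (ka la : int) (B : nat -> {linear F -> F}) : Prop := Field {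
  field_hv : forall i k s, hv A w k (B i s) = B i (hv A w k s);
  field_dpr : forall i s, dpr a (B i s) = B i (dpr a s);
  field_L : forall i (n : nat) s, K2 s -> (0 < n)%N -> Lv A n%:Z (B i s) = B i (Lv A n%:Z s)
     + (if (n <= i)%N then (ka + i%:Z - n%:Z + la * n.+1%:Z)%:~R *: B (i - n)%N s else 0);
  field_L0 : forall i s, Lv A 0 (B i s) = B i (Lv A 0 s) + i%:R *: B i s;
  field_0 : forall s, B 0%N s = s;
  field_coef : forall i s, coef a (onecm _) (B i.+1 s) = 0;
  field_J : forall i, Jop c (B i) }.

Lemma field_K2 ka la B i s : field ka la B -> K2 s -> K2 (B i s).
Proof.
move=> hB [hp ha]; split=> [k|]; first by rewrite (field_hv hB) hp linear0.
by rewrite (field_dpr hB) ha.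
Qed.

Lemma L_cre n j s : Lv A n (cre F A w j s) = cre F A w j (Lv A n s) + j.+1%:R *: hv A w (n - j.+1%:Z) s.
Proof.
have e : cre F A w j = hv A w (- j.+1%:Z) by [].
by rewrite e Lv_hv // -scaleNr -rmorphN opprK.
Qed.

(* common part of field_L for the two recursively defined series               *)
Lemma L_Sser_sum0 n i (G : nat -> F) : (0 < n)%N -> (forall j, K2 (G j)) ->
  \sum_(j < i) j.+1%:R *: hv A w (n%:Z - j.+1%:Z) (G (i - j.+1)%N)
  = (if (n <= i)%N then (n%:R * c%:~R) *: G (i - n)%N else 0)
    + \sum_(j < i - n) (j + n).+1%:R *: cre F A w j (G (i - n - j.+1)%N).
Proof.
move=> n0 hG.
have [le|lt] := leqP n i; last first.
  rewrite (_ : (i - n = 0)%N) ?big_ord0 ?addr0; last by lia.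
  apply: big1 => j _; rewrite K2_hv //; last by have := ltn_ord j; lia.
  by rewrite ifF ?scale0r ?scaler0 //; have := ltn_ord j; lia.
rewrite -(big_mkord xpredT (fun j => j.+1%:R *: hv A w (n%:Z - j.+1%:Z) (G (i - j.+1)%N))).
rewrite (big_cat_nat (n := n)) //=; congr (_ + _).
  case: n n0 le => // n _ le; rewrite big_nat_recr //= subrr big_nat_cond big1 ?add0r.
    by rewrite K2_hv // eqxx scalerA.
  move=> j /andP[lt _]; rewrite K2_hv //; last by lia.
  by rewrite ifF ?scale0r ?scaler0 //; lia.
rewrite -{1}[n]add0n big_addn big_mkord; apply: eq_bigr => j _.
have -> : n%:Z - (j + n).+1%:Z = Negz j by lia.
by congr (_ *: cre F A w j (G _)); lia.
Qed.

Lemma L_Sser_sum n i (G : nat -> F) : (0 < n)%N -> (forall j, K2 (G j)) ->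
  \sum_(j < i.+1) j.+1%:R *: hv A w (n%:Z - j.+1%:Z) (G (i - j)%N)
  = (if (n <= i.+1)%N then (n%:R * c%:~R) *: G (i.+1 - n)%N else 0)
    + \sum_(j < i.+1 - n) (j + n).+1%:R *: cre F A w j (G (i.+1 - n - j.+1)%N).
Proof. exact: L_Sser_sum0. Qed.

Lemma Sfr_hv t i k s : hv A w k (Sfr w t i s) = Sfr w t i (hv A w k s).
Proof.
by apply: (sch_comm (X := Sser w t) (T := hv A w k)) => j y; rewrite /= !Sser_cre linearZ /= /cre hv_nullC.
Qed.
Lemma Sfr_dpr t i s : dpr a (Sfr w t i s) = Sfr w t i (dpr a s).
Proof.
by apply: (sch_comm (X := Sser w t) (T := dpr a)) => j y; rewrite /= !Sser_cre linearZ /= /cre dpr_hv.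
Qed.
Lemma iser_hv t i k s : hv A w k (iser (Sser w t) i s) = iser (Sser w t) i (hv A w k s).
Proof.
by apply: iser_intertwine => j y; rewrite /= !Sser_cre linearZ /= /cre hv_nullC.
Qed.
Lemma iser_dpr t i s : dpr a (iser (Sser w t) i s) = iser (Sser w t) i (dpr a s).
Proof.
by apply: iser_intertwine => j y; rewrite /= !Sser_cre linearZ /= /cre dpr_hv.
Qed.

Lemma coef1_Sser t j s : coef a (onecm _) (Sser w t j s) = 0.
Proof. by rewrite Sser_cre linearZ /= coef1_cre scaler0. Qed.

(** Put x(z) = z exp(sum_j w(-j) z^j / (c j)). Under the L_n this transforms like a coordinate,
    because w(0) acts as c. The series here is (x(z) / z)^k, of weight 0 up to the shift k. *)
Lemma field_S (k : int) : field k 0 (Sfr w (k%:~R / c%:~R)).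
Proof.
set t := k%:~R / c%:~R; have c0' : (c%:~R : rat) != 0 by rewrite intr_eq0.
split=> [i n s|i s|i n s hs n0|i s|s|i s|i].
- exact: Sfr_hv.
- exact: Sfr_dpr.
- rewrite mul0r addr0; elim/ltn_ind: i => i ih.
  case: i ih => [|i] ih; first by rewrite leqn0 (gtn_eqF n0) addr0.
  have hK j : K2 (Sfr w t j s).
    by case: hs => hp ha; split=> [l|]; [rewrite Sfr_hv hp linear0 | rewrite Sfr_dpr ha].
  apply: (@scalerI _ _ i.+1%:R); rewrite ?pnatr_eq0 // -linearZ SfrSM linear_sum /=.
  have e j : Lv A n%:Z (Sser w t j (Sfr w t (i - j) s)) =
     Sser w t j (Lv A n%:Z (Sfr w t (i - j) s)) + t *: (j.+1%:R *: hv A w (n%:Z - j.+1%:Z) (Sfr w t (i - j) s)).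
    by rewrite !Sser_cre [Lv _ _ (_ *: _)]linearZ /= L_cre scalerDr.
  under eq_bigr => j _ do rewrite e ih ?ltnS ?leq_subr // linearD.
  rewrite !big_split /= -SfrSM [in RHS]scalerDr -addrA; congr (_ + _).
  have := congr1 (fun z => t *: z) (@L_Sser_sum n i (fun j => Sfr w t j s) n0 hK).
  rewrite /= scaler_sumr => ->.
  rewrite (eq_bigr (fun j : 'I_i.+1 => if (n <= i - j)%N then
      (k + (i - j)%N%:Z - n%:Z)%:~R *: Sser w t j (Sfr w t (i - j - n) s) else 0)); last first.
    by move=> j _; case: ifP => _; rewrite ?linear0 // linearZ.
  rewrite (big_ord_trunc i (fun j => (k + (i - j)%N%:Z - n%:Z)%:~R *: Sser w t j (Sfr w t (i - j - n) s)) n0).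
  case: leqP => le; last first.
    by rewrite (_ : (i.+1 - n = 0)%N) ?big_ord0 ?addr0 ?scaler0 ?addr0 //; lia.
  set d := (i.+1 - n)%N.
  rewrite scalerDr addrCA scaler_sumr -big_split /=.
  have -> : \sum_(j < d) ((k + (i - j)%N%:Z - n%:Z)%:~R *: Sser w t j (Sfr w t (i - j - n) s) +
      t *: ((j + n).+1%:R *: cre F A w j (Sfr w t (d - j.+1) s))) = (k + i.+1%:Z)%:~R *: (d%:R *: Sfr w t d s).
    rewrite SfrM scaler_sumr; apply: eq_bigr => j _; have lt := ltn_ord j.
    have -> : (i - j - n)%N = (d - j.+1)%N by lia.
    have -> : (k + (i - j)%N%:Z - n%:Z)%:~R = (k + i.+1%:Z)%:~R - (j + n).+1%:R :> rat.
      by rewrite (pmulrn _ (j + n).+1) -rmorphB /=; congr (_%:~R); lia.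
    by rewrite !Sser_cre; lin_combine rat (fock_space F).
  have -> : k + i.+1%:Z - n%:Z = k + d%:Z by lia.
  have -> : (i.+1%:R : rat) = d%:R + n%:R by rewrite -natrD; congr (_%:R); lia.
  have -> : k + i.+1%:Z = k + d%:Z + n%:Z by lia.
  rewrite !rmorphD /= -!pmulrn /t; lin_combine rat (fock_space F).
- elim/ltn_ind: i => -[|i] ih; first by rewrite scale0r addr0.
  apply: (@scalerI _ _ i.+1%:R); rewrite ?pnatr_eq0 // -linearZ SfrSM linear_sum /=.
  rewrite scalerDr !SfrSM scaler_sumr -big_split /=.
  apply: eq_bigr => j _; rewrite !Sser_cre [Lv _ _ (_ *: _)]linearZ /= L_cre ih ?ltnS ?leq_subr //.
  rewrite [cre _ _ _ _ (_ + _)]linearD /= [cre _ _ _ _ (_ *: _)]linearZ /= sub0r.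
  rewrite -[hv A w (- j.+1%:Z) _]/(cre F A w j _).
  have -> : (i.+1%:R : rat) = (i - j)%:R + j.+1%:R by rewrite -natrD; congr (_%:R); have := ltn_ord j; lia.
  by lin_combine rat (fock_space F).
- by [].
- rewrite /= /Sfr schS linearZ /= linear_sum big1 ?scaler0 // => j _; exact: coef1_Sser.
- exact: Jop_Sfr.
Qed.

(** With x(z) as for [field_S], z times this series is x / (dx/dz), the inverse of the logarithmic
    derivative of the coordinate x, hence of weight -1. *)
Lemma field_inv : field 1 (-1) (iser (Sser w c%:~R^-1)).
Proof.
set t := c%:~R^-1; have c0' : (c%:~R : rat) != 0 by rewrite intr_eq0.
split=> [i n s|i s|i n s hs n0|i s|s|i s|i].
- exact: iser_hv.
- exact: iser_dpr.
- elim/ltn_ind: i => i ih.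
  case: i ih => [|i] ih; first by rewrite leqn0 (gtn_eqF n0) addr0.
  have hK j : K2 (iser (Sser w t) j s).
    by case: hs => hp ha; split=> [l|]; [rewrite iser_hv hp linear0 | rewrite iser_dpr ha].
  rewrite /= !iserS linearN linear_sum /=.
  have e j : Lv A n%:Z (Sser w t j (iser (Sser w t) (i - j) s)) =
     Sser w t j (Lv A n%:Z (iser (Sser w t) (i - j) s)) + t *: (j.+1%:R *: hv A w (n%:Z - j.+1%:Z) (iser (Sser w t) (i - j) s)).
    by rewrite !Sser_cre [Lv _ _ (_ *: _)]linearZ /= L_cre scalerDr.
  under eq_bigr => j _ do rewrite e ih ?ltnS ?leq_subr // linearD.
  rewrite !big_split /= -addrA opprD; congr (_ + _).
  have := congr1 (fun z => t *: z) (@L_Sser_sum n i (fun j => iser (Sser w t) j s) n0 hK).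
  rewrite /= scaler_sumr => ->.
  rewrite (eq_bigr (fun j : 'I_i.+1 => if (n <= i - j)%N then
      (1 + (i - j)%N%:Z - n%:Z - 1 * n.+1%:Z)%:~R *: Sser w t j (iser (Sser w t) (i - j - n) s) else 0)); last first.
    by move=> j _; case: ifP => _; rewrite ?linear0 // linearZ mulN1r mul1r.
  rewrite (big_ord_trunc i (fun j => (1 + (i - j)%N%:Z - n%:Z - 1 * n.+1%:Z)%:~R *: Sser w t j (iser (Sser w t) (i - j - n) s)) n0).
  case: leqP => le; last first.
    by rewrite (_ : (i.+1 - n = 0)%N) ?big_ord0 ?addr0 ?scaler0 ?addr0 ?oppr0 //; lia.
  set d := (i.+1 - n)%N.
  rewrite scalerDr addrCA scaler_sumr -big_split /=.
  have -> : \sum_(j < d) ((1 + (i - j)%N%:Z - n%:Z - 1 * n.+1%:Z)%:~R *: Sser w t j (iser (Sser w t) (i - j - n) s) +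
      t *: ((j + n).+1%:R *: cre F A w j (iser (Sser w t) (d - j.+1) s))) = (i.+1%:Z - n%:Z)%:~R *: (- (d != 0)%N%:R *: iser (Sser w t) d s).
    have -> : - (d != 0)%N%:R *: iser (Sser w t) d s = \sum_(j < d) Sser w t j (iser (Sser w t) (d - j.+1) s).
      by case: (d) => [|d']; rewrite ?oppr0 ?scale0r ?big_ord0 // iserS scaleN1r opprK.
    rewrite scaler_sumr; apply: eq_bigr => j _; have lt := ltn_ord j.
    have -> : (i - j - n)%N = (d - j.+1)%N by lia.
    have -> : (1 + (i - j)%N%:Z - n%:Z - 1 * n.+1%:Z)%:~R = (i.+1%:Z - n%:Z)%:~R - (j + n).+1%:R :> rat.
      by rewrite (pmulrn _ (j + n).+1) -rmorphB /=; congr (_%:~R); lia.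
    by rewrite !Sser_cre; lin_combine rat (fock_space F).
  have -> : 1 + i.+1%:Z - n%:Z + -1 * n.+1%:Z = d%:Z - n%:Z by lia.
  have -> : i.+1%:Z - n%:Z = d%:Z by lia.
  have ed : (d%:~R : rat) * (d != 0)%N%:R = d%:R by case: (d) => [|d']; rewrite ?mulr0 ?mulr1 // pmulrn.
  have -> : d%:~R *: (- (d != 0)%N%:R *: iser (Sser w t) d s) = - (d%:R *: iser (Sser w t) d s).
    by rewrite scalerA mulrN ed scaleNr.
  rewrite !rmorphB /= -!pmulrn /t; lin_combine rat (fock_space F).
- elim/ltn_ind: i => -[|i] ih; first by rewrite scale0r addr0.
  rewrite /= !iserS linearN linear_sum scalerN scaler_sumr -opprD -big_split /=; congr (- _).
  apply: eq_bigr => j _; rewrite !Sser_cre [Lv _ _ (_ *: _)]linearZ /= L_cre ih ?ltnS ?leq_subr //.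
  rewrite [cre _ _ _ _ (_ + _)]linearD /= [cre _ _ _ _ (_ *: _)]linearZ /= sub0r.
  rewrite -[hv A w (- j.+1%:Z) _]/(cre F A w j _).
  have -> : (i.+1%:R : rat) = (i - j)%:R + j.+1%:R by rewrite -natrD; congr (_%:R); have := ltn_ord j; lia.
  by lin_combine rat (fock_space F).
- by [].
- rewrite /= iserS linearN linear_sum big1 ?oppr0 // => j _; exact: coef1_Sser.
- exact: Jop_iser.
Qed.

Definition fprod (B C : nat -> {linear F -> F}) i s : F := \sum_(l < i.+1) B l (C (i - l)%N s).
Fact fprod_linear B C i : linear (fprod B C i).
Proof.
move=> k x y; rewrite /fprod scaler_sumr -big_split; apply: eq_bigr => l _ /=.
by rewrite !linearP.
Qed.
HB.instance Definition _ B C i := GRing.isLinear.Build rat F F _ (fprod B C i) (fprod_linear B C i).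

Lemma field_prod ka la ka' la' B C : field ka la B -> field ka' la' C ->
  field (ka + ka') (la + la') (fprod B C).
Proof.
move=> hB hC; split=> [i n s|i s|i n s hs n0|i s|s|i s|i].
- rewrite linear_sum; apply: eq_bigr => l _ /=.
  by rewrite (field_hv hB) (field_hv hC).
- rewrite linear_sum; apply: eq_bigr => l _ /=.
  by rewrite (field_dpr hB) (field_dpr hC).
- rewrite /fprod linear_sum /=.
  rewrite (eq_bigr (fun l : 'I_i.+1 => B l (C (i - l)%N (Lv A n s)) +
     ((if (n <= i - l)%N then (ka' + (i - l)%N%:Z - n%:Z + la' * n.+1%:Z)%:~R *: B l (C (i - l - n)%N s) else 0)
     + (if (n <= l)%N then (ka + l%:Z - n%:Z + la * n.+1%:Z)%:~R *: B (l - n)%N (C (i - l)%N s) else 0)))).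
    rewrite big_split; congr (_ + _); rewrite big_split /=.
    rewrite (big_ord_trunc i (fun l => (ka' + (i - l)%N%:Z - n%:Z + la' * n.+1%:Z)%:~R *: B l (C (i - l - n)%N s)) n0).
    rewrite (big_ord_drop n i (fun l => (ka + l%:Z - n%:Z + la * n.+1%:Z)%:~R *: B (l - n)%N (C (i - l)%N s))).
    case: leqP => le; last first.
      by rewrite (_ : (i.+1 - n = 0)%N) ?big_ord0 ?addr0 //; lia.
    rewrite -big_split (_ : (i.+1 - n)%N = (i - n).+1)%N; last by lia.
    rewrite scaler_sumr; apply: eq_bigr => l _; have lt := ltn_ord l.
    rewrite addnK; have -> : (i - l - n = i - n - l)%N by lia.
    have -> : (i - (l + n) = i - n - l)%N by lia.
    by rewrite /= -scalerDl -rmorphD /=; congr (_%:~R *: _); nia.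
  move=> l _; rewrite (field_L hB _ (field_K2 _ hC hs) n0) (field_L hC _ hs n0) linearD -addrA; congr (_ + (_ + _)).
  by case: ifP => _; rewrite ?linear0 // linearZ.
- rewrite /fprod linear_sum scaler_sumr -big_split; apply: eq_bigr => l _ /=.
  rewrite (field_L0 hB) (field_L0 hC) linearD [B _ (_ *: _)]linearZ /=.
  have -> : (i%:R : rat) = (i - l)%:R + l%:R by rewrite -natrD subnK // -ltnS.
  by lin_combine rat (fock_space F).
- by rewrite /= /fprod big_ord1 (field_0 hB) (field_0 hC).
- rewrite /= /fprod linear_sum big1 // => l _; case: l => -[|l] lt /=.
    by rewrite (field_0 hB) (field_coef hC).
  by rewrite (field_coef hB).
- by apply: Jop_sum => l; apply: Jop_comp; [apply: (field_J hB) | apply: (field_J hC)].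
Qed.

Definition fone (i : nat) (s : F) : F := (i == 0%N)%:R *: s.
Fact fone_linear i : linear (fone i).
Proof. by move=> k x y; rewrite /fone scalerDr scalerC. Qed.
HB.instance Definition _ i := GRing.isLinear.Build rat F F _ (fone i) (fone_linear i).

Lemma field_one : field 0 0 fone.
Proof.
split=> [i n s|i s|i n s hs n0|i s|s|i s|i]; rewrite /= /fone.
- by rewrite linearZ.
- by rewrite linearZ.
- rewrite [Lv _ _ (_ *: _)]linearZ /= mul0r addr0 add0r; case: leqP => le; last by rewrite addr0.
  case: (eqVneq (i - n)%N 0%N) => e; last by rewrite scale0r scaler0 addr0.
  by rewrite (_ : i%:Z - n%:Z = 0) ?scale0r ?addr0 //; lia.
- by rewrite [Lv _ _ (_ *: _)]linearZ /=; case: i => [|i]; rewrite ?scale0r ?scaler0 ?addr0.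
- by rewrite scale1r.
- by rewrite scale0r linear0.
- case: i => [|i]; first by apply: Jop_ext (Jop_id c) => s; rewrite scale1r.
  by apply: Jop_ext (Jop_0 c) => s; rewrite scale0r.
Qed.

Lemma field_pow h : field h%:Z (- h%:Z)
  (iter h (fun C i => fprod (iser (Sser w c%:~R^-1)) C i : {linear F -> F}) fone).
Proof.
elim: h => [|h ih]; first exact: field_one.
have := field_prod field_inv ih.
by rewrite (_ : -1 - h%:Z = - h.+1%:Z) //; lia.
Qed.

(** A power of the weight -1 series provides the weight, and a series of weight 0 then adjusts the
    shift. *)
Lemma field_exists (k : int) (h : nat) :
  exists B, field k (- h%:Z) B.
Proof.
have := field_prod (field_S (k - h%:Z)) (field_pow h); set B := fprod _ _.
by rewrite subrK add0r; exists B.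
Qed.
End NullFields.

(** * Lattice vertex algebras *)

Section VertexAlgebraIdentities.
Variables (R : comNzRingType) (V : lmodType R) (one : V) (Y : int -> V -> V -> V).
Hypothesis YP : is_vertex_algebra one Y.

Lemma Ylin n u : linear (Y n u).
Proof. by case: YP => h _ _ _ _; case: (h n). Qed.
Lemma Ylinl n w : linear (fun u => Y n u w).
Proof. by case: YP => h _ _ _ _; case: (h n) => + _ k x y => /(_ w k x y). Qed.

Lemma Y0r n u : Y n u 0 = 0.
Proof. by have := Ylin n u 1 0 0; rewrite !scale1r addr0 => /eqP; rewrite -subr_eq0 opprD addNKr oppr_eq0 => /eqP. Qed.
Lemma Y0l n w : Y n 0 w = 0.
Proof. by have := Ylinl n w 1 0 0; rewrite !scale1r addr0 => /eqP; rewrite -subr_eq0 opprD addNKr oppr_eq0 => /eqP. Qed.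
Lemma YZl n k u w : Y n (k *: u) w = k *: Y n u w.
Proof. by have := Ylinl n w k u 0; rewrite !addr0 Y0l addr0. Qed.
Lemma Y_suml n I (s : seq I) (f : I -> V) w : Y n (\sum_(i <- s) f i) w = \sum_(i <- s) Y n (f i) w.
Proof.
elim: s => [|i s ih]; first by rewrite !big_nil Y0l.
by rewrite !big_cons -ih -[f i]scale1r Ylinl !scale1r.
Qed.

Lemma sum_binz0 K (G : nat -> V) : \sum_(i < K.+1) (binz 0 i)%:~R *: G i = G 0%N.
Proof.
rewrite big_ord_recl big1 ?addr0 => [|i _]; last by rewrite /= bin0n scale0r.
by rewrite /= scale1r.
Qed.

Lemma borcherds_commutator (m n : int) u v w J : (forall i, (J <= i)%N -> Y i%:Z u v = 0) ->
  Y m u (Y n v w) - Y n v (Y m u w) = \sum_(i < J) (binz m i)%:~R *: Y (m + n - i%:Z) (Y i%:Z u v) w.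
Proof.
move=> hJ; case: YP => _ _ _ _ /(_ m n 0 u v w)[K0 hK].
have := hK (maxn K0 J.+1) (leq_maxl _ _).
have -> : maxn K0 J.+1 = (maxn K0 J.+1).-1.+1 by lia.
rewrite [in RHS]big_ord_recl [X in _ = _ + X]big1 ?addr0; last first.
  by move=> i _; rewrite /= bin0n mulr0 scale0r.
rewrite /= !expr0 mul1r !scale1r => <-.
rewrite prednK; last by lia.
rewrite -(big_mkord xpredT (fun i => (binz m i)%:~R *: Y (m + n - i%:Z) (Y (0 + i%:Z) u v) w)).
rewrite (big_cat_nat (n := J)) //=; last by lia.
rewrite [X in _ + X]big_nat_cond [X in _ + X]big1 ?addr0 => [|i].
  by rewrite big_mkord; apply: eq_bigr => i _; rewrite add0r.
by move=> /andP[/andP[le _] _]; rewrite add0r hJ // Y0l scaler0.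
Qed.

Lemma Y_vac n v : Y n one v = if n == -1 then v else 0.
Proof. by case: YP. Qed.

(** The Borcherds identity for 0, n, -2 with the vacuum in the middle. The vacuum leaves only the
    indices i = -n - 1 and i = n - 1, of which at most one is nonnegative. *)
Lemma Y_deriv n u w : Y n (Y (-2) u one) w = - n%:~R *: Y (n - 1) u w.
Proof.
case: YP => _ _ _ _ /(_ 0 n (-2) u one w)[K0 hK].
have := hK (maxn K0 (absz n).+2) (leq_maxl _ _); set K := maxn _ _.
have -> : \sum_(i < K) (binz 0 i)%:~R *: Y (0 + n - i%:Z) (Y (-2 + i%:Z) u one) w = Y n (Y (-2) u one) w.
  have -> : K = K.-1.+1 by rewrite /K; lia.
  rewrite (sum_binz0 K.-1 (fun i => Y (0 + n - i%:Z) (Y (-2 + i%:Z) u one) w)).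
  by rewrite addr0 subr0 add0r.
move=> ->.
have -> : \sum_(i < K) ((-1) ^+ i * (binz (-2) i)%:~R : R) *: (Y (0 + -2 - i%:Z) u (Y (n + i%:Z) one w) -
     (-1) ^+ absz (-2)%R *: Y (n + -2 - i%:Z) one (Y (0 + i%:Z) u w))
   = \sum_(i < K) ((if i%:Z == - n - 1 then - n%:~R *: Y (n - 1) u w else 0) +
      (if i%:Z == n - 1 then - n%:~R *: Y (n - 1) u w else 0)).
  apply: eq_bigr => i _.
  have -> : ((-1) ^+ i * (binz (-2) i)%:~R : R) = i.+1%:R.
    rewrite [binz _ _]/((-1) ^+ i * 'C(1 + i, i)%:Z) rmorphM rmorphXn /= mulrA -exprMn mulrNN mulr1 expr1n mul1r.
    by rewrite -pmulrn add1n -bin_sub // subSnn bin1.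
  rewrite !Y_vac expr2 mulrNN mulr1 scale1r scalerBr; congr (_ + _).
    have -> : (n + i%:Z == -1) = (i%:Z == - n - 1) by apply/eqP/eqP; lia.
    case: eqP => [e|_]; last by rewrite Y0r scaler0.
    by rewrite pmulrn -rmorphN; congr (_%:~R *: Y _ _ _); lia.
  have -> : (n + -2 - i%:Z == -1) = (i%:Z == n - 1) by apply/eqP/eqP; lia.
  case: eqP => [e|_]; last by rewrite scaler0 oppr0.
  by rewrite -scaleNr pmulrn -!rmorphN; congr (_%:~R *: Y _ _ _); lia.
rewrite big_split /=.
have S0 (s : int) : (s < K%:Z) -> \sum_(i < K) (if i%:Z == s then - n%:~R *: Y (n - 1) u w else 0)
    = if 0 <= s then - n%:~R *: Y (n - 1) u w else 0.
  case: s => s lt; last by rewrite big1 // => i _; case: eqP.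
  rewrite (bigD1 (Ordinal (lt : (s < K)%N))) //= eqxx big1 ?addr0 // => i ne.
  by rewrite ifF //; apply: contraNF ne => /eqP[e]; apply/eqP/val_inj.
rewrite !S0; try by rewrite /K; lia.
case: (ltrgtP n 0) => h; [rewrite ifT ?ifF ?addr0 | rewrite ifF ?ifT ?add0r |]; try lia; first by [].
  by [].
have -> : (- n%:~R : R) = 0 by rewrite h mulr0z oppr0.
by rewrite scale0r; case: ifP; case: ifP; rewrite ?addr0.
Qed.

Lemma Y_normal n u v w : exists K0 : nat, forall K : nat, (K0 <= K)%N ->
  Y n (Y (-1) u v) w = \sum_(i < K) (Y (-1 - i%:Z) u (Y (n + i%:Z) v w) + Y (n - 1 - i%:Z) v (Y i%:Z u w)).
Proof.
case: YP => _ _ _ _ /(_ 0 n (-1) u v w)[K0 hK]; exists K0.+1 => K le.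
have := hK K (ltnW le); case: K le {hK} => // K _.
rewrite (sum_binz0 K (fun i => Y (0 + n - i%:Z) (Y (-1 + i%:Z) u v) w)).
rewrite addr0 subr0 add0r => ->; apply: eq_bigr => i _.
have -> : ((-1) ^+ i * (binz (-1) i)%:~R : R) = 1.
  rewrite [binz _ _]/((-1) ^+ i * 'C(0 + i, i)%:Z) rmorphM rmorphXn /= add0n binn mulr1.
  by rewrite -exprMn mulrNN mulr1 expr1n.
by rewrite scale1r expr1 scaleN1r opprK !add0r.
Qed.
End VertexAlgebraIdentities.

Lemma big_sym_fold (R : zmodType) (M : nat) (G : int -> R) :
  \sum_(t < (2 * M).+1) G (t%:Z - M%:Z) = \sum_(k < M) (G (-1 - k%:Z) + G k%:Z) + G M%:Z.
Proof.
elim: M => [|M ih].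
  by rewrite big_ord0 add0r muln0 big_ord1 subrr.
rewrite big_sym_recr ih big_ord_recr /= [G _ + (_ + _)]addrC -!addrA; congr (_ + _).
have -> : - M.+1%:Z = -1 - M%:Z by lia.
by rewrite [G M%:Z + _]addrCA.
Qed.

(** * Modes of exponentials and their action on the integral form *)

Section LatticeVertexAlgebra.
Variables (r : nat) (F : fock_model r) (A : 'M[int]_r) (Y : int -> F -> F -> F).
Local Notation L := 'rV[int]_r.
Implicit Types (a b g : L) (x y w : F).
Local Notation pr := (pairing A).
Local Notation expv := (expv F).
Local Notation bs i := (delta_mx 0 i : L).
Local Notation form := (form A).
Local Notation schv := (schv F A).
Local Notation Zf := (zspan (@is_schv r F A)).
Hypotheses (A_sym : A^T = A) (A_det : \det A != 0).
Hypothesis YP : is_vertex_algebra (expv 0) Y.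
Hypothesis Y_osc : forall i n x, Y n (mulv (i, 0%N) (expv 0)) x = hv A (bs i) n x.
Hypothesis Y_D : forall x, Y (-2) x (expv 0) = fD x.
Hypothesis Y_exp : forall a b, Y (-1 - pr a b) (expv a) (expv b) = cocycle A a b *: expv (a + b).

Definition omega : F :=
  \sum_(i < r) \sum_(j < r) (gram_inv A i j / 2) *: mulv (i, 0%N) (mulv (j, 0%N) (expv 0)).

Fact Y_linear n u : linear (Y n u). Proof. exact: (Ylin YP). Qed.
HB.instance Definition _ n u := GRing.isLinear.Build rat F F _ (Y n u) (Y_linear n u).

Lemma Y_omega n y : Y (n + 1) omega y = Lv A n y.
Proof.
have [W hW h] := Lv_QL A y.
have /choice[K hK] : forall p : 'I_r * 'I_r, exists K : nat, forall K', (K <= K')%N ->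
    Y (n + 1) (mulv (p.1, 0%N) (mulv (p.2, 0%N) (expv 0))) y
    = \sum_(k < K') (hv A (bs p.1) (-1 - k%:Z) (hv A (bs p.2) (n - (-1 - k%:Z)) y)
        + hv A (bs p.2) (n - k%:Z) (hv A (bs p.1) k%:Z y)).
  move=> [i j] /=.
  have [K0 hK0] := Y_normal YP (n + 1) (mulv (i, 0%N) (expv 0)) (mulv (j, 0%N) (expv 0)) y.
  exists K0 => K' le; have := hK0 K' le; rewrite Y_osc -[hv _ _ _ _ in LHS]/(hv _ _ _ _).
  have -> : hv A (bs i) (-1) (mulv (j, 0%N) (expv 0)) = mulv (i, 0%N) (mulv (j, 0%N) (expv 0)).
    by rewrite [in RHS](mulv_cre A).
  move=> ->; apply: eq_bigr => k _; rewrite !Y_osc; congr (hv _ _ _ (hv _ _ _ _) + hv _ _ _ _); lia.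
pose M := (W + absz n + \max_p K p).+1%N.
have hM p : (K p <= M)%N by rewrite /M; have := @leq_bigmax _ K p; lia.
rewrite (h n M); last by rewrite /M; lia.
rewrite /omega (Y_suml YP); apply: eq_bigr => i _; rewrite (Y_suml YP); apply: eq_bigr => j _.
rewrite (YZl YP); congr (_ *: _); rewrite (hK (i, j) M) //=.
(* The range from -M to M has odd length, so the two halves of the normally ordered product leave
   the term k = M over; it vanishes as M > W. *)
rewrite (big_sym_fold M (fun s => nordF A i j s (n - s) y)).
have hp b (k : nat) : (W < k)%N -> hv A b k%:Z y = 0 by apply: hW.
have -> : nordF A i j M%:Z (n - M%:Z) y = 0.
  by rewrite /nordF ifF; [rewrite hp ?linear0 // /M | rewrite /M]; lia.
rewrite addr0; apply: eq_bigr => k _; congr (_ + _); rewrite /nordF; case: ifP => // le.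
  rewrite hvC // (_ : (_ + _ == 0) = false) ?scale0r ?addr0 //; apply/eqP; move: le; lia.
have [n0|n0] := eqVneq n 0; last first.
  rewrite hvC // (_ : (_ + _ == 0) = false) ?scale0r ?addr0 //; apply/eqP; move: n0; lia.
have -> : k%:Z = 0 by move: le; lia.
by rewrite n0 subr0 hv0C.
Qed.

Lemma hv_Yexp a b m k w : hv A a m (Y k (expv b) w)
  = Y k (expv b) (hv A a m w) + (pr a b)%:~R *: Y (m + k) (expv b) w.
Proof.
have base i : hv A (bs i) m (Y k (expv b) w)
    = Y k (expv b) (hv A (bs i) m w) + (pr (bs i) b)%:~R *: Y (m + k) (expv b) w.
  have hJ q : (1 <= q)%N -> Y q%:Z (mulv (i, 0%N) (expv 0)) (expv b) = 0.
    by case: q => // q _; rewrite Y_osc hv_expv.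
  have := borcherds_commutator YP m k w hJ; rewrite big_ord1 !Y_osc hv0_expv (YZl YP) subr0.
  have -> : binz m 0 = 1 by case: m => m; rewrite /= bin0 ?expr0 ?mul1r.
  by rewrite scale1r => /eqP; rewrite subr_eq addrC => /eqP.
rewrite hv_sum (hv_sum A a m w) pairing_sum rmorph_sum scaler_suml linear_sum -big_split.
by apply: eq_bigr => i _; rewrite /= base scalerDr [Y _ _ (_ *: _)]linearZ /= intrM scalerA.
Qed.

Definition wt b : rat := (pr b b)%:~R / 2.

Lemma Lv_Yexp (n : nat) b k w : Lv A n%:Z (Y k (expv b) w) = Y k (expv b) (Lv A n%:Z w)
  + ((wt b - 1) * n.+1%:R - k%:~R) *: Y (n%:Z + k) (expv b) w.
Proof.
have hJ q : (2 <= q)%N -> Y q%:Z omega (expv b) = 0.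
  case: q => [|[|q]] // _; have -> : q.+2%:Z = q.+1%:Z + 1 by lia.
  by rewrite Y_omega Lv_expv.
have := borcherds_commutator YP (n%:Z + 1) k w hJ; rewrite !big_ord_recl big_ord0 addr0 /=.
have -> : Y 0%Z omega (expv b) = Y (-2) (expv b) (expv 0).
  rewrite -[0%Z]/(-1 + 1 : int) Y_omega Lm1_expv // Y_D.
  by rewrite (fD_expv_cre F A).
have -> : Y 1%Z omega (expv b) = wt b *: expv b.
  by rewrite -[1%Z]/(0 + 1 : int) Y_omega L0_expv.
rewrite (Y_deriv YP) (YZl YP) !Y_omega.
rewrite bin0 (_ : 'C(n + 1, bump 0 0) = n.+1); last by rewrite bin1 addn1.
rewrite -[1%Z%:~R]/(1 : rat).
rewrite (_ : n%:Z + 1 + k - 1 = n%:Z + k); last by lia.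
move=> /eqP; rewrite subr_eq addrC => /eqP ->.
have -> : ((n%:Z + 1 + k)%:~R : rat) = n.+1%:R + k%:~R.
  by rewrite !rmorphD /= -natr1 -!pmulrn.
rewrite -pmulrn; lin_combine rat (fock_space F).
Qed.

Lemma wtD b g : wt (b + g) = wt b + wt g + (pr b g)%:~R.
Proof.
rewrite /wt !pairingDl !pairingDr (pairingC A_sym g b) !rmorphD /=; by field.
Qed.

Lemma hv0_Yexp a b g k : hv A a 0 (Y k (expv b) (expv g)) = (pr a (b + g))%:~R *: Y k (expv b) (expv g).
Proof.
rewrite hv_Yexp hv0_expv linearZ /= add0r pairingDr rmorphD /=; lin_combine rat (fock_space F).
Qed.

Lemma L0_Yexp b g k :
  Lv A 0 (Y k (expv b) (expv g)) = (wt b + wt g - 1 - k%:~R) *: Y k (expv b) (expv g).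
Proof.
rewrite (Lv_Yexp 0) L0_expv // -/(wt g) linearZ /= add0r mulr1; lin_combine rat (fock_space F).
Qed.

(** Descending from the truncation bound, each such vector is killed by all positive modes, hence a
    multiple of e^(b+g); its L_0-weight is too small for a nonzero multiple. *)
Lemma Yexp_hi b g k : -1 - pr b g < k -> Y k (expv b) (expv g) = 0.
Proof.
have [n0 hn0] : exists n0 : int, forall n, n0 <= n -> Y n (expv b) (expv g) = 0 by case: YP.
suff [t] : exists t : nat, n0 - k <= t%:Z.
  elim: t k => [|t ih] k le lt; first by apply: hn0; lia.
  have e : Y k (expv b) (expv g) = coef (b + g) (onecm _) (Y k (expv b) (expv g)) *: expv (b + g).
    apply: (@vacuum_vec _ _ A) => // [a j|a]; last exact: hv0_Yexp.
    by rewrite hv_Yexp hv_expv linear0 add0r ih ?scaler0 //; lia.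
  have := L0_Yexp b g k; rewrite {1}e linearZ /= L0_expv // -/(wt _) scalerC -e wtD => /eqP.
  rewrite -subr_eq0 -scalerBl scaler_eq0 => /orP[/eqP h|/eqP //].
  have : ((pr b g + 1 + k)%:~R : rat) = 0.
    by rewrite !rmorphD /= -[RHS]h; ring.
  by move=> /eqP; rewrite intr_eq0 => /eqP; lia.
by exists (absz (n0 - k)); lia.
Qed.

(** Both sides behave alike under the Heisenberg modes, so they differ by a multiple of e^(b+g). *)
Lemma Yexp_lo b g i :
  Y (-1 - pr b g - i%:Z) (expv b) (expv g) = cocycle A b g *: Sop F A b i (expv (b + g)).
Proof.
elim/ltn_ind: i => -[|i] ih; first by rewrite subr0 Y_exp.
set y := Y _ _ _; apply/eqP; rewrite -subr_eq0; apply/eqP.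
have hS a j : hv A a j.+1%:Z (Sop F A b i.+1 (expv (b + g)))
    = (pr a b)%:~R *: schz (cre F A b) (i.+1%:Z - j.+1%:Z) (expv (b + g)).
  rewrite (sch_shift (X := cre F A b) (T := hv A a j.+1%:Z) (d := (pr a b)%:~R) (i := j)).
    by rewrite hv_expv linear0 add0r.
  by move=> j' z; rewrite /cre hv_pos_neg; congr (_ + (_ * _) *: _); rewrite eq_sym.
set z := y - _; have e : z = coef (b + g) (onecm _) z *: expv (b + g).
  apply: (@vacuum_vec _ _ A) => // [a j|a]; last first.
    rewrite /z linearB hv0_Yexp linearZ /= /Sop scalerBr; congr (_ - _).
    have -> : hv A a 0 (sch (cre F A b) i.+1 (expv (b + g))) = sch (cre F A b) i.+1 (hv A a 0 (expv (b + g))).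
      by apply: (sch_comm (X := cre F A b) (T := hv A a 0)) => j' u; exact: hv0C.
    by rewrite hv0_expv linearZ /= scalerC.
  rewrite /z /y linearB hv_Yexp hv_expv linear0 add0r linearZ /= hS.
  have [le|lt] := leqP j i.
    have -> : j.+1%:Z + (-1 - pr b g - i.+1%:Z) = -1 - pr b g - (i - j)%N%:Z by lia.
    have -> : i.+1%:Z - j.+1%:Z = (i - j)%N%:Z by lia.
    rewrite ih /=; last by lia.
    by rewrite scalerC subrr.
  rewrite Yexp_hi; last by lia.
  have -> : i.+1%:Z - j.+1%:Z = Negz (j - i.+1) by lia.
  by rewrite !scaler0 subrr.
rewrite e (_ : coef _ _ z = 0) ?scale0r // /z linearB linearZ /=.
have -> : coef (b + g) (onecm _) (Sop F A b i.+1 (expv (b + g))) = 0 :> rat.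
  rewrite /= /Sop schS linearZ /= linear_sum big1 ?scaler0 // => j _; exact: coef1_cre.
rewrite scaler0 subr0 -(form_expv A).
(* The multiple is zero: L_0 is self-adjoint, and the weights of y and of e^(b+g) differ by i+1. *)
have : form (Lv A 0 (expv (b + g))) y = form (expv (b + g)) (Lv A 0 y) by rewrite form_Lv // oppr0.
rewrite L0_expv // -/(wt _) formZl L0_Yexp formZr wtD => /eqP.
rewrite -subr_eq0 -mulrBl mulf_eq0 => /orP[/eqP h|/eqP //].
have : ((i.+1%:Z)%:~R : rat) = 0.
  by rewrite -[RHS]oppr0 -h !rmorphB /=; ring.
by move/eqP; rewrite intr_eq0.
Qed.

Lemma Y_Sop a b k l y : Y k (expv b) (Sop F A a l y)
  = \sum_(i < l.+1) (rbin (- pr a b) i)%:~R *: Sop F A a (l - i) (Y (k - i%:Z) (expv b) y).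
Proof.
apply: (sch_twist (X := cre F A a) (E := fun k => Y k (expv b))) => {}k j {}y.
rewrite /= /cre (hv_Yexp a b _ k); have -> : Negz j + k = k - j.+1%:Z by lia.
by rewrite rmorphN scaleNr addrK.
Qed.

Lemma Y_Zf b k x : Zf x -> Zf (Y k (expv b) x).
Proof.
apply: (zspan_map (f := Y k (expv b))) => [|_ [g [ls ->]]]; first exact: raddfB.
elim: ls k => [|[a l] ls ih] k /=.
  have [lt|le] := ltrP (-1 - pr b g) k; first by rewrite Yexp_hi //; apply: zspan_0.
  have -> : k = -1 - pr b g - (absz (-1 - pr b g - k)%R)%:Z by lia.
  rewrite Yexp_lo; have [n ->] := cocycle_int A b g; apply: zspanZ; apply: zspan_gen.
  by exists (b + g), [:: (b, absz (-1 - pr b g - k)%R)].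
by rewrite Y_Sop; apply: zspan_sum => i _; apply/zspanZ/zspan_Sop.
Qed.

Definition low_tail b g (tl : seq (L * nat)) x := exists l' tl',
  [/\ x = schv g ((b, l') :: tl'), size tl' = size tl & (sumn (map snd tl') < sumn (map snd tl))%N].

(** Triangularity: a mode of e^b prepends a Schur factor of b, up to vectors whose tail has the same
    length and a smaller sum of indices. *)
Lemma Y_lead b g tl l : zspan (low_tail b (b + g) tl)
  (Y (-1 - pr b g - l%:Z) (expv b) (schv g tl) - cocycle A b g *: schv (b + g) ((b, l) :: tl)).
Proof.
elim: tl l => [|[a j] tl ih] l; first by rewrite Yexp_lo subrr; apply: zspan_0.
have -> : schv g ((a, j) :: tl) = Sop F A a j (schv g tl) by [].
have -> : schv (b + g) [:: (b, l), (a, j) & tl] = Sop F A a j (schv (b + g) ((b, l) :: tl)).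
  exact: SopC.
rewrite Y_Sop big_ord_recl rbin0 scale1r subn0 subr0 addrAC; apply: zspanD.
  rewrite -[cocycle _ _ _ *: Sop _ _ a _ _]linearZ -linearB.
  apply: (zspan_map (f := Sop F A a j)) (ih l) => [|x [l' [tl' [-> s1 s2]]]]; first exact: raddfB.
  apply: zspan_gen; exists l', ((a, j) :: tl'); rewrite /= s1 ltn_add2l; split=> //.
  exact: SopC.
apply: zspan_sum => i _; apply: zspanZ; have lt := ltn_ord i.
have -> : -1 - pr b g - l%:Z - (bump 0 i)%:Z = -1 - pr b g - (l + i.+1)%N%:Z by rewrite /bump /=; lia.
rewrite -[Y _ _ _](subrK (cocycle A b g *: schv (b + g) ((b, (l + i.+1)%N) :: tl))) linearD.
apply: zspanD.
  apply: (zspan_map (f := Sop F A a (j - bump 0 i))) (ih _) => [|x [l' [tl' [-> s1 s2]]]]; first exact: raddfB.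
  apply: zspan_gen; exists l', ((a, j - bump 0 i)%N :: tl'); rewrite /= s1; split=> //; first exact: SopC.
  by rewrite /bump /=; lia.
rewrite linearZ /=; have [n ->] := cocycle_int A b g; apply: zspanZ; apply: zspan_gen.
exists (l + i.+1)%N, ((a, j - bump 0 i)%N :: tl); rewrite /=; split=> //; first exact: SopC.
by rewrite /bump /=; lia.
Qed.

(** Induction on the number of Schur factors and then on the sum of the indices in the tail, with
    [Y_lead] for the leading term. It reduces the dressing of integral vectors to the dressing of
    single vertex operators. *)
Lemma Zf_gen (Q : F -> Prop) : Q (expv 0) -> (forall x y, Q x -> Q y -> Q (x - y)) ->
  (forall b k x, Q x -> Q (Y k (expv b) x)) -> forall x, Zf x -> Q x.
Proof.
move=> Q1 QB QY.
have Q0 : Q 0 by rewrite -(subrr (expv 0)); apply: QB.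
have QN x : Q x -> Q (- x) by move=> h; rewrite -sub0r; apply: QB.
have Qsp P x : (forall y, P y -> Q y) -> zspan P x -> Q x.
  by move=> h; elim=> [y /h|//|y z _ hy _ hz] //; apply: QB.
have Qc b g x : Q (cocycle A b g *: x) -> Q x.
  rewrite /cocycle; move: (absz _) => n; rewrite -signr_odd; case: (odd n); rewrite ?scale1r //.
  by rewrite scaleN1r => /QN; rewrite opprK.
have key s : forall g ls, size ls = s -> Q (schv g ls).
  elim: s => [|s ihs] g ls.
    move/size0nil ->; apply: (Qc g 0); have := QY g (-1 - pr g 0) _ Q1; rewrite Y_exp.
    by rewrite addr0.
  case: ls => [//|[b l] tl] [hs].
  have [T hT] : exists T, (sumn (map snd tl) < T)%N by exists (sumn (map snd tl)).+1.
  elim: T g b l tl hs hT => // T ihT g b l tl hs hT.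
  have := Y_lead b (g - b) tl l; rewrite addrC subrK => h.
  apply: (Qc b (g - b)).
  have := QB _ _ (QY b (-1 - pr b (g - b) - l%:Z) _ (ihs (g - b) tl hs)) (Qsp _ _ _ h).
  rewrite opprB addrC subrK; apply => x [l' [tl' [-> s1 s2]]].
  by apply: ihT; [rewrite s1 | lia].
by move=> x; apply: Qsp => _ [g [ls ->]]; apply: (key (size ls)).
Qed.
End LatticeVertexAlgebra.

(** * Tensor products with rational vector spaces *)

Section RationalMaps.
Variables (M N : lmodType rat) (f : {linear M -> N}).
Definition rlin (x : restr M) : restr N := f x.
Fact rlin_linear : linear rlin.
Proof. by move=> a x y; rewrite /rlin [LHS]linearP. Qed.
HB.instance Definition _ := GRing.isLinear.Build Zhalf (restr M) (restr N) _ rlin rlin_linear.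
End RationalMaps.

(* a copy of the tensor product over Z[1/2], to carry its structure over Q *)
Definition tq (V : lmodType Zhalf) (F : lmodType rat) : Type := tensor V (restr F).
HB.instance Definition _ V F := GRing.Zmodule.on (tq V F).

Section RationalTensor.
Variables (V : lmodType Zhalf) (F : lmodType rat).
Implicit Types (v : V) (x : F) (t : tq V F).

Definition tn v x : tq V F := tens v (x : restr F).

Lemma tnDr v x y : tn v (x + y) = tn v x + tn v y.
Proof. by have := (tens_bilinear V (restr F)).2 v 1 x y; rewrite !scale1r. Qed.
Lemma tnDl v v' x : tn (v + v') x = tn v x + tn v' x.
Proof. by have := (tens_bilinear V (restr F)).1 (x : restr F) 1 v v'; rewrite !scale1r. Qed.
Lemma tn0r v : tn v 0 = 0.
Proof. by apply: (addrI (tn v 0)); rewrite -tnDr !addr0. Qed.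
Lemma tn0l x : tn 0 x = 0.
Proof. by apply: (addrI (tn 0 x)); rewrite -tnDl !addr0. Qed.
Lemma tnNr v x : tn v (- x) = - tn v x.
Proof. by apply: (addrI (tn v x)); rewrite -tnDr !subrr tn0r. Qed.
Lemma tnNl v x : tn (- v) x = - tn v x.
Proof. by apply: (addrI (tn v x)); rewrite -tnDl !subrr tn0l. Qed.
Lemma tnBr v x y : tn v (x - y) = tn v x - tn v y.
Proof. by rewrite tnDr tnNr. Qed.
Lemma tnBl v v' x : tn (v - v') x = tn v x - tn v' x.
Proof. by rewrite tnDl tnNl. Qed.
Lemma tn_suml I (s : seq I) (P : pred I) (f : I -> V) x :
  tn (\sum_(i <- s | P i) f i) x = \sum_(i <- s | P i) tn (f i) x.
Proof. by apply: (big_morph (tn^~ x)) => [v v'|]; rewrite ?tnDl ?tn0l. Qed.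
Lemma tn_sumr I (s : seq I) (P : pred I) (f : I -> F) v :
  tn v (\sum_(i <- s | P i) f i) = \sum_(i <- s | P i) tn v (f i).
Proof. by apply: (big_morph (tn v)) => [x y|]; rewrite ?tnDr ?tn0r. Qed.

Lemma tn_bal (a : Zhalf) v x : tn (a *: v) x = tn v (Zhalf_val a *: x).
Proof.
have h1 := (tens_bilinear V (restr F)).1 (x : restr F) a v 0.
have h2 := (tens_bilinear V (restr F)).2 v a (x : restr F) 0.
have e1 : tens (a *: v + 0) (x : restr F) = tn (a *: v) x by rewrite addr0.
have e2 : tens v (a *: (x : restr F) + 0) = tn v (Zhalf_val a *: x) by rewrite addr0.
rewrite /= in h1 h2; rewrite -e1 -e2 h1 h2 -/(tn _ _) -/(tn _ _).
by rewrite tn0l; congr (_ + _); apply/esym/(tn0r v).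
Qed.

Lemma tq_ind (Q : tq V F -> Prop) : Q 0 -> (forall v x t, Q t -> Q (tn v x + t)) -> forall t, Q t.
Proof. exact: (@tensor_ind _ V (restr F)). Qed.

Lemma tq_eq (P : zmodType) (f g : tq V F -> P) : zmod_morphism f -> zmod_morphism g ->
  (forall v x, f (tn v x) = g (tn v x)) -> f =1 g.
Proof.
move=> hf hg h; have f0 : f 0 = 0 by have := hf 0 0; rewrite !subrr.
have g0 : g 0 = 0 by have := hg 0 0; rewrite !subrr.
have D (k : tq V F -> P) : zmod_morphism k -> k 0 = 0 -> forall t u, k (t + u) = k t + k u.
 
  by move=> hk k0 t u; rewrite -[u in LHS]opprK hk -[- u]sub0r hk k0 sub0r opprK.
elim/tq_ind => [|v x t ih]; first by rewrite f0 g0.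
by rewrite (D f) // (D g) // h ih.
Qed.

Definition tq_scale (q : rat) (t : tq V F) : tq V F :=
  tensor_map idfun (rlin (q \*: idfun : {linear F -> F})) t.

Lemma tq_scaleE q v x : tq_scale q (tn v x) = tn v (q *: x).
Proof. exact: tensor_mapE. Qed.
Lemma tq_scaleB q : zmod_morphism (tq_scale q).
Proof. move=> x y; exact: raddfB. Qed.

Fact tq_scaleA a b t : tq_scale a (tq_scale b t) = tq_scale (a * b) t.
Proof.
move: t; apply: tq_eq => [x y|x y|v x]; rewrite ?tq_scaleB // !tq_scaleE.
by rewrite scalerA.
Qed.
Fact tq_scale1 : left_id 1 tq_scale.
Proof. by apply: tq_eq => [x y|x y|v x]; rewrite ?tq_scaleB // tq_scaleE scale1r. Qed.
Fact tq_scaleDr : right_distributive tq_scale +%R.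
Proof. by move=> a x y; exact: raddfD. Qed.
Fact tq_scaleDl t : {morph tq_scale^~ t : a b / a + b}.
Proof.
move=> a b; move: t; apply: tq_eq => [x y|x y|v x].
- by rewrite tq_scaleB.
- by rewrite !tq_scaleB addrACA -opprD.
- by rewrite !tq_scaleE scalerDl tnDr.
Qed.
HB.instance Definition _ := GRing.Zmodule_isLmodule.Build rat (tq V F)
  tq_scaleA tq_scale1 tq_scaleDr tq_scaleDl.

Lemma tnZr v q x : tn v (q *: x) = q *: tn v x.
Proof. by rewrite -[RHS]/(tq_scale q _) tq_scaleE. Qed.
Lemma tnZl v a x : tn (a *: v) x = Zhalf_val a *: tn v x.
Proof. by rewrite tn_bal tnZr. Qed.
End RationalTensor.

Section RationalTensorMap.
Variables (V V' : lmodType Zhalf) (F F' : lmodType rat).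

Definition tqm (f : {linear V -> V'}) (g : {linear F -> F'}) (t : tq V F) : tq V' F' :=
  tensor_map f (rlin g) t.

Lemma tqmE f g v x : tqm f g (tn v x) = tn (f v) (g x).
Proof. exact: tensor_mapE. Qed.
Lemma tqmB f g : zmod_morphism (tqm f g).
Proof. move=> x y; exact: raddfB. Qed.
Fact tqm_linear f g : linear (tqm f g).
Proof.
have D u u' : tqm f g (u + u') = tqm f g u + tqm f g u' by exact: raddfD.
have h q u : tqm f g (q *: u) = q *: tqm f g u.
  move: u; apply: tq_eq => [u u'|u u'|v z]; first by rewrite scalerBr tqmB.
    by rewrite tqmB scalerBr.
  by rewrite -tnZr !tqmE linearZ -tnZr.
by move=> a x y; rewrite D h.
Qed.
HB.instance Definition _ f g := GRing.isLinear.Build rat (tq V F) (tq V' F') _ (tqm f g) (tqm_linear f g).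
End RationalTensorMap.

Lemma tqm_comp (V1 V2 V3 : lmodType Zhalf) (F1 F2 F3 : lmodType rat)
    (f : {linear V1 -> V2}) (f' : {linear V2 -> V3}) (f'' : {linear V1 -> V3})
    (g : {linear F1 -> F2}) (g' : {linear F2 -> F3}) (g'' : {linear F1 -> F3}) :
  (forall v, f' (f v) = f'' v) -> (forall x, g' (g x) = g'' x) ->
  forall t, tqm f' g' (tqm f g t) = tqm f'' g'' t.
Proof.
move=> hf hg; apply: tq_eq => [x y|x y|v x]; rewrite ?linearB //.
by rewrite !tqmE hf hg.
Qed.

Lemma tqm_id (V : lmodType Zhalf) (F : lmodType rat) (t : tq V F) : tqm idfun idfun t = t.
Proof. by move: t; apply: tq_eq => [x y|x y|v x]; rewrite ?linearB // tqmE. Qed.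

Definition tspan (V : lmodType Zhalf) (F : lmodType rat) (P : V -> Prop) (Q : F -> Prop)
  : tq V F -> Prop := zspan (fun w => exists v x, [/\ P v, Q x & w = tn v x]).

Lemma tspan_gen (V : lmodType Zhalf) (F : lmodType rat) (P : V -> Prop) (Q : F -> Prop) v x :
  P v -> Q x -> tspan P Q (tn v x).
Proof. by move=> hv hx; apply: zspan_gen; exists v, x. Qed.

Lemma tspan_map (V V' : lmodType Zhalf) (F F' : lmodType rat) P Q P' Q'
    (f : {linear V -> V'}) (g : {linear F -> F'}) (t : tq V F) :
  (forall v, P v -> P' (f v)) -> (forall x, Q x -> Q' (g x)) ->
  tspan P Q t -> tspan P' Q' (tqm f g t).
Proof.
move=> hf hg; apply: (zspan_map (f := tqm f g)) => [|_ [v [x [hv hx ->]]]]; first exact: raddfB.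
by rewrite tqmE; apply: tspan_gen; [apply: hf | apply: hg].
Qed.

Lemma tspan_all (V : lmodType Zhalf) (F : lmodType rat) (t : tq V F) :
  tspan (fun=> True) (fun=> True) t.
Proof.
elim/tq_ind: t => [|v x t ih]; first exact: zspan_0.
by apply: zspanD => //; apply: tspan_gen.
Qed.

Section RationalPoints.
Variables (V : lmodType Zhalf) (N : submodule V).

Lemma intr_Zhalf (k : int) : Zhalf_val (k%:~R : Zhalf) = k%:~R.
Proof. exact: (rmorph_int (val : {rmorphism Zhalf -> rat}) k). Qed.

(** A common denominator merges a sum of pure tensors into one. *)
Lemma tspan_rat (t : tq V rat^o) : tspan (in_submod N) (fun=> True) t ->
  exists u d, [/\ N u, d != 0 :> int & t = tn u (d%:~R^-1 : rat^o)].
Proof.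
elim=> [w [v [q [hv _ ->]]]||x y _ [u [d [hu d0 ->]]] _ [u' [d' [hu' d0' ->]]]].
- exists ((numq q)%:~R *: v), (denq q); split; [|exact: denq_neq0|].
    by rewrite -[_ *: v]addr0; apply: submodP => //; apply: submod0.
  rewrite tn_bal intr_Zhalf; congr (tn v _).
  by rewrite scaler_reg [LHS](esym (divq_num_den q)).
- by exists 0, 1; split=> //; [apply: submod0 | rewrite tn0l].
exists (d'%:~R *: u - d%:~R *: u'), (d * d'); split.
- rewrite -scaleNr addrC; apply: submodP => //.
  by rewrite -[_ *: u]addr0; apply: submodP => //; apply: submod0.
- by rewrite mulf_neq0.
rewrite tnBl !tn_bal !intr_Zhalf !scaler_reg; congr (tn _ _ - tn _ _).
  by rewrite intrM; field; rewrite !intr_eq0 d0 d0'.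
by rewrite intrM; field; rewrite !intr_eq0 d0 d0'.
Qed.
End RationalPoints.

Section Coordinates.
Variables (V : lmodType Zhalf) (r : nat) (F : fock_model r).

Definition tcoef a m : {linear tq V F -> tq V rat^o} := tqm idfun (coef a m).
Definition vecm a m (q : rat^o) : F := (q : rat) *: vec F a m.
Fact vecm_linear a m : linear (vecm a m).
Proof. by move=> k x y; rewrite /vecm scalerDl -scalerA. Qed.
HB.instance Definition _ a m := GRing.isLinear.Build rat rat^o F _ (vecm a m) (vecm_linear a m).

Lemma fock_supp (x : F) : exists s : {fset fock_basis r}, forall s' : {fset fock_basis r},
  (s `<=` s')%fset -> x = \sum_(k <- s') (coef k.1 k.2 x : rat) *: vec F k.1 k.2.
Proof.
elim/vec_ind: x => [|c a m x [s hs]].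
  by exists fset0 => s' _; rewrite big1 // => k _; rewrite linear0 scale0r.
exists (((a, m) : fock_basis r) |` s)%fset => s' le.
have am : ((a, m) : fock_basis r) \in s' by apply: (fsubsetP le); rewrite !inE eqxx.
rewrite {1}(hs s'); last by apply: fsubset_trans le; apply: fsubsetUr.
under [RHS]eq_bigr => k _ do rewrite linearP scalerDl coef_vec.
rewrite big_split; congr (_ + _) => /=.
rewrite (big_fsetD1 ((a, m) : fock_basis r)) //= !eqxx big1_seq ?addr0.
  by rewrite scaler_reg mulr1.
move=> [b m'] /andP[_]; rewrite !inE => /andP[ne _] /=.
rewrite (_ : (a == b) && (m == m') = false) ?scaler0 ?scale0r //.
by apply: contraNF ne => /andP[/eqP -> /eqP ->].
Qed.

Lemma tq_expand (t : tq V F) : exists s : {fset fock_basis r}, forall s' : {fset fock_basis r},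
  (s `<=` s')%fset -> t = \sum_(k <- s') tqm idfun (vecm k.1 k.2) (tcoef k.1 k.2 t).
Proof.
elim/tq_ind: t => [|v x t [s hs]].
  by exists fset0 => s' _; rewrite big1 // => k _; rewrite !linear0.
have [s1 hs1] := fock_supp x; exists (s1 `|` s)%fset => s' le.
rewrite {1}(hs s'); last by apply: fsubset_trans le; apply: fsubsetUr.
rewrite {1}(hs1 s'); last by apply: fsubset_trans le; apply: fsubsetUl.
rewrite tn_sumr -big_split; apply: eq_bigr => k _ /=.
rewrite /tcoef [tqm idfun (coef _ _) (_ + _)]linearD /= [tqm idfun (vecm _ _) (_ + _)]linearD /= !tqmE.
by [].
Qed.

Lemma tq_coords (t : tq V F) : (forall a m, tcoef a m t = 0) -> t = 0.
Proof.
move=> h; have [s hs] := tq_expand t.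
by rewrite (hs s) // big1 // => k _; rewrite h linear0.
Qed.
End Coordinates.

(** * Dressed vectors *)

Lemma eventually_all (P : nat -> nat -> Prop) n :
  (forall i, (i < n)%N -> exists K0, forall K, (K0 <= K)%N -> P i K) ->
  exists K0, forall K, (K0 <= K)%N -> forall i, (i < n)%N -> P i K.
Proof.
elim: n => [|n ih] h; first by exists 0%N.
have [|K1 h1] := ih; first by move=> i lt; apply: h; lia.
have [K2 h2] := h n (ltnSn n); exists (maxn K1 K2) => K le i.
rewrite ltnS leq_eqVlt => /orP[/eqP ->|lt]; first by apply: h2; lia.
by apply: h1 => //; lia.
Qed.

Section EigenProjection.
Variables (M : lmodType rat) (T : {linear M -> M}).

Definition ann_weights (js : seq rat) (x : M) : M := foldr (fun j y => T y - j *: y) x js.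

Lemma ann_weights_eigen js h x : T x = h *: x ->
  ann_weights js x = (\prod_(j <- js) (h - j)) *: x.
Proof.
move=> hx; elim: js => [|j js ih] /=; first by rewrite big_nil scale1r.
by rewrite ih linearZ /= hx big_cons scalerC -scalerBl scalerA.
Qed.

Lemma ann_weights_sum js I (s : seq I) (f : I -> M) :
  ann_weights js (\sum_(i <- s) f i) = \sum_(i <- s) ann_weights js (f i).
Proof.
elim: js => [|j js ih] //=.
by rewrite ih linear_sum scaler_sumr -sumrB.
Qed.

(* apply the product of the T - j over the other eigenvalues j *)
Lemma eigen_component (s : seq (rat * M)) (h : rat) (x : M) :
  (forall p, p \in s -> T p.2 = p.1 *: p.2) -> T x = h *: x ->
  x = \sum_(p <- s) p.2 -> x = \sum_(p <- s | p.1 == h) p.2.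
Proof.
move=> hs hx ex; pose js := [seq p.1 | p <- s & p.1 != h].
have c0 : \prod_(j <- js) (h - j) != 0.
  rewrite /js big_map big_filter; elim: (s) => [|p s' ih]; first by rewrite big_nil oner_neq0.
  by rewrite big_cons; case: ifP => // ne; rewrite mulf_neq0 // subr_eq0 eq_sym.
apply: (scalerI c0); rewrite -(ann_weights_eigen js hx) {1}ex ann_weights_sum scaler_sumr.
rewrite [RHS]big_mkcond /= big_seq [RHS]big_seq; apply: eq_bigr => p ps.
rewrite (ann_weights_eigen js (hs p ps)); case: eqP => [-> //|/eqP ne].
suff -> : \prod_(j <- js) (p.1 - j) = 0 by rewrite scale0r.
apply/eqP; rewrite prodf_seq_eq0; apply/hasP; exists p.1; last by rewrite subrr eqxx.
by apply/mapP; exists p; rewrite // mem_filter ne.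
Qed.
End EigenProjection.

(* E is a lattice vertex algebra, F the Fock space of II_(1,1) or any lattice   *)
(* with a null vector w pairing to c with a. Good h u says that a power of c    *)
(* times u e^a can be corrected, integrally and by oscillators of w, to a       *)
(* vector killed by the positive Virasoro operators.                            *)
Section DressedVectors.
Variables (rE : nat) (E : fock_model rE) (AE : 'M[int]_rE) (Y : int -> E -> E -> E).
Hypotheses (AE_sym : AE^T = AE) (AE_det : \det AE != 0).
Hypothesis AE_even : forall b, exists k : int, pairing AE b b = 2 * k.
Hypothesis AE_pos : forall b, b != 0 -> 0 < pairing AE b b.
Hypothesis YP : is_vertex_algebra (expv E 0) Y.
Hypothesis Y_osc : forall i n x, Y n (mulv (i, 0%N) (expv E 0)) x = hv AE (delta_mx 0 i) n x.
Hypothesis Y_D : forall x, Y (-2) x (expv E 0) = fD x.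
Hypothesis Y_exp : forall a b,
  Y (-1 - pairing AE a b) (expv E a) (expv E b) = cocycle AE a b *: expv E (a + b).
Variables (r : nat) (F : fock_model r) (A : 'M[int]_r) (a w : 'rV[int]_r) (c : int).
Hypotheses (A_sym : A^T = A) (A_det : \det A != 0).
Hypotheses (w_null : pairing A w w = 0) (w_a : pairing A w a = c) (c0 : c != 0).
Local Notation H := (tq (restr E) F).
Local Notation ZE := (zspan (@is_schv rE E AE)).
Local Notation ZF := (zspan (@is_schv r F A)).
Local Notation K2 := (K2 A a w).
Implicit Types (u v : E) (s : F) (t : H).

HB.instance Definition _ n u := GRing.isLinear.Build rat E E _ (Y n u) (Ylin YP n u).

Definition LT n t : H := tqm (rlin (Lv AE n)) idfun t + tqm idfun (Lv A n) t.
Fact LT_linear n : linear (LT n).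
Proof. by move=> k x y; rewrite /LT !linearP /= scalerDr addrACA. Qed.
HB.instance Definition _ n := GRing.isLinear.Build rat H H _ (LT n) (LT_linear n).

Lemma LT_tn n u s : LT n (tn (u : restr E) s) = tn (Lv AE n u : restr E) s + tn (u : restr E) (Lv A n s).
Proof. by rewrite /LT !tqmE. Qed.

Definition cpr (s : F) : F := (coef a (onecm _) s : rat) *: expv F a.
Fact cpr_linear : linear cpr.
Proof. by move=> k x y; rewrite /cpr linearP scalerDl -scalerA. Qed.
HB.instance Definition _ := GRing.isLinear.Build rat F F _ cpr cpr_linear.

Lemma cpr_expv : cpr (expv F a) = expv F a.
Proof. by rewrite /cpr coef_vec !eqxx scale1r. Qed.

Definition ZK s := ZF s /\ K2 s.
Definition HZ t := tspan (ZE : restr E -> Prop) ZK t.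

Record Good (h : rat) (u : E) : Prop := MkGood {
  good_L0 : Lv AE 0 u = h *: u;
  good_ex : exists N t, [/\ HZ t, tqm idfun cpr t = tn (u : restr E) ((c%:~R ^+ N : rat) *: expv F a),
    forall n : nat, (0 < n)%N -> LT n%:Z t = 0
    & LT 0 t = (h + (pairing A a a)%:~R / 2) *: t] }.

Lemma tn_intl (z : int) u s : tn ((z%:~R : rat) *: u : restr E) s = z%:~R *: tn (u : restr E) s.
Proof.
have -> : ((z%:~R : rat) *: u : restr E) = (z%:~R : Zhalf) *: (u : restr E).
  by rewrite -[in LHS]intr_Zhalf.
by rewrite tn_bal intr_Zhalf tnZr.
Qed.

(** The tensor product is taken over Z[1/2] only; clearing the denominator of q shows that it is
    balanced over Q. *)
Lemma tn_ratl (q : rat) u s : tn (q *: u : restr E) s = q *: tn (u : restr E) s.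
Proof.
have d0 : ((denq q)%:~R : rat) != 0 by rewrite intr_eq0 denq_neq0.
have e : (denq q)%:~R * q = (numq q)%:~R :> rat by rewrite -{2}(divq_num_den q) mulrC divfK.
by apply: (scalerI d0); rewrite -tn_intl !scalerA e -tn_intl.
Qed.

Lemma ZK_exp : ZK (expv F a).
Proof.
split; first by apply: zspan_gen; exists a, [::].
by split=> [k|]; [rewrite hv_expv | rewrite dpr_expv].
Qed.

Lemma Good_vac : Good 0 (expv E 0).
Proof.
have z : pairing AE 0 0 = 0 by rewrite /pairing !mul0mx mxE.
split; first by rewrite L0_expv // z mul0r.
exists 0%N, (tn (expv E 0 : restr E) (expv F a)); split.
- apply: tspan_gen; last exact: ZK_exp.
  by apply: zspan_gen; exists 0, [::].
- by rewrite tqmE /= cpr_expv scale1r.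
- by move=> n n0; rewrite LT_tn !Lv_expv // tn0r [tn (0 : restr E) _]tn0l addr0.
rewrite LT_tn !L0_expv // z mul0r scale0r [tn (0 : restr E) _]tn0l.
by rewrite tnZr !add0r.
Qed.

Lemma HZZ (n : int) t : HZ t -> HZ (n%:~R *: t).
Proof. exact: zspanZ. Qed.

Lemma Good_0 h : Good h 0.
Proof.
split; first by rewrite linear0 scaler0.
exists 0%N, 0; split; rewrite ?linear0 ?scaler0 //.
- exact: zspan_0.
- by rewrite (@tn0l (restr E)).
- by move=> n _; rewrite linear0.
Qed.

Lemma Good_sub h u v : Good h u -> Good h v -> Good h (u - v).
Proof.
move=> [hu [N [t [tz tc tn0 th]]]] [hv [N' [t' [tz' tc' tn0' th']]]].
split; first by rewrite linearB /= hu hv scalerBr.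
exists (N + N')%N, ((c%:~R ^+ N' : rat) *: t - (c%:~R ^+ N : rat) *: t'); split.
- by apply: zspan_B; rewrite intrXz; apply: HZZ.
- rewrite linearB /= ![tqm _ _ (_ *: _)]linearZ /= tc tc' -!tnZr !scalerA -!exprD [(N' + N)%N]addnC.
  by rewrite -(tnBl (u : restr E)).
- by move=> n n0; rewrite linearB /= ![LT _ (_ *: _)]linearZ /= tn0 // tn0' // !scaler0 subrr.
- by rewrite linearB /= ![LT _ (_ *: _)]linearZ /= th th' scalerBr [_ *: (_ *: t)]scalerC [_ *: (_ *: t')]scalerC.
Qed.

Section Modes.
Variables (b : 'rV[int]_rE) (h : nat) (k : int) (B : nat -> {linear F -> F}).
Hypothesis b_wt : wt AE b = h.+1%:R.
Hypothesis hB : field A a w c k (- h%:Z) B.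

(** The corrected mode of e^b: a residue of the product of the field of e^b, of weight h+1, with the
    series B, of weight -h. On each vector the sum is finite, whence the cutoff. *)
Definition AK K t : H := \sum_(i < K) tqm (rlin (Y (k + i%:Z) (expv E b))) (B i) t.
Fact AK_linear K : linear (AK K).
Proof.
move=> q x y; rewrite /AK scaler_sumr -big_split; apply: eq_bigr => i _ /=.
by rewrite linearP.
Qed.
HB.instance Definition _ K := GRing.isLinear.Build rat H H _ (AK K) (AK_linear K).

Lemma AK_tn K u s : AK K (tn (u : restr E) s)
  = \sum_(i < K) tn (Y (k + i%:Z) (expv E b) u : restr E) (B i s).
Proof. by apply: eq_bigr => i _; rewrite tqmE. Qed.

Lemma Y_large u : exists n0 : nat, forall n : int, n0%:Z <= n -> Y n (expv E b) u = 0.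
Proof.
case: YP => _ tr _ _ _; have [n0 hn0] := tr (expv E b) u.
by exists (absz n0) => n le; apply: hn0; lia.
Qed.

Lemma AK_stable t : exists K0, forall K, (K0 <= K)%N -> AK K t = AK K0 t.
Proof.
have st u s : exists K0, forall K, (K0 <= K)%N -> AK K (tn (u : restr E) s) = AK K0 (tn (u : restr E) s).
  have [n0 hn0] := Y_large u; exists (n0 + absz k)%N => K le; rewrite !AK_tn.
  rewrite -(big_mkord xpredT (fun i => tn (Y (k + i%:Z) (expv E b) u : restr E) (B i s))).
  rewrite (big_cat_nat (n := (n0 + absz k)%N)) //= big_mkord.
  rewrite [X in _ + X]big_nat_cond [X in _ + X]big1 ?addr0 // => i /andP[/andP[le2 _] _].
  by rewrite hn0 ?(@tn0l (restr E)) //; lia.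
elim/tq_ind: t => [|u s t [K1 h1]]; first by exists 0%N => K _; rewrite !linear0.
have [K2 h2] := st u s; exists (maxn K1 K2) => K le.
by rewrite !linearD /= h1 ?h2 ?[AK (maxn _ _) t]h1 ?[AK (maxn _ _) (tn _ _)]h2 //; lia.
Qed.

(** Residues of fields of weight 1 commute with L_n: the commutator term of e^b at index i cancels
    that of B at index i+n. *)
Lemma AK_LT (n : nat) t : (0 < n)%N -> HZ t ->
  exists K0, forall K, (K0 <= K)%N -> LT n%:Z (AK K t) = AK K (LT n%:Z t).
Proof.
move=> n0; elim=> [_ [u [s [_ [_ hs] ->]]]||x y _ [K1 h1] _ [K2 h2]]; last 2 first.
- by exists 0%N => K _; rewrite !linear0.
- by exists (maxn K1 K2) => K le; rewrite !linearB /= h1 ?h2 //; lia.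
have [m0 hm0] := Y_large u; exists (m0 + absz k + n).+1%N => -[//|K] le.
rewrite LT_tn [AK _ (_ + _)]linearD /= !AK_tn linear_sum -big_split /=.
pose X i := ((h%:Z * n.+1%:Z - k - i%:Z)%:~R : rat) *: tn (Y (n%:Z + (k + i%:Z)) (expv E b) u : restr E) (B i s).
pose Z i := ((k + i%:Z - n%:Z - h%:Z * n.+1%:Z)%:~R : rat) *: tn (Y (k + i%:Z) (expv E b) u : restr E) (B (i - n)%N s).
rewrite (eq_bigr (fun i : 'I_K.+1 => (tn (Y (k + i%:Z) (expv E b) (Lv AE n%:Z u) : restr E) (B i s)
   + tn (Y (k + i%:Z) (expv E b) u : restr E) (B i (Lv A n%:Z s)))
   + (X i + if (n <= i)%N then Z i else 0))); last first.
  move=> i _; rewrite LT_tn (Lv_Yexp AE_sym AE_det YP Y_osc Y_D) b_wt (field_L hB _ hs n0).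
  rewrite (tnDl (Y (k + i%:Z) (expv E b) (Lv AE n%:Z u) : restr E)) tnDr addrACA; congr (_ + (_ + _)).
    rewrite tn_ratl /X; congr (_ *: _).
    by rewrite -natr1 !rmorphB !rmorphM /= -!pmulrn rmorphD /=; ring.
  by case: ifP => _; rewrite ?tn0r // /Z -tnZr mulNr.
rewrite big_split /= -[RHS]addr0; congr (_ + _).
rewrite big_split /= (big_ord_drop n K Z).
rewrite -(big_mkord xpredT X) (big_cat_nat (n := (K.+1 - n)%N)) //=; last by lia.
(* The last n terms have no partner, but there the modes of e^b already kill u. *)
rewrite [X in _ + X + _]big_nat_cond [X in _ + X + _]big1 ?addr0; last first.
  move=> i /andP[/andP[le1 lt1] _]; rewrite /X hm0 ?(@tn0l (restr E)) ?scaler0 //; lia.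
rewrite big_mkord -big_split big1 //= => i _; rewrite /X /Z addnK.
have -> : k + (i + n)%N%:Z = n%:Z + (k + i%:Z) by lia.
rewrite -scalerDl -rmorphD /= (_ : _ + _ = 0) ?scale0r //; lia.
Qed.

Lemma AK_LT0 t K : LT 0 (AK K t) = AK K (LT 0 t) + (h%:R - k%:~R) *: AK K t.
Proof.
move: t; apply: tq_eq => [x y|x y|u s]; first by rewrite !linearB.
  by rewrite [LT 0 (x - y)]linearB /= ![AK K (_ - _)]linearB /= scalerBr opprD addrACA.
rewrite LT_tn [AK _ (_ + _)]linearD /= !AK_tn linear_sum scaler_sumr -!big_split /=.
apply: eq_bigr => i _; rewrite LT_tn.
rewrite -[0 : int]/(0%N%:Z) (Lv_Yexp AE_sym AE_det YP Y_osc Y_D) b_wt (field_L0 hB).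
rewrite (tnDl (Y (k + i%:Z) (expv E b) (Lv AE 0 u) : restr E)) tnDr tn_ratl tnZr add0r.
rewrite rmorphD /= -pmulrn -natr1 mulr1.
set p1 := tn _ (B i s); set p2 := tn _ (B i (Lv A 0 s)); set p3 := tn _ (B i s).
move: p1 p2 p3 => p1 p2 p3.
lin_combine rat (tq (restr E) F).
Qed.

Lemma AK_cpr t K : tqm idfun cpr (AK K.+1 t) = tqm (rlin (Y k (expv E b))) cpr t.
Proof.
move: t; apply: tq_eq => [x y|x y|u s]; first by rewrite !linearB.
  by rewrite linearB.
rewrite AK_tn linear_sum big_ord_recl big1 ?addr0 => [|i _]; rewrite /= !tqmE.
  by rewrite /= /rlin ?addr0 (field_0 hB).
by rewrite /= /cpr (field_coef hB) scale0r tn0r.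
Qed.

Lemma AK_HZ t K : HZ t -> exists N, HZ ((c%:~R ^+ N : rat) *: AK K t).
Proof.
have [N hN] : exists N, forall i, (i < K)%N -> forall s, ZF s -> ZF ((c%:~R ^+ N : rat) *: B i s).
  have [|N hN] := @eventually_all (fun i N => forall s, ZF s -> ZF ((c%:~R ^+ N : rat) *: B i s)) K.
    by move=> i _; have [N hN] := field_J hB i; exists N => N' le; apply: Jop_widen le hN.
  by exists N => i lt; apply: hN.
move=> ht; exists N.
apply: (zspan_map (f := fun t => (c%:~R ^+ N : rat) *: AK K t)) ht => [x y|_ [u [s [hu [hs hk] ->]]]].
  by rewrite linearB scalerBr.
rewrite AK_tn scaler_sumr; apply: zspan_sum => i _; rewrite -tnZr; apply: tspan_gen.
  exact: (Y_Zf AE_sym AE_det YP Y_osc Y_D Y_exp).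
split; first exact: hN.
have [hp ha] := field_K2 i hB hk.
by split=> [l|]; rewrite linearZ /= ?hp ?scaler0 ?ha.
Qed.

Lemma Good_mode l u : Good l u -> Good (l + h%:R - k%:~R) (Y k (expv E b) u).
Proof.
move=> [hu [N [t [tz tc tn0 th]]]]; split.
  rewrite -[0 : int]/(0%N%:Z) (Lv_Yexp AE_sym AE_det YP Y_osc Y_D) b_wt hu.
  rewrite [Y k _ (_ *: _)]linearZ /= add0r -natr1; lin_combine rat (fock_space E).
have [K0 hK0] := AK_stable t; pose K := K0.+1.
have eK K' : (K <= K')%N -> AK K' t = AK K t by move=> le; rewrite hK0 ?[RHS]hK0 //; lia.
have [N' hz] := AK_HZ K tz; exists (N' + N)%N, ((c%:~R ^+ N' : rat) *: AK K t); split=> //.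
- rewrite linearZ /= AK_cpr.
  transitivity ((c%:~R ^+ N' : rat) *: tqm (rlin (Y k (expv E b))) idfun (tqm idfun cpr t)).
    by congr (_ *: _); apply/esym/tqm_comp.
  by rewrite tc tqmE -tnZr scalerA exprD.
- move=> n n0; rewrite linearZ /=; have [K1 hK1] := AK_LT n0 tz.
  rewrite -(eK (maxn K K1)) ?leq_maxl // hK1 ?leq_maxr //.
  by rewrite tn0 // linear0 scaler0.
- rewrite linearZ /= AK_LT0 th linearZ /=; move: (AK K t) => X; lin_combine rat (tq (restr E) F).
Qed.
End Modes.

Definition GoodSum u := exists s : seq (rat * E), (forall p, p \in s -> Good p.1 p.2)
  /\ u = \sum_(p <- s) p.2.

Lemma GoodSum_sub u v : GoodSum u -> GoodSum v -> GoodSum (u - v).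
Proof.
move=> [s [hs ->]] [s' [hs' ->]].
exists (s ++ [seq (p.1, - p.2) | p <- s']); split=> [p|]; last first.
  by rewrite big_cat big_map /= sumrN.
rewrite mem_cat => /orP[/hs //|/mapP[q qs ->]] /=; rewrite -sub0r.
by apply: Good_sub (hs' q qs); apply: Good_0.
Qed.

Lemma GoodSum_mode b k u : GoodSum u -> GoodSum (Y k (expv E b) u).
Proof.
(* e^0 is the vacuum: its weight 0 is not of the form h+1, but its modes are the identity or zero.
   All other e^b have positive integral weight. *)
have [->|b0] := eqVneq b 0.
  move=> hu; rewrite (Y_vac YP); case: ifP => // _.
  by exists [::]; split=> //; rewrite big_nil.
move=> [s [hs ->]]; have [m hm] := AE_even b; have := AE_pos b0; rewrite hm => m0.
have bw : wt AE b = (absz m).-1.+1%:R.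
  rewrite /wt hm (pmulrn _ (absz m).-1.+1) intrM; have -> : (absz m).-1.+1%:Z = m by lia.
  by field.
have [B hB] := field_exists F A_sym A_det w_null w_a c0 k (absz m).-1.
exists [seq (p.1 + (absz m).-1%:R - k%:~R, Y k (expv E b) p.2) | p <- s]; split=> [p|].
  by move=> /mapP[q /hs hq ->]; apply: Good_mode bw hB _ _ hq.
by rewrite linear_sum big_map.
Qed.

(** Generation by modes only gives a sum of good vectors of various weights; those of weight h are
    isolated by their L_0-eigenvalue. *)
Theorem ZE_Good h u : ZE u -> Lv AE 0 u = h *: u -> Good h u.
Proof.
move=> hz hu; have [s [hs e]] : GoodSum u.
  move: hz; apply: (Zf_gen AE_sym AE_det YP Y_osc Y_D Y_exp).
  - exists [:: (0, expv E 0)]; split; last by rewrite big_seq1.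
    by move=> p; rewrite inE => /eqP ->; apply: Good_vac.
  - exact: GoodSum_sub.
  - exact: GoodSum_mode.
rewrite (@eigen_component E (Lv AE 0) s h u) // => [|p ps]; last exact: good_L0 (hs p ps).
rewrite big_seq_cond; elim/big_ind: _ => [|x y hx hy|p /andP[ps /eqP <-]].
- exact: Good_0.
- by rewrite -[y]opprK -[- y]sub0r; apply: Good_sub => //; apply: Good_sub => //; apply: Good_0.
- exact: hs.
Qed.
End DressedVectors.

(** * Transport to the monster vertex algebra *)

Lemma tspan_sub (V : lmodType Zhalf) (F : lmodType rat) (P P' : V -> Prop) (Q Q' : F -> Prop) t :
  (forall v, P v -> P' v) -> (forall x, Q x -> Q' x) -> tspan P Q t -> tspan P' Q' t.
Proof.
move=> hP hQ h; rewrite -[t]tqm_id.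
by apply: tspan_map h => [v|x] /=; [apply: hP | apply: hQ].
Qed.

Section Collapse.
Variable M : lmodType rat.
Fact collapse_bilinear :
  bilinear_map (M := restr M) (N := restr rat^o) (P := restr M) (fun x q => (q : rat) *: (x : M)).
Proof.
split=> [q b x y|x b q q']; first by rewrite [LHS]scalerDr scalerA mulrC -scalerA.
by rewrite [LHS]scalerDl [(b *: q : restr rat^o)]/(Zhalf_val b * q) -scalerA.
Qed.

Lemma tn_collapse (x : M) (q : rat) : q != 0 -> tn (x : restr M) (q : rat^o) = 0 -> x = 0.
Proof.
move=> q0 e.
have := tensor_liftE (x : restr M) (q : restr rat^o) collapse_bilinear.
rewrite -[tens _ _]/(tn (x : restr M) (q : rat^o)) e.
have := tensor_lift_linear collapse_bilinear; set f := tensor_lift _ => lin.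
have -> : f 0 = 0.
  by have := lin (-1) 0 0; rewrite scaleN1r addNr scaleN1r addNr.
by move/esym/eqP; rewrite [_ == _](scaler_eq0 q) (negPf q0) => /eqP.
Qed.
End Collapse.

(** Flatness by hand: each coordinate in F is a single tensor u times 1/d, for which the injectivity
    of f on N applies. *)
Lemma tqm_inj (V : lmodType Zhalf) (N : submodule V) (M : lmodType rat)
    (f : {linear V -> restr M}) (r : nat) (F : fock_model r) (t : tq V F) :
  (forall v, N v -> f v = 0 -> v = 0) -> tspan (in_submod N) (fun=> True) t ->
  tqm f idfun t = 0 -> t = 0.
Proof.
move=> inj ht h0; apply: tq_coords => b m.
have [|u [d [hu d0 e]]] := @tspan_rat V N (tcoef V F b m t).
  by apply: tspan_map ht.
suff u0 : u = 0 by rewrite e u0 tn0l.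
apply: (inj u hu).
have : tqm f idfun (tcoef V F b m t) = 0.
  transitivity (tcoef (restr M) F b m (tqm f idfun t)); last by rewrite h0 linear0.
  rewrite /tcoef; transitivity (tqm f (coef b m) t); last symmetry; exact: tqm_comp.
rewrite e tqmE /=; apply: (@tn_collapse M (f u)).
by rewrite invr_eq0 intr_eq0.
Qed.

Section DressedMonster.
Variables (G : finGroupType) (V : monster_va G).
Variables (r : nat) (F : fock_model r) (A : 'M[int]_r) (a w : 'rV[int]_r) (c : int).
Implicit Types (v : V) (t : tq V F).
Local Notation ZK := (@ZK r F A a w).
Local Notation cpr := (@cpr r F a).

Definition LV n t : tq V F := tqm (@V_L G V n) idfun t + tqm idfun (Lv A n) t.
Fact LV_linear n : linear (LV n).
Proof. by move=> k x y; rewrite /LV !linearP /= scalerDr addrACA. Qed.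
HB.instance Definition _ n := GRing.isLinear.Build rat (tq V F) (tq V F) _ (LV n) (LV_linear n).

(** The exponent N is kept explicit because two dressings can be added only over the same power of
    c. *)
Definition dressed (h : rat) (v : V) (N : nat) t :=
  [/\ tspan (fun=> True) ZK t, tqm idfun cpr t = tn v ((c%:~R ^+ N : rat) *: expv F a),
    forall n : nat, (0 < n)%N -> LV n%:Z t = 0
    & LV 0 t = (h + (pairing A a a)%:~R / 2) *: t].

Definition GoodV h v := exists N t, dressed h v N t.

Lemma Zhalf_scale_span (q : Zhalf) t :
  tspan (fun=> True) ZK t -> tspan (fun=> True) ZK (Zhalf_val q *: t).
Proof.
apply: (zspan_map (f := fun t => Zhalf_val q *: t)) => [x y|_ [v [x [_ hx ->]]]].
  by rewrite scalerBr.
by rewrite -tnZl; apply: tspan_gen.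
Qed.

Lemma dressedZ h v N t (q : Zhalf) : dressed h v N t -> dressed h (q *: v) N (Zhalf_val q *: t).
Proof.
move=> [tz tc tn0 th]; split.
- exact: Zhalf_scale_span.
- by rewrite linearZ /= tc -tnZl.
- by move=> n n0; rewrite linearZ /= tn0 // scaler0.
- by rewrite linearZ /= th scalerC.
Qed.

Lemma dressedD h v v' N t t' :
  dressed h v N t -> dressed h v' N t' -> dressed h (v + v') N (t + t').
Proof.
move=> [tz tc tn0 th] [tz' tc' tn0' th']; split.
- exact: zspanD.
- by rewrite linearD /= tc tc' -tnDl.
- by move=> n n0; rewrite linearD /= tn0 // tn0' // addr0.
- by rewrite linearD /= th th' -scalerDr.
Qed.

Lemma dressed_exp h v N t k : dressed h v N t -> dressed h v (k + N) ((c%:~R ^+ k : rat) *: t).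
Proof.
move=> [tz tc tn0 th]; split.
- by rewrite intrXz; apply: zspanZ.
- by rewrite linearZ /= tc -tnZr scalerA exprD.
- by move=> n n0; rewrite linearZ /= tn0 // scaler0.
- by rewrite linearZ /= th scalerC.
Qed.

Lemma dressed_act h v N t g :
  dressed h v N t -> dressed h (mva_act V g v) N (tqm (mva_act V g) idfun t).
Proof.
have LVg n t' : LV n (tqm (mva_act V g) idfun t') = tqm (mva_act V g) idfun (LV n t').
  move: t'; apply: tq_eq => [x y|x y|u s]; first by rewrite !linearB.
    by rewrite [LV n (x - y)]linearB linearB.
  rewrite /LV linearD /= !tqmE /=; congr (tn _ _ + _).
  by rewrite /V_L /vir_mode mva_act_Y mva_act_omega.
move=> [tz tc tn0 th]; split.
- by apply: tspan_map tz.
- transitivity (tqm (mva_act V g) idfun (tqm idfun cpr t)); last by rewrite tc tqmE.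
  by transitivity (tqm (mva_act V g) cpr t); last symmetry; apply: tqm_comp.
- by move=> n n0; rewrite LVg tn0 // linear0.
- by rewrite LVg th linearZ.
Qed.

Lemma GoodVZ h v q : GoodV h v -> GoodV h (q *: v).
Proof. by move=> [N [t ht]]; exists N, (Zhalf_val q *: t); apply: dressedZ. Qed.

Lemma GoodVD h v v' : GoodV h v -> GoodV h v' -> GoodV h (v + v').
Proof.
move=> [N [t ht]] [N' [t' ht']].
exists (N + N')%N, ((c%:~R ^+ N' : rat) *: t + (c%:~R ^+ N : rat) *: t').
by apply: dressedD; [rewrite addnC|]; apply: dressed_exp.
Qed.

Lemma GoodV_act h v g : GoodV h v -> GoodV h (mva_act V g v).
Proof. by move=> [N [t ht]]; exists N, (tqm (mva_act V g) idfun t); apply: dressed_act. Qed.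

Definition fixed (z : G) : V -> Prop := fun v => mva_act V z v = v.

Fact fixed0 z : fixed z 0.
Proof. exact: linear0. Qed.
Fact fixedP z k x y : fixed z x -> fixed z y -> fixed z (k *: x + y).
Proof. by move=> hx hy; rewrite /fixed linearP hx hy. Qed.
Definition fixed_submod z : submodule V := Submodule (fixed0 z) (@fixedP z).

Lemma fixed_L z n v : fixed z v -> fixed z (@V_L G V n v).
Proof. by move=> hv; rewrite /fixed /V_L /vir_mode mva_act_Y mva_act_omega hv. Qed.

Section FixedPoints.
Variables (z : G) (rE : nat) (E : fock_model rE) (AE : 'M[int]_rE) (phi : {linear V -> restr E}).
Hypotheses (AE_sym : AE^T = AE) (AE_det : \det AE != 0).
Hypothesis E_good : forall h u, zspan (@is_schv rE E AE) u -> Lv AE 0 u = h *: u ->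
  @Good rE E AE r F A a w c h u.
Hypothesis phi_inj : forall v, fixed z v -> phi v = 0 -> v = 0.
Hypothesis phi_im : forall x : E,
  (exists k : nat, zspan (@is_schv rE E AE) (2 ^+ k *: x)) /\ thetaF x = x <->
  (exists2 v, fixed z v & phi v = x).
Hypothesis phi_L : forall n v, fixed z v -> phi (@V_L G V n v) = Lv AE n (phi v : E).
Local Notation ZE := (zspan (@is_schv rE E AE)).
Local Notation LT := (@LT rE E AE r F A).

Lemma lift_fixed (t : tq (restr E) F) : tspan (fun x : restr E => ZE x /\ thetaF (x : E) = x) ZK t ->
  exists2 t', tspan (in_submod (fixed_submod z)) ZK t' & tqm phi idfun t' = t.
Proof.
elim=> [_ [u [s [[hu hu'] hs ->]]]||x y _ [x' hx' ex] _ [y' hy' ey]].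
- have [|v hv <-] := (phi_im u).1; first by split=> //; exists 0%N; rewrite expr0 scale1r.
  by exists (tn v s); [apply: tspan_gen | rewrite tqmE].
- by exists 0; [apply: zspan_0 | rewrite linear0].
- by exists (x' - y'); [apply: zspan_B | rewrite linearB /= ex ey].
Qed.

(** Twice the average over theta; it keeps vectors integral, and the 2 is divided out in the
    Z[1/2]-module V. *)
Definition sym_theta (x : restr E) : restr E := (x : E) + thetaF (x : E).
Fact sym_theta_linear : linear sym_theta.
Proof. by move=> k x y; rewrite /sym_theta linearP /= addrACA [LHS]addrC scalerDr addrC. Qed.
HB.instance Definition _ := GRing.isLinear.Build Zhalf (restr E) (restr E) _ sym_theta sym_theta_linear.

Lemma LT_phi n t : tspan (in_submod (fixed_submod z)) (fun=> True) t ->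
  tqm phi idfun (LV n t) = LT n (tqm phi idfun t).
Proof.
elim=> [_ [v [s [hv _ ->]]]||x y _ hx _ hy]; first 1 last.
- by rewrite !linear0.
- by rewrite [LV n (x - y)]linearB ![tqm phi idfun (_ - _)]linearB /= hx hy linearB.
rewrite /LV linearD /= !tqmE /= LT_tn; congr (tn _ _ + _).
exact: phi_L.
Qed.

(** A power of 2 times [phi v] is an integral vector fixed by theta and so has a dressing.
    Symmetrized under theta, the dressing lifts along [phi], and since [phi] is injective on fixed
    points the required equations can be checked in the lattice algebra. *)
Lemma fixed_good k v : fixed z v -> V_ V k v -> GoodV (k + 1)%:~R v.
Proof.
move=> hz hk.
have [[j hj] ht] : (exists k : nat, ZE (2 ^+ k *: (phi v : E))) /\ thetaF (phi v : E) = phi v.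
  by apply/phi_im; exists v.
pose q : Zhalf := 2 ^+ j.
have hq : Zhalf_val q = 2 ^+ j by rewrite [LHS](rmorphXn (val : {rmorphism Zhalf -> rat})) rmorph_nat.
have hphi : phi (q *: v) = (2 ^+ j *: (phi v : E)) by rewrite linearZ /= -hq.
have hu0 : Lv AE 0 (phi v : E) = (k + 1)%:~R *: (phi v : E).
  rewrite -phi_L // [@V_L G V 0 v]hk linearZ /=.
  by rewrite -[LHS]/(Zhalf_val _ *: (phi v : E)) intr_Zhalf.
have := @E_good (k + 1)%:~R (2 ^+ j *: (phi v : E)) hj.
case; first by rewrite linearZ /= hu0 scalerC.
move=> _ [N [t [tz tc tn0 th]]].
pose T := tqm sym_theta idfun t.
have [t' ht' eT] : exists2 t', tspan (in_submod (fixed_submod z)) ZK t' & tqm phi idfun t' = T.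
  apply: lift_fixed; apply: tspan_map tz => // u hu; split.
    by apply: zspanD => //; apply: theta_Zform.
  by rewrite /= /sym_theta linearD /= thetaK addrC.
have LTT n : LT n T = tqm sym_theta idfun (LT n t).
  rewrite /T; move: (t); apply: tq_eq => [x y|x y|u s]; first by rewrite !linearB.
    by rewrite [LT n (x - y)]linearB linearB.
  have eg (x : restr E) (y : F) : tqm sym_theta idfun (tn x y) = tn (sym_theta x) y by exact: tqmE.
  transitivity (LT n (tn (sym_theta u) s)); first by congr (LT n _); exact: eg.
  transitivity (tqm sym_theta idfun (tn (Lv AE n (u : E) : restr E) s + tn (u : restr E) (Lv A n s))).
    rewrite LT_tn [RHS]linearD; congr (_ + _); last by symmetry; exact: eg.
    rewrite [RHS](eg (Lv AE n (u : E)) s); congr (tn _ _).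
    by rewrite /sym_theta linearD /= -theta_Lv.
  by congr (tqm sym_theta idfun _); rewrite LT_tn.
have ht1 : tspan (in_submod (fixed_submod z)) (fun=> True) t' by apply: tspan_sub ht'.
have inj t1 : tspan (in_submod (fixed_submod z)) (fun=> True) t1 -> tqm phi idfun t1 = 0 -> t1 = 0.
  exact: (tqm_inj (N := fixed_submod z) phi_inj).
have hL n : tspan (in_submod (fixed_submod z)) (fun=> True) (LV n t').
  rewrite /LV; apply: zspanD; apply: tspan_map ht1 => // u; exact: fixed_L.
suff hd : dressed (k + 1)%:~R ((2 * q) *: v) N t'.
  have [b hb] : exists b : Zhalf, b * (2 * q) = 1.
    suff hh : (2 ^+ j.+1)^-1 \in Zhalf_pred.
      exists (MkZhalf hh); apply: val_inj.
      transitivity ((2 ^+ j.+1)^-1 * (2 * 2 ^+ j) : rat); last first.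
        by rewrite -exprS mulVf // expf_neq0.
      by rewrite -hq !rmorphM (rmorph_nat (val : {rmorphism Zhalf -> rat}) 2).
    by apply/asboolP; exists j.+1; rewrite mulVf ?rpred1 // expf_neq0.
  rewrite -[v]scale1r -hb -scalerA; apply: GoodVZ; exists N, t'; exact: hd.
split.
- exact: tspan_sub ht'.
- apply/eqP; rewrite -subr_eq0; apply/eqP/inj.
    apply: zspan_B; first by apply: tspan_map ht1.
    apply: tspan_gen => //; rewrite -[_ *: v]addr0.
    by apply: fixedP => //; apply: fixed0.
  rewrite linearB /= tqmE.
  have -> : tqm phi idfun (tqm idfun cpr t') = tqm sym_theta idfun (tqm idfun cpr t).
    transitivity (tqm idfun cpr T).
      rewrite -eT; transitivity (tqm phi cpr t'); last symmetry; exact: tqm_comp.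
    transitivity (tqm sym_theta cpr t); last symmetry; exact: tqm_comp.
  have e1 : phi ((2 * q) *: v) = sym_theta (2 ^+ j *: (phi v : E) : E).
    rewrite -scalerA scaler_nat mulr2n raddfD /= hphi /sym_theta.
    by congr (_ + _); rewrite linearZ /= ht.
  rewrite e1 tc; apply/eqP; rewrite subr_eq0; apply/eqP; exact: tqmE.
- move=> n n0; apply: inj => //.
  by rewrite LT_phi // eT LTT tn0 // linear0.
- apply/eqP; rewrite -subr_eq0; apply/eqP/inj.
    apply: zspan_B; first exact: (hL 0).
    move: (_ + _ : rat) => y0; apply: (zspan_map (f := fun t => y0 *: t)) ht1 => [x y|_ [u [s [hu _ ->]]]]; first by rewrite scalerBr.
    by rewrite -tnZr; apply: tspan_gen.
  rewrite linearB /= linearZ /= LT_phi // eT LTT th linearZ.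
  by rewrite subrr.
Qed.
End FixedPoints.

(** As 2 is invertible, V is the sum of the fixed points of z, z' and z z', and the monster
    conjugates these three into each other. *)
Lemma decomposition_good z z' : #[z]%g = 2%N -> commute z z' -> z' \in (z ^: [set: G])%g ->
  (z * z')%g \in (z ^: [set: G])%g ->
  (forall k v, fixed z v -> V_ V k v -> GoodV (k + 1)%:~R v) ->
  forall k v, V_ V k v -> GoodV (k + 1)%:~R v.
Proof.
move=> oz cz hz' hzz' hg k v hv.
have conj y u : y \in (z ^: [set: G])%g -> fixed y u -> V_ V k u -> GoodV (k + 1)%:~R u.
  move=> /imsetP[x _ ->] hy hu.
  have -> : u = mva_act V x^-1%g (mva_act V x u) by rewrite -mva_actM mulVg mva_act1.
  apply/GoodV_act/hg; last exact: act_linear_V.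
  by rewrite /fixed -{2}hy -!mva_actM conjgE mulKVg.
have z2 : (z * z = 1)%g by rewrite -[(z * z)%g]/(z ^+ 2)%g -oz expg_order.
have sq y : y \in (z ^: [set: G])%g -> (y * y = 1)%g.
  by move=> /imsetP[x _ ->]; rewrite -conjMg z2 conj1g.
have VD (x y : V) : V_ V k x -> V_ V k y -> V_ V k (x + y).
  by move=> hx hy; rewrite -[x]scale1r; apply: submodP.
have act g : V_ V k (mva_act V g v) by apply: act_linear_V.
have fix_ g : (g * g = 1)%g -> fixed g (v + mva_act V g v).
  by move=> g2; rewrite /fixed linearD /= -mva_actM g2 mva_act1 addrC.
have [b hb] : exists b : Zhalf, b * 2 = 1.
  have hh : 2^-1 \in Zhalf_pred by apply/asboolP; exists 1%N; rewrite expr1 mulVf ?rpred1.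
  by exists (MkZhalf hh); apply: val_inj; rewrite rmorphM (rmorph_nat (val : {rmorphism Zhalf -> rat}) 2) [LHS]mulVf.
pose S := v + mva_act V z v + (mva_act V z' v + mva_act V (z * z')%g v).
(* Twice v is the sum of its three symmetrizations minus its sum S over the four-group, and S is
   fixed by z. *)
have -> : v = b *: ((v + mva_act V z v) + (v + mva_act V z' v)
                    + ((v + mva_act V (z * z')%g v) + (-1) *: S)).
  rewrite -[LHS]scale1r -{1}hb -scalerA; congr (_ *: _).
  rewrite /S scaleN1r scaler_nat mulr2n.
  move: (mva_act V z v) (mva_act V z' v) (mva_act V (z * z')%g v) => x y t.
  by lin_combine Zhalf V.
apply: GoodVZ; apply: GoodVD; apply: GoodVD.
- by apply: hg; [apply: fix_ | apply: VD].
- by apply: (conj z'); [|apply/fix_/sq|apply: VD].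
- by apply: (conj (z * z')%g); [|apply/fix_/sq|apply: VD].
apply/GoodVZ/hg; last by apply: (VD _ _ (VD _ _ _ _) (VD _ _ _ _)).
rewrite /fixed /S !linearD /= -!mva_actM mulgA z2 mva_act1 mul1g.
by rewrite [_ + v]addrC [mva_act V z' v + _]addrC.
Qed.
End DressedMonster.

Theorem monster_good (G : finGroupType) (V : monster_va G) (r : nat) (F : fock_model r)
    (A : 'M[int]_r) (a w : 'rV[int]_r) (c : int) :
  A^T = A -> \det A != 0 -> pairing A w w = 0 -> pairing A w a = c -> c != 0 ->
  forall k v, V_ V k v -> GoodV F A a w c (k + 1)%:~R v.
Proof.
move=> A_sym A_det w_null w_a c0.
have [A0 [YL [z [z' [phi [lee lva [oz cz h1 h2] [inj im] [p1 pw pY]]]]]]] := mva_leech V.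
have [s0 d0 even0 pos0 _] := lee; have [YP Yosc YD Yexp] := lva.
have dn0 : \det A0 != 0 by rewrite d0.
have hp (n : int) v : mva_act V z v = v -> phi (V_L n v) = YL (n + 1) (fock_omega A0) (phi v).
  by move=> hv; rewrite -pw -(pY _ _ _ (mva_act_omega V z) hv).
pose E := fock_mod 24.
have Yosc' i n (x : E) : YL n (mulv (i, 0%N) (expv E 0)) x = hv A0 (delta_mx 0 i) n x.
  rewrite -heisE -Yosc; congr (YL n _ x); rewrite mulv_vec; congr (bvec _ _).
  exact: mulm1.
have YD' (x : E) : YL (-2) x (expv E 0) = fD x by rewrite -fock_DE -YD.
have om : fock_omega A0 = (omega E A0 : fock 24).
  rewrite /omega /fock_omega; apply: eq_bigr => i _; apply: eq_bigr => j _.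
  congr (_ *: _); rewrite !mulv_vec; congr (bvec _ _); rewrite /mon_mul; congr (mulcm _ _).
  by symmetry; exact: mulm1.
have Yom (n : int) (y : E) : YL (n + 1) (fock_omega A0) y = Lv A0 n y.
  rewrite om; exact: (@Y_omega 24 E A0 YL s0 dn0 YP Yosc').
apply: (decomposition_good oz cz h1 h2).
apply: (@fixed_good G V r F A a w c z 24 E A0 phi).
- have hg := @ZE_Good 24 E A0 YL s0 dn0 even0 pos0 YP Yosc' YD' Yexp r F A a w c A_sym A_det w_null w_a c0.
  exact: hg.
- exact: inj.
- move=> x; split.
    move=> [[k hk] ht]; apply/im; split; last by rewrite fock_thetaE.
    by exists k; apply/lattice_ZformE.
  move=> /im[[k hk] ht]; split; last by rewrite -fock_thetaE.
  by exists k; apply/lattice_ZformE.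
- by move=> n v hv; rewrite (hp n v hv); exact: (Yom n (phi v)).
Qed.

(** * Primary vectors and their pairing *)

Lemma derv_bounded (r : nat) (F : fock_model r) (y : F) :
  exists J : nat, forall v, (J <= v.2)%N -> derv v y = 0.
Proof.
elim/fock_ind: y => [c x y [J1 h1] [J2 h2]|a|v y [J h]].
- by exists (maxn J1 J2) => v le; rewrite linearP /= h1 ?h2 ?scaler0 ?addr0 //; lia.
- by exists 0%N => v _; rewrite derv_expv.
exists (maxn J v.2.+1) => u le; rewrite derv_mulv h ?linear0; last by lia.
by rewrite (_ : (u == v) = false) ?scale0r ?addr0 //; apply/eqP => e; move: le; rewrite e; lia.
Qed.

Section Conformal.
Variables (G : finGroupType) (V : monster_va G).
Local Notation VL := (@V_L G V).
Local Notation one := (mva_one V).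
Local Notation om := (mva_omega V).
Local Notation Y := (@mva_Y G V).

Lemma V_L_comm (m n : int) v : VL m (VL n v) = VL n (VL m v)
  + ((m - n)%:~R *: VL (m + n) v + (if m + n == 0 then (2 * (m ^+ 3 - m))%:~R *: v else 0)).
Proof. by have [_ h] := mva_conformal V; rewrite -(h m n v) addrC subrK. Qed.

Lemma V_L_vac (n : nat) : VL (n%:Z - 1) one = 0.
Proof.
have [_ _ _ h _] := mvaP V; rewrite /V_L /vir_mode.
by have [_] := h om; apply; lia.
Qed.

Lemma V_L_omega : VL (-2) one = om.
Proof. by have [_ _ _ h _] := mvaP V; rewrite /V_L /vir_mode; case: (h om). Qed.

Lemma V_L1_omega : VL 1 om = 0.
Proof.
rewrite -{1}V_L_omega V_L_comm (V_L_vac 2) linear0 add0r addr0.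
by rewrite -[1 + -2 : int]/(0%N%:Z - 1) V_L_vac scaler0.
Qed.

Lemma V_L0_omega : VL 0 om = 2%:~R *: om.
Proof.
rewrite -{1}V_L_omega V_L_comm (V_L_vac 1) linear0 add0r addr0.
by rewrite add0r V_L_omega.
Qed.

(** Contravariance for the conformal vector: it has weight 2 and is killed by L_1, so only the term
    j = 0 survives. *)
Lemma V_form_L n a b : mva_form (VL n a) b = mva_form a (VL (- n) b).
Proof.
apply: val_inj; change (Zhalf_val (mva_form (VL n a) b) = Zhalf_val (mva_form a (VL (- n) b))).
have := @mva_form_contra G V 2 (n + 1) om a b V_L0_omega.
rewrite sqrrN expr1n !big_ord_recl big_ord0 /= addr0 mul1r.
have e1 : vir_mode Y om 1 om = 0 by exact: V_L1_omega.
have e0 : vir_mode Y om 1 0 = 0 by exact: (linear0 (VL 1)).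
have z n' : mva_form a (Y n' 0 b) = 0.
  have [h _] := mva_bilin V n'; have y0 : Y n' 0 b = 0.
    by have := h b (-1) 0 0; rewrite scaleN1r addNr scaleN1r addNr.
  rewrite y0; have [_ h'] := mva_form_bilin V.
  by have := h' a (-1) 0 0; rewrite scaleN1r addNr scaleN1r addNr.
rewrite /bump /= !e1 ?e0 !z !mulr0 !addr0 invr1 mul1r => ->.
congr (Zhalf_val (mva_form a _)); rewrite /V_L /vir_mode; congr (Y _ _ _); lia.
Qed.
End Conformal.

Section SpuriousStates.
Variables (G : finGroupType) (V : monster_va G) (F : fock_model 2) (A : 'M[int]_2).
Variables (a w : 'rV[int]_2) (c : int).
Hypotheses (A_sym : A^T = A) (A_det : \det A != 0).
Hypotheses (w_null : pairing A w w = 0) (w_a : pairing A w a = c) (c0 : c != 0).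
Variables i0 i1 : 'I_2.
Hypothesis ord2 : forall i : 'I_2, i = i0 \/ i = i1.
Hypotheses (w_i0 : w = delta_mx 0 i0) (A_i0 : A i0 i0 = 0) (A_i1 : A i0 i1 != 0) (i01 : i0 != i1).
Local Notation H := (tq V F).
Local Notation LV := (@LV G V 2 F A).
Local Notation cpr := (@cpr 2 F a).
Variable Wf : H -> H -> rat.
Hypothesis Wf_l : forall y, zmod_morphism (Wf^~ y).
Hypothesis Wf_r : forall x, zmod_morphism (Wf x).
Hypothesis WfE : forall v x v' x',
  Wf (tn v x) (tn v' x') = Zhalf_val (mva_form v v') * form A x x'.
Implicit Types (t y : H).

Definition TW k : {linear H -> H} := tqm idfun (hv A w k).
Definition TD : {linear H -> H} := tqm idfun (dpr a : {linear F -> F}).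

Lemma TWE k v x : TW k (tn v x) = tn v (hv A w k x).
Proof. exact: tqmE. Qed.
Lemma TDE v x : TD (tn v x) = tn v (dpr a x).
Proof. exact: tqmE. Qed.
Lemma LV_tn n v x : LV n (tn v x) = tn (V_L n v) x + tn v (Lv A n x).
Proof. by rewrite /LV !tqmE. Qed.

Lemma TW_comm k l t : TW k (TW l t) = TW l (TW k t).
Proof.
by move: t; apply: tq_eq => [x y|x y|v x]; rewrite ?linearB // !TWE (hv_nullC A_sym w_null).
Qed.

Lemma LV_TW n k t : LV n (TW k t) = TW k (LV n t) - k%:~R *: TW (n + k) t.
Proof.
move: t; apply: tq_eq => [x y|x y|v x].
- by rewrite !linearB.
- rewrite [TW (n + k) (x - y)]linearB [LV n (x - y)]linearB ![TW k (_ - _)]linearB /= scalerBr.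
  by rewrite !opprD !opprK addrACA.
rewrite TWE !LV_tn linearD /= !TWE -addrA (Lv_hv A_sym A_det); congr (_ + _).
by rewrite tnBr tnZr.
Qed.

Lemma LV_TD n t : LV n (TD t) = TD (LV n t).
Proof.
move: t; apply: tq_eq => [x y|x y|v x]; first by rewrite !linearB.
  by rewrite [LV n (x - y)]linearB linearB.
by rewrite TDE !LV_tn linearD /= !TDE dpr_Lv.
Qed.

Lemma TW_TD k t : TW k (TD t) = TD (TW k t).
Proof. by move: t; apply: tq_eq => [x y|x y|v x]; rewrite ?linearB // !(TWE, TDE) dpr_hv. Qed.

Lemma TDK t : TD (TD t) = TD t.
Proof. by move: t; apply: tq_eq => [x y|x y|v x]; rewrite ?linearB // !TDE dprK. Qed.

Lemma TW0 t : TD t = t -> TW 0 t = c%:~R *: t.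
Proof.
move=> <-; move: t; apply: tq_eq => [x y|x y|v x]; first by rewrite !linearB.
  by rewrite linearB scalerBr.
by rewrite !(TDE, TWE) hv0_dpr w_a -tnZr.
Qed.

Lemma V_L_tn m n v (x : F) : tn (@V_L G V m (V_L n v)) x = tn (V_L n (V_L m v)) x
  + (m - n)%:~R *: tn (V_L (m + n) v) x
  + (if m + n == 0 then (2 * (m ^+ 3 - m))%:~R else 0) *: tn v x.
Proof.
rewrite V_L_comm !tnDl addrA; congr (_ + _ + _); first by rewrite tnZl intr_Zhalf.
by case: ifP => _; rewrite ?tnZl ?intr_Zhalf // tn0l scale0r.
Qed.

Lemma LV_LV m n (q : rat) :
  (forall x : F, Lv A m (Lv A n x) = Lv A n (Lv A m x) + (m - n)%:~R *: Lv A (m + n) x + q *: x) ->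
  forall t, LV m (LV n t) = LV n (LV m t) + (m - n)%:~R *: LV (m + n) t
    + ((if m + n == 0 then (2 * (m ^+ 3 - m))%:~R else 0) + q) *: t.
Proof.
move=> h; apply: tq_eq => [x y|x y|v x]; first by rewrite !linearB.
  rewrite [LV (m + n) (x - y)]linearB [LV m (x - y)]linearB [LV n (_ - _)]linearB /= !scalerBr.
  have ac (x1 x2 x3 y1 y2 y3 : H) : x1 + x2 + x3 - (y1 + y2 + y3) = (x1 - y1) + (x2 - y2) + (x3 - y3).
    by rewrite !opprD [LHS]addrACA; congr (_ + _); rewrite [LHS]addrACA.
  by rewrite ac.
rewrite !LV_tn ![LV _ (_ + _)]linearD /= !LV_tn V_L_tn h !tnDr !tnZr.
move: (if _ then _ else _) => q0.
set z1 := tn (V_L n _) x; set z2 := tn (V_L (m + n) _) x; set z3 := tn v x.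
set z4 := tn (V_L n v) _; set z5 := tn (V_L m v) _; set z6 := tn v (Lv A n _); set z7 := tn v _.
move: z1 z2 z3 z4 z5 z6 z7 ((m - n)%:~R : rat) => z1 z2 z3 z4 z5 z6 z7 q1.
lin_combine rat (tq V F).
Qed.

Lemma LV_comm m n t : m + n != 0 -> LV m (LV n t) = LV n (LV m t) + (m - n)%:~R *: LV (m + n) t.
Proof.
move=> mn; rewrite (@LV_LV m n 0) ?(negbTE mn) ?addr0 ?scale0r ?addr0 // => x.
by rewrite scale0r addr0 Lv_comm.
Qed.

Lemma LV_comm1 t : LV 1 (LV (-1) t) = LV (-1) (LV 1 t) + (2 : rat) *: LV 0 t.
Proof.
by rewrite (@LV_LV 1 (-1) 0) => [|x]; rewrite ?addr0 ?scale0r ?addr0 // Lv_comm1.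
Qed.

(** 13 = 12 + 1: half of the central charges 24 of V and 2 of the lattice. *)
Lemma LV_comm2 t : LV 2 (LV (-2) t) = LV (-2) (LV 2 t) + (4 : rat) *: LV 0 t + (13 : rat) *: t.
Proof.
by rewrite (@LV_LV 2 (-2) 1) // => x; rewrite Lv_comm2 // divff.
Qed.

Fact degD0 : TD 0 = 0. Proof. exact: linear0. Qed.
Fact degDP k x y : TD x = x -> TD y = y -> TD (k *: x + y) = k *: x + y.
Proof. by move=> hx hy; rewrite linearP /= hx hy. Qed.
Definition degD := Submodule (M := H) degD0 degDP.

Fact TW_deg k t : degD t -> degD (TW k t).
Proof. by move=> h; apply: etrans (esym (TW_TD k t)) (congr1 (TW k) h). Qed.
Fact LV_deg n t : degD t -> degD (LV n t).
Proof. by move=> h; apply: etrans (esym (LV_TD n t)) (congr1 (LV n) h). Qed.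

Lemma TW_fin t : exists J, forall j, (J <= j)%N -> TW j%:Z t = 0.
Proof.
elim/tq_ind: t => [|v x t [J hJ]]; first by exists 0%N => j _; rewrite linear0.
have [J' hJ'] := derv_bounded x; exists (maxn J J').+1 => -[//|j] le.
rewrite linearD /= hJ ?addr0; last by lia.
rewrite TWE hv_pos big1 ?tn0r // => k _; rewrite hJ' ?scaler0 //=; lia.
Qed.

(** Multiplication by an oscillator raises the filtration degree by at most one, its commutators
    with the modes of w being scalars. *)
Lemma Fp_fock (x : F) : exists d, Fp (hv A w) d x.
Proof.
elim/fock_ind: x => [k x y [d1 h1] [d2 h2]|b|v y [d hd]].
- have up e d' (z : F) : Fp (hv A w) d' z -> Fp (hv A w) (e + d') z.
    by elim: e => // e ih h; apply: FpS; [exact: (hv_nullC A_sym w_null)|apply: ih].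
  exists (d1 + d2)%N; apply: Fp_lin; last exact: up.
  by rewrite addnC; apply: up.
- by exists 1%N => k /=; rewrite hv_expv.
exists d.+1; elim: d y hd => [|d ih] y hd.
  by rewrite hd => k /=; rewrite !linear0.
move=> k.
have [q ->] : exists q : rat, hv A w k.+1%:Z (mulv v y) = q *: y + mulv v (hv A w k.+1%:Z y).
  rewrite !hv_pos linear_sum /=; under eq_bigr => l _ do rewrite derv_mulv scalerDr scalerA.
  rewrite big_split /= -scaler_suml addrC; eexists; congr (_ + _).
  by apply: eq_bigr => l _; rewrite linearZ.
by apply: Fp_lin; [exact: hd | apply: ih; apply: hd].
Qed.

Lemma Fp_tq t : exists d, Fp TW d t.
Proof.
elim/tq_ind: t => [|v x t [d hd]]; first by exists 0%N.
have up e d' (z : H) : Fp TW d' z -> Fp TW (e + d') z.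
  by elim: e => // e ih h; apply: FpS; [exact: TW_comm|apply: ih].
have [d' hd'] := Fp_fock x.
have hd2 : Fp TW d' (tn v x).
  elim: d' x hd' => [|d' ih] x hx; first by rewrite hx /= tn0r.
  by move=> k; rewrite TWE; apply: ih; apply: hx.
exists (d' + d)%N; rewrite -[tn v x]scale1r; apply: Fp_lin; last exact: up.
by rewrite addnC; apply: up.
Qed.

Lemma WfD_l x y z : Wf (x + y) z = Wf x z + Wf y z.
Proof.
have h0 u : Wf 0 u = 0 by rewrite -(subrr 0) Wf_l subrr.
by rewrite -[y]opprK -[- y]sub0r !Wf_l h0 !opprB !subr0 ?sub0r ?opprK.
Qed.

Lemma Wf_LV n x y : Wf (LV n x) y = Wf x (LV (- n) y).
Proof.
move: x; apply: tq_eq => [x1 x2|x1 x2|v x]; first by rewrite linearB Wf_l.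
  by rewrite Wf_l.
move: y; apply: tq_eq => [y1 y2|y1 y2|v' x']; first by rewrite Wf_r.
  by rewrite linearB Wf_r.
have Dr z y1 y2 : Wf z (y1 + y2) = Wf z y1 + Wf z y2.
  have h0 u : Wf u 0 = 0 by rewrite -(subrr 0) Wf_r subrr.
  by rewrite -[y2]opprK -[- y2]sub0r !Wf_r h0 !opprB !subr0 ?sub0r ?opprK.
by rewrite !LV_tn WfD_l Dr !WfE V_form_L form_Lv.
Qed.

Definition primary t := [/\ TD t = t, LV 0 t = t & forall n : int, 0 < n -> LV n t = 0].
Definition TK t := forall k : nat, TW k.+1%:Z t = 0.

(** [no_ghost] is applied to the subspace of degree a, on which w(0) is the scalar c. The part s is
    a sum of vectors L_-n h, and L_n is the adjoint of L_-n. *)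
Lemma spurious_split p : primary p -> exists k s, [/\ p = k + s, primary k, TK k
  & forall y, (forall n : int, 0 < n -> LV n y = 0) -> Wf s y = 0].
Proof.
move=> [pa p0 pn].
pose H' : lmodType rat := sub_of degD.
pose w' k : {linear H' -> H'} := sub_map (@TW_deg k).
pose L' n : {linear H' -> H'} := sub_map (@LV_deg n).
have vi (x y : H') : val x = val y -> x = y by exact: val_inj.
have hc : (c%:~R : rat) != 0 by rewrite intr_eq0.
have vw k x : val (w' k x) = TW k (val x) by [].
have vL k x : val (L' k x) = LV k (val x) by [].
have vD (x y : H') : val (x + y) = val x + val y by [].
have vB (x y : H') : val (x - y) = val x - val y by [].
have vZ (q : rat) (x : H') : val (q *: x) = q *: val x by [].
have [||||||||||k [s [e hK k0 kn hs]]] := @no_ghost H' w' L' c%:~R hc _ _ _ _ _ _ _ _ (sub_mk (N := degD) pa).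
- by move=> k l h; apply: vi; rewrite !vw TW_comm.
- by move=> h; apply: vi; rewrite vw vZ TW0 //; exact: (sub_valP h).
- by move=> n k h; apply: vi; rewrite vB vZ !(vL, vw) LV_TW.
- by move=> m n h mn; apply: vi; rewrite vD vZ !vL LV_comm.
- by move=> h; apply: vi; rewrite vD vZ !vL LV_comm1.
- by move=> h; apply: vi; rewrite !vD !vZ !vL LV_comm2.
- by move=> h; have [J hJ] := TW_fin (val h); exists J => j le; apply: vi; rewrite vw hJ.
- move=> h; have [d hd] := Fp_tq (val h); exists d.
  elim: d h hd => [|d ih] h hd; first exact: vi.
  by move=> k; apply: ih; rewrite vw; apply: hd.
- by apply: vi; rewrite vL.
- by move=> n n0; apply: vi; rewrite vL /= pn.
exists (val k), (val s); split.
- by rewrite -vD -e.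
- split; first exact: (sub_valP k).
    by rewrite -vL k0.
  by move=> n n0; rewrite -vL kn.
- by move=> j; rewrite -vw hK.
move=> y hy; elim: hs => [|n h x _ _ ih]; first by rewrite -(subrr 0) Wf_l subrr.
by rewrite vD vL WfD_l ih addr0 Wf_LV opprK hy // -(subrr 0) Wf_r subrr.
Qed.

Lemma tcoefE b m v x : tcoef V F b m (tn v x) = tn v (coef b m x : rat^o).
Proof. exact: tqmE. Qed.

(** Since w is the null basis vector of index [i0], its positive modes are nonzero multiples of the
    derivatives in the variables (i1, j), so these variables do not occur in t. *)
Lemma TK_tcoef t b (m : {cmonom ('I_2 * nat)%type}) (j : nat) : TK t -> m (i1, j) != 0%N -> tcoef V F b m t = 0.
Proof.
move=> hK mj.
have hw k (x : F) : hv A w k.+1%:Z x = (k.+1%:R * (A i0 i1)%:~R) *: derv (i1, k) x.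
  rewrite hv_pos (bigD1 i1) //= big1 => [|l li]; last first.
    have [->|e] := ord2 l; last by rewrite e eqxx in li.
    by rewrite w_i0 -rowE mxE A_i0 mulr0 scale0r.
  by rewrite addr0 w_i0 -rowE mxE.
pose q : rat := j.+1%:R * (A i0 i1)%:~R * (m (i1, j))%:R.
have q0 : q != 0 by rewrite !mulf_neq0 ?pnatr_eq0 ?intr_eq0.
apply: (scalerI q0); rewrite scaler0.
transitivity (tcoef V F b (mon_div m (i1, j)) (TW j.+1%:Z t)); last by rewrite hK linear0.
move: (t); apply: tq_eq => [x y|x y|v x]; first by rewrite linearB scalerBr.
  by rewrite !linearB.
rewrite TWE !tcoefE hw -tnZr; congr (tn v _).
rewrite linearZ /= coef_derv mon_divK // mon_divE eqxx subn1 prednK ?lt0n //.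
by rewrite scalerA.
Qed.

Lemma TD_tcoef t b m : TD t = t -> b != a -> tcoef V F b m t = 0.
Proof.
move=> <- ba; move: t; apply: tq_eq => [x y|x y|v x]; rewrite ?linearB ?subrr //.
rewrite TDE tcoefE (_ : coef b m (dpr a x) = 0) ?tn0r //.
elim/vec_ind: x => [|q b' m' x ih]; first by rewrite !linear0.
rewrite !linearP ih addr0 /= dpr_vec linearZ /= coef_vec.
by have [->|_] := eqVneq b' a; rewrite ?scale0r ?mul0r ?scaler0 // eq_sym (negbTE ba) scaler0 ?mulr0.
Qed.

(* TK t says that t involves no oscillators but those of w, and these are       *)
(* adjoint to the positive modes of w, which kill y.                            *)
Lemma Wf_TK t y : TD t = t -> TK t -> TK y -> Wf t y = Wf (tqm idfun cpr t) y.
Proof.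
move=> ta hK hy; have [s hs] := tq_expand t.
pose o : fock_basis 2 := (a, onecm _).
have := hs (o |` s)%fset (fsubsetUr _ _); rewrite (big_fsetD1 o) ?fset1U1 //=.
have W0 u : Wf 0 u = 0 by rewrite -(subrr 0) Wf_l subrr.
have -> : tqm idfun (vecm F a (onecm _)) (tcoef V F a (onecm _) t) = tqm idfun cpr t.
  by rewrite /tcoef; apply: tqm_comp => x.
move=> {1}->; rewrite WfD_l -[RHS]addr0; congr (_ + _).
rewrite (_ : Wf _ y = \sum_(k <- (o |` s) `\ o) Wf (tqm idfun (vecm F k.1 k.2) (tcoef V F k.1 k.2 t)) y)%fset; last first.
  elim: (enum_fset _) => [|k l ih]; first by rewrite !big_nil.
  by rewrite !big_cons WfD_l ih.
rewrite big1_seq // => -[b m] /andP[_]; rewrite !inE => /andP[ne _] /=.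
have [ba|ba] := eqVneq b a; last by rewrite TD_tcoef // linear0 W0.
have m1 : m != onecm _ by apply: contraNN ne => /eqP ->; rewrite ba.
have [[i j] mij] : exists v, m v != 0%N.
  apply: contrapT => h; case/eqP: m1; apply/eqP/cmP => v.
  by rewrite cm1; apply/eqP; apply: contra_notT h => mv; exists v.
case: (ord2 i) => e; rewrite e in mij; last by rewrite (TK_tcoef _ hK mij) linear0 W0.
move: (tcoef _ _ _ _ t) => z.
have -> : tqm idfun (vecm F b m) z = tqm idfun (mulv (i0, j)) (tqm idfun (vecm F b (mon_div m (i0, j))) z).
  symmetry; apply: tqm_comp => // q.
  by rewrite /vecm linearZ /= mulv_vec mon_divK.
move: (tqm idfun (vecm _ _ _) z) => u {z}.
have -> : Wf (tqm idfun (mulv (i0, j)) u) y = Wf u (TW j.+1%:Z y); last first.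
  by rewrite hy -(subrr 0) Wf_r subrr.
move: u; apply: tq_eq => [x1 x2|x1 x2|v x]; first by rewrite linearB Wf_l.
  by rewrite Wf_l.
move: (y); apply: tq_eq => [y1 y2|y1 y2|v' x']; first by rewrite Wf_r.
  by rewrite linearB Wf_r.
by rewrite TWE tqmE !WfE form_mulv /= w_i0.
Qed.

Hypothesis Wf_sym : forall x y, Wf x y = Wf y x.

Lemma Wf_primary_TK x k : primary x -> primary k -> TK k -> tqm idfun cpr k = 0 -> Wf x k = 0.
Proof.
move=> hx [ka k0 kn] hK kc; have [k' [s [-> [ka' _ _] hK' hs]]] := spurious_split hx.
rewrite WfD_l hs // addr0 Wf_sym Wf_TK // kc.
by rewrite -(subrr 0) Wf_l subrr.
Qed.
End SpuriousStates.

Lemma form_dpr (r : nat) (F : fock_model r) (A : 'M[int]_r) (a : 'rV[int]_r) (x y : F) :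
  A^T = A -> form A (dpr a x) y = form A x (dpr a y).
Proof.
move=> A_sym; elim/fock_ind: x => [c x x' hx hx'|b|v x ih] in y *.
- by rewrite linearP /= !form_linl hx hx'.
- rewrite dpr_vec formZl !form_expv; elim/vec_ind: y => [|c b' m y ih]; first by rewrite !linear0 mulr0.
  rewrite !linearP /= mulrDr ih; congr (_ + _); rewrite dpr_vec linearZ /= !coef_vec !scaler_reg.
  have [->|ne] := eqVneq b' b; first by rewrite mulrCA.
  by rewrite !(mulr0, mul0r).
by rewrite dpr_mulv !form_mulv ih /ann dpr_hv.
Qed.

(** * The lift of V_k and the maps between V_k and a degree piece *)

Section Comparison.
Variables (G : finGroupType) (V : monster_va G) (F : fock_model 2) (A : 'M[int]_2).
Variables (a w : 'rV[int]_2) (c : int).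
Hypotheses (A_sym : A^T = A) (A_det : \det A != 0).
Hypotheses (w_null : pairing A w w = 0) (w_a : pairing A w a = c) (c0 : c != 0).
Variables i0 i1 : 'I_2.
Hypothesis ord2 : forall i : 'I_2, i = i0 \/ i = i1.
Hypotheses (w_i0 : w = delta_mx 0 i0) (A_i0 : A i0 i0 = 0) (A_i1 : A i0 i1 != 0) (i01 : i0 != i1).
Local Notation H := (tq V F).
Local Notation LV := (@LV G V 2 F A).
Local Notation cpr := (@cpr 2 F a).
Local Notation primary := (@primary G V F A a).
Local Notation TD := (@TD G V F a).
Local Notation TW := (@TW G V F A w).
Local Notation TK := (@TK G V F A w).
Variable Wf : H -> H -> rat.
Hypothesis Wf_l : forall y, zmod_morphism (Wf^~ y).
Hypothesis Wf_r : forall x, zmod_morphism (Wf x).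
Hypothesis WfE : forall v x v' x',
  Wf (tn v x) (tn v' x') = Zhalf_val (mva_form v v') * form A x x'.
Hypothesis Wf_sym : forall x y, Wf x y = Wf y x.
Variable k : int.
Hypothesis wt_a : (k + 1)%:~R + (pairing A a a)%:~R / 2 = 1 :> rat.
Local Notation Vk := (sub_of (V_ V k)).
Local Notation ZF := (zspan (@is_schv 2 F A)).
Local Notation dr := (@dressed G V 2 F A a w c (k + 1)%:~R).
Implicit Types (t x y : H) (v : Vk).

(** V_k has finite rank, so one power of c serves a whole basis. *)
Lemma uniform_dressing : exists N, forall v : Vk, exists t, dr (val v) N t.
Proof.
have [n _ [b hb]] := mva_rank V k.
have [N hN] : exists N, forall i, exists t, dr (val (b i)) N t.
  have /choice[f hf] : forall i, exists N, exists t, dr (val (b i)) N t.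
    by move=> i; apply: (monster_good F A_sym A_det w_null w_a c0 (sub_valP (b i))).
  exists (\sum_i f i)%N => i; have [t ht] := hf i; rewrite (bigD1 i) //= addnC.
  by eexists; apply: dressed_exp ht.
have /choice[t ht] := hN.
exists N => v; have [q [-> _]] := hb v.
exists (\sum_i Zhalf_val (q i) *: t i).
have -> : val (\sum_i q i *: b i) = \sum_i q i *: (val (b i) : V).
  by rewrite raddf_sum /=; apply: eq_bigr.
elim/big_rec2: _ => [|i x y _ h]; last by apply: dressedD h; apply: dressedZ.
split; rewrite ?linear0 ?scaler0 //; first exact: zspan_0.
- by rewrite tn0l.
- by move=> j _; rewrite linear0.
Qed.

Lemma tspan_ZK_deg t : tspan (fun=> True) (@ZK 2 F A a w) t -> TD t = t /\ TK t.
Proof.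
elim=> [_ [v [s [_ [_ [hs ha]] ->]]]||x y _ [hx hx'] _ [hy hy']].
- split; first by rewrite TDE ha.
  by move=> j; rewrite TWE hs tn0r.
- by split=> [|j]; rewrite linear0.
by split=> [|j]; rewrite linearB ?hx ?hy //= hx' hy' subrr.
Qed.

Lemma dressed_primary v N t : dr (val v) N t -> primary t /\ TK t.
Proof.
move=> [hz hc hn h0]; have [hd hk] := tspan_ZK_deg hz; split=> //; split=> //.
- by rewrite h0 wt_a scale1r.
- by case=> [[|n]|n] // _; apply: hn.
Qed.

Lemma transverse_comb q x y : primary x /\ TK x -> primary y /\ TK y ->
  primary (q *: x + y) /\ TK (q *: x + y).
Proof.
move=> [[xa x0 xn] xk] [[ya y0 yn] yk]; split; last by move=> j; rewrite linearP /= xk yk scaler0 addr0.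
split; rewrite ?linearP /= ?xa ?x0 ?ya ?y0 //.
by move=> n n0; rewrite linearP /= xn // yn // scaler0 addr0.
Qed.

Let W0l y : Wf 0 y = 0. Proof. by rewrite -(subrr 0) Wf_l subrr. Qed.
Let W0r y : Wf y 0 = 0. Proof. by rewrite -(subrr 0) Wf_r subrr. Qed.
Let WDr x y z : Wf x (y + z) = Wf x y + Wf x z.
Proof. by rewrite -[z]opprK -[- z]sub0r !Wf_r W0r !opprB !subr0 ?sub0r ?opprK. Qed.

Lemma WfZr q x y : Wf x (q *: y) = q * Wf x y.
Proof.
move: x; apply: tq_eq => [x1 x2|x1 x2|v x]; first by rewrite Wf_l.
  by rewrite Wf_l mulrBr.
move: y; apply: tq_eq => [y1 y2|y1 y2|v' x']; first by rewrite scalerBr Wf_r.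
  by rewrite Wf_r mulrBr.
by rewrite -tnZr !WfE formZr mulrCA.
Qed.

Lemma WfZl q x y : Wf (q *: x) y = q * Wf x y.
Proof. by rewrite Wf_sym WfZr Wf_sym. Qed.

Lemma Wf_cpr_eq x y y' : primary x -> primary y /\ TK y -> primary y' /\ TK y' ->
  tqm idfun cpr y = tqm idfun cpr y' -> Wf x y = Wf x y'.
Proof.
move=> hx hy hy' e; have [h1 h2] := transverse_comb (-1) hy hy'.
apply/esym/eqP; rewrite -subr_eq0 -[X in _ - X]mul1r -mulNr -WfZr -WDr addrC; apply/eqP.
apply: (Wf_primary_TK A_sym A_det w_null w_a c0 ord2 w_i0 A_i0 A_i1 i01 Wf_l Wf_r WfE Wf_sym hx h1 h2).
by rewrite linearP /= e scaleN1r addNr.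
Qed.

Lemma Wf_TD x y : Wf (TD x) y = Wf x (TD y).
Proof.
move: x; apply: tq_eq => [x1 x2|x1 x2|v x]; first by rewrite linearB Wf_l.
  by rewrite Wf_l.
move: y; apply: tq_eq => [y1 y2|y1 y2|v' x']; first by rewrite Wf_r.
  by rewrite linearB Wf_r.
by rewrite !TDE !WfE form_dpr.
Qed.

Lemma mva_graded_sum (u : V) : exists s : seq (int * V),
  (forall p, p \in s -> V_ V p.1 p.2) /\ u = \sum_(p <- s) p.2.
Proof.
elim: (mva_graded u) => [|q x y [j _ hx] _ [s [hs ->]]].
  by exists [::]; split=> //; rewrite big_nil.
exists ((j, q *: x) :: s); split; last by rewrite big_cons.
move=> p; rewrite inE => /orP[/eqP ->|/hs //].
by rewrite -[q *: x]addr0; apply: submodP => //; apply: submod0.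
Qed.

Lemma coef1_L0 (x : F) :
  coef a (onecm _) (Lv A 0 x) = ((pairing A a a)%:~R / 2 : rat) *: coef a (onecm _) x :> rat^o.
Proof.
by rewrite -!(form_expv A) scaler_reg -formZl -L0_expv // form_Lv // oppr0.
Qed.

(** The constant term inherits total L_0-weight 1, and e^a has weight (a, a)/2, so the factor in V
    can be cut down to its component in V_k. *)
Lemma primary_cpr t : primary t -> exists v (d : int), d != 0 /\
  tqm idfun cpr t = tn (val v) (d%:~R^-1 *: expv F a).
Proof.
move=> [ta t0 _]; pose T := tcoef V F a (onecm _) t.
have eT : tqm (@V_L G V 0) idfun T = (k + 1)%:~R *: T.
  have : tcoef V F a (onecm _) (LV 0 t) = T by rewrite t0.
  rewrite [LV 0 t]/(tqm (@V_L G V 0) idfun t + tqm idfun (Lv A 0) t) linearD /=.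
  have -> : tcoef V F a (onecm _) (tqm (@V_L G V 0) idfun t) = tqm (@V_L G V 0) idfun T.
    by rewrite /T /tcoef; transitivity (tqm (@V_L G V 0) (coef a (onecm _)) t); last symmetry; apply: tqm_comp.
  have -> : tcoef V F a (onecm _) (tqm idfun (Lv A 0) t) = ((pairing A a a)%:~R / 2 : rat) *: T.
    rewrite /T; move: (t); apply: tq_eq => [x y|x y|u x]; first by rewrite !linearB.
      by rewrite linearB scalerBr.
    by rewrite tqmE !tcoefE -tnZr coef1_L0.
  move=> e; have -> : (k + 1)%:~R = 1 - (pairing A a a)%:~R / 2 :> rat by exact: canRL (addrK _) wt_a.
  by rewrite scalerBl scale1r -[X in X - _]e addrK.
pose top : submodule V := Submodule (in_submod := fun=> True) I (fun _ _ _ _ _ => I).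
have [u [d [_ d0 eu]]] : exists u d, [/\ top u, d != 0 :> int & T = tn u (d%:~R^-1 : rat^o)].
  exact/tspan_rat/tspan_all.
have [s [hs us]] := mva_graded_sum u.
have tn_s (s' : seq (int * V)) (P : pred (int * V)) :
    tn (\sum_(p <- s' | P p) p.2) (d%:~R^-1 : rat^o) = \sum_(p <- s' | P p) tn p.2 (d%:~R^-1 : rat^o).
  exact: tn_suml.
pose s1 : seq (rat * tq V rat^o) := [seq ((p.1 + 1)%:~R, tn p.2 (d%:~R^-1 : rat^o)) | p <- s].
have e1 : T = \sum_(p <- s1 | p.1 == (k + 1)%:~R) p.2.
  apply: (eigen_component (T := tqm (@V_L G V 0) idfun)) => //.
    move=> _ /mapP[p ps ->] /=; rewrite tqmE /= (_ : V_L 0 p.2 = (p.1 + 1)%:~R *: p.2); last exact: hs.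
    by rewrite tnZl intr_Zhalf.
  by rewrite big_map /= eu us tn_s.
have hv : V_ V k (\sum_(p <- s | (p.1 + 1)%:~R == (k + 1)%:~R :> rat) p.2).
  rewrite big_seq_cond; elim/big_ind: _ => [|x y hx hy|p /andP[ps]].
  - exact: submod0.
  - by rewrite -[x]scale1r; apply: submodP.
  rewrite eqr_int => /eqP e; have -> : k = p.1 by apply: (addIr 1); rewrite e.
  exact: hs.
exists (sub_mk hv), d; split=> //.
transitivity (tqm idfun (vecm F a (onecm _)) T).
  by symmetry; rewrite /T /tcoef; apply: tqm_comp.
rewrite e1 big_map /= -tn_s; exact: tqmE.
Qed.

Variables (N : nat) (tau : Vk -> H).
Hypothesis tauP : forall v, dr (val v) N (tau v).

Let cN : (c%:~R ^+ N : rat) != 0. Proof. by rewrite expf_neq0 // intr_eq0. Qed.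

Lemma tau_primary v : primary (tau v) /\ TK (tau v).
Proof. exact: dressed_primary (tauP v). Qed.

Lemma tau_cpr v : tqm idfun cpr (tau v) = tn (val v) ((c%:~R ^+ N : rat) *: expv F a).
Proof. by have [] := tauP v. Qed.

(** The lifts are chosen one by one, so [tau] need not be linear; its pairings with primary vectors
    are, as they depend only on constant terms. *)
Lemma Wf_tau_lin x q v v' : primary x ->
  Wf x (tau (q *: v + v')) = Zhalf_val q * Wf x (tau v) + Wf x (tau v').
Proof.
move=> hx; rewrite -WfZr -WDr; apply: Wf_cpr_eq => //; first exact: tau_primary.
  by apply: transverse_comb; apply: tau_primary.
by rewrite linearP /= !tau_cpr -tnZl -tnDl.
Qed.

Lemma Wf_tau_tau v v' :
  Wf (tau v) (tau v') = c%:~R ^+ (2 * N) * Zhalf_val (mva_form (val v) (val v')).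
Proof.
have [[ta _ _] tk] := tau_primary v; have [[ta' _ _] tk'] := tau_primary v'.
rewrite (Wf_TK ord2 w_i0 A_i0 A_i1 Wf_l Wf_r WfE ta tk tk') Wf_sym.
have -> : Wf (tau v') (tqm idfun cpr (tau v)) = Wf (tqm idfun cpr (tau v')) (tqm idfun cpr (tau v)).
  rewrite (Wf_TK ord2 w_i0 A_i0 A_i1 Wf_l Wf_r WfE ta' tk') //.
  move=> j; rewrite tau_cpr TWE linearZ /= hv_expv.
  by rewrite scaler0 tn0r.
rewrite !tau_cpr WfE formZl formZr form_expvv mulr1 mulnC exprM expr2 mulrC.
by rewrite [mva_form _ _]mva_form_sym.
Qed.

(** Projected to degree a and freed of its spurious part, y has the same constant term as a rational
    multiple of some lift. *)
Lemma Wf_tau_ker x : primary x -> (forall v, Wf x (tau v) = 0) ->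
  forall y, LV 0 y = y -> (forall n : int, 0 < n -> LV n y = 0) -> Wf x y = 0.
Proof.
move=> hx h y y0 yn; have [xa _ xn] := hx.
have hy : primary (TD y).
  by split=> [||n n0]; rewrite ?TDK // LV_TD ?y0 // yn // linear0.
rewrite -{1}xa Wf_TD.
have [y' [s [-> hy' hK hs]]] := spurious_split A_sym A_det w_null w_a c0 A_i0 A_i1 i01 Wf_l Wf_r WfE hy.
rewrite WDr [Wf x s]Wf_sym hs // addr0.
have [v [d [d0 e]]] := primary_cpr hy'.
have q0 : (d%:~R * c%:~R ^+ N : rat) != 0 by rewrite mulf_neq0 // intr_eq0.
apply: (mulfI q0); rewrite mulr0 -WfZr -(h v); apply: Wf_cpr_eq => //; last 2 first.
- exact: tau_primary.
- rewrite linearZ /= e tau_cpr -tnZr scalerA mulrAC divff ?intr_eq0 //.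
  by rewrite mul1r.
rewrite -[_ *: y']addr0; apply: transverse_comb => //.
split; last by move=> j; rewrite linear0.
by split; rewrite ?linear0 // => n _; rewrite linear0.
Qed.

Lemma Wf_act g x y : Wf (tqm (mva_act V g) idfun x) (tqm (mva_act V g) idfun y) = Wf x y.
Proof.
move: x; apply: tq_eq => [x1 x2|x1 x2|v x]; first by rewrite linearB Wf_l.
  by rewrite Wf_l.
move: y; apply: tq_eq => [y1 y2|y1 y2|v' x']; first by rewrite linearB Wf_r.
  by rewrite Wf_r.
by rewrite !tqmE !WfE mva_form_inv.
Qed.

Lemma Wf_act_tau g x v : primary x ->
  Wf x (tqm (mva_act V g) idfun (tau v)) = Wf x (tau (V_act V g k v)).
Proof.
move=> hx; have hg := dressed_act g (tauP v).
apply: Wf_cpr_eq => //; last 2 first.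
- exact: tau_primary.
- by rewrite tau_cpr; have [_ -> _ _] := hg.
exact: (@dressed_primary (V_act V g k v) N).
Qed.

Lemma Wf_int x y : tspan (fun=> True) ZF x -> tspan (fun=> True) ZF y ->
  exists q : Zhalf, Zhalf_val q = Wf x y.
Proof.
move=> hx hy; elim: hx => [_ [v [s [_ hs ->]]]||x1 x2 _ [q1 e1] _ [q2 e2]]; last 2 first.
- by exists 0; rewrite W0l.
- by exists (q1 - q2); rewrite Wf_l -e1 -e2.
elim: hy => [_ [v' [s' [_ hs' ->]]]||x1 x2 _ [q1 e1] _ [q2 e2]]; last 2 first.
- by exists 0; rewrite W0r.
- by exists (q1 - q2); rewrite Wf_r -e1 -e2.
have [n hn] : exists n : int, form A s s' = n%:~R by exact: form_int.
exists (mva_form v v' * n%:~R).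
by rewrite WfE hn -intr_Zhalf.
Qed.

(* M is the module of classes, modulo the vectors orthogonal to all primary     *)
(* vectors, of integral primary vectors of degree a; rep q x: x represents q.   *)
Variables (M : lmodType Zhalf) (rep : M -> H -> Prop) (act : G -> M -> M) (bM : M -> M -> rat).
Hypothesis rep_ex : forall q, exists x, rep q x.
Hypothesis repP : forall q x, rep q x -> primary x /\ tspan (fun=> True) ZF x.
Hypothesis rep_tau : forall v, exists q, rep q (tau v).
Hypothesis rep_lin : forall z q q' x x', rep q x -> rep q' x' -> rep (z *: q + q') (Zhalf_val z *: x + x').
Hypothesis rep_eq : forall q q' x x', rep q x -> rep q' x' ->
  q = q' <-> forall y, LV 0 y = y -> (forall n : int, 0 < n -> LV n y = 0) -> Wf x y = Wf x' y.
Hypothesis rep_act : forall g q x, rep q x -> rep (act g q) (tqm (mva_act V g) idfun x).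
Hypothesis rep_form : forall q q' x x', rep q x -> rep q' x' -> bM q q' = Wf x x'.

Let B (u v : Vk) := mva_form (val u) (val v).

Lemma B_inj u u' : (forall v, B u v = B u' v) -> u = u'.
Proof.
have Bl : linear (B u' : Vk -> Zhalf^o).
  by move=> z v v'; apply: (mva_form_bilin V).2.
pose L := HB.pack_for {linear Vk -> Zhalf^o} (B u' : Vk -> Zhalf^o) (GRing.isLinear.Build _ _ _ _ _ Bl).
have [x [_ ux]] := mva_form_dual (m := V) L => h.
by rewrite -(ux u h) -(ux u').
Qed.

Lemma B_scale z u v : B (z *: u) v = z * B u v.
Proof.
have l := (mva_form_bilin V).1 (val v).
have h0 : mva_form 0 (val v) = 0.
  by have := l (-1) 0 0; rewrite !scaleN1r !addNr.
have := l z (val u) 0; rewrite addr0 => e; rewrite [LHS]e h0; exact: addr0.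
Qed.

Lemma primary_comb q x y : primary x -> primary y -> primary (q *: x + y).
Proof.
move=> [xa x0 xn] [ya y0 yn].
split; rewrite ?linearP /= ?xa ?x0 ?ya ?y0 //.
by move=> n n0; rewrite linearP /= xn // yn // scaler0 addr0.
Qed.

Lemma rep_tau_Wf q x x' v : rep q x -> rep q x' -> Wf x (tau v) = Wf x' (tau v).
Proof.
move=> h h'; have [[_ t0 tn] _] := tau_primary v.
by have [e _] := rep_eq h h'; apply: e.
Qed.

(** The functional v -> (x, tau v) is linear with values in Z[1/2], so the self-dual form on V_k
    represents it by a vector. *)
Lemma comparison_map : exists f : {linear M -> Vk},
  forall q x v, rep q x -> Zhalf_val (B (f q) v) = Wf x (tau v).
Proof.
have /choice[f hf] : forall q, exists u : Vk, forall x v, rep q x -> Zhalf_val (B u v) = Wf x (tau v).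
  move=> q; have [x hx] := rep_ex q; have [px zx] := repP hx.
  have tz v : tspan (fun=> True) ZF (tau v).
    by have [h _ _ _] := tauP v; apply: tspan_sub h => // s [].
  have /choice[l hl] : forall v, exists z : Zhalf, Zhalf_val z = Wf x (tau v).
    by move=> v; apply: Wf_int.
  have l_lin : linear (l : Vk -> Zhalf^o).
    move=> z v v'; apply: val_inj; apply: etrans (hl _) _; rewrite Wf_tau_lin //.
    by rewrite -!hl.
  pose L := HB.pack_for {linear Vk -> Zhalf^o} (l : Vk -> Zhalf^o) (GRing.isLinear.Build _ _ _ _ _ l_lin).
  have [u [hu _]] := mva_form_dual (m := V) L.
  exists u => x' v hx'; rewrite (rep_tau_Wf v hx' hx) -hl.
  by congr Zhalf_val; apply: hu.
have f_lin : linear f.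
  move=> z q q'; apply: B_inj => v; apply: val_inj.
  have [x hx] := rep_ex q; have [x' hx'] := rep_ex q'.
  apply: etrans (hf _ _ v (rep_lin z hx hx')) _.
  have -> : B (z *: f q + f q') v = z * B (f q) v + B (f q') v by apply: (mva_form_bilin V).1.
  rewrite [RHS](_ : _ = Zhalf_val z * Zhalf_val (B (f q) v) + Zhalf_val (B (f q') v)) //.
  rewrite (hf _ _ _ hx) (hf _ _ _ hx') !(Wf_sym _ (tau v)).
  by rewrite WDr WfZr.
by exists (HB.pack_for {linear M -> Vk} f (GRing.isLinear.Build _ _ _ _ _ f_lin)).
Qed.

Let C : Zhalf := c%:~R ^+ (2 * N).
Let valC : Zhalf_val C = c%:~R ^+ (2 * N).
Proof. by rewrite [LHS](rmorphXn (val : {rmorphism Zhalf -> rat})) rmorph_int. Qed.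

(** g sends v to the class of its lift. f g = C is [Wf_tau_tau]; g f = C and the linearity of g hold
    because both sides have the same pairings with all lifts, which suffices by [Wf_tau_ker]. *)
Lemma comparison_maps : exists (f : {linear M -> Vk}) (g : {linear Vk -> M}),
  [/\ forall q, g (f q) = C *: q, forall v, f (g v) = C *: v,
    forall q q', Zhalf_val (B (f q) (f q')) = Zhalf_val C * bM q q',
    forall q q', exists z : Zhalf, Zhalf_val z = bM q q'
  & forall h q, f (act h q) = V_act V h k (f q)].
Proof.
have [f hf] := comparison_map; have /choice[g hg] := rep_tau.
have fg v : f (g v) = C *: v.
  apply: B_inj => v'; apply: val_inj; apply: etrans (hf _ _ v' (hg v)) _.
  rewrite B_scale.
  by rewrite Wf_tau_tau [RHS](_ : _ = Zhalf_val C * Zhalf_val (B v v')) // valC.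
have gfx q x v : rep q x -> Wf (tau (f q)) (tau v) = Wf (Zhalf_val C *: x) (tau v).
  by move=> hx; rewrite Wf_tau_tau WfZl -(hf q x v hx) valC.
have gf q : g (f q) = C *: q.
  have [x hx] := rep_ex q; have [px zx] := repP hx.
  have hCx : rep (C *: q) (Zhalf_val C *: x).
    have := rep_lin C hx (rep_lin (-1) hx hx); rewrite !scaleN1r !addNr !addr0; apply.
  have [_ h] := rep_eq (hg (f q)) hCx; apply: h => y y0 yn.
  apply/eqP; rewrite -subr_eq0 -Wf_l; apply/eqP; apply: Wf_tau_ker y0 yn => //.
  - by rewrite addrC -scaleNr; apply: primary_comb px _; have [] := tau_primary (f q).
  - by move=> v; rewrite Wf_l (gfx q x v hx) subrr.
have g_lin : linear g.
  move=> z v v'; have [_ h] := rep_eq (hg (z *: v + v')) (rep_lin z (hg v) (hg v')).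
  apply: h => y y0 yn; apply/eqP; rewrite -subr_eq0 -Wf_l; apply/eqP; apply: Wf_tau_ker y0 yn => //.
    rewrite addrC -scaleN1r; apply: primary_comb; last by have [] := tau_primary (z *: v + v').
    by apply: primary_comb; [have [] := tau_primary v | have [] := tau_primary v'].
  move=> v''; have [pv _] := tau_primary v''.
  by rewrite Wf_sym Wf_r Wf_tau_lin // WDr WfZr subrr.
exists f, (HB.pack_for {linear Vk -> M} g (GRing.isLinear.Build _ _ _ _ _ g_lin)); split=> //.
- move=> q q'; have [x hx] := rep_ex q; have [x' hx'] := rep_ex q'.
  have [[_ x0 xn] _] := repP hx.
  have hCx : rep (C *: q') (Zhalf_val C *: x').
    by have := rep_lin C hx' (rep_lin (-1) hx' hx'); rewrite !scaleN1r !addNr !addr0; apply.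
  have [h _] := rep_eq (hg (f q')) hCx.
  by rewrite (hf q x _ hx) Wf_sym (h (gf q')) // WfZl Wf_sym (rep_form hx hx').
- move=> q q'; have [x hx] := rep_ex q; have [x' hx'] := rep_ex q'.
  by rewrite (rep_form hx hx'); apply: Wf_int; [have [] := repP hx | have [] := repP hx'].
move=> h q; have [x hx] := rep_ex q; have [px _] := repP hx.
apply: B_inj => v; apply: val_inj; apply: etrans (hf _ _ v (rep_act h hx)) _.
have hK t : tqm (mva_act V h) idfun (tqm (mva_act V h^-1%g) idfun t) = t.
  rewrite -[RHS]tqm_id; apply: tqm_comp => // u /=.
  by rewrite -mva_actM mulgV mva_act1.
(* Invariance moves h to the other argument, where the translate of a lift by h^-1 may be replaced
   by the lift of the translate. *)
rewrite -[tau v](hK (tau v)) Wf_act (Wf_act_tau h^-1%g v px) -(hf q x _ hx); congr Zhalf_val.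
rewrite /B /= -(mva_form_inv h (val (f q))); congr (mva_form _ _).
by rewrite -mva_actM mulgV mva_act1.
Qed.
End Comparison.

(** * Extension of scalars *)

Section BaseChangeTheory.
Variables (R S : comPzRingType) (h : {rmorphism R -> S}).

Lemma base_ind (M : lmodType R) (Q : base_change h M -> Prop) :
  Q 0 -> (forall s x t, Q t -> Q (base_tens h s x + t)) -> forall t, Q t.
Proof.
move=> h0 hS t; rewrite -[t]reprK -[X in Q X]/(pres_pi (G := base_pres h M) (repr t)).
elim: (repr t) => [|[s x] l ih]; first exact: h0.
have -> : pres_pi (G := base_pres h M) ((s, x) :: l) = base_tens h s x + pres_pi (G := base_pres h M) l.
  apply: (@presP S (base_pres h M)) => P f hf.
  by rewrite lift_addr // !pres_liftE // /eval_word !big_cons big_nil addr0.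
exact: hS.
Qed.

Lemma base_tensE (M : lmodType R) s (x : M) : base_tens h s x = s *: base_tens h 1 x.
Proof. by have [_ e _ _] := base_tens_balanced h M; rewrite -e mulr1. Qed.

Lemma base_tensZ (M : lmodType R) s a (x : M) : base_tens h s (a *: x) = h a *: base_tens h s x.
Proof. by have [_ e _ e'] := base_tens_balanced h M; rewrite e' mulrC e. Qed.

Lemma base_tensD (M : lmodType R) s (x y : M) :
  base_tens h s (x + y) = base_tens h s x + base_tens h s y.
Proof. by have [e _ _ _] := base_tens_balanced h M; apply: e. Qed.

Lemma base_tens_sum (M : lmodType R) s n (f : 'I_n -> M) :
  base_tens h s (\sum_i f i) = \sum_i base_tens h s (f i).
Proof.
apply: (big_morph (base_tens h s)) => [x y|]; first exact: base_tensD.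
by apply: (addrI (base_tens h s 0)); rewrite -base_tensD !addr0.
Qed.

Section FreeModule.
Variables (M : lmodType R) (n : nat) (b : 'I_n -> M).
Hypothesis b_basis : forall x, exists! c : {ffun 'I_n -> R}, x = \sum_i c i *: b i.

Definition coord (x : M) : {ffun 'I_n -> R} := projT1 (cid (b_basis x)).
Lemma coordE x : x = \sum_i coord x i *: b i.
Proof. exact: (projT2 (cid (b_basis x))).1. Qed.
Lemma coord_uniq x (c : {ffun 'I_n -> R}) : x = \sum_i c i *: b i -> coord x = c.
Proof. exact: (projT2 (cid (b_basis x))).2. Qed.

Definition coord1 i (x : M) : R^o := coord x i.
Fact coord1_linear i : linear (coord1 i).
Proof.
move=> k x y; rewrite /coord1 (@coord_uniq _ [ffun i => k * coord x i + coord y i]).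
  by rewrite ffunE.
rewrite {1}(coordE x) {1}(coordE y) scaler_sumr -big_split.
by apply: eq_bigr => j _ /=; rewrite ffunE scalerDl scalerA.
Qed.
HB.instance Definition _ i := GRing.isLinear.Build R M R^o _ (coord1 i) (coord1_linear i).

Lemma coord1_basis i j : coord1 i (b j) = (i == j)%:R.
Proof.
rewrite /coord1 (@coord_uniq _ [ffun i => (i == j)%:R]) ?ffunE //.
rewrite (bigD1 j) //= ffunE eqxx scale1r big1 ?addr0 // => k ne.
by rewrite ffunE (negbTE ne) scale0r.
Qed.

Fact base_coord_balanced i : balanced_map h (P := S^o) (fun s x => s * h (coord1 i x)).
Proof.
split=> [s x y|s t x|s t x|s k x].
- by rewrite linearD rmorphD mulrDr.
- by rewrite -mulrA.
- by rewrite mulrDl.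
- by rewrite linearZ /= rmorphM mulrA.
Qed.

Definition base_coord i (t : base_change h M) : S^o :=
  pres_lift (G := base_pres h M) (P := S^o) (fun z => z.1 * h (coord1 i z.2)) t.
HB.instance Definition _ i := GRing.isLinear.Build S (base_change h M) S^o _ (base_coord i)
  (@pres_lift_linear S (base_pres h M) _ _ (base_coord_balanced i)).

Lemma base_coordE i s x : base_coord i (base_tens h s x) = s * h (coord1 i x).
Proof.
rewrite /base_coord pres_liftE; last exact: base_coord_balanced.
by rewrite /eval_word big_cons big_nil addr0.
Qed.

Variable B : M -> M -> R.
Hypotheses (B_bil : bilinear_form B) (B_sym : symmetric_form B) (B_dual : self_dual_form B).

Definition base_form (x y : base_change h M) : S :=
  \sum_i \sum_j base_coord i x * base_coord j y * h (B (b i) (b j)).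

Lemma base_form_linl y : linear (base_form^~ y : _ -> S^o).
Proof.
move=> k x x'; rewrite /base_form scaler_sumr -big_split; apply: eq_bigr => i _ /=.
rewrite scaler_sumr -big_split; apply: eq_bigr => j _ /=.
by rewrite linearP /= !mulrDl -!mulrA.
Qed.

Lemma base_form_sym x y : base_form x y = base_form y x.
Proof.
rewrite /base_form exchange_big; apply: eq_bigr => i _; apply: eq_bigr => j _.
by rewrite B_sym [base_coord _ _ * _]mulrC.
Qed.

Lemma base_form_linr x : linear (base_form x : _ -> S^o).
Proof. by move=> k y y'; rewrite ![base_form x _]base_form_sym; exact: base_form_linl. Qed.

HB.instance Definition _ x := GRing.isLinear.Build S (base_change h M) S^o _ (base_form x) (base_form_linr x).

Definition Blin x (y : M) : R^o := B x y.
Fact Blin_linear x : linear (Blin x). Proof. exact: B_bil.2. Qed.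
HB.instance Definition _ x := GRing.isLinear.Build R M R^o _ (Blin x) (Blin_linear x).

Lemma B_sumr x m (c : 'I_m -> R) (y : 'I_m -> M) :
  B x (\sum_i c i *: y i) = \sum_i c i * B x (y i).
Proof.
rewrite -[LHS]/(Blin x _) linear_sum; apply: eq_bigr => i _.
by rewrite linearZ.
Qed.

Lemma base_formE x y : base_form (base_tens h 1 x) (base_tens h 1 y) = h (B x y).
Proof.
rewrite /base_form; transitivity (h (\sum_i \sum_j coord1 i x * coord1 j y * B (b i) (b j))).
  rewrite rmorph_sum; apply: eq_bigr => i _; rewrite rmorph_sum; apply: eq_bigr => j _.
  by rewrite !base_coordE !mul1r !rmorphM.
congr (h _); rewrite B_sym [in RHS](coordE x) B_sumr; apply: eq_bigr => i _.
rewrite [in RHS]B_sym [in RHS](coordE y) B_sumr mulr_sumr.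
by apply: eq_bigr => j _; rewrite mulrA.
Qed.

Lemma dual_basis : exists d : 'I_n -> M, forall i j, B (d i) (b j) = (i == j)%:R.
Proof.
have /choice[d hd] : forall i, exists d, forall x, B d x = coord1 i x.
  by move=> i; have [d [hd _]] := B_dual (coord1 i); exists d.
by exists d => i j; rewrite hd coord1_basis.
Qed.

Lemma base_form_self_dual : self_dual_form base_form.
Proof.
have [d hd] := dual_basis; move=> l.
(* The dual basis over R still computes coordinates after extension of scalars; existence and
   uniqueness of the representing vector follow. *)
have rec x : x = \sum_i base_form (base_tens h 1 (d i)) x *: base_tens h 1 (b i).
  elim/base_ind: x => [|s x t ih].
    by rewrite big1 // => i _; rewrite linear0 scale0r.
  under eq_bigr => i _ do rewrite linearD /= scalerDl.
  rewrite big_split /= -ih; congr (_ + _).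
  rewrite base_tensE; under eq_bigr => i _ do rewrite linearZ /= -scalerA.
  rewrite -scaler_sumr; congr (_ *: _).
  under eq_bigr => i _ do rewrite base_formE -base_tensZ.
  rewrite -base_tens_sum; congr (base_tens h 1 _).
  rewrite {1}(coordE x); apply: eq_bigr => i _; congr (_ *: _).
  rewrite [in RHS](coordE x) B_sumr (bigD1 i) //= hd eqxx mulr1 big1 ?addr0 // => j ne.
  by rewrite hd eq_sym (negbTE ne) mulr0.
exists (\sum_i (l (base_tens h 1 (b i)) : S) *: base_tens h 1 (d i)); split.
  move=> y; rewrite base_form_sym linear_sum /= [in RHS](rec y) linear_sum; apply: eq_bigr => i _.
  rewrite !linearZ /= base_form_sym; exact: mulrC.
move=> x hx; rewrite [RHS](_ : x = \sum_i base_form x (base_tens h 1 (b i)) *: base_tens h 1 (d i)).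
  by apply: eq_bigr => i _; rewrite hx.
move: (x) => {x hx} x.
have nd y : (forall i, base_form y (base_tens h 1 (b i)) = 0) -> y = 0.
  move=> hy; rewrite (rec y) big1 // => i _.
  suff -> : base_form (base_tens h 1 (d i)) y = 0 by rewrite scale0r.
  rewrite base_form_sym (rec (base_tens h 1 (d i))) linear_sum big1 // => j _.
  rewrite linearZ /= hy; exact: mulr0.
apply/eqP; rewrite -subr_eq0; apply/eqP/nd => j.
rewrite base_form_sym linearB /= linear_sum (bigD1 j) //= big1 ?addr0.
  rewrite linearZ /= [base_form (base_tens h 1 (b j)) (base_tens h 1 (d j))]base_form_sym base_formE hd eqxx rmorph1.
  rewrite [base_form (base_tens h 1 (b j)) x]base_form_sym; apply/eqP; rewrite subr_eq0.
  by apply/eqP/esym/mulr1.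
move=> i ne; rewrite linearZ /= [base_form (base_tens h 1 (b j)) _]base_form_sym.
rewrite base_formE hd (negbTE ne) rmorph0; exact: mulr0.
Qed.
End FreeModule.

Section Comparison.
Variables (M N : lmodType R) (f : {linear M -> N}) (g : {linear N -> M}) (C : R) (u : S).
Hypotheses (gf : forall x, g (f x) = C *: x) (fg : forall y, f (g y) = C *: y).
Hypothesis uC : u * h C = 1.

Lemma base_map_comp (M1 M2 : lmodType R) (f1 : {linear M1 -> M2}) (g1 : {linear M2 -> M1}) x :
  (forall x, g1 (f1 x) = C *: x) -> base_map g1 (base_map (h := h) f1 x) = h C *: x.
Proof.
move=> e; elim/base_ind: x => [|s x t ih]; first by rewrite !linear0.
rewrite [base_map f1 _]linearD /= [base_map g1 _]linearD /= ih scalerDr; congr (_ + _).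
by transitivity (base_map (h := h) g1 (base_tens h s (f1 x)));
  [congr (base_map _ _); exact: base_mapE | rewrite base_mapE e base_tensZ].
Qed.

Definition base_inv (y : base_change h N) : base_change h M := u *: base_map g y.
Fact base_inv_linear : linear base_inv.
Proof. by move=> k x y; rewrite /base_inv linearP scalerDr scalerA mulrC -scalerA. Qed.
HB.instance Definition _ := GRing.isLinear.Build S _ _ _ base_inv base_inv_linear.

Lemma base_mapK : cancel (base_map (h := h) f) base_inv.
Proof. by move=> x; rewrite /base_inv base_map_comp // scalerA uC scale1r. Qed.

Lemma base_invK : cancel base_inv (base_map (h := h) f).
Proof. by move=> y; rewrite /base_inv linearZ /= base_map_comp // scalerA uC scale1r. Qed.

(** The extension of B is pulled back along the isomorphism induced by f and multiplied by the
    inverse u of C, which removes the factor C from B (f x, f y). *)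
Lemma base_map_dual (B : N -> N -> R) (b : M -> M -> R) n :
  free_of_rank (N := N) n -> bilinear_form B -> symmetric_form B -> self_dual_form B ->
  (forall x y, B (f x) (f y) = C * b x y) ->
  exists B' : base_change h M -> base_change h M -> S, [/\ bilinear_form B', self_dual_form B'
    & forall x y, B' (base_tens h 1 x) (base_tens h 1 y) = h (b x y)].
Proof.
move=> [e he] Bb Bs Bd fb; pose ph : {linear base_change h M -> base_change h N} := base_map (h := h) f.
pose BF := @base_form N n e he B.
have phK z : ph (base_inv z) = z by exact: base_invK.
have Kph z : base_inv (ph z) = z by exact: base_mapK.
have BFl y : linear (BF^~ y : _ -> S^o) by exact: base_form_linl.
have BFr x : linear (BF x : _ -> S^o) by exact: base_form_linr.
exists (fun x y => u * BF (ph x) (ph y)); split.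
- split=> [y k x x'|x k y y'] /=.
    by rewrite [ph _]linearP BFl mulrDr mulrCA.
  have -> : base_map (h := h) f (k *: y + y') = k *: base_map f y + base_map f y' by exact: linearP.
  by rewrite BFr mulrDr mulrCA.
- move=> l; pose l' (z : base_change h N) : S^o := h C * l (base_inv z).
  have l'_lin : linear l'.
    by move=> k x y; rewrite /l' linearP /= linearP mulrDr mulrCA.
  pose L := HB.pack_for {linear base_change h N -> S^o} l' (GRing.isLinear.Build _ _ _ _ l' l'_lin).
  have [z [hz uz]] := base_form_self_dual he Bb Bs Bd L.
  exists (base_inv z); split=> [y|x hx].
    by rewrite phK /BF hz /= /l' Kph mulrA uC mul1r.
  rewrite (uz (ph x)) ?Kph // => y.
  by rewrite /= /l' -hx phK mulrA [h C * u]mulrC uC mul1r.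
move=> x y; have eb t : ph (base_tens h 1 t) = base_tens h 1 (f t) by exact: base_mapE.
by rewrite !eb /BF base_formE // fb rmorphM mulrA uC mul1r.
Qed.
End Comparison.
End BaseChangeTheory.

(** Bezout gives inverses modulo each p^n; inverses are unique, so they are compatible and define an
    element of the limit. *)
Lemma padic_int_unit (p : nat) (p_odd : odd p) (c : int) : prime p -> ~~ (p%:Z %| c)%Z ->
  exists u : padicZ p, u * Zhalf_to_padic p_odd c%:~R = 1.
Proof.
move=> p_pr hc.
have cop n : exists v : int, (v * c = 1 %[mod p%:Z ^+ n])%Z.
  have : coprimez c (p%:Z ^+ n).
    rewrite coprimezE abszX coprime_sym; case: n => [|n]; first by rewrite coprime1n.
    by rewrite coprime_pexpl // prime_coprime // -[p]/(absz p%:Z) -dvdzE.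
  move=> /coprimezP[[v1 v2] /= e]; exists v1.
  by rewrite -e addrC modzMDl.
have /choice[v hv] := cop.
have coh n : (v n = v n.+1 %[mod p%:Z ^+ n])%Z.
  have e : (v n.+1 * c = 1 %[mod p%:Z ^+ n])%Z.
    apply/eqP; rewrite eqz_mod_dvd; apply: (@dvdz_trans (p%:Z ^+ n.+1)).
      by rewrite exprS dvdz_mull.
    by rewrite -eqz_mod_dvd hv.
  rewrite -[v n]mulr1 -modzMmr -e modzMmr mulrCA -modzMmr hv modzMmr.
  by rewrite mulr1.
exists (padic_lim coh); apply: padic_eq => n /=.
rewrite modzMml (@Zhalf_modE p p_odd _ 0 c) ?intr_Zhalf ?mulr1 // modzMmr.
exact: hv.
Qed.

(** * The monster Lie algebra *)

Lemma in_span_gen (R : comPzRingType) (M : lmodType R) (P : M -> Prop) x : P x -> in_span P x.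
Proof. by move=> h; have := spanP 1 h (span0 P); rewrite scale1r addr0. Qed.

Lemma coef_dpr (r : nat) (F : fock_model r) (a b : 'rV[int]_r) m (x : F) :
  coef b m (dpr a x) = (b == a)%:R * coef b m x :> rat.
Proof.
elim/vec_ind: x => [|q b' m' x ih]; first by rewrite !linear0 mulr0.
rewrite !linearP /= ih mulrDr; congr (_ + _); rewrite dpr_vec linearZ /= !coef_vec !scaler_reg.
have [->|ne] := eqVneq b' b; first by rewrite mulrCA.
by rewrite !mulr0.
Qed.

Lemma LV_ext (G : finGroupType) (V : monster_va G) r (F : fock_model r) (A : 'M[int]_r) n
    (f : tq V F -> tq V F) : zmod_morphism f ->
  (forall v x, f (tn v x) = tn (V_L n v) x + tn v (Lv A n x)) -> f =1 LV A n.
Proof.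
move=> fB fE; apply: tq_eq => // [x y|v x]; first by rewrite linearB.
by rewrite fE /LV !tqmE.
Qed.

Section MonsterLie.
Variables (G : finGroupType) (V : monster_va G).
Local Notation F := (fock_mod 2).
Local Notation A := II_gram.
Local Notation H := (tq V F).
Local Notation ZF := (zspan (@is_schv 2 F A)).

Lemma W_LE n (t : H) : W_L n (t : WQ V) = LV A n t.
Proof.
apply: (@LV_ext G V 2 F A n (fun t : H => W_L n (t : WQ V))) => [x y|v x].
  exact: (linearB (W_L n)).
transitivity (tens (V_L n v) (x : restr F) + tens v (II_L n x) : WQ V).
  by congr (_ + _); exact: tensor_mapE.
have e : II_L n (x : restr F) = (Lv A n x : restr F) by exact: fock_virE.
exact: (congr1 (fun y : restr F => tens (V_L n v) (x : restr F) + tens v y : WQ V) e).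
Qed.

Lemma W_form_l (y : H) : zmod_morphism (fun x : H => W_form (x : WQ V) (y : WQ V)).
Proof.
by move=> x x'; have := (W_form_bilinear V).1 y (-1) x' x; rewrite !scaleN1r !(addrC (- _)).
Qed.

Lemma W_form_r (x : H) : zmod_morphism (fun y : H => W_form (x : WQ V) (y : WQ V)).
Proof.
by move=> y y'; have := (W_form_bilinear V).2 x (-1) y' y; rewrite !scaleN1r !(addrC (- _)).
Qed.

Lemma W_form_tn v (x : F) v' (x' : F) :
  W_form (tn v x : WQ V) (tn v' x' : WQ V) = Zhalf_val (mva_form v v') * form A x x'.
Proof. by rewrite -fock_formE; exact: W_formE. Qed.

Lemma II_gram_sym : A^T = A.
Proof. by apply/matrixP => i j; rewrite !mxE eq_sym. Qed.

Lemma W_form_sym (x y : H) : W_form (x : WQ V) (y : WQ V) = W_form (y : WQ V) (x : WQ V).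
Proof.
move: x; apply: tq_eq => [x1 x2|x1 x2|v x]; [exact: W_form_l|exact: W_form_r|].
move: y; apply: tq_eq => [y1 y2|y1 y2|v' x']; [exact: W_form_r|exact: W_form_l|].
by rewrite !W_form_tn form_sym ?II_gram_sym // mva_form_sym.
Qed.

Lemma tens_scale (q : Zhalf) v (x : F) :
  q *: (tens v (x : restr F) : WQ V) = tn (q *: v) x.
Proof.
have := (tens_bilinear V (restr F)).1 (x : restr F) q v 0; rewrite addr0 => e.
by rewrite [RHS]e [tens 0 _](tn0l _ (x : F)) addr0.
Qed.

(** The power of 2 in the lattice factor is absorbed by V, which is a Z[1/2]-module. *)
Lemma W_tspan (t : H) : W V t -> tspan (fun=> True) ZF t.
Proof.
elim=> [|q _ y [v [x [[j hj] ->]]] _ ih]; first exact: zspan_0.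
apply: zspanD => //.
have [b hb] : exists b : Zhalf, Zhalf_val b * 2 ^+ j = 1.
  have hh : (2 ^+ j)^-1 \in Zhalf_pred by apply/asboolP; exists j; rewrite mulVf ?rpred1 // expf_neq0.
  by exists (MkZhalf hh); rewrite /= mulVf // expf_neq0.
have -> : q *: tens v (x : restr F) = tn (q *: (b *: v)) (2 ^+ j *: (x : F)).
  rewrite tens_scale.
  by rewrite scalerA mulrC -scalerA [RHS]tn_bal scalerA hb scale1r.
by apply: tspan_gen => //; apply/lattice_ZformE.
Qed.

Lemma tspan_W (t : H) : tspan (fun=> True) ZF t -> W V t.
Proof.
elim=> [_ [v [x [_ hx ->]]]||x y _ hx _ hy]; last 2 first.
- exact: span0.
- by have := span_closed (-1) hy hx; rewrite scaleN1r addrC.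
apply: in_span_gen; suff : exists v' (u : fock 2), lattice_Zhalf A u /\ (tn v x : WQ V) = tens v' (u : restr F).
  by [].
exists v, x; split=> //; exists 0%N.
by rewrite expr0 scale1r; apply/lattice_ZformE.
Qed.

Section Degree.
Variable a : 'rV[int]_2.

Lemma dpr_supp (x : F) : (forall k, k \in msupp (x : fock 2) -> k.1 = a) -> dpr a x = x.
Proof.
move=> h; apply: coef_inj => b m; rewrite coef_dpr.
have [->|ba] := eqVneq b a; rewrite ?mul1r // mul0r.
by rewrite coefE; apply/esym/mcoeff_outdom; apply: contraNN ba => /h /= ->.
Qed.

Lemma supp_dpr (x : F) : dpr a x = x -> forall k, k \in msupp (x : fock 2) -> k.1 = a.
Proof.
move=> h [b m] /=; rewrite -mcoeff_neq0 -coefE -h coef_dpr.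
by have [//|_] := eqVneq b a; rewrite mul0r eqxx.
Qed.

Lemma WQ_deg_TD (t : H) : WQ_deg V a t -> @TD G V F a t = t.
Proof.
elim=> [|q _ y [v [x [hx ->]]] _ ih]; first exact: linear0.
rewrite tens_scale; transitivity (@TD G V F a (tn (q *: v) (x : F)) + @TD G V F a (y : H)); first exact: linearD.
by rewrite ih TDE dpr_supp.
Qed.

Lemma TD_WQ_deg (t : H) : tspan (fun=> True) (fun x : F => dpr a x = x) t -> WQ_deg V a t.
Proof.
elim=> [_ [v [x [_ hx ->]]]||x y _ hx _ hy]; last 2 first.
- exact: span0.
- by have := span_closed (-1) hy hx; rewrite scaleN1r addrC.
apply: in_span_gen; suff : exists v' (u : fock 2), (forall k, k \in msupp u -> k.1 = a) /\ (tn v x : WQ V) = tens v' (u : restr F).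
  by [].
by exists v, x; split=> //; apply: supp_dpr.
Qed.
End Degree.
End MonsterLie.

Lemma sub_val_lin (R : comPzRingType) (M : lmodType R) (N : submodule M) z (x y : sub_of N) :
  val (z *: x + y) = z *: val x + val y.
Proof. by []. Qed.

Lemma sub_valB (R : comPzRingType) (M : lmodType R) (N : submodule M) (x y : sub_of N) :
  val (x - y) = val x - val y.
Proof. by []. Qed.

(** * Representatives in P^1 of the elements of a degree piece *)

Section DegreePiece.
Variables (G : finGroupType) (V : monster_va G) (a : 'rV[int]_2).
Local Notation F := (fock_mod 2).
Local Notation A := II_gram.
Local Notation H := (tq V F).
Local Notation ZF := (zspan (@is_schv 2 F A)).
Local Notation M := (sub_of (m_deg V a)).

Definition represents (q : M) (t : H) : Prop := exists x : sub_of (P1 V),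
  [/\ W V (val x), WQ_deg V a (val x), val (val q) = quot_pi (P1_ker V) x & t = val x].

Lemma WQ_scale (z : Zhalf) (t : H) : z *: (t : WQ V) = Zhalf_val z *: t.
Proof.
move: t; apply: tq_eq => [x y|x y|v x]; first exact: scalerBr.
  exact: (@scalerBr rat (tq V F)).
by rewrite -[tn v x]/(tens v (x : restr F)) tens_scale tnZl.
Qed.

Lemma represents_ex q : exists t, represents q t.
Proof. by have [x [hW hd e]] := sub_valP q; exists (val x), x. Qed.

Lemma representsP q t : represents q t -> primary A a t /\ tspan (fun=> True) ZF t.
Proof.
move=> [x [hW hd _ ->]]; have [x0 xn] := sub_valP x; split; last exact: W_tspan.
split; [exact: WQ_deg_TD | by rewrite -W_LE |].
by move=> n n0; rewrite -W_LE; apply: xn.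
Qed.

Lemma integral_represents t : tspan (fun=> True) (fun s => ZF s /\ dpr a s = s) t ->
  primary A a t -> exists q, represents q t.
Proof.
move=> ht [_ t0 tn].
have hP : P1 V t by split=> [|n n0]; rewrite W_LE ?t0 ?tn.
have hW : W V t by apply: tspan_W; apply: tspan_sub ht => // s [].
have hd : WQ_deg V a t by apply: TD_WQ_deg; apply: tspan_sub ht => // s [].
pose x := sub_mk hP.
have hm : monster_lie V (quot_pi (P1_ker V) x) by exists x.
have hq : m_deg V a (sub_mk hm) by exists x.
by exists (sub_mk hq), x.
Qed.

Lemma represents_lin z q q' t t' : represents q t -> represents q' t' ->
  represents (z *: q + q') (Zhalf_val z *: t + t').
Proof.
move=> [x [hW hd e ->]] [x' [hW' hd' e' ->]]; exists (z *: x + x'); split.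
- exact: span_closed.
- exact: span_closed.
- transitivity (z *: val (val q) + val (val q')); last by rewrite e e' [RHS]linearP.
  transitivity (val (z *: val q + val q')); last exact: sub_val_lin.
  by congr val; exact: sub_val_lin.
by rewrite -WQ_scale.
Qed.

Lemma represents_eq q q' t t' : represents q t -> represents q' t' ->
  q = q' <-> forall y : H, LV A 0 y = y -> (forall n : int, 0 < n -> LV A n y = 0) ->
    W_form (t : WQ V) (y : WQ V) = W_form (t' : WQ V) (y : WQ V).
Proof.
move=> [x [hW hd e ->]] [x' [hW' hd' e' ->]]; split=> [qq y y0 yn|h].
  have hy : P1 V y by split=> [|n n0]; rewrite W_LE ?y0 ?yn.
  have : P1_ker V (x - x') by apply/quot_piP; rewrite -e -e' qq.
  move=> /(_ (sub_mk hy)); have -> : val (x - x') = val x - val x' by [].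
  by move=> /= h; apply/eqP; rewrite -subr_eq0 -(W_form_l y) h.
apply/val_inj/val_inj; rewrite e e'; apply/quot_piP => y.
have [y0 yn] := sub_valP y.
apply: etrans (congr1 (fun u : WQ V => W_form u (val y)) (sub_valB x x')) _.
apply: etrans (W_form_l (val y) (val x) (val x')) _.
apply/eqP; rewrite subr_eq0; apply/eqP/h; first by apply: etrans y0; rewrite W_LE.
by move=> n n0; apply: etrans (yn n n0); rewrite W_LE.
Qed.

Lemma represents_act g q t : represents q t ->
  represents (m_deg_act V g a q) (tqm (mva_act V g) idfun t).
Proof.
move=> [x [hW hd e ->]]; exists (P1_act g x); split.
- exact: W_act_W.
- exact: W_act_deg.
- rewrite -[LHS]/(P1_quot_act g (val (val q))) e; exact: quot_mapE.
by [].
Qed.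

(** The form on the quotient is computed on canonical representatives; any other representative
    differs by an element of the kernel. *)
Lemma represents_form q q' t t' : represents q t -> represents q' t' ->
  m_deg_form V a q q' = W_form (t : WQ V) (t' : WQ V).
Proof.
have ker (x : sub_of (P1 V)) (y : sub_of (P1 V)) :
    W_form (val (repr (quot_pi (P1_ker V) x))) (val y) = W_form (val x) (val y).
  apply/eqP; rewrite -subr_eq0 -(W_form_l (val y)); apply/eqP.
  exact: (quot_repr (P1_ker V) x y).
move=> [x [_ _ e ->]] [x' [_ _ e' ->]].
by rewrite /m_deg_form /P1_quot_form e e' ker W_form_sym ker W_form_sym.
Qed.
End DegreePiece.

Lemma ord2_cases (i i0 i1 : 'I_2) : i0 != i1 -> i = i0 \/ i = i1.
Proof.
move=> i01; have [->|ne] := eqVneq i i0; first by left.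
right; apply/val_inj; move: i01 ne (ltn_ord i) (ltn_ord i0) (ltn_ord i1).
by rewrite -!val_eqE /=; lia.
Qed.

Lemma base_map_equivariant (R S : comPzRingType) (h : {rmorphism R -> S}) (M N : lmodType R)
    (f : {linear M -> N}) (u : {linear M -> M}) (v : {linear N -> N}) :
  (forall x, f (u x) = v (f x)) ->
  forall t, base_map (h := h) f (base_map u t) = base_map v (base_map (h := h) f t).
Proof.
move=> e; elim/base_ind => [|s x t ih]; first by rewrite !linear0.
have D (P Q : lmodType R) (k : {linear P -> Q}) y z :
  base_map (h := h) k (y + z) = base_map k y + base_map k z by exact: linearD.
by rewrite !D ih !base_mapE e.
Qed.

Lemma pairing_II i (a : 'rV[int]_2) j : i != j -> pairing II_gram (delta_mx 0 i) a = - a 0 j.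
Proof.
move=> ij; rewrite /pairing -rowE mxE (bigD1 j) //= big1 => [|l lj]; last first.
  rewrite !mxE; have -> : l = i by apply/val_inj; move: ij lj (ltn_ord i) (ltn_ord j) (ltn_ord l); rewrite -!val_eqE /=; lia.
  by rewrite eqxx mul0r.
by rewrite !mxE (negbTE ij) addr0 mulN1r.
Qed.

Lemma pairing_II_vec m n : pairing II_gram (II_vec m n) (II_vec m n) = - 2 * (m * n).
Proof.
rewrite /pairing mxE !big_ord_recl big_ord0 !mxE !big_ord_recl !big_ord0 !mxE /=.
by ring.
Qed.

Lemma det_II : \det II_gram != 0.
Proof.
suff -> : \det II_gram = -1 by [].
rewrite (expand_det_row _ 0) !big_ord_recl big_ord0 /cofactor !det_mx11 !mxE /=.
by ring.
Qed.

Theorem theorem7p1 (M : finGroupType) (M_monster : is_monster M) (V : monster_va M)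
  (p : nat) (p_prime : prime p) (p_odd : odd p)
  (m n : int) (p_ndvd : ~ ((p%:Z %| m)%Z /\ (p%:Z %| n)%Z)) :
  let m_mn := m_deg V (II_vec m n) in
  let V_mn := V_ V (m * n) in
  (exists B : padic_ext p_odd (sub_of m_mn) -> padic_ext p_odd (sub_of m_mn) -> padicZ p,
     is_padic_extension p_odd (m_deg_form V (II_vec m n)) B /\ self_dual_form B) /\
  (exists phi : {linear padic_ext p_odd (sub_of m_mn) -> padic_ext p_odd (sub_of V_mn)},
     bijective phi /\
     forall (g : M) x, phi (padic_map p_odd (m_deg_act V g (II_vec m n)) x)
                       = padic_map p_odd (V_act V g (m * n)) (phi x)).
Proof.
move=> m_mn V_mn; pose a := II_vec m n.
(* [i1] is a coordinate of a prime to p, and w is the other basis vector, which pairs with a to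
   minus that coordinate. *)
have [i0 [i1 [i01 pc]]] : exists i0 i1 : 'I_2, i0 != i1 /\ ~~ (p%:Z %| (- a 0 i1)%R)%Z.
  have [pm|pm] := boolP (p%:Z %| m)%Z.
    exists 0, 1; split=> //; rewrite dvdzE abszN -dvdzE mxE /=; apply/negP => pn; exact: p_ndvd.
  by exists 1, 0; split=> //; rewrite dvdzE abszN -dvdzE mxE.
pose c := - a 0 i1; pose w : 'rV[int]_2 := delta_mx 0 i0.
have c0 : c != 0 by apply: contraNneq pc; rewrite -/c => ->; apply: dvdz0.
have w_a : pairing II_gram w a = c by apply: pairing_II.
have w_null : pairing II_gram w w = 0.
  by rewrite (pairing_II _ i01) mxE eqxx eq_sym (negbTE i01) oppr0.
have ord2 i := ord2_cases i i01.
have A_i0 : II_gram i0 i0 = 0 by rewrite mxE eqxx.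
have A_i1 : II_gram i0 i1 != 0 by rewrite mxE (negbTE i01).
(* The norm of a is -2mn, so e^a has weight -mn and V_mn is the piece that brings the total weight
   to 1. *)
have wt_a : (m * n + 1)%:~R + (pairing II_gram a a)%:~R / 2 = 1 :> rat.
  by rewrite pairing_II_vec mulNr intrN intrD !intrM; field.
have [N /choice[tau tauP]] := uniform_dressing V (fock_mod 2) II_gram_sym det_II w_null w_a c0 (m * n).
have rep_tau (v : sub_of V_mn) : exists q, represents (V := V) (a := a) q (tau v).
  have [pt _] := dressed_primary wt_a (tauP v); apply: integral_represents pt.
  by have [hz _ _ _] := tauP v; apply: tspan_sub hz => // s [hs [_ hd]].
have [f [g [gf fg fB intB fact]]] := comparison_maps II_gram_sym det_II w_null w_a c0 ord2 erefl A_i0 A_i1 i01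
  (@W_form_l M V) (@W_form_r M V) (@W_form_tn M V) (@W_form_sym M V) wt_a tauP
  (@represents_ex M V a) (@representsP M V a) rep_tau (@represents_lin M V a) (@represents_eq M V a)
  (@represents_act M V a) (@represents_form M V a).
set C : Zhalf := c%:~R ^+ (2 * N) in gf fg fB.
have [u uc] := padic_int_unit p_odd p_prime pc.
(* The only obstruction to inverting f, the scalar c^2N, is a unit of Z_p. *)
have uC : u ^+ (2 * N) * Zhalf_to_padic p_odd C = 1.
  by rewrite rmorphXn -exprMn uc expr1n.
split; last first.
  exists (base_map (h := Zhalf_to_padic p_odd) f); split.
    exact: Bijective (base_mapK gf uC) (base_invK fg uC).
  by move=> h x; apply: base_map_equivariant => y; apply: fact.
have /choice[b hb] : forall q, exists b : sub_of m_mn -> Zhalf, forall q', Zhalf_val (b q') = m_deg_form V a q q'.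
  by move=> q; have /choice[b hb] := intB q; exists b.
have [rk _ free] := mva_rank V (m * n).
pose BV (x y : sub_of V_mn) := mva_form (val x) (val y).
have BV_bil : bilinear_form BV.
  by split=> [y k x x'|x k y y']; [apply: (mva_form_bilin V).1 | apply: (mva_form_bilin V).2].
have BV_sym : symmetric_form BV by move=> x y; apply: mva_form_sym.
have BVb q q' : BV (f q) (f q') = C * b q q'.
  by apply: val_inj; apply: etrans (fB q q') _; rewrite -(hb q q').
have [B [Bbil Bdual Bb]] := base_map_dual gf fg uC free BV_bil BV_sym (@mva_form_dual M V (m * n)) BVb.
exists B; split=> //; split=> // x y; exists (b x y); first exact: hb.
exact: Bb.
Qed.
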